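(* Let $\mathcal{R}\subset\mathbb{R}^3$ be a Riemann minimal example. Then any bounded Jacobi function on $\mathcal{R}$ is linear.
   Context: A Jacobi function on a minimal surface $M\subset\mathbb{R}^3$ is a function $v\colon M\to\mathbb{R}$ with $\Delta v-2Kv=0$, where $\Delta$ is the intrinsic Laplacian and $K$ the Gaussian curvature of $M$. It is called linear if $v=\langle N,a\rangle$ for some $a\in\mathbb{R}^3$, where $N$ is the Gauss map of $M$. Riemann minimal examples. For $s>0$ let $\Lambda_s=\{sm+in\mid m,n\in\mathbb{Z}\}$ ($i=\sqrt{-1}$), let $\mathcal{P}_s$ be the Weierstrass $\mathcal{P}$-function of the torus $\mathbb{C}/\Lambda_s$, regarded also as a meromorphic function on the cylinder $\mathbb{C}/\langle i\rangle$, where $\langle i\rangle=i\mathbb{Z}$. Put $e_s=\mathcal{P}_s\big(\tfrac{s+i}{2}\big)$ and $g_s=a_s(\mathcal{P}_s-e_s)$, where $a_s=\big(-(\mathcal{P}_s(i/2)-e_s)(\mathcal{P}_s(s/2)-e_s)\big)^{-1/2}>0$ is chosen so that the branch values of $g_s$ are $0,\infty$ and one pair of antipodal points on the real axis. Let $E_s=g_s^{-1}(\{0,\infty\})$ and $z_0=\tfrac{i}{2}$. Then $\mathcal{R}(s)$ is the image of the conformal harmonic map $X_s\colon(\mathbb{C}/\langle i\rangle)-E_s\to\mathbb{R}^3$, $X_s(z)=\Re\int_{z_0}^z\left(\tfrac12(\tfrac1{g_s}-g_s),\tfrac i2(\tfrac1{g_s}+g_s),1\right)dz$. The surfaces $\mathcal{R}(s)$,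 $s\in(0,\infty)$, are the Riemann minimal examples (considered up to rigid motions). *)

(* Defs.v *)
From Stdlib Require Import Reals ZArith ClassicalEpsilon.
From Coquelicot Require Import Coquelicot.
Open Scope R_scope.

(** * Euclidean space *)

Definition vec3 : Type := (R * R * R)%type.
Definition c1 (p : vec3) : R := fst (fst p).
Definition c2 (p : vec3) : R := snd (fst p).
Definition c3 (p : vec3) : R := snd p.

Definition dot (p q : vec3) : R := c1 p * c1 q + c2 p * c2 q + c3 p * c3 q.
Definition cross (p q : vec3) : vec3 :=
  (c2 p * c3 q - c3 p * c2 q, c3 p * c1 q - c1 p * c3 q, c1 p * c2 q - c2 p * c1 q).
Definition scale (t : R) (p : vec3) : vec3 := (t * c1 p, t * c2 p, t * c3 p).
Definition sub3 (p q : vec3) : vec3 := (c1 p - c1 q, c2 p - c2 q, c3 p - c3 q).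
Definition norm3 (p : vec3) : R := sqrt (dot p p).

Definition rigid_motion (Phi : vec3 -> vec3) : Prop :=
  forall p q : vec3, norm3 (sub3 (Phi p) (Phi q)) = norm3 (sub3 p q).

(** * Parametrized surfaces *)

(** A parameter is a complex number [x + iy]; [dx], [dy] are the partial
    derivatives in [x] and [y].  They take junk values at points where the
    derivative does not exist. *)
Definition dx (u : C -> R) (z : C) : R := Derive (fun t : R => u (t, snd z)) (fst z).
Definition dy (u : C -> R) (z : C) : R := Derive (fun t : R => u (fst z, t)) (snd z).
Definition ex_dx (u : C -> R) (z : C) : Prop :=
  ex_derive (fun t : R => u (t, snd z)) (fst z).
Definition ex_dy (u : C -> R) (z : C) : Prop :=
  ex_derive (fun t : R => u (fst z, t)) (snd z).

(** For [D] open this is the class C^2: a function with continuous second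
    partial derivatives has continuous first ones. *)
Definition C2_on (D : C -> Prop) (u : C -> R) : Prop :=
  forall z : C, D z ->
    (ex_dx u z /\ ex_dy u z) /\
    (ex_dx (dx u) z /\ ex_dy (dx u) z /\ ex_dx (dy u) z /\ ex_dy (dy u) z) /\
    (continuous (dx (dx u)) z /\ continuous (dy (dx u)) z /\
     continuous (dx (dy u)) z /\ continuous (dy (dy u)) z).

Definition dx3 (X : C -> vec3) (z : C) : vec3 :=
  (dx (fun w => c1 (X w)) z, dx (fun w => c2 (X w)) z, dx (fun w => c3 (X w)) z).
Definition dy3 (X : C -> vec3) (z : C) : vec3 :=
  (dy (fun w => c1 (X w)) z, dy (fun w => c2 (X w)) z, dy (fun w => c3 (X w)) z).

Definition gauss_map (X : C -> vec3) (z : C) : vec3 :=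
  let n := cross (dx3 X z) (dy3 X z) in scale (/ norm3 n) n.

(** First and second fundamental forms. *)
Definition formE (X : C -> vec3) (z : C) : R := dot (dx3 X z) (dx3 X z).
Definition formF (X : C -> vec3) (z : C) : R := dot (dx3 X z) (dy3 X z).
Definition formG (X : C -> vec3) (z : C) : R := dot (dy3 X z) (dy3 X z).
Definition det1 (X : C -> vec3) (z : C) : R :=
  formE X z * formG X z - formF X z * formF X z.
Definition form_l (X : C -> vec3) (z : C) : R := dot (dx3 (dx3 X) z) (gauss_map X z).
Definition form_m (X : C -> vec3) (z : C) : R := dot (dy3 (dx3 X) z) (gauss_map X z).
Definition form_n (X : C -> vec3) (z : C) : R := dot (dy3 (dy3 X) z) (gauss_map X z).

Definition gauss_curvature (X : C -> vec3) (z : C) : R :=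
  (form_l X z * form_n X z - form_m X z * form_m X z) / det1 X z.

(** Laplace-Beltrami operator [(det g)^(-1/2) d_i ((det g)^(1/2) g^(ij) d_j u)]
    of the metric induced by [X]. *)
Definition laplacian (X : C -> vec3) (u : C -> R) (z : C) : R :=
  (dx (fun w => (formG X w * dx u w - formF X w * dy u w) / sqrt (det1 X w)) z
   + dy (fun w => (formE X w * dy u w - formF X w * dx u w) / sqrt (det1 X w)) z)
  / sqrt (det1 X z).

(** A surface given by a map [param] on the quotient of the region [dom] of
    the plane by the equivalence relation [ident].  Functions on the surface
    are represented on the parameter side, as [ident]-invariant functions on
    [dom]; values outside [dom] are irrelevant. *)
Record surface : Type := Surface {
  dom : C -> Prop;
  ident : C -> C -> Prop;
  param : C -> vec3
}.

Definition move (Phi : vec3 -> vec3) (M : surface) : surface :=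
  Surface (dom M) (ident M) (fun z => Phi (param M z)).

Definition function_on (M : surface) (v : C -> R) : Prop :=
  forall z w : C, dom M z -> dom M w -> ident M z w -> v z = v w.

Definition jacobi_function (M : surface) (v : C -> R) : Prop :=
  function_on M v /\ C2_on (dom M) v /\
  forall z : C, dom M z ->
    laplacian (param M) v z - 2 * gauss_curvature (param M) z * v z = 0.

Definition bounded_on (M : surface) (v : C -> R) : Prop :=
  exists B : R, forall z : C, dom M z -> Rabs (v z) <= B.

Definition linear_function (M : surface) (v : C -> R) : Prop :=
  exists a : vec3, forall z : C, dom M z -> v z = dot (gauss_map (param M) z) a.

(** * Weierstrass data of the Riemann minimal examples *)

Definition lattice_point (s : R) (m n : Z) : C := (s * IZR m, IZR n).

Definition wp_term (s : R) (z : C) (m n : Z) : C :=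
  if ((m =? 0) && (n =? 0))%Z%bool then RtoC 0
  else let w := lattice_point s m n in
       (/ ((z - w) * (z - w)) - / (w * w))%C.

Definition wp_partial_sum (s : R) (z : C) (k : nat) : C :=
  sum_n (G := C_AbelianMonoid) (fun i =>
    sum_n (G := C_AbelianMonoid) (fun j =>
      wp_term s z (Z.of_nat i - Z.of_nat k) (Z.of_nat j - Z.of_nat k))
      (2 * k)) (2 * k).

(** Weierstrass function of the lattice; the absolutely convergent lattice sum
    is the limit of the sums over the squares [|m|, |n| <= k].  The value at a
    lattice point is junk. *)
Definition wp (s : R) (z : C) : C :=
  (/ (z * z) + C_complete_lim (filtermap (wp_partial_sum s z) eventually))%C.

Definition e_ (s : R) : C := wp s (s / 2, 1 / 2).

(** The product under the root is real and negative: the lattice is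
    rectangular. *)
Definition a_ (s : R) : R :=
  / sqrt (- Re ((wp s (0, 1 / 2)%R - e_ s) * (wp s (s / 2, 0)%R - e_ s))%C).

Definition g_ (s : R) (z : C) : C := (RtoC (a_ s) * (wp s z - e_ s))%C.

Definition pole (f : C -> C) (z : C) : Prop :=
  filterlim (fun w => Cmod (f w)) (locally' (T := C_UniformSpace) z)
    (Rbar_locally p_infty).

Definition E_ (s : R) (z : C) : Prop := g_ s z = RtoC 0 \/ pole (g_ s) z.

Definition mod_i (z w : C) : Prop := exists n : Z, (w = z + RtoC (IZR n) * Ci)%C.

Definition phi1 (s : R) (z : C) : C := (RtoC (1 / 2) * (/ g_ s z - g_ s z))%C.
Definition phi2 (s : R) (z : C) : C := (Ci / 2 * (/ g_ s z + g_ s z))%C.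
Definition phi3 (s : R) (z : C) : C := RtoC 1.

(** [gamma] is of class C^1 with derivative [gamma'], and on [0,1] it is a path
    in the complement of [E_ s] from [z0] to [z], up to the period [i] at the
    end point: a lift of a path in the cylinder. *)
Definition path_to (s : R) (z0 z : C) (gamma gamma' : R -> C) : Prop :=
  (forall t : R, is_derive (V := C_R_NormedModule) gamma t (gamma' t)) /\
  (forall t : R, continuous (U := C_UniformSpace) gamma' t) /\
  (forall t : R, 0 <= t <= 1 -> ~ E_ s (gamma t)) /\
  gamma 0 = z0 /\ mod_i z (gamma 1).

Definition path_integral (f : C -> C) (gamma gamma' : R -> C) : C :=
  RInt (V := C_R_CompleteNormedModule) (fun t => (f (gamma t) * gamma' t)%C) 0 1.

Definition re_integral (s : R) (gamma gamma' : R -> C) : vec3 :=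
  (Re (path_integral (phi1 s) gamma gamma'),
   Re (path_integral (phi2 s) gamma gamma'),
   Re (path_integral (phi3 s) gamma gamma')).

(** The value does not depend on the path, because the real periods of the
    three forms vanish; [epsilon] merely picks one path. *)
Definition X_ (s : R) (z : C) : vec3 :=
  epsilon (inhabits ((0, 0, 0) : vec3)) (fun p : vec3 =>
    exists gamma gamma' : R -> C,
      path_to s (0, 1 / 2) z gamma gamma' /\ p = re_integral s gamma gamma').

(** The cylinder [C/iZ] minus [E_ s].  [X_ s] is injective there, so functions on
    this surface are the functions on its image in space. *)
Definition riemann_surface (s : R) : surface :=
  Surface (fun z => ~ E_ s z) mod_i (X_ s).

Definition riemann_minimal_example (M : surface) : Prop :=
  exists (s : R) (Phi : vec3 -> vec3),
    0 < s /\ rigid_motion Phi /\ M = move Phi (riemann_surface s).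

(* Main.v *)
Require Import Defs.
From Stdlib Require Import Reals ZArith ClassicalEpsilon Lra Lia Psatz.
From Coquelicot Require Import Coquelicot.
Import Defs.
Open Scope R_scope.

(** Let [g] be the Gauss map of a Riemann example in the conformal parameter
    [z = x + iy], [h = g'/g], and [ch], [sh] the hyperbolic cosine and sine of
    [log |g|].  The induced metric is [ch^2 |dz|^2] and the curvature is
    [-|h|^2 / ch^4], so the Jacobi equation is
    [v_xx + v_yy + 2 (|h|^2 / ch^2) v = 0].

    The potential separates.  The differential equation of the Weierstrass
    function gives [h^2 = c (g - 1/g) + 2 A] with real [c > 0] and [A], and this
    makes [Re h / ch] a function [k x] and [- Im h / ch] a function [mu y]: the
    potential is [2 (k x ^ 2 + mu y ^ 2)] ([kap_spec], [mu_spec]).  Both are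
    elliptic functions, each completed by two others to a solution of the Euler
    top: [(p, q, k)], of period [s] in [x], and [(P, Q, mu)], of period 1 in [y].
    The products [q P], [k mu] and [p Q] are solutions of the Jacobi equation,
    and they span the three components of the Gauss map
    ([gauss_components]).  It remains to show that a bounded solution [v] is a
    combination of these products ([bounded_solution_classification]).

    On the circles [x = const] the functions [P], [mu], [Q] are eigenfunctions of
    one and the same operator.  By Green's formula ([flux_const]) the
    coefficients of [v] against [P] and [mu] satisfy the ordinary equations of
    [q] and [k]; the second solutions of these equations grow linearly, because
    of the integral of a square that reduction of order produces, so boundedness
    makes the coefficients multiples of [q] and [k] ([lowest_coefficients]).  After
    subtraction of the corresponding products the remainder [w] is orthogonal to
    [P] and [mu] on every circle.  There the quadratic form
    [int w_y^2 - (2 mu^2 + A + B) w^2] is nonnegative ([slice_form_nonneg]), since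
    a combination of [P] and [mu] can be added to [w] so as to vanish at the two
    zeros of [Q], the positive and negative parts of [Q] being ground states of
    the Dirichlet problems between these zeros.  The quotient [u = w / p] solves
    [div (p^2 grad u) + p^2 (2 mu^2 + A + B) u = 0], and testing this equation
    with [u] times a cut-off leaves [u_x = 0] ([energy_main]): [u] is a periodic
    solution of the equation of [Q] alone, hence a multiple of [Q].

    The ends of the surface lie in the half-lattice, where [v] is only known to be
    bounded.  Points have zero capacity in the plane: logarithmic
    cut-offs ([cutoff_exists]) of small Dirichlet energy remove them from both
    integral arguments.  The same energy argument, with potential 0, is a
    Liouville theorem for bounded holomorphic functions ([liouville]); applied to
    combinations of Eisenstein series it yields the differential equation of the
    Weierstrass function and the constancy of [g(z) g(z + omega)], [omega] being
    the half period [(s + i)/2].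

    Last, the immersion has an explicit primitive in terms of [k] and [mu]
    ([X_value]), so that its value does not depend on the path, and rigid motions
    of space are affine orthogonal ([rigid_motion_affine]), which changes the
    Gauss map by an orthogonal matrix and a sign. *)

(** * Calculus of one and two real variables *)

(** Rewriting with lemmas on integrals and derivatives leaves equations in the carrier
    of a structure on [R]; [ring], [field] and [lra] want the type [R] itself. *)
Ltac eqR := match goal with |- @eq _ ?a ?b => change (@eq R a b) end.

Lemma is_derive_eq (f : R -> R) (x a b : R) : is_derive f x a -> a = b -> is_derive f x b.
Proof. intros H <-; exact H. Qed.

Lemma D_const (c x : R) : is_derive (fun _ : R => c) x 0.
Proof. exact (is_derive_const (V := R_NormedModule) c x). Qed.
Lemma D_id (x : R) : is_derive (fun t : R => t) x 1.
Proof. exact (is_derive_id x). Qed.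
Lemma D_plus (f g : R -> R) (x a b : R) :
  is_derive f x a -> is_derive g x b -> is_derive (fun t => f t + g t) x (a + b).
Proof. intros; exact (is_derive_plus (V := R_NormedModule) f g x a b H H0). Qed.
Lemma D_minus (f g : R -> R) (x a b : R) :
  is_derive f x a -> is_derive g x b -> is_derive (fun t => f t - g t) x (a - b).
Proof. intros; exact (is_derive_minus (V := R_NormedModule) f g x a b H H0). Qed.
Lemma D_opp (f : R -> R) (x a : R) : is_derive f x a -> is_derive (fun t => - f t) x (- a).
Proof. intros; exact (is_derive_opp (V := R_NormedModule) f x a H). Qed.
Lemma D_mult (f g : R -> R) (x a b : R) :
  is_derive f x a -> is_derive g x b ->
  is_derive (fun t => f t * g t) x (a * g x + f x * b).
Proof.
intros; exact (is_derive_mult (K := R_AbsRing) f g x a b H H0 (fun n m => Rmult_comm n m)).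
Qed.
Lemma D_scal c (f : R -> R) (x a : R) : is_derive f x a -> is_derive (fun t => c * f t) x (c * a).
Proof. intros; exact (is_derive_scal f x c a H). Qed.
Lemma D_inv (f : R -> R) (x a : R) :
  is_derive f x a -> f x <> 0 -> is_derive (fun t => / f t) x (- a / f x ^ 2).
Proof. intros; exact (is_derive_inv f x a H H0). Qed.
Lemma D_div (f g : R -> R) (x a b : R) :
  is_derive f x a -> is_derive g x b -> g x <> 0 ->
  is_derive (fun t => f t / g t) x ((a * g x - f x * b) / g x ^ 2).
Proof. intros; exact (is_derive_div f g x a b H H0 H1). Qed.
Lemma D_pow2 (f : R -> R) (x a : R) : is_derive f x a -> is_derive (fun t => f t ^ 2) x (2 * f x * a).
Proof.
intro H. apply (is_derive_ext (fun t => f t * f t)).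
- intro; simpl; eqR; ring.
- eapply is_derive_eq. apply D_mult; eauto. eqR; ring.
Qed.
Lemma D_comp (f g : R -> R) (x a b : R) :
  is_derive f (g x) a -> is_derive g x b -> is_derive (fun t => f (g t)) x (b * a).
Proof. intros; exact (is_derive_comp (V := R_NormedModule) f g x a b H H0). Qed.

Lemma C_of_D (f : R -> R) (x l : R) : is_derive f x l -> continuous f x.
Proof. intro H. apply (ex_derive_continuous f x). exists l; apply H. Qed.
Lemma C_const (c x : R) : continuous (fun _ : R => c) x.
Proof. exact (continuous_const (U := R_UniformSpace) (V := R_UniformSpace) c x). Qed.
Lemma C_id (x : R) : continuous (fun t : R => t) x.
Proof. exact (continuous_id (U := R_UniformSpace) x). Qed.
Lemma C_plus (f g : R -> R) (x : R) :
  continuous f x -> continuous g x -> continuous (fun t => f t + g t) x.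
Proof. intros; exact (continuous_plus (V := R_NormedModule) f g x H H0). Qed.
Lemma C_minus (f g : R -> R) (x : R) :
  continuous f x -> continuous g x -> continuous (fun t => f t - g t) x.
Proof. intros; exact (continuous_minus (V := R_NormedModule) f g x H H0). Qed.
Lemma C_mult (f g : R -> R) (x : R) :
  continuous f x -> continuous g x -> continuous (fun t => f t * g t) x.
Proof. intros; exact (continuous_mult (K := R_AbsRing) f g x H H0). Qed.
Lemma C_pow2 (f : R -> R) (x : R) : continuous f x -> continuous (fun t => f t ^ 2) x.
Proof.
intro H. apply (continuous_ext (fun t => f t * f t)); [intro; simpl; eqR; ring|].
apply C_mult; auto.
Qed.

Lemma locally_R (P : R -> Prop) x (d : R) :
  0 < d -> (forall y, Rabs (y - x) < d -> P y) -> locally x P.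
Proof. intros Hd H. exists (mkposreal d Hd). intros y Hy. apply H, Hy. Qed.
Lemma locally_R_inv (P : R -> Prop) x :
  locally x P -> exists d, 0 < d /\ forall y, Rabs (y - x) < d -> P y.
Proof. intros [d H]. exists d; split; [apply cond_pos|]. intros y Hy; apply H, Hy. Qed.
Lemma continuous_R (f : R -> R) (x : R) :
  continuous f x <->
  forall eps, 0 < eps -> exists d, 0 < d /\ forall y, Rabs (y - x) < d -> Rabs (f y - f x) < eps.
Proof.
split.
- intros H eps He.
  destruct (locally_R_inv (fun y => Rabs (f y - f x) < eps) x) as [d [H1 H2]].
  + apply (H (fun y => Rabs (y - f x) < eps)). exists (mkposreal eps He). intros y Hy; apply Hy.
  + exists d; auto.
- intros H P [e He]. destruct (H e (cond_pos e)) as [d [H1 H2]].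
  apply (locally_R _ x d H1). intros y Hy. apply He, H2, Hy.
Qed.

Lemma RInt_le_primitive (f g g' : R -> R) (a b : R) :
  a <= b ->
  (forall x, a <= x <= b -> continuous f x) ->
  (forall x, a <= x <= b -> is_derive g x (g' x)) ->
  (forall x, a <= x <= b -> continuous g' x) ->
  (forall x, a <= x <= b -> f x <= g' x) ->
  RInt f a b <= g b - g a.
Proof.
intros Hab Hf Hg Hc Hle.
assert (E : is_RInt g' a b (g b - g a)).
{ apply (is_RInt_derive (V := R_CompleteNormedModule) g g'); intros x Hx;
    rewrite Rmin_left, Rmax_right in Hx by lra; auto. }
rewrite <- (is_RInt_unique _ _ _ _ E).
apply RInt_le; auto.
- apply (ex_RInt_continuous (V := R_CompleteNormedModule)).
  intros x Hx; rewrite Rmin_left, Rmax_right in Hx by lra; auto.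
- eexists; apply E.
- intros; apply Hle; lra.
Qed.

(** Used throughout instead of integration in [x]: an inequality between a derivative
    and a constant is integrated by the mean value theorem, so that no double
    integral occurs. *)
Lemma increment_ge (f f' : R -> R) (c a b : R) :
  a <= b ->
  (forall x, a <= x <= b -> is_derive f x (f' x)) ->
  (forall x, a <= x <= b -> c <= f' x) ->
  c * (b - a) <= f b - f a.
Proof.
intros Hab Hf Hc.
destruct (MVT_gen f a b f') as [t [Ht E]].
- intros x Hx; rewrite Rmin_left, Rmax_right in Hx by lra; apply Hf; lra.
- intros x Hx; rewrite Rmin_left, Rmax_right in Hx by lra.
  apply continuity_pt_filterlim. eapply C_of_D; apply Hf; lra.
- rewrite Rmin_left, Rmax_right in Ht by lra. rewrite E.
  apply Rmult_le_compat_r; [lra|]. apply Hc; lra.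
Qed.

Lemma ex_RInt_C (f : R -> R) (a b : R) :
  (forall x, continuous f x) -> ex_RInt f a b.
Proof. intro H. apply (ex_RInt_continuous (V := R_CompleteNormedModule)). intros; apply H. Qed.
Lemma ex_RInt_C' (f : R -> R) (a b : R) : a <= b ->
  (forall x, a <= x <= b -> continuous f x) -> ex_RInt f a b.
Proof.
intros Hab H. apply (ex_RInt_continuous (V := R_CompleteNormedModule)). intros x Hx.
rewrite Rmin_left, Rmax_right in Hx by lra. auto.
Qed.
Lemma D_RInt (f : R -> R) (a x : R) :
  (forall x, continuous f x) -> is_derive (fun t => RInt f a t) x (f x).
Proof.
intro H. apply (is_derive_RInt (V := R_NormedModule) f (fun t => RInt f a t) a x); auto.
apply filter_forall. intro t.
apply (RInt_correct (V := R_CompleteNormedModule)), ex_RInt_C; auto.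
Qed.
Ltac rring := try (intros; simpl; eqR); ring.
Notation c2d := continuity_2d_pt.
Lemma c2d_x (f : R -> R) (x y : R) : continuous f x -> c2d (fun u _ => f u) x y.
Proof.
intro H. apply (continuity_1d_2d_pt_comp f (fun u _ => u)).
apply continuity_pt_filterlim, H. apply continuity_2d_pt_id1.
Qed.
Lemma c2d_y (f : R -> R) (x y : R) : continuous f y -> c2d (fun _ v => f v) x y.
Proof.
intro H. apply (continuity_1d_2d_pt_comp f (fun _ v => v)).
apply continuity_pt_filterlim, H. apply continuity_2d_pt_id2.
Qed.
Lemma c2d_comp (f : R -> R) (g : R -> R -> R) (x y : R) :
  continuous f (g x y) -> c2d g x y -> c2d (fun u v => f (g u v)) x y.
Proof. intros H H1. apply continuity_1d_2d_pt_comp; auto. apply continuity_pt_filterlim, H. Qed.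
Lemma c2d_pow2 (f : R -> R -> R) (x y : R) : c2d f x y -> c2d (fun u v => f u v ^ 2) x y.
Proof.
intro H. apply (continuity_2d_pt_ext (fun u v => f u v * f u v)); [intros; simpl; ring|].
apply continuity_2d_pt_mult; auto.
Qed.
Lemma c2d_slice_y (f : R -> R -> R) (x y : R) : c2d f x y -> continuous (fun v => f x v) y.
Proof.
intro H. apply continuous_R. intros eps He.
destruct (H (mkposreal eps He)) as [d Hd]. exists d; split; [apply cond_pos|].
intros v Hv. apply Hd; auto. rewrite Rminus_diag, Rabs_R0. apply cond_pos.
Qed.
Lemma c2d_slice_x (f : R -> R -> R) (x y : R) : c2d f x y -> continuous (fun u => f u y) x.
Proof.
intro H. apply continuous_R. intros eps He.
destruct (H (mkposreal eps He)) as [d Hd]. exists d; split; [apply cond_pos|].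
intros v Hv. apply Hd; auto. rewrite Rminus_diag, Rabs_R0. apply cond_pos.
Qed.
Ltac c2d_auto :=
  repeat first [ assumption | apply continuity_2d_pt_plus | apply continuity_2d_pt_minus
    | apply continuity_2d_pt_mult | apply continuity_2d_pt_opp
    | apply continuity_2d_pt_const | apply continuity_2d_pt_id1 | apply continuity_2d_pt_id2 | apply c2d_pow2 ].

(** A copy of [RInt] at the type [R], which keeps the rewriting rules below from acting
    on their own results. *)
Definition rint (f : R -> R) (a b : R) : R := RInt f a b.
Lemma RI_plus (f g : R -> R) (a b : R) : ex_RInt f a b -> ex_RInt g a b ->
  RInt (fun t => f t + g t) a b = rint f a b + rint g a b.
Proof. intros; exact (RInt_plus (V := R_CompleteNormedModule) f g a b H H0). Qed.
Lemma RI_minus (f g : R -> R) (a b : R) : ex_RInt f a b -> ex_RInt g a b ->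
  RInt (fun t => f t - g t) a b = rint f a b - rint g a b.
Proof. intros; exact (RInt_minus (V := R_CompleteNormedModule) f g a b H H0). Qed.
Lemma RI_scal (f : R -> R) (c a b : R) : ex_RInt f a b ->
  RInt (fun t => c * f t) a b = c * rint f a b.
Proof. intros; exact (RInt_scal (V := R_CompleteNormedModule) f a b c H). Qed.
Lemma RI_const (c a b : R) : RInt (fun _ => c) a b = c * (b - a).
Proof. rewrite RInt_const. unfold scal; simpl; unfold mult; simpl. apply Rmult_comm. Qed.

Lemma C_opp (f : R -> R) (x : R) : continuous f x -> continuous (fun t => - f t) x.
Proof. intros; exact (continuous_opp (V := R_NormedModule) f x H). Qed.
Ltac contR :=
  lazymatch goal with
  | |- continuous (fun x => x) _ => apply C_id
  | |- continuous (fun x => @?f x + @?g x) _ => apply (C_plus f g); contR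
  | |- continuous (fun x => @?f x - @?g x) _ => apply (C_minus f g); contR
  | |- continuous (fun x => @?f x * @?g x) _ => apply (C_mult f g); contR
  | |- continuous (fun x => @?f x ^ 2) _ => apply (C_pow2 f); contR
  | |- continuous (fun x => - @?f x) _ => apply (C_opp f); contR
  | H : forall y, continuous ?f y |- continuous ?f _ => apply H
  | H : forall y, continuous ?f y |- continuous (fun x => ?f x) _ => exact (H _)
  | _ => first [apply C_const | solve [auto] | idtac]
  end.

(** * Logarithmic cut-off functions *)

Lemma is_derive_sq_pos (t : R) :
  is_derive (fun t => Rmax 0 t ^ 2) t (2 * Rmax 0 t).
Proof.
destruct (Rtotal_order t 0) as [H|[H|H]].
- rewrite (Rmax_left 0 t) by lra.
  apply (is_derive_ext_loc (fun _ => 0)).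
  + apply (locally_R _ t (- t)); [lra|]; intros y Hy.
    apply Rabs_def2 in Hy. rewrite Rmax_left by lra. rring.
  + rewrite Rmult_0_r. apply D_const.
- subst t. apply is_derive_Reals. intros eps He.
  exists (mkposreal eps He); intros h Hh Hd; simpl in Hd.
  rewrite (Rmax_left 0 0) by lra. rewrite Rplus_0_l.
  assert (E : Rmax 0 h = 0 \/ Rmax 0 h = h) by (unfold Rmax; destruct (Rle_dec 0 h); auto).
  destruct E as [E|E]; rewrite E.
  + replace ((0 ^ 2 - 0 ^ 2) / h - 2 * 0) with 0 by (field; auto). rewrite Rabs_R0; auto.
  + replace ((h ^ 2 - 0 ^ 2) / h - 2 * 0) with h by (field; auto). auto.
- rewrite (Rmax_right 0 t) by lra.
  apply (is_derive_ext_loc (fun t => t ^ 2)).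
  + apply (locally_R _ t t); [lra|]; intros y Hy.
    apply Rabs_def2 in Hy. rewrite Rmax_right by lra. rring.
  + auto_derive; auto; rring.
Qed.

(** A quadratic spline of class C^1 rising from 0 on [t <= 0] to 1 on [1 <= t]. *)
Definition step (t : R) : R :=
  2 * (Rmax 0 t ^ 2 - 2 * Rmax 0 (t - / 2) ^ 2 + Rmax 0 (t - 1) ^ 2).
Definition step' (t : R) : R :=
  4 * (Rmax 0 t - 2 * Rmax 0 (t - / 2) + Rmax 0 (t - 1)).

Lemma is_derive_step (t : R) : is_derive step t (step' t).
Proof.
assert (H : forall c, is_derive (fun t => Rmax 0 (t - c) ^ 2) t (2 * Rmax 0 (t - c))).
{ intro c. replace (2 * Rmax 0 (t - c)) with (scal 1 (2 * Rmax 0 (t - c)))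
    by (unfold scal; simpl; unfold mult; simpl; rring).
  apply (is_derive_comp (fun u => Rmax 0 u ^ 2) (fun t => t - c)).
  - apply is_derive_sq_pos.
  - auto_derive; auto; rring. }
unfold step, step'.
replace (4 * (Rmax 0 t - 2 * Rmax 0 (t - / 2) + Rmax 0 (t - 1)))
  with (2 * ((2 * Rmax 0 t - 2 * (2 * Rmax 0 (t - / 2))) + 2 * Rmax 0 (t - 1))) by rring.
apply D_scal. apply D_plus. apply D_minus.
- apply is_derive_sq_pos.
- apply D_scal, H.
- apply H.
Qed.

Lemma continuous_Rmax0 (t : R) : continuous (fun t => Rmax 0 t) t.
Proof.
apply (continuous_ext (fun t => (t + Rabs t) / 2)).
- intro x. unfold Rmax. destruct (Rle_dec 0 x).
  + rewrite Rabs_pos_eq by lra. lra.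
  + rewrite Rabs_left by lra. lra.
- apply C_mult. apply C_plus.
  apply C_id. apply continuous_Rabs. apply C_const.
Qed.

Lemma continuous_step' (t : R) : continuous step' t.
Proof.
assert (H : forall c, continuous (fun t => Rmax 0 (t - c)) t).
{ intro c. apply (continuous_comp (fun t => t - c) (fun t => Rmax 0 t)).
  apply C_minus. apply C_id. apply C_const.
  apply continuous_Rmax0. }
unfold step'.
apply C_mult. apply C_const.
apply C_plus. apply C_minus.
- apply continuous_Rmax0.
- apply C_mult. apply C_const. apply H.
- apply H.
Qed.

Lemma step_neg (t : R) : t <= 0 -> step t = 0 /\ step' t = 0.
Proof.
intro H. unfold step, step'. rewrite !Rmax_left by lra. split; rring.
Qed.

Lemma step_ge1 (t : R) : 1 <= t -> step t = 1 /\ step' t = 0.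
Proof.
intro H. unfold step, step'. rewrite !Rmax_right by lra. split; field.
Qed.

Lemma step_bounds (t : R) : 0 <= step t <= 1 /\ 0 <= step' t <= 2.
Proof.
destruct (Rle_dec t 0) as [H|H].
{ destruct (step_neg t H) as [-> ->]. lra. }
destruct (Rle_dec 1 t) as [H1|H1].
{ destruct (step_ge1 t H1) as [-> ->]. lra. }
unfold step, step'. rewrite (Rmax_right 0 t), (Rmax_left 0 (t - 1)) by lra.
destruct (Rle_dec t (/ 2)).
- rewrite (Rmax_left 0 (t - / 2)) by lra. split; nra.
- rewrite (Rmax_right 0 (t - / 2)) by lra. split; nra.
Qed.

(** Vanishes exactly on the half-lattice when [a] is 2 pi over the real period; near a
    half-lattice point it is comparable to the squared distance. *)
Definition rho (a x y : R) : R := sin (a * x) ^ 2 + sin (2 * PI * y) ^ 2.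

Lemma is_derive_sin2 (b t : R) :
  is_derive (fun t => sin (b * t) ^ 2) t (2 * b * sin (b * t) * cos (b * t)).
Proof. auto_derive; auto; rring. Qed.

(** The derivative of [cos * atan (sin / A)] is the integrand up to a bounded error,
    because [atan] is bounded and [cos^2 = 1 - sin^2]: an elementary substitute for
    the exact value of the integral. *)
Lemma int_inv_sin2_pointwise (b A t : R) :
  0 < b -> 0 < A ->
  is_derive (fun t => cos (b * t) * atan (sin (b * t) / A) / (b * A)) t
    (cos (b * t) ^ 2 / (A ^ 2 + sin (b * t) ^ 2)
     - sin (b * t) * atan (sin (b * t) / A) / A)
  /\ / (A ^ 2 + sin (b * t) ^ 2) <=
     (cos (b * t) ^ 2 / (A ^ 2 + sin (b * t) ^ 2)
     - sin (b * t) * atan (sin (b * t) / A) / A) + (1 + 2 / A).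
Proof.
intros Hb HA. split.
- auto_derive; [ repeat split; nra|].
  unfold Rdiv. set (z := atan _).
  generalize (pow2_ge_0 (sin (b * t))) (pow2_gt_0 A ltac:(lra)); intros.
  field. repeat split; simpl in *; lra.
- set (u := sin (b * t)). assert (Hu : -1 <= u <= 1) by apply SIN_bound.
  assert (Hc : cos (b * t) ^ 2 = 1 - u ^ 2).
  { unfold u. generalize (sin2_cos2 (b * t)); unfold Rsqr; intro; nra. }
  rewrite Hc.
  assert (Hat : Rabs (u * atan (u / A)) <= 2).
  { rewrite Rabs_mult. assert (Rabs u <= 1) by (apply Rabs_le; lra).
    assert (Rabs (atan (u / A)) <= 2).
    { generalize (atan_bound (u / A)) PI_4; intros. apply Rabs_le. lra. }
    generalize (Rabs_pos u) (Rabs_pos (atan (u/A))); nra. }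
  apply Rabs_le_between in Hat.
  assert (Hi : 0 < / A) by (apply Rinv_0_lt_compat; auto).
  assert (Hd : 0 < A ^ 2 + u ^ 2) by nra.
  assert (E : (1 - u ^ 2) / (A ^ 2 + u ^ 2) = / (A ^ 2 + u ^ 2) - u ^ 2 * / (A ^ 2 + u ^ 2)).
  { field. lra. }
  assert (F : u ^ 2 * / (A ^ 2 + u ^ 2) <= 1).
  { apply Rmult_le_reg_r with (A ^ 2 + u ^ 2); auto. rewrite Rmult_assoc, Rinv_l by lra. nra. }
  rewrite E. unfold Rdiv. nra.
Qed.

(** The integral over a period is of order [1 / A] as [A] tends to 0. *)
Lemma RInt_inv_sin2_le (b A u v : R) :
  0 < b -> 0 < A -> u <= v ->
  RInt (fun t => / (A ^ 2 + sin (b * t) ^ 2)) u v <= (1 + 2 / A) * (v - u) + 4 / (b * A).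
Proof.
intros Hb HA Huv.
assert (Hpos : forall x, A ^ 2 + sin (b * x) ^ 2 <> 0) by (intro x; nra).
set (g := fun t => cos (b * t) * atan (sin (b * t) / A) / (b * A) + (1 + 2 / A) * t).
set (g' := fun t => (cos (b * t) ^ 2 / (A ^ 2 + sin (b * t) ^ 2)
     - sin (b * t) * atan (sin (b * t) / A) / A) + (1 + 2 / A)).
eapply Rle_trans. apply (RInt_le_primitive _ g g'); auto.
- intros x _. eapply C_of_D; auto_derive; [|reflexivity]. repeat split; try apply Hpos; auto.
- intros x _. unfold g, g'. apply D_plus.
  apply int_inv_sin2_pointwise; auto. auto_derive; auto; rring.
- intros x _. unfold g'. eapply C_of_D; auto_derive; [|reflexivity]. repeat split; try apply Hpos; auto.
- intros x _. apply int_inv_sin2_pointwise; auto.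
- unfold g.
  assert (H : forall t, Rabs (cos (b * t) * atan (sin (b * t) / A)) <= 2).
  { intro t. rewrite Rabs_mult.
    assert (Rabs (cos (b * t)) <= 1) by (apply Rabs_le, COS_bound).
    assert (Rabs (atan (sin (b * t) / A)) <= 2).
    { generalize (atan_bound (sin (b * t) / A)) PI_4; intros. apply Rabs_le. lra. }
    generalize (Rabs_pos (cos (b * t))) (Rabs_pos (atan (sin (b * t) /A))); nra. }
  generalize (H u) (H v); intros H1 H2. apply Rabs_le_between in H1. apply Rabs_le_between in H2.
  assert (0 < b * A) by nra. assert (0 < / (b * A)) by (apply Rinv_0_lt_compat; auto).
  unfold Rdiv. set (i := / (b * A)) in *. nra.
Qed.

(** The logarithmic divergence as [d] tends to 0 is what makes logarithmic cut-offs
    cheap. *)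
Lemma RInt_inv_sqrt_le (a d u v : R) :
  0 < a -> 0 < d <= 1 -> u <= v ->
  RInt (fun t => / sqrt (sin (a * t) ^ 2 + d)) u v <=
  (1 + ln (3 / d)) * (v - u) + 2 * ln (3 / d) / a.
Proof.
intros Ha Hd Huv.
assert (Hsq : forall t, 0 < sqrt (sin (a * t) ^ 2 + d)) by (intro; apply sqrt_lt_R0; nra).
assert (Hsq2 : forall t, sqrt (sin (a * t) ^ 2 + d) * sqrt (sin (a * t) ^ 2 + d)
   = sin (a * t) ^ 2 + d) by (intro; apply sqrt_sqrt; nra).
set (L := fun t => ln (sin (a * t) + sqrt (sin (a * t) ^ 2 + d))).
assert (Harg : forall t, d / 3 <= sin (a * t) + sqrt (sin (a * t) ^ 2 + d) <= 3).
{ intro t. generalize (Hsq t) (Hsq2 t) (SIN_bound (a * t)).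
  set (r := sqrt _). set (z := sin _). intros H1 H2 H3.
  assert (r <= 2) by nra.
  assert (Hp : (r - z) * (r + z) = d) by nra.
  assert (0 < r - z) by nra. assert (0 < r + z) by nra.
  split; nra. }
assert (HL : forall t, Rabs (L t) <= ln (3 / d)).
{ intro t. unfold L. destruct (Harg t) as [H1 H2]. apply Rabs_le. split.
  - rewrite <- ln_Rinv by (apply Rdiv_lt_0_compat; lra).
    replace (/ (3 / d)) with (d / 3) by (field; lra).
    apply ln_le; lra.
  - apply ln_le; try lra. apply Rle_trans with 3; auto.
    apply Rmult_le_reg_r with d; try lra. unfold Rdiv; rewrite Rmult_assoc, Rinv_l by lra. lra. }
set (g := fun t => cos (a * t) * L t / a + (1 + ln (3 / d)) * t).
set (g' := fun t => (cos (a * t) ^ 2 / sqrt (sin (a * t) ^ 2 + d) - sin (a * t) * L t)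
   + (1 + ln (3 / d))).
eapply Rle_trans. apply (RInt_le_primitive _ g g'); auto.
- intros x _. eapply C_of_D; auto_derive; [|reflexivity]. split; [nra|].
  split; auto. specialize (Hsq x). simpl in Hsq. lra.
- intros x _. unfold g, g'. apply D_plus; [|auto_derive; auto; rring].
  unfold L. specialize (Hsq x). specialize (Harg x). specialize (Hsq2 x). auto_derive.
  + repeat split; try nra; simpl in *; lra.
  + simpl in *. set (r := sqrt _) in *. set (z := sin (a * x)) in *.
    field. repeat split; lra.
- intros x _. unfold g', L. specialize (Hsq x). specialize (Harg x).
  eapply C_of_D; auto_derive; [|reflexivity]. simpl in *.
  repeat split; try nra; lra.
- intros x _. unfold g'. generalize (Hsq x) (Hsq2 x) (HL x) (SIN_bound (a * x)).
  set (r := sqrt _). generalize (sin2_cos2 (a * x)); unfold Rsqr.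
  set (z := sin (a * x)). set (w := cos _). set (l := L x). set (m := ln _).
  intros E H1 H2 H3 H4. apply Rabs_le_between in H3.
  assert (Hi : 0 < / r) by (apply Rinv_0_lt_compat; auto).
  assert (Hir : r * / r = 1) by (field; lra).
  replace (w ^ 2) with (1 - z ^ 2) by nra.
  assert (z ^ 2 * / r <= 1).
  { apply Rmult_le_reg_r with r; auto. rewrite Rmult_assoc, Rinv_l by lra.
    assert (z ^ 2 <= r * r) by lra. assert (Rabs z <= 1) by (apply Rabs_le; lra).
    assert (Rabs z <= r).
    { apply Rabs_le. split; nra. }
    assert (z ^ 2 = Rabs z * Rabs z) by (rewrite <- Rabs_mult, Rabs_pos_eq; nra).
    generalize (Rabs_pos z); nra. }
  unfold Rdiv. rewrite Rmult_minus_distr_r, Rmult_1_l.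
  assert (z * l <= m) by nra. lra.
- unfold g.
  assert (H : forall t, Rabs (cos (a * t) * L t) <= ln (3 / d)).
  { intro t. rewrite Rabs_mult.
    assert (Rabs (cos (a * t)) <= 1) by (apply Rabs_le, COS_bound).
    specialize (HL t).
    generalize (Rabs_pos (cos (a * t))) (Rabs_pos (L t)); nra. }
  generalize (H u) (H v); intros H1 H2. apply Rabs_le_between in H1. apply Rabs_le_between in H2.
  assert (0 < / a) by (apply Rinv_0_lt_compat; auto).
  unfold Rdiv in *. set (i := / a) in *. set (m := ln _) in *. nra.
Qed.

(** A cut-off [eta] vanishing near the half-lattice, together with a bound [M x] for the
    Dirichlet integral over the circle at [x], whose integral over [-L, L] is at
    most [eps].  Circles that meet the transition zone of [eta] lie in thin strips;
    there [M x >= 1], so that [M] also pays for bounded error terms on them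
    ([cut_strip]). *)
Set Implicit Arguments.
Record cutoff (a L eps r1 : R) (eta etax etay : R -> R -> R) (M : R -> R) : Prop := {
  cut_range : forall x y, 0 <= eta x y <= 1;
  cut_dx : forall x y, is_derive (fun t => eta t y) x (etax x y);
  cut_dy : forall x y, is_derive (fun t => eta x t) y (etay x y);
  cut_c : forall x y, c2d eta x y;
  cut_cx : forall x y, c2d etax x y;
  cut_cy : forall x y, c2d etay x y;
  cut_zero : exists d, 0 < d /\ forall x y, rho a x y < d ->
    eta x y = 0 /\ etax x y = 0 /\ etay x y = 0;
  cut_one : forall x y, r1 <= sin (a * x) ^ 2 ->
    eta x y = 1 /\ etax x y = 0 /\ etay x y = 0;
  cut_per : forall x, eta x 1 = eta x 0;
  cut_Mc : forall x, continuous M x;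
  cut_M0 : forall x, 0 <= M x;
  cut_int : forall x, RInt (fun y => etax x y ^ 2 + etay x y ^ 2) 0 1 <= M x;
  cut_strip : forall x, 1 <= M x \/
    forall y, eta x y = 1 /\ etax x y = 0 /\ etay x y = 0;
  cut_M : RInt M (- L) L <= eps }.
Unset Implicit Arguments.
Arguments cut_one {a L eps r1 eta etax etay M} _.

(** [rho] enters through its logarithm: [lstep] rises from 0 at [r0 exp (-n)] to 1 at
    [r0], with slope of order [1 / (n r)]. *)
Definition lstep (r0 n r : R) : R :=
  if Rlt_dec 0 r then step (1 + ln (r / r0) / n) else 0.
Definition lstep' (r0 n r : R) : R :=
  if Rlt_dec 0 r then step' (1 + ln (r / r0) / n) / (n * r) else 0.

Lemma lstep_zero (r0 n r : R) : 0 < r0 -> 0 < n -> r <= r0 * exp (- n) ->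
  lstep r0 n r = 0 /\ lstep' r0 n r = 0.
Proof.
intros Hr Hn H. unfold lstep, lstep'. destruct (Rlt_dec 0 r) as [H0|H0]; auto.
assert (E : 1 + ln (r / r0) / n <= 0).
{ assert (ln (r / r0) <= - n).
  { rewrite <- (ln_exp (- n)). apply ln_le. apply Rdiv_lt_0_compat; lra.
    apply Rmult_le_reg_r with r0; auto. unfold Rdiv. rewrite Rmult_assoc, Rinv_l by lra. lra. }
  apply Rmult_le_reg_r with n; auto.
  replace ((1 + ln (r / r0) / n) * n) with (n + ln (r / r0)) by (field; lra). lra. }
destruct (step_neg _ E) as [-> ->]. split; auto. unfold Rdiv; ring.
Qed.

Lemma lstep_one (r0 n r : R) : 0 < r0 -> 0 < n -> r0 <= r ->
  lstep r0 n r = 1 /\ lstep' r0 n r = 0.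
Proof.
intros Hr Hn H. unfold lstep, lstep'. destruct (Rlt_dec 0 r) as [H0|H0]; [|lra].
assert (E : 1 <= 1 + ln (r / r0) / n).
{ assert (0 <= ln (r / r0)).
  { rewrite <- ln_1. apply ln_le; try lra.
    apply Rmult_le_reg_r with r0; auto. unfold Rdiv. rewrite Rmult_assoc, Rinv_l by lra. lra. }
  assert (0 <= ln (r / r0) / n) by (apply Rdiv_le_0_compat; auto). lra. }
destruct (step_ge1 _ E) as [-> ->]. split; auto. unfold Rdiv; ring.
Qed.

Lemma lstep_range (r0 n r : R) : 0 <= lstep r0 n r <= 1.
Proof. unfold lstep. destruct (Rlt_dec 0 r); [apply step_bounds|lra]. Qed.

Lemma D_lstep (r0 n r : R) : 0 < r0 -> 0 < n ->
  is_derive (lstep r0 n) r (lstep' r0 n r) /\ continuous (lstep' r0 n) r.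
Proof.
intros Hr Hn. destruct (Rlt_dec 0 r) as [H|H].
- split.
  + unfold lstep' at 1. destruct (Rlt_dec 0 r) as [_|]; [|lra].
    apply (is_derive_ext_loc (fun r => step (1 + ln (r / r0) / n))).
    { apply (locally_R _ r r H). intros y Hy. apply Rabs_def2 in Hy. unfold lstep.
      destruct (Rlt_dec 0 y); [reflexivity|lra]. }
    eapply is_derive_eq. apply (D_comp step (fun r => 1 + ln (r / r0) / n)). apply is_derive_step.
    { auto_derive. apply Rdiv_lt_0_compat; lra. reflexivity. }
    unfold Rdiv. eqR. field. split; lra.
  + apply (continuous_ext_loc _ (fun r => step' (1 + ln (r / r0) / n) * / (n * r))).
    { apply (locally_R _ r r H). intros y Hy. apply Rabs_def2 in Hy. unfold lstep'.
      destruct (Rlt_dec 0 y); [reflexivity|lra]. }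
    apply C_mult.
    * apply (continuous_comp (fun r => 1 + ln (r / r0) / n) step').
      eapply C_of_D. auto_derive; [|reflexivity].
      apply Rdiv_lt_0_compat; lra. apply continuous_step'.
    * eapply C_of_D. auto_derive; [|reflexivity]. nra.
- assert (He : 0 < r0 * exp (- n)) by (apply Rmult_lt_0_compat; [auto|apply exp_pos]).
  destruct (lstep_zero r0 n r Hr Hn ltac:(lra)) as [_ ->].
  split.
  + apply (is_derive_ext_loc (fun _ => 0)).
    { apply (locally_R _ r (r0 * exp (-n))); auto. intros y Hy. apply Rabs_def2 in Hy.
      symmetry. apply (lstep_zero r0 n y); lra. }
    apply D_const.
  + apply (continuous_ext_loc _ (fun _ => 0)).
    { apply (locally_R _ r (r0 * exp (-n))); auto. intros y Hy. apply Rabs_def2 in Hy.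
      symmetry. apply (lstep_zero r0 n y); lra. }
    apply C_const.
Qed.

(** The left side is, up to a constant, the squared gradient of the cut-off, as [|grad
    rho|^2] is bounded by a multiple of [rho]. *)
Lemma lstep'_bound (r0 n r : R) : 0 < r0 -> 0 < n -> 0 <= r ->
  lstep' r0 n r ^ 2 * r <= 8 / n ^ 2 * / (r + r0 * exp (- n)).
Proof.
intros Hr Hn H.
assert (He : 0 < r0 * exp (- n)) by (apply Rmult_lt_0_compat; [auto|apply exp_pos]).
assert (Hn2 : 0 < n ^ 2) by nra.
assert (0 < / (r + r0 * exp (- n))) by (apply Rinv_0_lt_compat; lra).
assert (0 < 8 / n ^ 2) by (apply Rdiv_lt_0_compat; lra).
destruct (Rle_dec r (r0 * exp (- n))) as [Hd|Hd].
{ destruct (lstep_zero r0 n r Hr Hn Hd) as [_ ->]. rewrite pow_ne_zero by lia. nra. }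
unfold lstep'. destruct (Rlt_dec 0 r) as [_|]; [|lra].
set (s := step' _). assert (Hs : 0 <= s <= 2) by apply step_bounds.
replace ((s / (n * r)) ^ 2 * r) with (s ^ 2 / n ^ 2 * / r) by (field; lra).
assert (s ^ 2 <= 4) by nra.
assert (/ r <= 2 * / (r + r0 * exp (- n))).
{ replace (2 * / (r + r0 * exp (- n))) with (/ ((r + r0 * exp (- n)) / 2)) by (field; lra).
  apply Rinv_le_contravar; lra. }
assert (0 < / r) by (apply Rinv_0_lt_compat; lra).
assert (0 < / n ^ 2) by (apply Rinv_0_lt_compat; lra).
replace (8 / n ^ 2 * / (r + r0 * exp (- n))) with (4 / n ^ 2 * (2 * / (r + r0 * exp (- n)))) by (field; lra).
apply Rmult_le_compat; try lra; unfold Rdiv; nra.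
Qed.

Lemma sin2PI_per (t : R) : sin (2 * PI * (t + 1)) = sin (2 * PI * t).
Proof.
replace (2 * PI * (t + 1)) with (2 * PI * t + 2 * PI) by ring.
rewrite sin_plus, sin_2PI, cos_2PI. ring.
Qed.

(** The squared gradient is at most [C / (n^2 (rho + d))] with [d = r0 exp (-n)].
    Integrated over the circle at [x] this is of order [1 / (n^2 sqrt (sin^2 + d))],
    and integrated over [x] of order [ln (1/d) / n^2], that is [1 / n]. *)
Lemma cutoff_exists (a L eps r1 : R) :
  0 < a -> 0 < L -> 0 < eps -> 0 < r1 ->
  exists eta etax etay M, cutoff a L eps r1 eta etax etay M.
Proof.
intros Ha HL Heps Hr1.
generalize PI_RGT_0; intro HPI.
(* the strips [sin^2 <= t^2] have total length of order [t], hence cost at most [eps / 2] for small [t] *)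
set (c1 := 4 * L + 8 * L + 8 / a).
assert (Hc1 : 0 < c1).
{ unfold c1. assert (0 < 8 / a) by (apply Rdiv_lt_0_compat; lra). lra. }
set (t := Rmin 1 (Rmin r1 (eps / (2 * c1)))).
assert (Ht : 0 < t /\ t <= 1 /\ t <= r1 /\ t * c1 <= eps / 2).
{ assert (0 < eps / (2 * c1)) by (apply Rdiv_lt_0_compat; lra).
  unfold t. split. repeat apply Rmin_pos; lra.
  split. apply Rmin_l. split. eapply Rle_trans. apply Rmin_r. apply Rmin_l.
  replace (eps / 2) with (eps / (2 * c1) * c1) by (field; lra).
  apply Rmult_le_compat_r. lra. eapply Rle_trans. apply Rmin_r. apply Rmin_r. }
destruct Ht as [Ht0 [Ht1 [Htr Htc]]].
set (r0 := t ^ 2). assert (Hr0 : 0 < r0 /\ r0 <= 1 /\ r0 <= r1) by (unfold r0; nra).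
destruct Hr0 as [Hr0 [Hr01 Hr0r]].
set (C := 32 * Rmax (a ^ 2) ((2 * PI) ^ 2)).
assert (HC : 0 < C).
{ unfold C. assert (a ^ 2 <= Rmax (a ^ 2) ((2 * PI) ^ 2)) by apply Rmax_l. nra. }
set (l3 := ln (3 / r0)).
assert (Hl3 : 0 <= l3).
{ unfold l3. rewrite <- ln_1. apply ln_le. lra.
  apply Rmult_le_reg_r with r0; auto. unfold Rdiv; rewrite Rmult_assoc, Rinv_l by lra. lra. }
set (al := 2 * L + 3 * (2 * L * (1 + l3) + 2 / a * l3)).
set (be := 3 * (2 * L + 2 / a)).
assert (H2a : 0 < 2 / a) by (apply Rdiv_lt_0_compat; lra).
assert (Hal : 0 <= al) by (unfold al; assert (0 <= 2 * L * (1 + l3)) by (apply Rmult_le_pos; lra);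
   assert (0 <= 2 / a * l3) by (apply Rmult_le_pos; lra); lra).
assert (Hbe : 0 <= be) by (unfold be; lra).
set (n := 1 + 2 * C * (al + be) / eps).
assert (Hn : 1 <= n).
{ unfold n. assert (0 <= 2 * C * (al + be) / eps).
  { apply Rdiv_le_0_compat; auto. apply Rmult_le_pos; nra. } lra. }
assert (Hne : C / n ^ 2 * (al + be * n) <= eps / 2).
{ assert (al + be * n <= (al + be) * n) by nra.
  apply Rle_trans with (C / n ^ 2 * ((al + be) * n)).
  { apply Rmult_le_compat_l; auto. apply Rlt_le, Rdiv_lt_0_compat; nra. }
  replace (C / n ^ 2 * ((al + be) * n)) with (C * (al + be) / n) by (field; lra).
  apply Rmult_le_reg_r with n; [lra|].
  replace (C * (al + be) / n * n) with (C * (al + be)) by (field; lra).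
  unfold n. replace (eps / 2 * (1 + 2 * C * (al + be) / eps))
    with (eps / 2 + C * (al + be)) by (field; lra). lra. }
assert (Hn0 : 0 < n) by lra.
set (d := r0 * exp (- n)).
assert (Hd : 0 < d) by (apply Rmult_lt_0_compat; [auto|apply exp_pos]).
assert (Hd1 : d <= 1).
{ unfold d. assert (exp (- n) <= 1). { rewrite <- exp_0. apply Rlt_le, exp_increasing. lra. }
  generalize (exp_pos (- n)); intro; nra. }
set (ga := fun x => sin (a * x) ^ 2).
set (eta := fun x y => lstep r0 n (rho a x y)).
set (etax := fun x y => lstep' r0 n (rho a x y) * (2 * a * sin (a * x) * cos (a * x))).
set (etay := fun x y => lstep' r0 n (rho a x y) *
   (2 * (2 * PI) * sin (2 * PI * y) * cos (2 * PI * y))).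
set (M := fun x => 2 * r0 * / (t ^ 2 + sin (a * x) ^ 2)
   + C / n ^ 2 * (1 + 3 * / sqrt (sin (a * x) ^ 2 + d))).
assert (Crho : forall x y, c2d (rho a) x y).
{ intros x y. unfold rho. apply continuity_2d_pt_plus.
  apply (c2d_x (fun x => sin (a * x) ^ 2)). eapply C_of_D, is_derive_sin2.
  apply (c2d_y (fun y => sin (2 * PI * y) ^ 2)). eapply C_of_D, is_derive_sin2. }
assert (Hrho0 : forall x y, 0 <= rho a x y) by (intros; unfold rho; nra).
assert (Cex : forall x y, c2d etax x y).
{ intros x y. apply continuity_2d_pt_mult.
  apply c2d_comp; auto. apply D_lstep; auto.
  apply (c2d_x (fun x => 2 * a * sin (a * x) * cos (a * x))). eapply C_of_D.
  auto_derive; auto. }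
assert (Cey : forall x y, c2d etay x y).
{ intros x y. apply continuity_2d_pt_mult.
  apply c2d_comp; auto. apply D_lstep; auto.
  apply (c2d_y (fun y => 2 * (2 * PI) * sin (2 * PI * y) * cos (2 * PI * y))). eapply C_of_D.
  auto_derive; auto. }
assert (Hsq : forall x, 0 < sqrt (sin (a * x) ^ 2 + d)) by (intro; apply sqrt_lt_R0; nra).
assert (HCn : 0 < C / n ^ 2) by (apply Rdiv_lt_0_compat; nra).
assert (Cq1 : forall x, continuous (fun x => / (t ^ 2 + sin (a * x) ^ 2)) x).
{ intro x. eapply C_of_D. auto_derive; [|reflexivity]. nra. }
assert (Cq2 : forall x, continuous (fun x => / sqrt (sin (a * x) ^ 2 + d)) x).
{ intro x. specialize (Hsq x). eapply C_of_D. auto_derive; [|reflexivity]. simpl in *.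
  split; [nra|]. split; [lra|auto]. }
assert (Cq3 : forall x, continuous (fun x => C / n ^ 2 * (1 + 3 * / sqrt (sin (a * x) ^ 2 + d))) x).
{ intro x. apply C_mult. apply C_const. apply C_plus. apply C_const. apply C_mult. apply C_const. apply Cq2. }
assert (Cq0 : forall x, continuous (fun x => 2 * r0 * / (t ^ 2 + sin (a * x) ^ 2)) x).
{ intro x. apply C_mult. apply C_const. apply Cq1. }
assert (HM1 : forall x, 0 < 2 * r0 * / (t ^ 2 + sin (a * x) ^ 2)).
{ intro x. apply Rmult_lt_0_compat. lra. apply Rinv_0_lt_compat. nra. }
assert (HM2 : forall x, 0 < C / n ^ 2 * (1 + 3 * / sqrt (sin (a * x) ^ 2 + d))).
{ intro x. apply Rmult_lt_0_compat; auto. generalize (Rinv_0_lt_compat _ (Hsq x)). lra. }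
exists eta, etax, etay, M. constructor.
- intros; apply lstep_range.
- intros x y. unfold eta, etax. eapply is_derive_eq.
  apply D_comp. apply D_lstep; auto. unfold rho. apply D_plus. apply is_derive_sin2. apply D_const.
  rring.
- intros x y. unfold eta, etay. eapply is_derive_eq.
  apply D_comp. apply D_lstep; auto. unfold rho. apply D_plus. apply D_const. apply is_derive_sin2.
  rring.
- intros x y. apply c2d_comp; auto. eapply C_of_D. apply D_lstep; auto.
- auto.
- auto.
- exists d; split; auto. intros x y H. unfold eta, etax, etay.
  destruct (lstep_zero r0 n (rho a x y)) as [-> ->]; auto. fold d; lra. repeat split; ring.
- intros x y H. unfold eta, etax, etay.
  destruct (lstep_one r0 n (rho a x y)) as [-> ->]; auto. unfold rho; nra. repeat split; ring.
- intro x. unfold eta, rho. do 3 f_equal.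
  replace (2 * PI * 1) with (2 * PI * (0 + 1)) by ring. now rewrite sin2PI_per.
- intro x. apply C_plus; auto.
- intro x. unfold M. generalize (HM1 x) (HM2 x). lra.
- intro x. apply Rle_trans with (C / n ^ 2 * (1 + 3 * / sqrt (sin (a * x) ^ 2 + d))).
  2:{ unfold M. generalize (HM1 x); lra. }
  set (A := sqrt (sin (a * x) ^ 2 + d)).
  assert (HA : 0 < A) by apply Hsq.
  assert (HA2 : A ^ 2 = sin (a * x) ^ 2 + d).
  { unfold A. rewrite pow2_sqrt; [ring|nra]. }
  apply Rle_trans with (RInt (fun y => C / n ^ 2 * / (A ^ 2 + sin (2 * PI * y) ^ 2)) 0 1).
  + apply RInt_le; [lra| | |].
    * apply ex_RInt_C. intro y. apply C_plus; apply C_pow2.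
      apply (c2d_slice_y etax), Cex. apply (c2d_slice_y etay), Cey.
    * apply ex_RInt_C. intro y. apply C_mult. apply C_const. eapply C_of_D. auto_derive; [|reflexivity]. nra.
    * intros y _. unfold etax, etay.
      generalize (lstep'_bound r0 n (rho a x y) Hr0 Hn0 (Hrho0 x y)). fold d.
      replace (A ^ 2 + sin (2 * PI * y) ^ 2) with (rho a x y + d) by (unfold rho; rewrite HA2; ring).
      assert (Hi : 0 < / (rho a x y + d)) by (apply Rinv_0_lt_compat; generalize (Hrho0 x y); lra).
      set (i := / _) in *. set (l := lstep' _ _ _). unfold rho.
      generalize (COS_bound (a * x)) (COS_bound (2 * PI * y)).
      set (s1 := sin (a * x)). set (s2 := sin (2 * PI * y)).
      set (k1 := cos (a * x)). set (k2 := cos (2 * PI * y)). intros B1 B2 Hl.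
      set (mx := Rmax (a ^ 2) ((2 * PI) ^ 2)) in *.
      assert (E1 : a ^ 2 <= mx) by apply Rmax_l. assert (E2 : (2 * PI) ^ 2 <= mx) by apply Rmax_r.
      assert (F1 : (2 * a * s1 * k1) ^ 2 <= 4 * mx * s1 ^ 2).
      { replace ((2 * a * s1 * k1) ^ 2) with (4 * (a ^ 2 * k1 ^ 2) * s1 ^ 2) by ring.
        apply Rmult_le_compat_r. nra. assert (k1 ^ 2 <= 1) by nra. nra. }
      assert (F2 : (2 * (2 * PI) * s2 * k2) ^ 2 <= 4 * mx * s2 ^ 2).
      { replace ((2 * (2 * PI) * s2 * k2) ^ 2) with (4 * ((2 * PI) ^ 2 * k2 ^ 2) * s2 ^ 2) by ring.
        apply Rmult_le_compat_r. nra. assert (k2 ^ 2 <= 1) by nra. nra. }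
      rewrite !Rpow_mult_distr in *.
      apply Rle_trans with (4 * mx * (l ^ 2 * (s1 ^ 2 + s2 ^ 2))).
      { assert (0 <= l ^ 2) by nra. nra. }
      replace (C / n ^ 2 * i) with (4 * mx * (8 / n ^ 2 * i)) by (unfold C; fold mx; field; lra).
      fold mx in HC. assert (0 < mx) by (unfold C in HC; lra).
      apply Rmult_le_compat_l; [lra|]. exact Hl.
  + rewrite (RInt_scal (V := R_CompleteNormedModule)).
    2:{ apply ex_RInt_C. intro y. eapply C_of_D. auto_derive; [|reflexivity]. nra. }
    apply Rmult_le_compat_l; [lra|].
    eapply Rle_trans. apply RInt_inv_sin2_le; lra.
    assert (HiA : 0 < / A) by (apply Rinv_0_lt_compat; auto).
    assert (4 / (2 * PI * A) <= / A).
    { replace (4 / (2 * PI * A)) with (2 / PI * / A) by (field; lra).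
      generalize PI2_3_2; intro. assert (2 / PI <= 1).
      { apply Rmult_le_reg_r with PI; auto. unfold Rdiv. rewrite Rmult_assoc, Rinv_l; lra. }
      nra. }
    unfold Rdiv in *. lra.
- intro x. destruct (Rle_dec r0 (sin (a * x) ^ 2)) as [H|H].
  + right. intro y. unfold eta, etax, etay.
    destruct (lstep_one r0 n (rho a x y)) as [-> ->]; auto. unfold rho; nra. repeat split; ring.
  + left. unfold M. generalize (HM2 x). intro.
    assert (1 <= 2 * r0 * / (t ^ 2 + sin (a * x) ^ 2)); [|lra].
    fold r0. apply Rmult_le_reg_r with (r0 + sin (a * x) ^ 2); [nra|].
    rewrite Rmult_assoc, Rinv_l by nra. lra.
- unfold M. rewrite (RInt_plus (V := R_CompleteNormedModule)) by (apply ex_RInt_C; auto).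
  rewrite (RInt_scal (V := R_CompleteNormedModule) (fun x => / (t ^ 2 + sin (a * x) ^ 2)))
    by (apply ex_RInt_C; auto).
  rewrite (RInt_scal (V := R_CompleteNormedModule) (fun x => 1 + 3 * / sqrt (sin (a * x) ^ 2 + d)))
    by (apply ex_RInt_C; intro; apply C_plus; [apply C_const|apply C_mult; [apply C_const|auto]]).
  rewrite (RInt_plus (V := R_CompleteNormedModule) (fun _ => 1) (fun x => 3 * / sqrt (sin (a * x) ^ 2 + d)))
    by (apply ex_RInt_C; intro; first [apply C_const|apply C_mult; [apply C_const|auto]]).
  rewrite (RInt_scal (V := R_CompleteNormedModule) (fun x => / sqrt (sin (a * x) ^ 2 + d)))
    by (apply ex_RInt_C; auto).
  rewrite RInt_const.
  unfold scal, plus; simpl; unfold mult; simpl.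
  generalize (RInt_inv_sin2_le a t (- L) L Ha Ht0 ltac:(lra)).
  generalize (RInt_inv_sqrt_le a d (- L) L Ha ltac:(lra) ltac:(lra)).
  replace (ln (3 / d)) with (l3 + n).
  2:{ unfold l3, d. replace (3 / (r0 * exp (- n))) with (3 / r0 * exp n).
      rewrite ln_mult, ln_exp; auto. apply Rdiv_lt_0_compat; lra. apply exp_pos.
      rewrite exp_Ropp. field. split. apply Rgt_not_eq, exp_pos. lra. }
  simpl. set (I1 := RInt _ _ _). set (I2 := RInt _ _ _). intros H1 H2.
  apply Rle_trans with (eps / 2 + eps / 2); [|lra].
  apply Rplus_le_compat.
  + eapply Rle_trans; [|apply Htc]. unfold r0.
    apply Rle_trans with (2 * t ^ 2 * ((1 + 2 / t) * (L - - L) + 4 / (a * t))).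
    { apply Rmult_le_compat_l. nra. exact H2. }
    replace (2 * t ^ 2 * ((1 + 2 / t) * (L - - L) + 4 / (a * t)))
      with (t * (4 * L * t + 8 * L + 8 / a)) by (field; lra).
    apply Rmult_le_compat_l; [lra|]. unfold c1. nra.
  + eapply Rle_trans; [|apply Hne].
    apply Rmult_le_compat_l; [apply Rlt_le, HCn|].
    unfold al, be.
    replace (2 * (l3 + n) / a) with (2 / a * (l3 + n)) in H1 by (field; lra).
    set (w := 2 / a) in *. nra.
Qed.

(** * Green's formula with cut-offs *)

(** Regular points: the complement of the half-lattice. *)
Definition ns (a x y : R) : Prop := 0 < rho a x y.

Lemma rho_pos (a x y : R) : 0 <= rho a x y.
Proof. unfold rho; nra. Qed.

Lemma c2d_rho (a x y : R) : c2d (rho a) x y.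
Proof.
unfold rho. apply continuity_2d_pt_plus.
apply (c2d_x (fun x => sin (a * x) ^ 2)). eapply C_of_D, is_derive_sin2.
apply (c2d_y (fun y => sin (2 * PI * y) ^ 2)). eapply C_of_D, is_derive_sin2.
Qed.

Lemma rho_small_locally (a d x y : R) : rho a x y < d -> locally_2d (fun u v => rho a u v < d) x y.
Proof.
intro H. destruct (c2d_rho a x y (mkposreal (d - rho a x y) ltac:(lra))) as [e He].
exists e. intros u v Hu Hv. specialize (He u v Hu Hv). simpl in He. apply Rabs_def2 in He. lra.
Qed.

(** A product with a factor that vanishes near the half-lattice inherits the regularity
    which the other factor has off it. *)
Lemma cut_c2d (a d : R) (e f : R -> R -> R) :
  0 < d -> (forall x y, rho a x y < d -> e x y = 0) ->
  (forall x y, c2d e x y) -> (forall x y, ns a x y -> c2d f x y) ->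
  forall x y, c2d (fun u v => e u v * f u v) x y.
Proof.
intros Hd H0 He Hf x y. destruct (Rlt_dec 0 (rho a x y)) as [H|H].
- apply continuity_2d_pt_mult; auto.
- apply (continuity_2d_pt_ext_loc (fun _ _ => 0)).
  + destruct (rho_small_locally a d x y) as [r Hr]. lra.
    exists r. intros u v Hu Hv. rewrite (H0 u v); auto. ring.
  + apply continuity_2d_pt_const.
Qed.

Lemma locally_2d_slice_x (P : R -> R -> Prop) x y :
  locally_2d P x y -> locally x (fun u => P u y).
Proof.
intros [d H]. apply (locally_R _ x d (cond_pos d)). intros u Hu. apply H; auto.
rewrite Rminus_diag, Rabs_R0. apply cond_pos.
Qed.
Lemma locally_2d_slice_y (P : R -> R -> Prop) x y :
  locally_2d P x y -> locally y (fun v => P x v).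
Proof.
intros [d H]. apply (locally_R _ y d (cond_pos d)). intros u Hu. apply H; auto.
rewrite Rminus_diag, Rabs_R0. apply cond_pos.
Qed.

Lemma cut_dx' (a d : R) (e ex f fx : R -> R -> R) :
  0 < d -> (forall x y, rho a x y < d -> e x y = 0 /\ ex x y = 0) ->
  (forall x y, is_derive (fun t => e t y) x (ex x y)) ->
  (forall x y, ns a x y -> is_derive (fun t => f t y) x (fx x y)) ->
  forall x y, is_derive (fun t => e t y * f t y) x (ex x y * f x y + e x y * fx x y).
Proof.
intros Hd H0 He Hf x y. destruct (Rlt_dec 0 (rho a x y)) as [H|H].
- apply (D_mult (fun t => e t y) (fun t => f t y)); auto.
- destruct (H0 x y ltac:(lra)) as [-> ->].
  apply (is_derive_ext_loc (fun _ => 0)).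
  + apply (locally_2d_slice_x (fun u v => 0 = e u v * f u v)).
    destruct (rho_small_locally a d x y) as [r Hr]. lra.
    exists r. intros u v Hu Hv. destruct (H0 u v) as [-> _]; auto. ring.
  + eapply is_derive_eq. apply D_const. rring.
Qed.
Lemma cut_dy' (a d : R) (e ey f fy : R -> R -> R) :
  0 < d -> (forall x y, rho a x y < d -> e x y = 0 /\ ey x y = 0) ->
  (forall x y, is_derive (fun t => e x t) y (ey x y)) ->
  (forall x y, ns a x y -> is_derive (fun t => f x t) y (fy x y)) ->
  forall x y, is_derive (fun t => e x t * f x t) y (ey x y * f x y + e x y * fy x y).
Proof.
intros Hd H0 He Hf x y. destruct (Rlt_dec 0 (rho a x y)) as [H|H].
- apply (D_mult (fun t => e x t) (fun t => f x t)); auto.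
- destruct (H0 x y ltac:(lra)) as [-> ->].
  apply (is_derive_ext_loc (fun _ => 0)).
  + apply (locally_2d_slice_y (fun u v => 0 = e u v * f u v)).
    destruct (rho_small_locally a d x y) as [r Hr]. lra.
    exists r. intros u v Hu Hv. destruct (H0 u v) as [-> _]; auto. ring.
  + eapply is_derive_eq. apply D_const. rring.
Qed.

Lemma D_RInt_slices (f fx : R -> R -> R) (x : R) :
  (forall x y, is_derive (fun t => f t y) x (fx x y)) ->
  (forall x y, c2d f x y) -> (forall x y, c2d fx x y) ->
  is_derive (fun x => RInt (fun y => f x y) 0 1) x (RInt (fun y => fx x y) 0 1).
Proof.
intros Hf Hc Hcx.
rewrite (RInt_ext (fun y => fx x y) (fun y => Derive (fun u => f u y) x)).
2:{ intros y _. symmetry. apply is_derive_unique, Hf. }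
apply (is_derive_RInt_param f 0 1 x).
- apply filter_forall. intros u t _. eexists; apply Hf.
- intros t _. apply (continuity_2d_pt_ext fx); auto.
  intros; symmetry; apply is_derive_unique, Hf.
- apply filter_forall. intro u. apply ex_RInt_C. intro y. apply (c2d_slice_y f), Hc.
Qed.

Lemma RInt_derivative (f f' : R -> R) (a b : R) :
  (forall x, is_derive f x (f' x)) -> (forall x, continuous f' x) ->
  RInt f' a b = f b - f a.
Proof.
intros H H1. apply is_RInt_unique.
apply (is_RInt_derive (V := R_CompleteNormedModule) f f'); auto.
Qed.

(** The [y]-component of the field integrates to 0 over a circle by periodicity, so the
    flux of [eta^2 (u, w)] through the circle at [x] has the integral of the
    divergence for derivative. *)
Lemma green_cut (a L eps r1 : R) (eta etax etay : R -> R -> R) (M : R -> R)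
  (u ux w wy : R -> R -> R) :
  cutoff a L eps r1 eta etax etay M ->
  (forall x y, ns a x y -> is_derive (fun t => u t y) x (ux x y)) ->
  (forall x y, ns a x y -> is_derive (fun t => w x t) y (wy x y)) ->
  (forall x y, ns a x y -> c2d u x y /\ c2d ux x y /\ c2d w x y /\ c2d wy x y) ->
  (forall x, ns a x 0 -> w x 1 = w x 0) ->
  let T x y := 2 * eta x y * (etax x y * u x y + etay x y * w x y)
     + eta x y ^ 2 * (ux x y + wy x y) in
  (forall x y, c2d T x y) /\
  (forall x, is_derive (fun x => RInt (fun y => eta x y ^ 2 * u x y) 0 1) x
    (RInt (fun y => T x y) 0 1)).
Proof.
intros Hcut Hu Hw Hc Hper T.
destruct (cut_zero Hcut) as [d [Hd H0]].
assert (Ce := cut_c Hcut).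
assert (Cex := cut_cx Hcut).
assert (Cey := cut_cy Hcut).
assert (Dex := cut_dx Hcut).
assert (Dey := cut_dy Hcut).
set (e2 := fun x y => eta x y ^ 2).
set (e2x := fun x y => 2 * eta x y * etax x y).
set (e2y := fun x y => 2 * eta x y * etay x y).
assert (Z2 : forall x y, rho a x y < d -> e2 x y = 0 /\ e2x x y = 0 /\ e2y x y = 0).
{ intros x y H. unfold e2, e2x, e2y. destruct (H0 x y H) as [-> [-> ->]]. repeat split; ring. }
assert (C2 : forall x y, c2d e2 x y) by (intros; unfold e2; c2d_auto; auto).
assert (C2x : forall x y, c2d e2x x y) by (intros; unfold e2x; c2d_auto; auto).
assert (C2y : forall x y, c2d e2y x y) by (intros; unfold e2y; c2d_auto; auto).
assert (D2x : forall x y, is_derive (fun t => e2 t y) x (e2x x y)).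
{ intros x y. unfold e2, e2x. apply (D_pow2 (fun t => eta t y)); auto. }
assert (D2y : forall x y, is_derive (fun t => e2 x t) y (e2y x y)).
{ intros x y. unfold e2, e2y. apply (D_pow2 (fun t => eta x t)); auto. }
assert (CU : forall x y, c2d (fun x y => e2 x y * u x y) x y).
{ apply (cut_c2d a d); auto. intros x y H; apply Z2; auto. intros; apply Hc; auto. }
assert (CUx : forall x y, c2d (fun x y => e2x x y * u x y + e2 x y * ux x y) x y).
{ intros x y. apply continuity_2d_pt_plus; apply (cut_c2d a d); auto;
   try (intros ? ? H; apply Z2; exact H); intros; apply Hc; auto. }
assert (CWy : forall x y, c2d (fun x y => e2y x y * w x y + e2 x y * wy x y) x y).
{ intros x y. apply continuity_2d_pt_plus; apply (cut_c2d a d); auto;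
   try (intros ? ? H; apply Z2; exact H); intros; apply Hc; auto. }
assert (DU : forall x y, is_derive (fun t => e2 t y * u t y) x (e2x x y * u x y + e2 x y * ux x y)).
{ apply (cut_dx' a d); auto. intros x y H; split; apply Z2; auto. }
assert (DW : forall x y, is_derive (fun t => e2 x t * w x t) y (e2y x y * w x y + e2 x y * wy x y)).
{ apply (cut_dy' a d); auto. intros x y H; split; apply Z2; auto. }
assert (ET : forall x y, (e2x x y * u x y + e2 x y * ux x y)
   + (e2y x y * w x y + e2 x y * wy x y) = T x y).
{ intros; unfold T, e2, e2x, e2y; ring. }
split.
- intros x y. eapply continuity_2d_pt_ext. intros; apply ET.
  apply continuity_2d_pt_plus; auto.
- intro x.
  replace (RInt (fun y => T x y) 0 1) with (RInt (fun y => e2x x y * u x y + e2 x y * ux x y) 0 1).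
  { apply (D_RInt_slices (fun x y => e2 x y * u x y)
      (fun x y => e2x x y * u x y + e2 x y * ux x y)); auto. }
  rewrite (RInt_ext (fun y => T x y) (fun y => (e2x x y * u x y + e2 x y * ux x y)
   + (e2y x y * w x y + e2 x y * wy x y))) by (intros; symmetry; apply ET).
  rewrite (RI_plus (fun y => e2x x y * u x y + e2 x y * ux x y) (fun y => e2y x y * w x y + e2 x y * wy x y)).
  2:{ apply ex_RInt_C. intro y. apply (c2d_slice_y (fun x y => e2x x y * u x y + e2 x y * ux x y)), CUx. }
  2:{ apply ex_RInt_C. intro y. apply (c2d_slice_y (fun x y => e2y x y * w x y + e2 x y * wy x y)), CWy. }
  assert (EW : rint (fun y => e2y x y * w x y + e2 x y * wy x y) 0 1
    = e2 x 1 * w x 1 - e2 x 0 * w x 0).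
  { apply (RInt_derivative (fun y => e2 x y * w x y)); auto.
    intro y. apply (c2d_slice_y (fun x y => e2y x y * w x y + e2 x y * wy x y)), CWy. }
  rewrite EW. fold (rint (fun y => e2x x y * u x y + e2 x y * ux x y) 0 1).
  generalize (rint (fun y => e2x x y * u x y + e2 x y * ux x y) 0 1); intro I1. eqR.
  destruct (Rlt_dec 0 (rho a x 0)) as [H|H].
  + rewrite (Hper x H). unfold e2. rewrite (cut_per Hcut). rring.
  + assert (rho a x 1 = rho a x 0).
    { unfold rho. replace (2 * PI * 1) with (2 * PI * (0 + 1)) by ring. now rewrite sin2PI_per. }
    destruct (Z2 x 0) as [-> _]; [lra|]. destruct (Z2 x 1) as [-> _]; [lra|]. rring.
Qed.

(** Only the pure second derivatives are recorded: no mixed one occurs in the equations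
    below. *)
Set Implicit Arguments.
Record reg2 (a : R) (q qx qy qxx qyy : R -> R -> R) : Prop := {
  reg_dx : forall x y, ns a x y -> is_derive (fun t => q t y) x (qx x y);
  reg_dy : forall x y, ns a x y -> is_derive (fun t => q x t) y (qy x y);
  reg_dxx : forall x y, ns a x y -> is_derive (fun t => qx t y) x (qxx x y);
  reg_dyy : forall x y, ns a x y -> is_derive (fun t => qy x t) y (qyy x y);
  reg_c : forall x y, ns a x y -> c2d q x y;
  reg_cx : forall x y, ns a x y -> c2d qx x y;
  reg_cy : forall x y, ns a x y -> c2d qy x y;
  reg_cxx : forall x y, ns a x y -> c2d qxx x y;
  reg_cyy : forall x y, ns a x y -> c2d qyy x y;
  reg_per : forall x y, ns a x y -> q x (y + 1) = q x y }.
Unset Implicit Arguments.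
Arguments reg_dx {a q qx qy qxx qyy} _.
Arguments reg_dy {a q qx qy qxx qyy} _.
Arguments reg_dxx {a q qx qy qxx qyy} _.
Arguments reg_dyy {a q qx qy qxx qyy} _.
Arguments reg_c {a q qx qy qxx qyy} _.
Arguments reg_cx {a q qx qy qxx qyy} _.
Arguments reg_cy {a q qx qy qxx qyy} _.
Arguments reg_cxx {a q qx qy qxx qyy} _.
Arguments reg_cyy {a q qx qy qxx qyy} _.
Arguments reg_per {a q qx qy qxx qyy} _.

Lemma rho_per (a x y : R) : rho a x (y + 1) = rho a x y.
Proof. unfold rho. now rewrite sin2PI_per. Qed.

Lemma ns_locally (a x y : R) : ns a x y -> locally_2d (ns a) x y.
Proof.
intro H. destruct (c2d_rho a x y (mkposreal _ H)) as [e He].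
exists e. intros u v Hu Hv. specialize (He u v Hu Hv). simpl in He. apply Rabs_def2 in He.
unfold ns. lra.
Qed.

Lemma reg_per_xy (a : R) (q qx qy qxx qyy : R -> R -> R) :
  reg2 a q qx qy qxx qyy ->
  forall x y, ns a x y -> qx x (y + 1) = qx x y /\ qy x (y + 1) = qy x y.
Proof.
intros Hq x y H.
assert (H1 : ns a x (y + 1)) by (unfold ns; rewrite rho_per; auto).
split.
- rewrite <- (is_derive_unique _ _ _ (reg_dx Hq x y H)).
  rewrite <- (is_derive_unique _ _ _ (reg_dx Hq x (y + 1) H1)).
  apply Derive_ext_loc.
  apply (locally_2d_slice_x (fun u v => q u (v + 1) = q u v) x y).
  destruct (ns_locally a x y H) as [e He]. exists e. intros u v Hu Hv.
  apply (reg_per Hq), He; auto.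
- rewrite <- (is_derive_unique _ _ _ (reg_dy Hq x y H)).
  assert (E : is_derive (fun t => q x (t + 1)) y (qy x (y + 1))).
  { eapply is_derive_eq. apply (D_comp (fun t => q x t) (fun t => t + 1)).
    apply (reg_dy Hq x (y + 1) H1). apply D_plus. apply D_id. apply D_const. rring. }
  rewrite <- (is_derive_unique _ _ _ E).
  apply Derive_ext_loc.
  apply (locally_2d_slice_y (fun u v => q u (v + 1) = q u v) x y).
  destruct (ns_locally a x y H) as [e He]. exists e. intros u v Hu Hv.
  apply (reg_per Hq), He; auto.
Qed.

(** * The energy argument *)

Lemma RInt_lower_bound (f : R -> R) (c u v : R) :
  (forall y, continuous f y) -> (forall y, 0 <= f y) -> 0 <= u <= v -> v <= 1 ->
  (forall y, u <= y <= v -> c <= f y) -> c * (v - u) <= RInt f 0 1.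
Proof.
intros Hc H0 Hu Hv H.
assert (E : forall a b, ex_RInt f a b) by (intros; apply ex_RInt_C; auto).
assert (P : forall a b, a <= b -> 0 <= RInt f a b).
{ intros a b Hab. apply RInt_ge_0; auto. }
rewrite <- (RInt_Chasles f 0 u 1), <- (RInt_Chasles f u v 1); auto.
assert (c * (v - u) <= RInt f u v).
{ rewrite <- RI_const. apply RInt_le; auto. lra. apply ex_RInt_const. intros; apply H; lra. }
generalize (P 0 u ltac:(lra)) (P v 1 ltac:(lra)). unfold plus; simpl. lra.
Qed.

(** The divergence of [e^2 f^2 q grad q] completed to squares: half of the gradient term
    survives, the rest is a multiple of [q^2]. *)
Lemma energy_pointwise (q qx qy e ex ey f f' K : R) :
  2 * e * (ex * (f ^ 2 * (q * qx)) + ey * (f ^ 2 * (q * qy)))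
   + e ^ 2 * (2 * f * f' * (q * qx) + f ^ 2 * (qx ^ 2 + qy ^ 2 - K * q ^ 2))
  >= / 2 * (e * f * qx) ^ 2 + / 2 * (e * f * qy) ^ 2
    - q ^ 2 * (4 * (f * ex) ^ 2 + 4 * (e * f') ^ 2 + 2 * (f * ey) ^ 2 + (e * f) ^ 2 * K).
Proof.
set (X := e * f * qx). set (Y := e * f * qy).
replace (2 * e * (ex * (f ^ 2 * (q * qx)) + ey * (f ^ 2 * (q * qy)))
   + e ^ 2 * (2 * f * f' * (q * qx) + f ^ 2 * (qx ^ 2 + qy ^ 2 - K * q ^ 2)))
  with (X ^ 2 + Y ^ 2 + 2 * (X * (q * (f * ex))) + 2 * (X * (q * (e * f')))
     + 2 * (Y * (q * (f * ey))) - q ^ 2 * ((e * f) ^ 2 * K)) by (unfold X, Y; ring).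
generalize (pow2_ge_0 (X / 2 + 2 * (q * (f * ex)))) (pow2_ge_0 (X / 2 + 2 * (q * (e * f'))))
  (pow2_ge_0 (Y / 2 + q * (f * ey))). intros. nra.
Qed.

(** A bounded solution of [div (p^2 grad q) + p^2 K q = 0] off the half-lattice; [ws_eq]
    is this equation divided by [p]. *)
Set Implicit Arguments.
Record weighted_solution (a : R) (p p' : R -> R) (K : R -> R -> R)
  (p0 p1 Kb Bq : R) (q qx qy qxx qyy : R -> R -> R) : Prop := {
  ws_a : 0 < a;
  ws_dp : forall x, is_derive p x (p' x);
  ws_cp : forall x, continuous p' x;
  ws_p0 : 0 < p0;
  ws_p : forall x, p0 <= p x <= p1;
  ws_cK : forall x y, c2d K x y;
  ws_K : forall x y, K x y <= Kb;
  ws_Kb : 0 <= Kb;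
  ws_reg : reg2 a q qx qy qxx qyy;
  ws_q : forall x y, ns a x y -> Rabs (q x y) <= Bq;
  ws_eq : forall x y, ns a x y ->
    p x * (qxx x y + qyy x y) + 2 * p' x * qx x y + p x * K x y * q x y = 0 }.
Unset Implicit Arguments.
Arguments ws_q {a p p' K p0 p1 Kb Bq q qx qy qxx qyy} _.
Arguments ws_eq {a p p' K p0 p1 Kb Bq q qx qy qxx qyy} _.

(** Cut-off in [x]: it vanishes at both ends of [-L, L] and has slope of order [1 / L]. *)
Definition phi (L x : R) : R := 1 - (x / L) ^ 2.
Definition phi' (L x : R) : R := - 2 * x / L ^ 2.

Lemma D_phi L x : 0 < L -> is_derive (phi L) x (phi' L x).
Proof. intro H. unfold phi, phi'. auto_derive; auto. field. lra. Qed.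

Lemma phi_bounds L x : 0 < L -> Rabs x <= L -> 0 <= phi L x <= 1 /\ phi' L x ^ 2 <= 4 / L ^ 2.
Proof.
intros HL Hx. apply Rabs_le_between in Hx. unfold phi, phi'.
assert (Hd : -1 <= x / L <= 1).
{ split; apply Rmult_le_reg_r with L; auto; unfold Rdiv; rewrite Rmult_assoc, Rinv_l by lra; lra. }
split. nra.
replace ((- 2 * x / L ^ 2) ^ 2) with (4 / L ^ 2 * (x / L) ^ 2) by (field; lra).
assert (0 < 4 / L ^ 2) by (apply Rdiv_lt_0_compat; [lra|apply pow_lt; lra]).
assert (H1 : (x / L) ^ 2 <= 1) by nra. set (w := (x / L) ^ 2) in *. set (i := 4 / L ^ 2) in *. nra.
Qed.

(** Flux of [q grad q], weighted by the cut-offs, through the circle at [x]. *)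
Definition energy_flux (p : R -> R) (q qx : R -> R -> R) L (eta : R -> R -> R) (x : R) : R :=
  RInt (fun y => eta x y ^ 2 * (phi L x ^ 2 * p x ^ 2 * (q x y * qx x y))) 0 1.

Lemma energy_flux_ends p q qx L eta : 0 < L ->
  energy_flux p q qx L eta L = 0 /\ energy_flux p q qx L eta (- L) = 0.
Proof.
intro HL.
assert (E1 : phi L L = 0) by (unfold phi; field; lra).
assert (E2 : phi L (- L) = 0) by (unfold phi; field; lra).
unfold energy_flux. rewrite E1, E2. split.
- transitivity (RInt (fun _ => 0) 0 1); [apply RInt_ext; intros; simpl; eqR; ring|rewrite RI_const; apply Rmult_0_l].
- transitivity (RInt (fun _ => 0) 0 1); [apply RInt_ext; intros; simpl; eqR; ring|rewrite RI_const; apply Rmult_0_l].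
Qed.

Lemma D_energy_flux a p p' K p0 p1 Kb Bq q qx qy qxx qyy L eps r1 eta etax etay M :
  weighted_solution a p p' K p0 p1 Kb Bq q qx qy qxx qyy ->
  0 < L -> cutoff a L eps r1 eta etax etay M ->
  exists T : R -> R -> R,
  (forall x y, c2d T x y) /\
  (forall x, is_derive (energy_flux p q qx L eta) x (RInt (fun y => T x y) 0 1)) /\
  (forall x y, ~ ns a x y -> T x y = 0 /\ eta x y = 0 /\ etax x y = 0 /\ etay x y = 0) /\
  (forall x y, ns a x y -> T x y = p x ^ 2 *
    (2 * eta x y * (etax x y * (phi L x ^ 2 * (q x y * qx x y))
                  + etay x y * (phi L x ^ 2 * (q x y * qy x y)))
    + eta x y ^ 2 * (2 * phi L x * phi' L x * (q x y * qx x y)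
       + phi L x ^ 2 * (qx x y ^ 2 + qy x y ^ 2 - K x y * q x y ^ 2)))).
Proof.
intros Hw HL Hcut.
assert (Hr := ws_reg Hw).
set (m := fun x => phi L x ^ 2 * p x ^ 2).
set (m' := fun x => 2 * phi L x * phi' L x * p x ^ 2 + phi L x ^ 2 * (2 * p x * p' x)).
assert (Dm : forall x, is_derive m x (m' x)).
{ intro x. unfold m, m'. apply (D_mult (fun x => phi L x ^ 2) (fun x => p x ^ 2)).
  apply D_pow2, D_phi; auto. apply D_pow2, (ws_dp Hw). }
assert (Cm : forall x y, c2d (fun x _ => m x) x y).
{ intros; apply c2d_x. eapply C_of_D, Dm. }
assert (Cm' : forall x y, c2d (fun x _ => m' x) x y).
{ intros; apply c2d_x. unfold m'.
  assert (Cp : continuous p x) by (eapply C_of_D, (ws_dp Hw)).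
  assert (Cf : continuous (phi L) x) by (eapply C_of_D, D_phi; auto).
  assert (Cp' : continuous p' x) by apply (ws_cp Hw).
  assert (Cf' : continuous (phi' L) x).
  { unfold phi'. eapply C_of_D. auto_derive; auto. }
  apply C_plus; apply C_mult.
  - apply C_mult; [apply C_mult; [apply C_const|exact Cf]|exact Cf'].
  - apply C_pow2, Cp.
  - apply C_pow2, Cf.
  - apply C_mult; [apply C_mult; [apply C_const|exact Cp]|exact Cp']. }
destruct (green_cut a L eps r1 eta etax etay M
  (fun x y => m x * (q x y * qx x y))
  (fun x y => m' x * (q x y * qx x y) + m x * (qx x y * qx x y + q x y * qxx x y))
  (fun x y => m x * (q x y * qy x y))
  (fun x y => m x * (qy x y * qy x y + q x y * qyy x y)) Hcut) as [H1 H2].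
- intros x y H. apply (D_mult m (fun x => q x y * qx x y)); auto.
  apply (D_mult (fun x => q x y) (fun x => qx x y)); [apply (reg_dx Hr)|apply (reg_dxx Hr)]; auto.
- intros x y H. apply D_scal.
  apply (D_mult (fun y => q x y) (fun y => qy x y)); [apply (reg_dy Hr)|apply (reg_dyy Hr)]; auto.
- intros x y H.
  generalize (reg_c Hr x y H) (reg_cx Hr x y H) (reg_cy Hr x y H)
   (reg_cxx Hr x y H) (reg_cyy Hr x y H) (Cm x y) (Cm' x y); intros.
  repeat split; c2d_auto.
- intros x H. replace 1 with (0 + 1) by ring.
  rewrite (reg_per Hr x 0 H). destruct (reg_per_xy a q qx qy qxx qyy Hr x 0 H) as [_ ->]. ring.
- eexists; split; [exact H1|]. split.
  { intro x. apply H2. }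
  split.
  + intros x y Hn. destruct (cut_zero Hcut) as [d [Hd H0]].
    destruct (H0 x y) as [-> [-> ->]].
    { generalize (rho_pos a x y). unfold ns in Hn. lra. }
    repeat split; ring.
  + intros x y H. generalize (ws_eq Hw x y H).
    intro E. cbn beta. unfold m, m'.
    assert (E2 : p x * q x y * (p x * (qxx x y + qyy x y) + 2 * p' x * qx x y + p x * K x y * q x y) = 0)
      by (rewrite E; ring).
    match goal with |- ?l = ?r => assert (El : l - r = eta x y ^ 2 * phi L x ^ 2 *
      (p x * q x y * (p x * (qxx x y + qyy x y) + 2 * p' x * qx x y + p x * K x y * q x y))) by ring end.
    rewrite E2 in El. lra.
Qed.

Lemma cut_square_c2d a L eps r1 eta etax etay M (f : R -> R -> R) :
  cutoff a L eps r1 eta etax etay M ->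
  (forall x y, ns a x y -> c2d f x y) ->
  forall x y, c2d (fun u v => eta u v ^ 2 * f u v) x y.
Proof.
intros Hcut Hf. destruct (cut_zero Hcut) as [d [Hd H0]].
apply (cut_c2d a d (fun x y => eta x y ^ 2)); auto.
- intros x y H. destruct (H0 x y H) as [-> _]. ring.
- intros x y. apply c2d_pow2, (cut_c Hcut).
Qed.

(** On circles through the strips the form [int q_y^2 - K q^2] is not under control,
    since [q] may be singular there; bounding [K q^2] crudely costs a constant,
    which [M] pays for. *)
Lemma energy_slice a p p' K p0 p1 Kb Bq q qx qy qxx qyy L eps r1 eta etax etay M T :
  weighted_solution a p p' K p0 p1 Kb Bq q qx qy qxx qyy ->
  0 < L -> cutoff a L eps r1 eta etax etay M ->
  (forall x y, c2d T x y) ->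
  (forall x y, ~ ns a x y -> T x y = 0 /\ eta x y = 0 /\ etax x y = 0 /\ etay x y = 0) ->
  (forall x y, ns a x y -> T x y = p x ^ 2 *
    (2 * eta x y * (etax x y * (phi L x ^ 2 * (q x y * qx x y))
                  + etay x y * (phi L x ^ 2 * (q x y * qy x y)))
    + eta x y ^ 2 * (2 * phi L x * phi' L x * (q x y * qx x y)
       + phi L x ^ 2 * (qx x y ^ 2 + qy x y ^ 2 - K x y * q x y ^ 2)))) ->
  forall x, Rabs x <= L ->
  p0 ^ 2 / 2 * RInt (fun y => eta x y ^ 2 * (phi L x ^ 2 * (qx x y ^ 2 + qy x y ^ 2))) 0 1
   - (p1 * Bq) ^ 2 * (4 * M x + 16 / L ^ 2 + Kb) <= RInt (fun y => T x y) 0 1.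
Proof.
intros Hw HL Hcut CT T0 T1 x Hx.
assert (Hr := ws_reg Hw).
destruct (phi_bounds L x HL Hx) as [Hf Hf'].
set (D := (p1 * Bq) ^ 2). assert (HD : 0 <= D) by (unfold D; nra).
set (G := fun y => etax x y ^ 2 + etay x y ^ 2).
set (Z := fun y => eta x y ^ 2 * (phi L x ^ 2 * (qx x y ^ 2 + qy x y ^ 2))).
assert (CZ : forall y, continuous Z y).
{ intro y. apply (c2d_slice_y (fun x y => eta x y ^ 2 * (phi L x ^ 2 * (qx x y ^ 2 + qy x y ^ 2)))).
  apply (cut_square_c2d a L eps r1 eta etax etay M (fun x y => phi L x ^ 2 * (qx x y ^ 2 + qy x y ^ 2)) Hcut).
  intros u v H. generalize (reg_cx Hr u v H) (reg_cy Hr u v H); intros.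
  assert (c2d (fun u _ => phi L u) u v) by (apply c2d_x; eapply C_of_D, D_phi; auto).
  c2d_auto. }
assert (CG : forall y, continuous G y).
{ intro y. apply C_plus; apply C_pow2.
  apply (c2d_slice_y etax), (cut_cx Hcut).
  apply (c2d_slice_y etay), (cut_cy Hcut). }
assert (HI : RInt (fun y => (p0 ^ 2 / 2 * Z y - D * 4 * G y) - D * (16 / L ^ 2 + Kb)) 0 1
   <= RInt (fun y => T x y) 0 1).
{ apply RInt_le; [lra| | |].
  - apply ex_RInt_C. intro y. apply C_minus; [|apply C_const]. apply C_minus; apply C_mult; auto; apply C_const.
  - apply ex_RInt_C. intro y. apply (c2d_slice_y T), CT.
  - intros y _.
    assert (HKb := ws_Kb Hw).
    assert (Hr0 := cut_range Hcut x y).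
    assert (H16 : 0 < 16 / L ^ 2) by (apply Rdiv_lt_0_compat; [lra|apply pow_lt; lra]).
    destruct (Rlt_dec 0 (rho a x y)) as [H|H].
    + rewrite (T1 x y H). unfold Z, G, D.
      generalize (energy_pointwise (q x y) (qx x y) (qy x y) (eta x y) (etax x y) (etay x y)
        (phi L x) (phi' L x) (K x y)).
      match goal with |- _ >= ?r -> _ <= _ * ?l => set (LL := l); set (RR := r) end. intro HP.
      assert (HLL : LL >= RR) by (unfold LL, RR in *; exact HP). clear HP.
      assert (Hp0 := ws_p0 Hw).
      assert (Hp := ws_p Hw x).
      assert (HK := ws_K Hw x y).
      assert (Hq := ws_q Hw x y H).
      assert (Hq2 : 0 <= q x y ^ 2 <= Bq ^ 2).
      { split. nra. rewrite <- (pow2_abs (q x y)). generalize (Rabs_pos (q x y)); nra. }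
      assert (Hpp : p0 ^ 2 <= p x ^ 2 <= p1 ^ 2) by (split; apply pow_incr; lra).
      apply Rle_trans with (p x ^ 2 * RR).
      2:{ apply Rmult_le_compat_l; lra || nra. }
      set (N := 4 * etax x y ^ 2 + 4 * etay x y ^ 2 + 16 / L ^ 2 + Kb).
      set (S := qx x y ^ 2 + qy x y ^ 2).
      set (ZZ := eta x y ^ 2 * (phi L x ^ 2 * S)).
      assert (HZZ : 0 <= ZZ).
      { unfold ZZ, S. apply Rmult_le_pos; [nra|]. apply Rmult_le_pos; nra. }
      assert (HR : RR >= / 2 * ZZ - q x y ^ 2 * N).
      { unfold RR, ZZ, S. set (e := eta x y) in *. set (f := phi L x) in *.
        assert (e ^ 2 <= 1) by nra. assert (f ^ 2 <= 1) by nra.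
        assert (HN : 4 * (f * etax x y) ^ 2 + 4 * (e * phi' L x) ^ 2 + 2 * (f * etay x y) ^ 2 +
          (e * f) ^ 2 * K x y <= N).
        { unfold N. rewrite !Rpow_mult_distr.
          assert (f ^ 2 * etax x y ^ 2 <= etax x y ^ 2) by (generalize (pow2_ge_0 (etax x y)); nra).
          assert (f ^ 2 * etay x y ^ 2 <= etay x y ^ 2) by (generalize (pow2_ge_0 (etay x y)); nra).
          assert (e ^ 2 * phi' L x ^ 2 <= 4 / L ^ 2) by (generalize (pow2_ge_0 (phi' L x)); nra).
          assert (e ^ 2 * f ^ 2 * K x y <= Kb).
          { assert (0 <= e ^ 2 * f ^ 2 <= 1) by (generalize (pow2_ge_0 e) (pow2_ge_0 f); nra). nra. }
          replace (16 / L ^ 2) with (4 * (4 / L ^ 2)) by (field; lra).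
          generalize (pow2_ge_0 (etay x y)); lra. }
        replace (/ 2 * (e * f * qx x y) ^ 2 + / 2 * (e * f * qy x y) ^ 2)
          with (/ 2 * (e ^ 2 * (f ^ 2 * (qx x y ^ 2 + qy x y ^ 2)))) by ring.
        assert (q x y ^ 2 * (4 * (f * etax x y) ^ 2 + 4 * (e * phi' L x) ^ 2 + 2 * (f * etay x y) ^ 2 +
          (e * f) ^ 2 * K x y) <= q x y ^ 2 * N) by (apply Rmult_le_compat_l; lra). lra. }
      assert (HN0 : 0 <= N).
      { unfold N. generalize (pow2_ge_0 (etax x y)) (pow2_ge_0 (etay x y)). lra. }
      apply Rle_trans with (p x ^ 2 * (/ 2 * ZZ - q x y ^ 2 * N)).
      2:{ apply Rmult_le_compat_l; [nra|lra]. }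
      assert (p0 ^ 2 * ZZ <= p x ^ 2 * ZZ) by (apply Rmult_le_compat_r; lra).
      assert (p x ^ 2 * q x y ^ 2 <= p1 ^ 2 * Bq ^ 2) by (apply Rmult_le_compat; nra).
      assert (p x ^ 2 * q x y ^ 2 * N <= p1 ^ 2 * Bq ^ 2 * N) by (apply Rmult_le_compat_r; lra).
      apply Rle_trans with (p0 ^ 2 / 2 * ZZ - p1 ^ 2 * Bq ^ 2 * N).
      { apply Req_le. unfold N, ZZ, S. ring. }
      lra.
    + destruct (T0 x y H) as [-> [E1 [E2 E3]]]. unfold Z, G. rewrite E1, E2, E3.
      nra. }
rewrite RI_minus in HI.
2:{ apply ex_RInt_C. intro y. apply C_minus; apply C_mult; auto; apply C_const. }
2:{ apply ex_RInt_const. }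
unfold rint in HI. rewrite RI_minus, RI_const in HI.
2:{ apply ex_RInt_C. intro y. apply C_mult; auto; apply C_const. }
2:{ apply ex_RInt_C. intro y. apply C_mult; auto; apply C_const. }
unfold rint in HI. rewrite RI_scal, RI_scal in HI by (apply ex_RInt_C; auto).
unfold rint in HI. fold Z.
generalize (cut_int Hcut x). fold G. intro HG.
assert (D * 4 * RInt G 0 1 <= D * 4 * M x) by (apply Rmult_le_compat_l; lra).
lra.
Qed.

Lemma ns_of_sin a x y : sin (a * x) <> 0 -> ns a x y.
Proof. intro H. unfold ns, rho. assert (0 < sin (a * x) ^ 2) by (apply pow2_gt_0; auto). nra. Qed.

(** On circles away from the strips the cut-off is 1 and the hypothesis on the form
    removes all terms in [q_y] and [K]. *)
Lemma energy_slice_clean a p p' K p0 p1 Kb Bq q qx qy qxx qyy L eta etax etay T x :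
  weighted_solution a p p' K p0 p1 Kb Bq q qx qy qxx qyy ->
  0 < L -> sin (a * x) <> 0 ->
  (forall x y, c2d T x y) ->
  (forall y, eta x y = 1 /\ etax x y = 0 /\ etay x y = 0) ->
  (forall x y, ns a x y -> T x y = p x ^ 2 *
    (2 * eta x y * (etax x y * (phi L x ^ 2 * (q x y * qx x y))
                  + etay x y * (phi L x ^ 2 * (q x y * qy x y)))
    + eta x y ^ 2 * (2 * phi L x * phi' L x * (q x y * qx x y)
       + phi L x ^ 2 * (qx x y ^ 2 + qy x y ^ 2 - K x y * q x y ^ 2)))) ->
  0 <= RInt (fun y => qy x y ^ 2 - K x y * q x y ^ 2) 0 1 ->
  Rabs x <= L ->
  p0 ^ 2 / 2 * RInt (fun y => eta x y ^ 2 * (phi L x ^ 2 * qx x y ^ 2)) 0 1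
   - (p1 * Bq) ^ 2 * (8 / L ^ 2) <= RInt (fun y => T x y) 0 1.
Proof.
intros Hw HL Hsin CT He T1 Hs Hx.
assert (Hns : forall y, ns a x y) by (intro; apply ns_of_sin; auto).
assert (Hr := ws_reg Hw).
destruct (phi_bounds L x HL Hx) as [Hf Hf'].
assert (Hp0 := ws_p0 Hw).
assert (Hp := ws_p Hw x).
set (D := (p1 * Bq) ^ 2). assert (HD : 0 <= D) by (unfold D; nra).
assert (Cq : forall y, continuous (fun y => q x y) y) by (intro; apply (c2d_slice_y q), (reg_c Hr); auto).
assert (Cqx : forall y, continuous (fun y => qx x y) y) by (intro; apply (c2d_slice_y qx), (reg_cx Hr); auto).
assert (Cqy : forall y, continuous (fun y => qy x y) y) by (intro; apply (c2d_slice_y qy), (reg_cy Hr); auto).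
assert (CK : forall y, continuous (fun y => K x y) y) by (intro; apply (c2d_slice_y K), (ws_cK Hw)).
set (Z := fun y => eta x y ^ 2 * (phi L x ^ 2 * qx x y ^ 2)).
assert (CZ : forall y, continuous Z y).
{ intro y. unfold Z. apply (continuous_ext (fun y => phi L x ^ 2 * qx x y ^ 2)).
  intro t. destruct (He t) as [-> _]. simpl; eqR; ring.
  apply C_mult. apply C_const. apply C_pow2; auto. }
set (S := fun y => qy x y ^ 2 - K x y * q x y ^ 2).
assert (CS : forall y, continuous S y).
{ intro y. apply C_minus. apply C_pow2; auto. apply C_mult; auto. apply C_pow2; auto. }
assert (HI : RInt (fun y => (p0 ^ 2 / 2 * Z y + p x ^ 2 * phi L x ^ 2 * S y) - D * (8 / L ^ 2)) 0 1
   <= RInt (fun y => T x y) 0 1).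
{ apply RInt_le; [lra| | |].
  - apply ex_RInt_C. intro y. apply C_minus; [|apply C_const]. apply C_plus; apply C_mult; auto; apply C_const.
  - apply ex_RInt_C. intro y. apply (c2d_slice_y T), CT.
  - intros y _. rewrite (T1 x y (Hns y)). unfold Z, S.
    destruct (He y) as [-> [-> ->]].
    assert (Hq := ws_q Hw x y (Hns y)).
    assert (Hq2 : 0 <= q x y ^ 2 <= Bq ^ 2).
    { split. nra. rewrite <- (pow2_abs (q x y)). generalize (Rabs_pos (q x y)); nra. }
    assert (Hpp : p0 ^ 2 <= p x ^ 2 <= p1 ^ 2) by (split; apply pow_incr; lra).
    set (f := phi L x) in *. set (f' := phi' L x) in *.
    set (X := f * qx x y). set (W := p x ^ 2) in *.
    assert (HX : X ^ 2 + 2 * (X * (q x y * f')) >= / 2 * X ^ 2 - 2 * (q x y ^ 2 * f' ^ 2)).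
    { generalize (pow2_ge_0 (X / 2 + q x y * f')). intro. nra. }
    replace (f ^ 2 * qx x y ^ 2) with (X ^ 2) by (unfold X; ring).
    match goal with |- _ <= ?r => replace r with
      (W * (X ^ 2 + 2 * (X * (q x y * f'))) + W * f ^ 2 * (qy x y ^ 2 - K x y * q x y ^ 2))
      by (unfold X; ring) end.
    assert (HW : 0 <= W) by (unfold W; nra).
    assert (W * (/ 2 * X ^ 2 - 2 * (q x y ^ 2 * f' ^ 2)) <= W * (X ^ 2 + 2 * (X * (q x y * f'))))
      by (apply Rmult_le_compat_l; lra).
    assert (W * q x y ^ 2 <= p1 ^ 2 * Bq ^ 2) by (apply Rmult_le_compat; lra).
    assert (W * q x y ^ 2 * f' ^ 2 <= p1 ^ 2 * Bq ^ 2 * (4 / L ^ 2)).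
    { apply Rmult_le_compat; try lra. nra. nra. }
    assert (p0 ^ 2 * X ^ 2 <= W * X ^ 2) by (apply Rmult_le_compat_r; [nra|lra]).
    assert (ED : D * (8 / L ^ 2) = 2 * (p1 ^ 2 * Bq ^ 2 * (4 / L ^ 2))) by (unfold D; field; lra).
    rewrite ED. lra. }
rewrite RI_minus in HI.
2:{ apply ex_RInt_C. intro y. apply C_plus; apply C_mult; auto; apply C_const. }
2:{ apply ex_RInt_const. }
unfold rint in HI. rewrite RI_plus, RI_const in HI.
2:{ apply ex_RInt_C. intro y. apply C_mult; auto; apply C_const. }
2:{ apply ex_RInt_C. intro y. apply C_mult; auto; apply C_const. }
unfold rint in HI. rewrite RI_scal, RI_scal in HI by (apply ex_RInt_C; auto).
unfold rint in HI. fold Z. fold S in Hs.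
assert (0 <= p x ^ 2 * phi L x ^ 2 * RInt S 0 1).
{ apply Rmult_le_pos; auto. apply Rmult_le_pos; nra. }
lra.
Qed.

(** Summation over [x] of the inequalities on circles: the energy flux vanishes at [-L]
    and [L], so the weighted integral of [q_x^2] is at most a constant times [eps +
    1 / L].  If [q_x] did not vanish at some point, it would contribute a fixed
    amount. *)
Lemma energy_main a p p' K p0 p1 Kb Bq q qx qy qxx qyy :
  weighted_solution a p p' K p0 p1 Kb Bq q qx qy qxx qyy ->
  (forall x, sin (a * x) <> 0 ->
     0 <= RInt (fun y => qy x y ^ 2 - K x y * q x y ^ 2) 0 1) ->
  forall x y, sin (a * x) <> 0 -> 0 < y < 1 -> qx x y = 0.
Proof.
intros Hw Hs xs ys Hxs Hys.
destruct (Req_dec (qx xs ys) 0) as [H|Hne]; auto. exfalso.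
assert (Ha := ws_a Hw).
assert (Hr := ws_reg Hw).
assert (Hp0 := ws_p0 Hw).
assert (HKb := ws_Kb Hw).
set (c0 := qx xs ys ^ 2). assert (Hc0 : 0 < c0) by (apply pow2_gt_0; auto).
set (r1 := sin (a * xs) ^ 2 / 2).
assert (Hr1 : 0 < r1). { assert (0 < sin (a * xs) ^ 2) by (apply pow2_gt_0; auto). unfold r1; lra. }
assert (HC2 : c2d (fun x y => qx x y ^ 2) xs ys).
{ apply c2d_pow2, (reg_cx Hr), ns_of_sin; auto. }
destruct (HC2 (mkposreal (c0 / 2) ltac:(lra))) as [d1 Hd1]. simpl in Hd1.
destruct (proj1 (continuous_R (fun x => sin (a * x) ^ 2) xs) (C_of_D _ _ _ (is_derive_sin2 a xs)) r1 Hr1)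
  as [d2 [Hd2 Hd2']].
set (r := Rmin (Rmin (d1 / 2) (d2 / 2)) (Rmin (1 / 2) (Rmin (ys / 2) ((1 - ys) / 2)))).
assert (Hd1p := cond_pos d1).
assert (Hrr : 0 < r /\ r < d1 /\ r < d2 /\ r <= 1 / 2 /\ r <= ys / 2 /\ r <= (1 - ys) / 2).
{ unfold r. split. repeat apply Rmin_pos; lra.
  generalize (Rmin_l (Rmin (d1 / 2) (d2 / 2)) (Rmin (1 / 2) (Rmin (ys / 2) ((1 - ys) / 2))))
    (Rmin_r (Rmin (d1 / 2) (d2 / 2)) (Rmin (1 / 2) (Rmin (ys / 2) ((1 - ys) / 2))))
    (Rmin_l (d1 / 2) (d2 / 2)) (Rmin_r (d1 / 2) (d2 / 2))
    (Rmin_l (1 / 2) (Rmin (ys / 2) ((1 - ys) / 2))) (Rmin_r (1 / 2) (Rmin (ys / 2) ((1 - ys) / 2)))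
    (Rmin_l (ys / 2) ((1 - ys) / 2)) (Rmin_r (ys / 2) ((1 - ys) / 2)). lra. }
destruct Hrr as [Hr0 [Hrd1 [Hrd2 [Hr12 [Hry Hry']]]]].
set (z0 := p0 ^ 2 / 2 * (c0 / 4 * (2 * r))).
assert (Hz0 : 0 < z0).
{ unfold z0. apply Rmult_lt_0_compat. nra. apply Rmult_lt_0_compat; lra. }
set (D := (p1 * Bq) ^ 2). assert (HD : 0 <= D) by (unfold D; nra).
set (C := D * (4 + Kb) + 1). assert (HC : 0 < C) by (unfold C; nra).
set (C' := 16 * D). assert (HC' : 0 <= C') by (unfold C'; lra).
(* a nonzero [qx xs ys] contributes at least [2 * z0 * r]; the cost [C * eps + 2 * C' / L] is made smaller *)
set (L := 2 * (Rabs xs + 1) + 2 * C' / (z0 * r)).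
assert (HL0 : 2 * (Rabs xs + 1) <= L /\ C' * 2 <= z0 * r * L).
{ assert (0 < z0 * r) by nra. unfold L. split.
  - assert (0 <= 2 * C' / (z0 * r)) by (apply Rdiv_le_0_compat; lra). lra.
  - rewrite Rmult_plus_distr_l. replace (z0 * r * (2 * C' / (z0 * r))) with (2 * C') by (field; lra).
    assert (0 <= Rabs xs) by apply Rabs_pos. nra. }
destruct HL0 as [HLx HLC].
assert (HL : 0 < L) by (generalize (Rabs_pos xs); lra).
set (eps := z0 * r / (2 * C)).
assert (Heps : 0 < eps) by (apply Rdiv_lt_0_compat; [nra|lra]).
destruct (cutoff_exists a L eps r1 Ha HL Heps Hr1) as [eta [etax [etay [M Hcut]]]].
destruct (D_energy_flux a p p' K p0 p1 Kb Bq q qx qy qxx qyy L eps r1 eta etax etay M Hw HL Hcut)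
  as [T [CT [DT [T0 T1]]]].
set (I := energy_flux p q qx L eta) in *.
assert (CM := cut_Mc Hcut).
assert (M0 := cut_M0 Hcut).
set (J := fun x => I x + (C * RInt M (- L) x + C' / L ^ 2 * x)).
assert (DJ : forall x, is_derive J x (RInt (fun y => T x y) 0 1 + (C * M x + C' / L ^ 2 * 1))).
{ intro x. apply D_plus. apply DT. apply D_plus. apply D_scal, D_RInt, CM. apply D_scal, D_id. }
assert (HL2 : 0 < / L ^ 2) by (apply Rinv_0_lt_compat, pow_lt; lra).
assert (Hlow : forall x, Rabs x <= L ->
   p0 ^ 2 / 2 * RInt (fun y => eta x y ^ 2 * (phi L x ^ 2 * qx x y ^ 2)) 0 1 <=
   RInt (fun y => T x y) 0 1 + (C * M x + C' / L ^ 2 * 1)).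
{ intros x Hx. destruct (cut_strip Hcut x) as [H1|H1].
  - assert (E := energy_slice a p p' K p0 p1 Kb Bq q qx qy qxx qyy L eps r1 eta etax etay M T
     Hw HL Hcut CT T0 T1 x Hx). fold D in E.
    assert (E2 : RInt (fun y => eta x y ^ 2 * (phi L x ^ 2 * qx x y ^ 2)) 0 1 <=
       RInt (fun y => eta x y ^ 2 * (phi L x ^ 2 * (qx x y ^ 2 + qy x y ^ 2))) 0 1).
    { assert (Cf : forall u v, c2d (fun u _ => phi L u ^ 2) u v).
      { intros. apply c2d_pow2, c2d_x. eapply C_of_D, D_phi; auto. }
      apply RInt_le; [lra| | |].
      - apply ex_RInt_C. intro y. apply (c2d_slice_y (fun x y => eta x y ^ 2 * (phi L x ^ 2 * qx x y ^ 2))).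
        apply (cut_square_c2d a L eps r1 eta etax etay M (fun x y => phi L x ^ 2 * qx x y ^ 2) Hcut).
        intros u v Huv. generalize (reg_cx Hr u v Huv) (Cf u v); intros.
        apply continuity_2d_pt_mult; auto. apply c2d_pow2; auto.
      - apply ex_RInt_C. intro y.
        apply (c2d_slice_y (fun x y => eta x y ^ 2 * (phi L x ^ 2 * (qx x y ^ 2 + qy x y ^ 2)))).
        apply (cut_square_c2d a L eps r1 eta etax etay M (fun x y => phi L x ^ 2 * (qx x y ^ 2 + qy x y ^ 2)) Hcut).
        intros u v Huv. generalize (reg_cx Hr u v Huv) (reg_cy Hr u v Huv) (Cf u v); intros.
        apply continuity_2d_pt_mult; auto. apply continuity_2d_pt_plus; apply c2d_pow2; auto.
      - intros y _. apply Rmult_le_compat_l. apply pow2_ge_0.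
        apply Rmult_le_compat_l. apply pow2_ge_0. generalize (pow2_ge_0 (qy x y)); lra. }
    assert (0 < p0 ^ 2 / 2) by nra.
    assert (p0 ^ 2 / 2 * RInt (fun y => eta x y ^ 2 * (phi L x ^ 2 * qx x y ^ 2)) 0 1 <=
       p0 ^ 2 / 2 * RInt (fun y => eta x y ^ 2 * (phi L x ^ 2 * (qx x y ^ 2 + qy x y ^ 2))) 0 1)
      by (apply Rmult_le_compat_l; lra).
    assert (D * (4 * M x + 16 / L ^ 2 + Kb) <= C * M x + C' / L ^ 2 * 1).
    { unfold C, C', Rdiv. assert (D * Kb <= D * Kb * M x) by (assert (0 <= D * Kb) by nra; nra).
      set (l := / L ^ 2) in *. nra. }
    lra.
  - destruct (Req_dec (sin (a * x)) 0) as [Hs0|Hs0].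
    { exfalso. destruct (cut_zero Hcut) as [d [Hd H0]].
      destruct (H0 x 0) as [E _]. unfold rho. rewrite Hs0, Rmult_0_r, sin_0. lra.
      destruct (H1 0) as [E1 _]. lra. }
    assert (E := energy_slice_clean a p p' K p0 p1 Kb Bq q qx qy qxx qyy L eta etax etay T x
      Hw HL Hs0 CT H1 T1 (Hs x Hs0) Hx). fold D in E.
    assert (D * (8 / L ^ 2) <= C * M x + C' / L ^ 2 * 1).
    { unfold C', Rdiv. assert (0 <= C * M x) by (apply Rmult_le_pos; [lra|auto]).
      set (l := / L ^ 2) in *. nra. }
    lra. }
assert (Hlow0 : forall x, Rabs x <= L -> 0 <= RInt (fun y => T x y) 0 1 + (C * M x + C' / L ^ 2 * 1)).
{ intros x Hx. eapply Rle_trans; [|apply Hlow; auto].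
  apply Rmult_le_pos; [nra|]. apply RInt_ge_0; [lra| |].
  - apply ex_RInt_C. intro y. apply (c2d_slice_y (fun x y => eta x y ^ 2 * (phi L x ^ 2 * qx x y ^ 2))).
    apply (cut_square_c2d a L eps r1 eta etax etay M (fun x y => phi L x ^ 2 * qx x y ^ 2) Hcut).
    intros u v Huv. apply continuity_2d_pt_mult; apply c2d_pow2.
    apply c2d_x. eapply C_of_D, D_phi; auto. apply (reg_cx Hr); auto.
  - intros y _. apply Rmult_le_pos; [apply pow2_ge_0|]. apply Rmult_le_pos; apply pow2_ge_0. }
assert (Hxs2 : - (L / 2) <= xs - 1 / 2 /\ xs + 1 / 2 <= L / 2).
{ generalize (Rabs_pos xs). assert (Hx := Rle_refl (Rabs xs)). apply Rabs_le_between in Hx. lra. }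
assert (Hmid : forall x, xs - r <= x <= xs + r -> z0 <= RInt (fun y => T x y) 0 1 + (C * M x + C' / L ^ 2 * 1)).
{ intros x Hx. eapply Rle_trans; [|apply Hlow]. 2: apply Rabs_le; lra.
  unfold z0. apply Rmult_le_compat_l; [nra|].
  replace (2 * r) with ((ys + r) - (ys - r)) by ring.
  assert (Hxx : Rabs (x - xs) < d2) by (apply Rabs_def1; lra).
  assert (Hsx : r1 <= sin (a * x) ^ 2).
  { specialize (Hd2' x Hxx). apply Rabs_def2 in Hd2'. unfold r1 in *. lra. }
  assert (He : forall y, eta x y = 1) by (intro y; apply (cut_one Hcut x y Hsx)).
  assert (Hns : forall y, ns a x y).
  { intro y. unfold ns, rho. nra. }
  assert (Hphi : 1 / 2 <= phi L x ^ 2).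
  { assert (Hxl : - (1 / 2) <= x / L <= 1 / 2).
    { split; apply Rmult_le_reg_r with L; auto; unfold Rdiv; rewrite (Rmult_assoc x), Rinv_l by lra; lra. }
    unfold phi. assert ((x / L) ^ 2 <= 1 / 4) by nra. set (w := (x / L) ^ 2) in *. nra. }
  apply RInt_lower_bound.
  - intro y. apply (c2d_slice_y (fun x y => eta x y ^ 2 * (phi L x ^ 2 * qx x y ^ 2))).
    apply (cut_square_c2d a L eps r1 eta etax etay M (fun x y => phi L x ^ 2 * qx x y ^ 2) Hcut).
    intros u v Huv. apply continuity_2d_pt_mult; apply c2d_pow2.
    apply c2d_x. eapply C_of_D, D_phi; auto. apply (reg_cx Hr); auto.
  - intro y. apply Rmult_le_pos; [apply pow2_ge_0|]. apply Rmult_le_pos; apply pow2_ge_0.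
  - lra.
  - lra.
  - intros y Hy. rewrite He.
    assert (E : Rabs (qx x y ^ 2 - c0) < c0 / 2).
    { apply Hd1; apply Rabs_def1; lra. }
    apply Rabs_def2 in E. nra. }
destruct (energy_flux_ends p q qx L eta HL) as [IL ImL].
assert (E1 : 0 * ((xs - r) - - L) <= J (xs - r) - J (- L)).
{ apply (increment_ge J (fun x => RInt (fun y => T x y) 0 1 + (C * M x + C' / L ^ 2 * 1))).
  lra. intros; apply DJ. intros x Hx; apply Hlow0, Rabs_le; lra. }
assert (E2 : z0 * ((xs + r) - (xs - r)) <= J (xs + r) - J (xs - r)).
{ apply (increment_ge J (fun x => RInt (fun y => T x y) 0 1 + (C * M x + C' / L ^ 2 * 1))).
  lra. intros; apply DJ. intros x Hx; apply Hmid; lra. }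
assert (E3 : 0 * (L - (xs + r)) <= J L - J (xs + r)).
{ apply (increment_ge J (fun x => RInt (fun y => T x y) 0 1 + (C * M x + C' / L ^ 2 * 1))).
  lra. intros; apply DJ. intros x Hx; apply Hlow0, Rabs_le; lra. }
assert (EJ : J L - J (- L) <= C * eps + 2 * C' / L).
{ unfold J, I. rewrite IL, ImL. rewrite RInt_point. change (@zero R_CompleteNormedModule) with 0.
  generalize (cut_M Hcut). intro HM.
  assert (C * RInt M (- L) L <= C * eps) by (apply Rmult_le_compat_l; lra).
  replace (2 * C' / L) with (C' / L ^ 2 * L - C' / L ^ 2 * - L) by (field; lra). lra. }
assert (F1 : C * eps = z0 * r / 2) by (unfold eps; field; lra).
assert (F2 : 2 * C' / L <= z0 * r).
{ apply Rmult_le_reg_r with L; auto. unfold Rdiv. rewrite Rmult_assoc, Rinv_l by lra. lra. }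
assert (0 < z0 * r) by nra. lra.
Qed.

(** * Flux of a pair of solutions *)

Lemma continuous_bounded (f : R -> R) (a b : R) : (forall x, a <= x <= b -> continuous f x) ->
  exists B, 0 < B /\ forall x, a <= x <= b -> Rabs (f x) <= B.
Proof.
intro H. destruct (Rle_dec a b) as [Hab|Hab].
2:{ exists 1. split; [lra|]. intros; lra. }
assert (Hc : forall x, a <= x <= b -> continuity_pt (fun x => Rabs (f x)) x).
{ intros x Hx. apply continuity_pt_filterlim. apply (continuous_comp f Rabs); auto. apply continuous_Rabs. }
destruct (continuity_ab_maj _ a b Hab Hc) as [m [Hm _]].
exists (Rabs (f m) + 1). split. generalize (Rabs_pos (f m)); lra.
intros x Hx. specialize (Hm x Hx). lra.
Qed.

(** How the limit in the cut-off parameters is taken, without limits. *)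
Lemma Rabs_le_all_eps (u C : R) : 0 <= C -> (forall e, 0 < e <= 1 -> Rabs u <= e * C) -> u = 0.
Proof.
intros HC H. destruct (Req_dec u 0) as [|Hu]; auto. exfalso.
assert (Hp : 0 < Rabs u) by (apply Rabs_pos_lt; auto).
set (e := Rmin 1 (Rabs u / (2 * (C + 1)))).
assert (He : 0 < Rabs u / (2 * (C + 1))) by (apply Rdiv_lt_0_compat; lra).
assert (H1 : 0 < e <= 1) by (unfold e; split; [apply Rmin_pos; lra|apply Rmin_l]).
specialize (H e H1).
assert (e * C <= Rabs u / (2 * (C + 1)) * C) by (apply Rmult_le_compat_r; auto; apply Rmin_r).
assert (Rabs u / (2 * (C + 1)) * C <= Rabs u / 2).
{ apply Rmult_le_reg_r with (2 * (C + 1)); [lra|].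
  replace (Rabs u / (2 * (C + 1)) * C * (2 * (C + 1))) with (Rabs u * C) by (field; lra). nra. }
lra.
Qed.

Lemma flux_pointwise (e ex ey v vx vy s sx sy Bs Bv k : R) :
  0 < k -> 0 <= e <= 1 -> Rabs s <= Bs -> Rabs sx <= Bs -> Rabs sy <= Bs -> Rabs v <= Bv ->
  Rabs (2 * e * (ex * (vx * s - v * sx) + ey * (vy * s - v * sy))) <=
  k * (e ^ 2 * (vx ^ 2 + vy ^ 2)) + (Bs ^ 2 + 1) / k * (ex ^ 2 + ey ^ 2) + 2 * k * (Bv ^ 2 * Bs ^ 2).
Proof.
intros Hk He Hs Hsx Hsy Hv.
assert (Q : forall a b, Rabs (2 * (a * b)) <= k * a ^ 2 + b ^ 2 / k).
{ intros a b. assert (E : k * a ^ 2 + b ^ 2 / k - 2 * (a * b) = k * (a - b / k) ^ 2) by (field; lra).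
  assert (E' : k * a ^ 2 + b ^ 2 / k + 2 * (a * b) = k * (a + b / k) ^ 2) by (field; lra).
  assert (0 <= k * (a - b / k) ^ 2) by (apply Rmult_le_pos; [lra|apply pow2_ge_0]).
  assert (0 <= k * (a + b / k) ^ 2) by (apply Rmult_le_pos; [lra|apply pow2_ge_0]).
  apply Rabs_le; lra. }
assert (S2 : s ^ 2 <= Bs ^ 2) by (rewrite <- (pow2_abs s); apply pow_incr; split; [apply Rabs_pos|auto]).
assert (Sx2 : sx ^ 2 <= Bs ^ 2) by (rewrite <- (pow2_abs sx); apply pow_incr; split; [apply Rabs_pos|auto]).
assert (Sy2 : sy ^ 2 <= Bs ^ 2) by (rewrite <- (pow2_abs sy); apply pow_incr; split; [apply Rabs_pos|auto]).
assert (V2 : v ^ 2 <= Bv ^ 2) by (rewrite <- (pow2_abs v); apply pow_incr; split; [apply Rabs_pos|auto]).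
replace (2 * e * (ex * (vx * s - v * sx) + ey * (vy * s - v * sy)))
  with (2 * (e * vx * (s * ex)) + 2 * (e * vy * (s * ey)) + (- (2 * (e * v * sx * ex)) + - (2 * (e * v * sy * ey)))) by ring.
assert (Hik : 0 < / k) by (apply Rinv_0_lt_compat; auto).
eapply Rle_trans. apply Rabs_triang.
assert (T1 := Rabs_triang (2 * (e * vx * (s * ex))) (2 * (e * vy * (s * ey)))).
assert (T2 := Rabs_triang (- (2 * (e * v * sx * ex))) (- (2 * (e * v * sy * ey)))).
rewrite !Rabs_Ropp in T2.
generalize (Q (e * vx) (s * ex)) (Q (e * vy) (s * ey)) (Q (e * v * sx) ex) (Q (e * v * sy) ey).
intros Q1 Q2 Q3 Q4. unfold Rdiv in *.
assert (F1 : (s * ex) ^ 2 * / k <= Bs ^ 2 * / k * ex ^ 2).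
{ replace ((s * ex) ^ 2 * / k) with (s ^ 2 * / k * ex ^ 2) by ring.
  apply Rmult_le_compat_r; [apply pow2_ge_0|]. apply Rmult_le_compat_r; lra. }
assert (F2 : (s * ey) ^ 2 * / k <= Bs ^ 2 * / k * ey ^ 2).
{ replace ((s * ey) ^ 2 * / k) with (s ^ 2 * / k * ey ^ 2) by ring.
  apply Rmult_le_compat_r; [apply pow2_ge_0|]. apply Rmult_le_compat_r; lra. }
assert (E2 : e ^ 2 <= 1) by nra.
assert (G : forall z, z ^ 2 <= Bs ^ 2 -> k * (e * v * z) ^ 2 <= k * (Bv ^ 2 * Bs ^ 2)).
{ intros z Hz. apply Rmult_le_compat_l; [lra|].
  replace ((e * v * z) ^ 2) with (e ^ 2 * (v ^ 2 * z ^ 2)) by ring.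
  assert (0 <= v ^ 2 * z ^ 2) by (apply Rmult_le_pos; apply pow2_ge_0).
  assert (v ^ 2 * z ^ 2 <= Bv ^ 2 * Bs ^ 2) by (apply Rmult_le_compat; auto; apply pow2_ge_0).
  nra. }
generalize (G sx Sx2) (G sy Sy2). intros G1 G2. nra.
Qed.

(** Green's formula for the two solutions [v] and [f g].  The error terms contain the
    gradient of [v], which may be unbounded near the half-lattice; the energy
    inequality for [v] itself bounds its weighted square integral, and with a
    cut-off of energy [eps = k^2] the error is of order [k]. *)
Lemma flux_const a V Kb Bv v vx vy vxx vyy (f f' f'' g g' g'' : R -> R) :
  weighted_solution a (fun _ => 1) (fun _ => 0) V 1 1 Kb Bv v vx vy vxx vyy ->
  (forall x, is_derive f x (f' x)) -> (forall x, is_derive f' x (f'' x)) ->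
  (forall x, continuous f'' x) ->
  (forall x, is_derive g x (g' x)) -> (forall x, is_derive g' x (g'' x)) ->
  (forall x, continuous g'' x) -> g 1 = g 0 -> g' 1 = g' 0 ->
  (forall x y, f'' x * g y + f x * g'' y + V x y * (f x * g y) = 0) ->
  forall x1 x2, sin (a * x1) <> 0 -> sin (a * x2) <> 0 ->
  RInt (fun y => vx x1 y * (f x1 * g y) - v x1 y * (f' x1 * g y)) 0 1 =
  RInt (fun y => vx x2 y * (f x2 * g y) - v x2 y * (f' x2 * g y)) 0 1.
Proof.
intros Hw Df Df' Cf'' Dg Dg' Cg'' Pg Pg' Hpsi.
assert (Main : forall x1 x2, x1 <= x2 -> sin (a * x1) <> 0 -> sin (a * x2) <> 0 ->
  RInt (fun y => vx x1 y * (f x1 * g y) - v x1 y * (f' x1 * g y)) 0 1 =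
  RInt (fun y => vx x2 y * (f x2 * g y) - v x2 y * (f' x2 * g y)) 0 1).
2:{ intros x1 x2 H1 H2. destruct (Rle_dec x1 x2). apply Main; auto. symmetry; apply Main; auto; lra. }
intros x1 x2 H12 H1 H2.
assert (Ha := ws_a Hw).
assert (HKb := ws_Kb Hw).
assert (Hr := ws_reg Hw).
assert (Cf : forall x, continuous f x) by (intro; eapply C_of_D; auto).
assert (Cf' : forall x, continuous f' x) by (intro; eapply C_of_D; auto).
assert (Cg : forall x, continuous g x) by (intro; eapply C_of_D; auto).
assert (Cg' : forall x, continuous g' x) by (intro; eapply C_of_D; auto).
set (L := 2 * (Rabs x1 + Rabs x2) + 1).
assert (HL : 0 < L) by (unfold L; generalize (Rabs_pos x1) (Rabs_pos x2); lra).
assert (Hx : - (L / 2) <= x1 /\ x2 <= L / 2).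
{ unfold L. generalize (Rabs_pos x1) (Rabs_pos x2).
  assert (E1 := Rle_refl (Rabs x1)). apply Rabs_le_between in E1.
  assert (E2 := Rle_refl (Rabs x2)). apply Rabs_le_between in E2. lra. }
destruct (continuous_bounded f (- L) L (fun x _ => Cf x)) as [B1 [HB1 HB1']].
destruct (continuous_bounded f' (- L) L (fun x _ => Cf' x)) as [B2 [HB2 HB2']].
destruct (continuous_bounded g 0 1 (fun x _ => Cg x)) as [B3 [HB3 HB3']].
destruct (continuous_bounded g' 0 1 (fun x _ => Cg' x)) as [B4 [HB4 HB4']].
set (Bs := (B1 + B2) * (B3 + B4)).
set (D := (1 * Bv) ^ 2). assert (HD : 0 <= D) by (unfold D; nra).
set (r1 := Rmin (sin (a * x1) ^ 2) (sin (a * x2) ^ 2)).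
assert (Hr1 : 0 < r1) by (apply Rmin_pos; apply pow2_gt_0; auto).
set (k2 := 16 / L ^ 2 + Kb).
assert (Hk2 : 0 < k2).
{ unfold k2. assert (0 < 16 / L ^ 2) by (apply Rdiv_lt_0_compat; [lra|apply pow_lt; lra]). lra. }
assert (HBB : 0 <= Bv ^ 2 * Bs ^ 2) by (apply Rmult_le_pos; apply pow2_ge_0).
set (Const := 4 * (D * (4 + k2 * (2 * L))) + (Bs ^ 2 + 1) + 2 * (Bv ^ 2 * Bs ^ 2) * (2 * L)).
assert (HConst : 0 <= Const).
{ unfold Const. assert (0 <= k2 * (2 * L)) by nra. assert (0 <= Bs ^ 2) by apply pow2_ge_0. 
  assert (0 <= D * (4 + k2 * (2 * L))) by (apply Rmult_le_pos; lra). nra. }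
apply Rminus_diag_uniq_sym. apply (Rabs_le_all_eps _ Const HConst).
intros k Hk.
set (eps := k ^ 2). assert (Heps : 0 < eps <= 1) by (unfold eps; nra).
destruct (cutoff_exists a L eps r1 Ha HL (proj1 Heps) Hr1) as [eta [etax [etay [M Hcut]]]].
destruct (D_energy_flux a _ _ V 1 1 Kb Bv v vx vy vxx vyy L eps r1 eta etax etay M Hw HL Hcut)
  as [T [CT [DT [T0 T1]]]].
assert (ES := energy_slice a _ _ V 1 1 Kb Bv v vx vy vxx vyy L eps r1 eta etax etay M T
     Hw HL Hcut CT T0 T1). fold D in ES.
set (I := energy_flux (fun _ => 1) v vx L eta) in *.
assert (CM := cut_Mc Hcut).
assert (M0 := cut_M0 Hcut).
assert (cf : forall x y, c2d (fun x _ => f x) x y) by (intros; apply c2d_x; auto).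
assert (cf' : forall x y, c2d (fun x _ => f' x) x y) by (intros; apply c2d_x; auto).
assert (cf'' : forall x y, c2d (fun x _ => f'' x) x y) by (intros; apply c2d_x; auto).
assert (cg : forall x y, c2d (fun _ y => g y) x y) by (intros; apply c2d_y; auto).
assert (cg' : forall x y, c2d (fun _ y => g' y) x y) by (intros; apply c2d_y; auto).
assert (cg'' : forall x y, c2d (fun _ y => g'' y) x y) by (intros; apply c2d_y; auto).
destruct (green_cut a L eps r1 eta etax etay M
  (fun x y => vx x y * (f x * g y) - v x y * (f' x * g y))
  (fun x y => (vxx x y * (f x * g y) + vx x y * (f' x * g y)) - (vx x y * (f' x * g y) + v x y * (f'' x * g y)))
  (fun x y => vy x y * (f x * g y) - v x y * (f x * g' y))
  (fun x y => (vyy x y * (f x * g y) + vy x y * (f x * g' y)) - (vy x y * (f x * g' y) + v x y * (f x * g'' y)))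
  Hcut) as [CW DW].
{ intros x y H. apply (D_minus (fun x => vx x y * (f x * g y)) (fun x => v x y * (f' x * g y))).
  - apply (D_mult (fun x => vx x y) (fun x => f x * g y)). apply (reg_dxx Hr); auto.
    eapply is_derive_eq. apply (D_mult f (fun _ => g y)). apply Df. apply D_const. rring.
  - apply (D_mult (fun x => v x y) (fun x => f' x * g y)). apply (reg_dx Hr); auto.
    eapply is_derive_eq. apply (D_mult f' (fun _ => g y)). apply Df'. apply D_const. rring. }
{ intros x y H. apply (D_minus (fun y => vy x y * (f x * g y)) (fun y => v x y * (f x * g' y))).
  - apply (D_mult (fun y => vy x y) (fun y => f x * g y)). apply (reg_dyy Hr); auto.
    apply D_scal; auto.
  - apply (D_mult (fun y => v x y) (fun y => f x * g' y)). apply (reg_dy Hr); auto.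
    apply D_scal; auto. }
{ intros x y H.
  generalize (reg_c Hr x y H) (reg_cx Hr x y H) (reg_cy Hr x y H)
   (reg_cxx Hr x y H) (reg_cyy Hr x y H) (cf x y) (cf' x y) (cf'' x y) (cg x y) (cg' x y) (cg'' x y); intros.
  repeat split; c2d_auto. }
{ intros x H. rewrite Pg, Pg'. replace 1 with (0 + 1) by ring.
  rewrite (reg_per Hr x 0 H). destruct (reg_per_xy a v vx vy vxx vyy Hr x 0 H) as [_ ->]. ring. }
cbv zeta in CW, DW.
match type of DW with forall x, is_derive ?W _ _ => set (W0 := W) in * end.
match type of CW with forall x y, c2d ?W _ _ => set (T2 := W) in * end.
assert (WF : forall x, r1 <= sin (a * x) ^ 2 -> W0 x = RInt (fun y => vx x y * (f x * g y) - v x y * (f' x * g y)) 0 1).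
{ intros x H. unfold W0. apply RInt_ext. intros y _.
  destruct (cut_one Hcut x y H) as [-> _]. simpl; eqR; ring. }
rewrite <- (WF x1), <- (WF x2) by (apply Rmin_l || apply Rmin_r).
set (J0 := fun x => I x + (4 * D * RInt M (- L) x + D * k2 * x)).
assert (DJ0 : forall x, is_derive J0 x (RInt (fun y => T x y) 0 1 + (4 * D * M x + D * k2 * 1))).
{ intro x. apply D_plus. apply DT. apply D_plus. apply D_scal, D_RInt, CM. apply D_scal, D_id. }
assert (CZ : forall x y, continuous (fun y => eta x y ^ 2 * (phi L x ^ 2 * (vx x y ^ 2 + vy x y ^ 2))) y).
{ intros x y. apply (c2d_slice_y (fun x y => eta x y ^ 2 * (phi L x ^ 2 * (vx x y ^ 2 + vy x y ^ 2)))).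
  apply (cut_square_c2d a L eps r1 eta etax etay M (fun x y => phi L x ^ 2 * (vx x y ^ 2 + vy x y ^ 2)) Hcut).
  intros u w Huv. apply continuity_2d_pt_mult. apply c2d_pow2, c2d_x. eapply C_of_D, D_phi; auto.
  apply continuity_2d_pt_plus; apply c2d_pow2; [apply (reg_cx Hr)|apply (reg_cy Hr)]; auto. }
assert (HZ : forall x, Rabs x <= L ->
  / 2 * RInt (fun y => eta x y ^ 2 * (phi L x ^ 2 * (vx x y ^ 2 + vy x y ^ 2))) 0 1 <=
  RInt (fun y => T x y) 0 1 + (4 * D * M x + D * k2 * 1)).
{ intros x Hx'. specialize (ES x Hx'). fold k2 in ES.
  replace (1 ^ 2 / 2) with (/ 2) in ES by field.
  rewrite (Rplus_assoc (4 * M x)) in ES. fold k2 in ES. lra. }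
assert (HZ0 : forall x, 0 <= RInt (fun y => eta x y ^ 2 * (phi L x ^ 2 * (vx x y ^ 2 + vy x y ^ 2))) 0 1).
{ intro x. apply RInt_ge_0; [lra| |]. apply ex_RInt_C, CZ. intros y _.
  apply Rmult_le_pos; [apply pow2_ge_0|]. apply Rmult_le_pos; [apply pow2_ge_0|].
  generalize (pow2_ge_0 (vx x y)) (pow2_ge_0 (vy x y)); lra. }
set (c3 := (Bs ^ 2 + 1) / k).
assert (Hc3 : 0 < c3) by (apply Rdiv_lt_0_compat; [generalize (pow2_ge_0 Bs)|]; lra).
set (H' := fun x => 4 * k * (RInt (fun y => T x y) 0 1 + (4 * D * M x + D * k2 * 1))
   + (c3 * M x + 2 * k * (Bv ^ 2 * Bs ^ 2) * 1)).
set (H := fun x => 4 * k * J0 x + (c3 * RInt M (- L) x + 2 * k * (Bv ^ 2 * Bs ^ 2) * x)).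
assert (DH : forall x, is_derive H x (H' x)).
{ intro x. apply D_plus. apply D_scal, DJ0. apply D_plus. apply D_scal, D_RInt, CM. apply D_scal, D_id. }
assert (HW : forall x, - (L / 2) <= x <= L / 2 -> Rabs (RInt (fun y => T2 x y) 0 1) <= H' x).
{ intros x Hx'. assert (Hxl : Rabs x <= L) by (apply Rabs_le; lra).
  assert (Hphi : 1 / 2 <= phi L x ^ 2).
  { assert (Hxd : - (1 / 2) <= x / L <= 1 / 2).
    { split; apply Rmult_le_reg_r with L; auto; unfold Rdiv; rewrite (Rmult_assoc x), Rinv_l by lra; lra. }
    unfold phi. assert ((x / L) ^ 2 <= 1 / 4) by nra. set (w := (x / L) ^ 2) in *. nra. }
  eapply Rle_trans. apply (abs_RInt_le (fun y => T2 x y)); [lra|].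
  { apply ex_RInt_C. intro y. apply (c2d_slice_y T2), CW. }
  set (Z := fun y => eta x y ^ 2 * (phi L x ^ 2 * (vx x y ^ 2 + vy x y ^ 2))).
  set (G := fun y => etax x y ^ 2 + etay x y ^ 2).
  assert (CG : forall y, continuous G y).
  { intro y. apply C_plus; apply C_pow2.
    apply (c2d_slice_y etax), (cut_cx Hcut).
    apply (c2d_slice_y etay), (cut_cy Hcut). }
  apply Rle_trans with (RInt (fun y => (2 * k * Z y + c3 * G y) + 2 * k * (Bv ^ 2 * Bs ^ 2)) 0 1).
  - apply RInt_le; [lra| | |].
    + apply ex_RInt_C. intro y. apply (continuous_comp (fun y => T2 x y) Rabs).
      apply (c2d_slice_y T2), CW. apply continuous_Rabs.
    + apply ex_RInt_C. intro y. apply C_plus; [|apply C_const].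
      apply C_plus; apply C_mult; try apply C_const; auto. apply CZ.
    + intros y Hy. unfold T2, Z, G. 
      assert (Hb : 0 <= k * (eta x y ^ 2 * (vx x y ^ 2 + vy x y ^ 2))).
      { apply Rmult_le_pos; [lra|]. apply Rmult_le_pos; [apply pow2_ge_0|].
        generalize (pow2_ge_0 (vx x y)) (pow2_ge_0 (vy x y)); lra. }
      assert (Hz1 : k * (eta x y ^ 2 * (vx x y ^ 2 + vy x y ^ 2)) <=
        2 * k * (eta x y ^ 2 * (phi L x ^ 2 * (vx x y ^ 2 + vy x y ^ 2)))).
      { replace (2 * k * (eta x y ^ 2 * (phi L x ^ 2 * (vx x y ^ 2 + vy x y ^ 2))))
          with (2 * phi L x ^ 2 * (k * (eta x y ^ 2 * (vx x y ^ 2 + vy x y ^ 2)))) by ring. nra. }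
      destruct (Rlt_dec 0 (rho a x y)) as [Hn|Hn].
      * assert (Heq := ws_eq Hw x y Hn). cbn beta in Heq.
        match goal with |- Rabs (_ + _ * ?z) <= _ => assert (Ez : z = 0) end.
        { assert (Hp := Hpsi x y).
          replace (vxx x y) with (- vyy x y - V x y * v x y) by lra.
          replace (f'' x * g y) with (- (f x * g'' y) - V x y * (f x * g y)) by lra. ring. }
        rewrite Ez, Rmult_0_r, Rplus_0_r.
        assert (Hxi : - L <= x <= L) by lra. assert (Hyi : 0 <= y <= 1) by lra.
        specialize (HB1' x Hxi). specialize (HB2' x Hxi). specialize (HB3' y Hyi). specialize (HB4' y Hyi).
        assert (Bb : forall p q P Q, Rabs p <= P -> Rabs q <= Q -> 0 < P <= B1 + B2 -> 0 < Q <= B3 + B4 -> Rabs (p * q) <= Bs).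
        { intros p q P Q Hp Hq HP HQ. rewrite Rabs_mult. unfold Bs.
          apply Rmult_le_compat; try apply Rabs_pos; lra. }
        eapply Rle_trans.
        apply (flux_pointwise (eta x y) (etax x y) (etay x y) (v x y) (vx x y) (vy x y)
          (f x * g y) (f' x * g y) (f x * g' y) Bs Bv k); try lra.
        { apply (cut_range Hcut). }
        { apply (Bb _ _ B1 B3); lra. } { apply (Bb _ _ B2 B3); lra. } { apply (Bb _ _ B1 B4); lra. }
        { apply (ws_q Hw); auto. }
        fold c3. lra.
      * destruct (T0 x y Hn) as [_ [E1 [E2 E3]]]. rewrite E1, E2, E3 in *.
        match goal with |- Rabs ?z <= _ => replace z with 0 by ring end. rewrite Rabs_R0. nra.
  - rewrite RI_plus.
    2:{ apply ex_RInt_C. intro y. apply C_plus; apply C_mult; try apply C_const; auto. apply CZ. }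
    2:{ apply ex_RInt_const. }
    unfold rint. rewrite RI_plus, RI_const.
    2:{ apply ex_RInt_C. intro y. apply C_mult; try apply C_const; auto. apply CZ. }
    2:{ apply ex_RInt_C. intro y. apply C_mult; try apply C_const; auto. }
    unfold rint. rewrite RI_scal, RI_scal. 2: apply ex_RInt_C; auto. 2: apply ex_RInt_C, CZ.
    unfold rint, H'. specialize (HZ x Hxl). fold Z in HZ.
    assert (HGM : RInt G 0 1 <= M x) by apply (cut_int Hcut x).
    assert (c3 * RInt G 0 1 <= c3 * M x) by (apply Rmult_le_compat_l; lra).
    assert (2 * k * RInt Z 0 1 <= 4 * k * (RInt (fun y => T x y) 0 1 + (4 * D * M x + D * k2 * 1))).
    { replace (2 * k * RInt Z 0 1) with (4 * k * (/ 2 * RInt Z 0 1)) by field.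
      apply Rmult_le_compat_l; lra. }
    lra. }
assert (U1 : 0 * (x2 - x1) <= (H x2 - W0 x2) - (H x1 - W0 x1)).
{ apply (increment_ge (fun x => H x - W0 x) (fun x => H' x - RInt (fun y => T2 x y) 0 1)); auto.
  - intros x _. apply D_minus; auto.
  - intros x Hx'. specialize (HW x ltac:(lra)). apply Rabs_le_between in HW. lra. }
assert (U2 : 0 * (x2 - x1) <= (H x2 + W0 x2) - (H x1 + W0 x1)).
{ apply (increment_ge (fun x => H x + W0 x) (fun x => H' x + RInt (fun y => T2 x y) 0 1)); auto.
  - intros x _. apply D_plus; auto.
  - intros x Hx'. specialize (HW x ltac:(lra)). apply Rabs_le_between in HW. lra. }
assert (JP : forall u w, - L <= u <= w -> w <= L -> 0 * (w - u) <= J0 w - J0 u).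
{ intros u w Hu Hw'. apply (increment_ge J0 (fun x => RInt (fun y => T x y) 0 1 + (4 * D * M x + D * k2 * 1))); [lra|auto|].
  intros x Hx'. generalize (HZ x ltac:(apply Rabs_le; lra)) (HZ0 x). lra. }
assert (MP : forall u w, - L <= u <= w -> w <= L -> 0 <= RInt M (- L) w - RInt M (- L) u).
{ intros u w Hu Hw'. assert (E := increment_ge (fun t => RInt M (- L) t) M 0 u w ltac:(lra)
    ltac:(intros; apply D_RInt, CM) ltac:(intros; apply M0)). lra. }
assert (HM := cut_M Hcut).
destruct (energy_flux_ends (fun _ => 1) v vx L eta HL) as [IL ImL].
assert (RP : RInt M (- L) (- L) = 0) by (rewrite RInt_point; reflexivity).
assert (EJ : J0 x2 - J0 x1 <= 4 * D * eps + D * k2 * (2 * L)).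
{ generalize (JP (- L) x1 ltac:(lra) ltac:(lra)) (JP x2 L ltac:(lra) ltac:(lra)). intros J1 J2.
  assert (J0 L - J0 (- L) <= 4 * D * eps + D * k2 * (2 * L)).
  { unfold J0, I. rewrite IL, ImL, RP.
    assert (4 * D * RInt M (- L) L <= 4 * D * eps) by (apply Rmult_le_compat_l; lra). lra. }
  lra. }
assert (EM : RInt M (- L) x2 - RInt M (- L) x1 <= eps).
{ generalize (MP (- L) x1 ltac:(lra) ltac:(lra)) (MP x2 L ltac:(lra) ltac:(lra)). lra. }
assert (EH : H x2 - H x1 <= k * Const).
{ unfold H.
  assert (4 * k * (J0 x2 - J0 x1) <= 4 * k * (4 * D * eps + D * k2 * (2 * L))) by (apply Rmult_le_compat_l; lra).
  assert (c3 * (RInt M (- L) x2 - RInt M (- L) x1) <= c3 * eps) by (apply Rmult_le_compat_l; lra).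
  assert (c3 * eps = k * (Bs ^ 2 + 1)) by (unfold c3, eps; field; lra).
  assert (2 * k * (Bv ^ 2 * Bs ^ 2) * (x2 - x1) <= 2 * k * (Bv ^ 2 * Bs ^ 2) * (2 * L)).
  { apply Rmult_le_compat_l; [|lra]. apply Rmult_le_pos; lra. }
  assert (4 * k * (4 * D * eps + D * k2 * (2 * L)) <= 4 * k * (D * (4 + k2 * (2 * L)))).
  { apply Rmult_le_compat_l; [lra|]. assert (D * eps <= D) by nra. nra. }
  unfold Const. lra. }
apply Rabs_le. lra.
Qed.

(** * The Euler top *)

Lemma linear_growth_bounded (u w C : R) :
  (forall n : nat, Rabs (u + INR n * w) <= C) -> w = 0.
Proof.
intro H. destruct (Req_dec w 0) as [|Hw]; auto. exfalso.
assert (Hp : 0 < Rabs w) by (apply Rabs_pos_lt; auto).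
destruct (INR_unbounded ((C + Rabs u + 1) / Rabs w)) as [n Hn].
specialize (H n).
assert (E : INR n * Rabs w <= C + Rabs u).
{ rewrite <- (Rabs_pos_eq (INR n)) by apply pos_INR. rewrite <- Rabs_mult.
  replace (INR n * w) with ((u + INR n * w) - u) by ring.
  eapply Rle_trans. apply Rabs_triang. rewrite Rabs_Ropp. lra. }
apply (Rmult_lt_compat_r (Rabs w)) in Hn; auto.
unfold Rdiv in Hn. rewrite Rmult_assoc, Rinv_l in Hn by lra. lra.
Qed.

Lemma constant_of_derive_zero (f : R -> R) : (forall x, is_derive f x 0) -> forall x y, f x = f y.
Proof.
intro H. assert (G : forall x y, x <= y -> f x = f y).
{ intros x y Hxy.
  generalize (increment_ge f (fun _ => 0) 0 x y Hxy ltac:(auto) ltac:(intros; lra)).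
  generalize (increment_ge (fun t => - f t) (fun _ => - 0) 0 x y Hxy
    ltac:(intros; apply D_opp; auto) ltac:(intros; lra)). lra. }
intros x y. destruct (Rle_dec x y). auto. symmetry; apply G; lra.
Qed.

(** The growth rate [sg] over a period is the source of the unboundedness of the second
    solutions below. *)
Lemma primitive_periodic (f : R -> R) (T x0 : R) :
  (forall x, continuous f x) -> (forall x, f (x + T) = f x) -> (forall x, 0 <= f x) ->
  0 < T -> 0 < f x0 ->
  exists sg, 0 < sg /\ forall n : nat, RInt f 0 (x0 + INR n * T) = RInt f 0 x0 + INR n * sg.
Proof.
intros Hc Hp H0 HT Hx0.
set (S := fun x => RInt f 0 x).
assert (DS : forall x, is_derive S x (f x)) by (intro; apply D_RInt; auto).
assert (E : forall x, S (x + T) - S x = S (x0 + T) - S x0).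
{ intro x. apply (constant_of_derive_zero (fun x => S (x + T) - S x)).
  intro t. eapply is_derive_eq. apply D_minus; [|apply DS].
  apply (D_comp S (fun x => x + T)). apply DS. apply D_plus. apply D_id. apply D_const.
  rewrite Hp. rring. }
exists (S (x0 + T) - S x0). split.
- destruct (proj1 (continuous_R f x0) (Hc x0) (f x0 / 2) ltac:(lra)) as [d [Hd Hd']].
  set (r := Rmin (d / 2) T). assert (Hr : 0 < r) by (apply Rmin_pos; lra).
  assert (Hr1 : r <= d / 2) by apply Rmin_l. assert (Hr2 : r <= T) by apply Rmin_r.
  generalize (increment_ge S f (f x0 / 2) x0 (x0 + r) ltac:(lra) ltac:(auto)
    ltac:(intros x Hx; specialize (Hd' x ltac:(apply Rabs_def1; lra)); apply Rabs_def2 in Hd'; lra)).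
  generalize (increment_ge S f 0 (x0 + r) (x0 + T) ltac:(lra) ltac:(auto) ltac:(intros; auto)).
  intros. assert (0 < f x0 / 2 * (x0 + r - x0)) by (apply Rmult_lt_0_compat; lra). lra.
- induction n as [|n IH].
  + simpl. rewrite !Rmult_0_l, !Rplus_0_r. reflexivity.
  + rewrite S_INR. specialize (E (x0 + INR n * T)).
    replace (x0 + (INR n + 1) * T) with (x0 + INR n * T + T) by ring.
    unfold S in *. fold (rint f 0 (x0 + INR n * T)) in *. lra.
Qed.

(** The system of the Euler top.  With [p = cos F], [q = sin F] and [k = F'] it is the
    pendulum equation [F'' = - B sin (2 F)] with energy integral [top_sq]. *)
Set Implicit Arguments.
Record top (A B : R) (p q k : R -> R) : Prop := {
  top_dp : forall x, is_derive p x (- (q x * k x));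
  top_dq : forall x, is_derive q x (p x * k x);
  top_dk : forall x, is_derive k x (- (2 * B * p x * q x));
  top_unit : forall x, p x ^ 2 + q x ^ 2 = 1;
  top_sq : forall x, k x ^ 2 = A + B * (p x ^ 2 - q x ^ 2);
  top_pos : forall x, 0 < p x }.
Unset Implicit Arguments.

Lemma top_cont {A B p q k} : top A B p q k ->
  forall x, continuous p x /\ continuous q x /\ continuous k x.
Proof.
intros H x. split; [|split]; eapply C_of_D; [apply (top_dp H)|apply (top_dq H)|apply (top_dk H)].
Qed.

Lemma top_bounds {A B p q k} : Rabs A < B -> top A B p q k -> forall x,
  sqrt ((B - A) / (2 * B)) <= p x <= 1 /\ Rabs (q x) <= 1 /\ k x ^ 2 <= 2 * B.
Proof.
intros HAB H x. apply Rabs_def2 in HAB.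
assert (U := top_unit H x). assert (S := top_sq H x).
assert (P := top_pos H x).
assert (E : p x ^ 2 = (k x ^ 2 + B - A) / (2 * B)).
{ replace (q x ^ 2) with (1 - p x ^ 2) in S by lra. rewrite S. field. lra. }
repeat split.
- rewrite <- (sqrt_pow2 (p x)) by lra. apply sqrt_le_1_alt. rewrite E.
  apply Rmult_le_compat_r. apply Rlt_le, Rinv_0_lt_compat; lra. generalize (pow2_ge_0 (k x)); lra.
- generalize (pow2_ge_0 (q x)); nra.
- apply Rabs_le. generalize (pow2_ge_0 (p x)); nra.
- generalize (pow2_ge_0 (q x)); nra.
Qed.

(** Second solution of the equation of [q], by reduction of order: [q] times a primitive
    of [(A + B) / q^2], rewritten so as to be regular at the zeros of [q]. *)
Definition qq2 (B : R) (p q k : R -> R) (x : R) : R :=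
  - (k x * p x) + 2 * B * q x * RInt (fun t => q t ^ 2) 0 x.
Definition qq2' (B : R) (p q k : R -> R) (x : R) : R :=
  q x * (2 * B + k x ^ 2) + 2 * B * p x * k x * RInt (fun t => q t ^ 2) 0 x.

Lemma D_qq2 {A B p q k} : top A B p q k -> forall x,
  is_derive (qq2 B p q k) x (qq2' B p q k x) /\
  is_derive (qq2' B p q k) x ((A - B - 2 * k x ^ 2) * qq2 B p q k x).
Proof.
intros H x.
assert (DS : is_derive (fun x => RInt (fun t => q t ^ 2) 0 x) x (q x ^ 2)).
{ apply (D_RInt (fun t => q t ^ 2)). intro t. apply C_pow2, (top_cont H). }
assert (U := top_unit H x). assert (S := top_sq H x).
assert (Dp := top_dp H x). assert (Dq := top_dq H x). assert (Dk := top_dk H x).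
split.
- unfold qq2, qq2'. eapply is_derive_eq.
  apply D_plus. apply D_opp. apply D_mult; eauto. apply D_mult; eauto. apply D_scal; eauto.
  eqR. cbv beta. set (I := RInt _ _ _ : R). 
  replace (q x ^ 2) with (1 - p x ^ 2) by lra. ring.
- unfold qq2, qq2'. eapply is_derive_eq.
  apply D_plus. apply D_mult. eauto. apply D_plus. apply D_const. apply D_pow2; eauto.
  apply D_mult; eauto. apply D_mult; eauto. apply D_scal; eauto.
  eqR. cbv beta. set (I := RInt _ _ _ : R).
  assert (E : k x ^ 2 = A - B + 2 * B * p x ^ 2) by (rewrite S; replace (q x ^ 2) with (1 - p x ^ 2) by lra; ring).
  replace (A - B - 2 * k x ^ 2) with (- k x ^ 2 - 2 * B * p x ^ 2) by (rewrite E; ring).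
  replace (p x * k x * (2 * B + k x ^ 2)) with (p x * k x * (2 * B * (p x ^ 2 + q x ^ 2) + k x ^ 2)) by (rewrite U; ring).
  ring.
Qed.

Lemma wronskian_qq2 {A B p q k} : top A B p q k -> forall x,
  q x * qq2' B p q k x - p x * k x * qq2 B p q k x = A + B.
Proof.
intros H x. unfold qq2, qq2'. set (I := RInt _ _ _ : R).
assert (U := top_unit H x). assert (S := top_sq H x).
replace (q x * (q x * (2 * B + k x ^ 2) + 2 * B * p x * k x * I) -
  p x * k x * (- (k x * p x) + 2 * B * q x * I)) with (2 * B * q x ^ 2 + k x ^ 2 * (p x ^ 2 + q x ^ 2)) by ring.
rewrite U, S. replace (p x ^ 2) with (1 - q x ^ 2) by lra. ring.
Qed.

(** Likewise for the equation of [k]. *)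
Definition kk2 (B : R) (p q k : R -> R) (x : R) : R :=
  2 * B * p x * q x - k x * RInt (fun t => k t ^ 2) 0 x.
Definition kk2' (B : R) (p q k : R -> R) (x : R) : R :=
  2 * B * k x * (p x ^ 2 - q x ^ 2) + 2 * B * p x * q x * RInt (fun t => k t ^ 2) 0 x - k x ^ 3.

Lemma D_kk2 {A B p q k} : top A B p q k -> forall x,
  is_derive (kk2 B p q k) x (kk2' B p q k x) /\
  is_derive (kk2' B p q k) x ((2 * A - 2 * k x ^ 2) * kk2 B p q k x).
Proof.
intros H x.
assert (DS : is_derive (fun x => RInt (fun t => k t ^ 2) 0 x) x (k x ^ 2)).
{ apply (D_RInt (fun t => k t ^ 2)). intro t. apply C_pow2, (top_cont H). }
assert (S := top_sq H x).
assert (Dp := top_dp H x). assert (Dq := top_dq H x). assert (Dk := top_dk H x).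
split.
- unfold kk2, kk2'. eapply is_derive_eq.
  apply D_minus. apply D_mult; eauto. apply D_scal; eauto. apply D_mult; eauto.
  eqR. cbv beta. set (I := RInt _ _ _ : R). ring.
- unfold kk2, kk2'. eapply is_derive_eq.
  apply D_minus. apply D_plus. apply D_mult. apply D_scal; eauto. apply D_minus; apply D_pow2; eauto.
  apply D_mult. apply D_mult; eauto. apply D_scal; eauto. eauto.
  { apply (is_derive_ext (fun t => k t * (k t * k t))). intro; simpl; eqR; ring.
    apply D_mult. eauto. apply D_mult; eauto. }
  eqR. cbv beta. set (I := RInt _ _ _ : R).
  replace (2 * A - 2 * k x ^ 2) with (- (2 * B * (p x ^ 2 - q x ^ 2))) by (rewrite S; ring).
  ring.
Qed.

Lemma wronskian_kk2 A B p q k : top A B p q k -> forall x,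
  k x * kk2' B p q k x - - (2 * B * p x * q x) * kk2 B p q k x = B ^ 2 - A ^ 2.
Proof.
intros H x. unfold kk2, kk2'. set (I := RInt _ _ _ : R).
assert (U := top_unit H x). assert (S := top_sq H x).
replace (k x * (2 * B * k x * (p x ^ 2 - q x ^ 2) + 2 * B * p x * q x * I - k x ^ 3) -
  - (2 * B * p x * q x) * (2 * B * p x * q x - k x * I))
  with (2 * B * k x ^ 2 * (p x ^ 2 - q x ^ 2) - (k x ^ 2) ^ 2 + 4 * B ^ 2 * p x ^ 2 * q x ^ 2) by ring.
rewrite S. replace (p x ^ 2) with (1 - q x ^ 2) by lra. ring.
Qed.

(** Along [x0 + n T] the integral in [qq2] grows linearly while all other factors are
    periodic. *)
Lemma qq2_bounded A B p q k T C1 C2 Bd : Rabs A < B -> top A B p q k ->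
  0 < T -> (forall x, p (x + T) = p x /\ q (x + T) = q x /\ k (x + T) = k x) ->
  forall x0, q x0 <> 0 ->
  (forall n : nat, Rabs (C1 * qq2 B p q k (x0 + INR n * T) + C2 * q (x0 + INR n * T)) <= Bd) ->
  C1 = 0.
Proof.
intros HAB H HT Hper x0 Hq Hb. apply Rabs_def2 in HAB.
destruct (primitive_periodic (fun t => q t ^ 2) T x0) as [sg [Hsg E]]; auto.
- intro. apply C_pow2, (top_cont H).
- intro x. destruct (Hper x) as [_ [-> _]]. reflexivity.
- intro; apply pow2_ge_0.
- apply pow2_gt_0; auto.
- assert (Pn : forall n : nat, p (x0 + INR n * T) = p x0 /\ q (x0 + INR n * T) = q x0 /\ k (x0 + INR n * T) = k x0).
  { induction n as [|n IH]. simpl. rewrite Rmult_0_l, Rplus_0_r. auto.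
    rewrite S_INR. replace (x0 + (INR n + 1) * T) with (x0 + INR n * T + T) by ring.
    destruct (Hper (x0 + INR n * T)) as [-> [-> ->]]. auto. }
  assert (Z : C1 * (2 * B * q x0 * sg) = 0).
  { apply (linear_growth_bounded (C1 * qq2 B p q k x0 + C2 * q x0) _ Bd).
    intro n. specialize (Hb n). unfold qq2 in *. destruct (Pn n) as [E1 [E2 E3]].
    rewrite E1, E2, E3 in Hb.
    match type of Hb with context [RInt ?f ?a ?b] => replace (RInt f a b) with (RInt (fun t => q t ^ 2) 0 x0 + INR n * sg) in Hb by (symmetry; apply E) end.
    match goal with |- Rabs ?l <= _ => match type of Hb with Rabs ?m <= _ => replace l with m; auto end end.
    rring. }
  apply Rmult_integral in Z. destruct Z as [Z|Z]; auto. exfalso.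
  assert (2 * B * q x0 * sg <> 0) by (repeat apply Rmult_integral_contrapositive_currified; lra). auto.
Qed.

Lemma kk2_bounded A B p q k T C1 C2 Bd : Rabs A < B -> top A B p q k ->
  0 < T -> (forall x, p (x + T) = p x /\ q (x + T) = q x /\ k (x + T) = k x) ->
  forall x0, k x0 <> 0 ->
  (forall n : nat, Rabs (C1 * kk2 B p q k (x0 + INR n * T) + C2 * k (x0 + INR n * T)) <= Bd) ->
  C1 = 0.
Proof.
intros HAB H HT Hper x0 Hq Hb.
destruct (primitive_periodic (fun t => k t ^ 2) T x0) as [sg [Hsg E]]; auto.
- intro. apply C_pow2, (top_cont H).
- intro x. destruct (Hper x) as [_ [_ ->]]. reflexivity.
- intro; apply pow2_ge_0.
- apply pow2_gt_0; auto.
- assert (Pn : forall n : nat, p (x0 + INR n * T) = p x0 /\ q (x0 + INR n * T) = q x0 /\ k (x0 + INR n * T) = k x0).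
  { induction n as [|n IH]. simpl. rewrite Rmult_0_l, Rplus_0_r. auto.
    rewrite S_INR. replace (x0 + (INR n + 1) * T) with (x0 + INR n * T + T) by ring.
    destruct (Hper (x0 + INR n * T)) as [-> [-> ->]]. auto. }
  assert (Z : C1 * (- k x0 * sg) = 0).
  { apply (linear_growth_bounded (C1 * kk2 B p q k x0 + C2 * k x0) _ Bd).
    intro n. specialize (Hb n). unfold kk2 in *. destruct (Pn n) as [E1 [E2 E3]].
    rewrite E1, E2, E3 in Hb.
    match type of Hb with context [RInt ?f ?a ?b] => replace (RInt f a b) with (RInt (fun t => k t ^ 2) 0 x0 + INR n * sg) in Hb by (symmetry; apply E) end.
    match goal with |- Rabs ?l <= _ => match type of Hb with Rabs ?m <= _ => replace l with m; auto end end.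
    rring. }
  apply Rmult_integral in Z. destruct Z as [Z|Z]; auto. exfalso.
  assert (- k x0 * sg <> 0) by (repeat apply Rmult_integral_contrapositive_currified; lra). auto.
Qed.

(** * The transversal quadratic form *)

Lemma lipschitz_of_derive (u u' : R -> R) (a b M : R) :
  (forall x, is_derive u x (u' x)) -> (forall x, a <= x <= b -> Rabs (u' x) <= M) ->
  forall x y, a <= x <= b -> a <= y <= b -> Rabs (u y - u x) <= M * Rabs (y - x).
Proof.
intros H HM.
assert (G : forall x y, a <= x <= y -> y <= b -> Rabs (u y - u x) <= M * (y - x)).
{ intros x y Hx Hy. apply Rabs_le.
  generalize (increment_ge u u' (- M) x y ltac:(lra) ltac:(auto)
    ltac:(intros t Ht; specialize (HM t ltac:(lra)); apply Rabs_le_between in HM; lra)).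
  generalize (increment_ge (fun t => - u t) (fun t => - u' t) (- M) x y ltac:(lra)
    ltac:(intros; apply D_opp; auto)
    ltac:(intros t Ht; specialize (HM t ltac:(lra)); apply Rabs_le_between in HM; lra)). lra. }
intros x y Hx Hy. destruct (Rle_dec x y).
- rewrite (Rabs_pos_eq (y - x)) by lra. apply G; lra.
- rewrite (Rabs_minus_sym (u y)), (Rabs_minus_sym y), (Rabs_pos_eq (x - y)) by lra. apply G; lra.
Qed.

Lemma simple_zero_lower (Q : R -> R) (y0 l : R) : is_derive Q y0 l -> l <> 0 -> Q y0 = 0 ->
  exists d, 0 < d /\ forall y, Rabs (y - y0) < d -> Rabs l / 2 * Rabs (y - y0) <= Rabs (Q y).
Proof.
intros H Hl H0. assert (Hp : 0 < Rabs l) by (apply Rabs_pos_lt; auto).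
apply is_derive_Reals in H. destruct (H (Rabs l / 2) ltac:(lra)) as [d Hd].
exists d; split; [apply cond_pos|]. intros y Hy.
destruct (Req_dec y y0) as [->|Hne].
{ rewrite Rminus_diag, Rabs_R0, Rmult_0_r. apply Rabs_pos. }
specialize (Hd (y - y0) ltac:(lra) Hy). replace (y0 + (y - y0)) with y in Hd by ring.
rewrite H0, Rminus_0_r in Hd.
assert (Hyp : 0 < Rabs (y - y0)) by (apply Rabs_pos_lt; lra).
assert (E : Rabs l - Rabs (Q y / (y - y0)) <= Rabs (Q y / (y - y0) - l)).
{ rewrite <- (Rabs_Ropp (Q y / (y - y0) - l)). eapply Rle_trans; [apply Rabs_triang_inv|].
  right. f_equal. ring. }
assert (E2 : Rabs (Q y) = Rabs (Q y / (y - y0)) * Rabs (y - y0)).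
{ rewrite <- Rabs_mult. f_equal. field. lra. }
rewrite E2. apply Rmult_le_compat_r; lra.
Qed.

(** Near a zero of [Q], [|u|] is at most linear and [|Q|] at least linear in the
    distance; elsewhere compactness bounds the quotient. *)
Lemma dominated_by_simple_zeros (u u' Q : R -> R) (y0 y1 l0 l1 : R) :
  (forall y, is_derive u y (u' y)) -> (forall y, continuous u' y) ->
  (forall y, continuous Q y) ->
  is_derive Q y0 l0 -> is_derive Q y1 l1 -> l0 <> 0 -> l1 <> 0 ->
  Q y0 = 0 -> Q y1 = 0 -> u y0 = 0 -> u y1 = 0 -> 0 <= y0 <= 1 -> 0 <= y1 <= 1 ->
  (forall y, 0 <= y <= 1 -> Q y = 0 -> y = y0 \/ y = y1) ->
  exists m, 0 <= m /\ forall y, 0 <= y <= 1 -> u y ^ 2 <= m * Q y ^ 2.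
Proof.
intros Du Cu' CQ D0 D1 Hl0 Hl1 Q0 Q1 U0 U1 Hy0 Hy1 Hz.
destruct (simple_zero_lower Q y0 l0 D0 Hl0 Q0) as [d0 [Hd0 L0]].
destruct (simple_zero_lower Q y1 l1 D1 Hl1 Q1) as [d1 [Hd1 L1]].
destruct (continuous_bounded u' 0 1 (fun x _ => Cu' x)) as [B1 [HB1 HB1']].
destruct (continuous_bounded u 0 1 ltac:(intros; eapply C_of_D; auto)) as [B0 [HB0 HB0']].
set (N := fun y => Q y ^ 2 + (Rmax 0 (d0 - Rabs (y - y0)) + Rmax 0 (d1 - Rabs (y - y1)))).
assert (CR : forall c d y, continuous (fun y => Rmax 0 (d - Rabs (y - c))) y).
{ intros c d y. apply (continuous_comp (fun y => d - Rabs (y - c)) (fun t => Rmax 0 t)); [|apply continuous_Rmax0].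
  apply C_minus. apply C_const. apply (continuous_comp (fun y => y - c) Rabs).
  apply C_minus. apply C_id. apply C_const. apply continuous_Rabs. }
assert (CN : forall y, continuous N y).
{ intro y. apply C_plus. apply C_pow2; auto. apply C_plus; apply CR. }
destruct (continuity_ab_min N 0 1 ltac:(lra)) as [ym [Hm Hym]].
{ intros; apply continuity_pt_filterlim, CN. }
assert (HNm : 0 < N ym).
{ unfold N. generalize (Rmax_l 0 (d0 - Rabs (ym - y0))) (Rmax_l 0 (d1 - Rabs (ym - y1))) (pow2_ge_0 (Q ym)); intros.
  destruct (Req_dec (Q ym) 0) as [E|E].
  - destruct (Hz ym Hym E) as [-> | ->].
    + rewrite Rminus_diag, Rabs_R0, Rminus_0_r in *. rewrite (Rmax_right 0 d0) by lra. lra.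
    + rewrite (Rminus_diag y1), Rabs_R0, Rminus_0_r in *. rewrite (Rmax_right 0 d1) by lra. lra.
  - assert (0 < Q ym ^ 2) by (apply pow2_gt_0; auto). lra. }
assert (Near : forall yz l d, 0 <= yz <= 1 -> u yz = 0 -> l <> 0 ->
   (forall y, Rabs (y - yz) < d -> Rabs l / 2 * Rabs (y - yz) <= Rabs (Q y)) ->
   forall y, 0 <= y <= 1 -> Rabs (y - yz) < d -> u y ^ 2 <= (2 * B1 / Rabs l) ^ 2 * Q y ^ 2).
{ intros yz l d Hyz Uz Hl Hlow y Hy Hyd. assert (Hlp : 0 < Rabs l) by (apply Rabs_pos_lt; auto).
  specialize (Hlow y Hyd).
  generalize (lipschitz_of_derive u u' 0 1 B1 Du HB1' yz y Hyz Hy). rewrite Uz, Rminus_0_r. intro Hu.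
  rewrite <- (pow2_abs (u y)), <- (pow2_abs (Q y)), <- Rpow_mult_distr.
  apply pow_incr. split; [apply Rabs_pos|]. eapply Rle_trans; [apply Hu|].
  replace (B1 * Rabs (y - yz)) with (2 * B1 / Rabs l * (Rabs l / 2 * Rabs (y - yz))) by (field; lra).
  apply Rmult_le_compat_l; auto. apply Rdiv_le_0_compat; lra. }
exists ((2 * B1 / Rabs l0) ^ 2 + (2 * B1 / Rabs l1) ^ 2 + B0 ^ 2 / N ym).
assert (H0 := pow2_ge_0 (2 * B1 / Rabs l0)). assert (H1 := pow2_ge_0 (2 * B1 / Rabs l1)).
assert (H2 : 0 <= B0 ^ 2 / N ym) by (apply Rdiv_le_0_compat; [apply pow2_ge_0|lra]).
split; [lra|]. intros y Hy. assert (HQ := pow2_ge_0 (Q y)).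
destruct (Rlt_dec (Rabs (y - y0)) d0) as [A0|A0].
{ eapply Rle_trans. apply (Near y0 l0 d0); auto. apply Rmult_le_compat_r; lra. }
destruct (Rlt_dec (Rabs (y - y1)) d1) as [A1|A1].
{ eapply Rle_trans. apply (Near y1 l1 d1); auto. apply Rmult_le_compat_r; lra. }
assert (E : N y = Q y ^ 2) by (unfold N; rewrite !Rmax_left by lra; ring).
specialize (Hm y Hy). rewrite E in Hm.
apply Rle_trans with (B0 ^ 2 / N ym * Q y ^ 2).
2:{ apply Rmult_le_compat_r; lra. }
apply Rle_trans with (B0 ^ 2 / N ym * N ym).
2:{ apply Rmult_le_compat_l; lra. }
replace (B0 ^ 2 / N ym * N ym) with (B0 ^ 2) by (field; lra).
rewrite <- (pow2_abs (u y)). apply pow_incr. split; [apply Rabs_pos|auto].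
Qed.

(** A motion of the top of period 1 that is symmetric under [y -> 1 - y], such that [mu]
    vanishes only at the multiples of 1/2: a pendulum swinging back and forth. *)
Set Implicit Arguments.
Record libration (A B : R) (P Q mu : R -> R) : Prop := {
  lib_top : top (- A) B P Q mu;
  lib_AB : Rabs A < B;
  lib_per : forall y, P (y + 1) = P y /\ Q (y + 1) = Q y /\ mu (y + 1) = mu y;
  lib_sym : forall y, P (1 - y) = P y /\ Q (1 - y) = Q y /\ mu (1 - y) = - mu y;
  lib_nz : forall y, 0 < y < / 2 -> mu y <> 0 }.
Unset Implicit Arguments.
Arguments lib_nz {A B P Q mu} _.

(** As [Q' = P mu], [Q] is strictly monotone on the half period, and at both ends, where
    [mu] vanishes, [Q^2] has the same value, positive because [|A| < B]: [Q] takes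
    opposite values there. *)
Lemma libration_zeros {A B P Q mu} : libration A B P Q mu ->
  exists y0, 0 < y0 < / 2 /\ Q y0 = 0 /\ Q (1 - y0) = 0 /\ mu y0 <> 0 /\
  forall y, 0 <= y <= 1 -> Q y = 0 -> y = y0 \/ y = 1 - y0.
Proof.
intro H. assert (HAB := lib_AB H). apply Rabs_def2 in HAB.
assert (Ht := lib_top H).
assert (mu12 : mu (/ 2) = 0).
{ destruct (lib_sym H (/ 2)) as [_ [_ E]]. replace (1 - / 2) with (/ 2) in E by field. lra. }
assert (mu0 : mu 0 = 0).
{ destruct (lib_sym H 0) as [_ [_ E]]. destruct (lib_per H 0) as [_ [_ E']].
  rewrite Rminus_0_r in E. rewrite Rplus_0_l in E'. lra. }
assert (Qn : forall y, mu y = 0 -> Q y ^ 2 = (B - A) / (2 * B)).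
{ intros y E. assert (U := top_unit Ht y). assert (S := top_sq Ht y).
  rewrite E in S. replace (P y ^ 2) with (1 - Q y ^ 2) in S by lra.
  apply Rmult_eq_reg_r with (2 * B); [|lra]. field_simplify; lra. }
assert (Hpos : 0 < (B - A) / (2 * B)) by (apply Rdiv_lt_0_compat; lra).
assert (DQ := top_dq Ht). assert (HP := top_pos Ht).
assert (Hsgn : (forall y, 0 < y < / 2 -> 0 < mu y) \/ (forall y, 0 < y < / 2 -> mu y < 0)).
{ assert (Hq := lib_nz H (/ 4) ltac:(lra)).
  assert (Cmu : continuity mu).
  { intro t. apply continuity_pt_filterlim. apply (top_cont Ht). }
  assert (Sgn : forall y, 0 < y < / 2 -> 0 < mu (/ 4) * mu y).
  { intros y Hy. destruct (Rlt_dec 0 (mu (/ 4) * mu y)) as [|Hn]; auto. exfalso.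
    assert (Hny := lib_nz H y Hy).
    destruct (Rle_dec (/ 4) y) as [Hle|Hle].
    - destruct (IVT_cor mu (/ 4) y Cmu Hle ltac:(lra)) as [z [Hz Ez]].
      apply (lib_nz H z); auto. lra.
    - destruct (IVT_cor mu y (/ 4) Cmu ltac:(lra) ltac:(lra)) as [z [Hz Ez]].
      apply (lib_nz H z); auto. lra. }
  destruct (Rlt_dec 0 (mu (/ 4))) as [Hm|Hm].
  - left. intros y Hy. specialize (Sgn y Hy). nra.
  - right. intros y Hy. specialize (Sgn y Hy). nra. }
assert (Mono : forall u v, 0 <= u < v -> v <= / 2 -> Q u <> Q v).
{ intros u v Hu Hv E.
  destruct (MVT_gen Q u v (fun y => P y * mu y)) as [t [Ht' Et]].
  - intros; apply DQ.
  - intros; apply continuity_pt_filterlim. apply (top_cont Ht).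
  - (* the mean value point may be an end point, where [mu] vanishes; strict monotonicity is read off an inner interval *)
    set (u1 := (2 * u + v) / 3). set (v1 := (u + 2 * v) / 3).
    assert (E0 : Q u <= Q v). lra. assert (E0' : Q v <= Q u) by lra.
    destruct Hsgn as [Hs|Hs].
    + assert (M : forall a b, 0 <= a <= b -> b <= / 2 -> Q a <= Q b).
      { intros a b Ha Hb.
        generalize (increment_ge Q (fun y => P y * mu y) 0 a b ltac:(lra) ltac:(auto)).
        intro G. enough (0 * (b - a) <= Q b - Q a) by lra. apply G. intros y Hy.
        destruct (Req_dec y 0) as [->|]. rewrite mu0; lra.
        destruct (Req_dec y (/ 2)) as [->|]. rewrite mu12; lra.
        apply Rmult_le_pos. apply Rlt_le, HP. apply Rlt_le, Hs; lra. }
      destruct (MVT_gen Q u1 v1 (fun y => P y * mu y)) as [z [Hz Ez]].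
      { intros; apply DQ. } { intros; apply continuity_pt_filterlim. apply (top_cont Ht). }
      rewrite Rmin_left, Rmax_right in Hz by (unfold u1, v1; lra).
      assert (0 < P z * mu z) by (apply Rmult_lt_0_compat; [auto|apply Hs; unfold u1, v1 in Hz; lra]).
      assert (0 < P z * mu z * (v1 - u1)) by (apply Rmult_lt_0_compat; unfold u1, v1; lra).
      generalize (M u u1 ltac:(unfold u1; lra) ltac:(unfold u1; lra)) (M v1 v ltac:(unfold v1; lra) ltac:(unfold v1; lra)). lra.
    + assert (M : forall a b, 0 <= a <= b -> b <= / 2 -> Q b <= Q a).
      { intros a b Ha Hb.
        generalize (increment_ge (fun y => - Q y) (fun y => - (P y * mu y)) 0 a b ltac:(lra) ltac:(intros; apply D_opp; auto)).
        intro G. enough (0 * (b - a) <= - Q b - - Q a) by lra. apply G. intros y Hy.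
        destruct (Req_dec y 0) as [->|]. rewrite mu0; lra.
        destruct (Req_dec y (/ 2)) as [->|]. rewrite mu12; lra.
        specialize (Hs y ltac:(lra)). specialize (HP y). nra. }
      destruct (MVT_gen Q u1 v1 (fun y => P y * mu y)) as [z [Hz Ez]].
      { intros; apply DQ. } { intros; apply continuity_pt_filterlim. apply (top_cont Ht). }
      rewrite Rmin_left, Rmax_right in Hz by (unfold u1, v1; lra).
      assert (P z * mu z < 0) by (specialize (Hs z ltac:(unfold u1, v1 in Hz; lra)); specialize (HP z); nra).
      assert (P z * mu z * (v1 - u1) < 0) by (assert (0 < v1 - u1) by (unfold u1, v1; lra); nra).
      generalize (M u u1 ltac:(unfold u1; lra) ltac:(unfold u1; lra)) (M v1 v ltac:(unfold v1; lra) ltac:(unfold v1; lra)). lra. }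
assert (Q0 := Qn 0 mu0). assert (Q12 := Qn (/ 2) mu12).
assert (Qop : Q (/ 2) = - Q 0).
{ assert (E : (Q (/ 2) - Q 0) * (Q (/ 2) + Q 0) = 0) by nra.
  apply Rmult_integral in E. destruct E as [E|E]; [|lra].
  exfalso. apply (Mono 0 (/ 2)); lra. }
assert (Qnz : Q 0 <> 0) by (intro E; rewrite E in Q0; lra).
destruct (IVT_cor Q 0 (/ 2)) as [y0 [Hy0 E0]].
{ intro t. apply continuity_pt_filterlim. apply (top_cont Ht). }
{ lra. } { rewrite Qop. nra. }
assert (Hy0' : 0 < y0 < / 2).
{ split. destruct (Req_dec y0 0) as [->|]; [contradiction|lra].
  destruct (Req_dec y0 (/ 2)) as [->|]; [lra|lra]. }
exists y0. split; auto. split; auto. split.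
{ destruct (lib_sym H y0) as [_ [-> _]]. auto. }
split. { apply (lib_nz H); auto. }
intros y Hy Ey.
assert (Uniq : forall t, 0 <= t <= / 2 -> Q t = 0 -> t = y0).
{ intros t Ht' Et. destruct (Rtotal_order t y0) as [L|[L|L]]; auto; exfalso.
  apply (Mono t y0); lra. apply (Mono y0 t); lra. }
destruct (Rle_dec y (/ 2)). left; apply Uniq; auto; lra.
right. enough (1 - y = y0) by lra. apply Uniq. lra.
destruct (lib_sym H y) as [_ [-> _]]. auto.
Qed.

(** The second-order equations of [q], [p], [k]: the same potential [2 k^2] with three
    eigenvalues. *)
Lemma top_q_eq {A B p q k} : top A B p q k -> forall x,
  is_derive (fun x => p x * k x) x (- (2 * k x ^ 2 - A + B) * q x).
Proof.
intros H x. assert (U := top_unit H x). assert (S := top_sq H x).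
eapply is_derive_eq. apply D_mult. apply (top_dp H). apply (top_dk H).
eqR. cbv beta. replace (2 * k x ^ 2 - A + B) with (k x ^ 2 + 2 * B * p x ^ 2).
ring. rewrite S. replace (q x ^ 2) with (1 - p x ^ 2) by lra. ring.
Qed.
Lemma top_p_eq {A B p q k} : top A B p q k -> forall x,
  is_derive (fun x => - (q x * k x)) x (- (2 * k x ^ 2 - A - B) * p x).
Proof.
intros H x. assert (U := top_unit H x). assert (S := top_sq H x).
eapply is_derive_eq. apply D_opp. apply D_mult. apply (top_dq H). apply (top_dk H).
eqR. cbv beta. replace (2 * k x ^ 2 - A - B) with (k x ^ 2 - 2 * B * q x ^ 2).
ring. rewrite S. replace (q x ^ 2) with (1 - p x ^ 2) by lra. ring.
Qed.
Lemma top_k_eq {A B p q k} : top A B p q k -> forall x,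
  is_derive (fun x => - (2 * B * p x * q x)) x (- (2 * k x ^ 2 - 2 * A) * k x).
Proof.
intros H x. assert (S := top_sq H x).
apply (is_derive_ext (fun x => (- (2 * B)) * (p x * q x))). intro; simpl; eqR; ring.
eapply is_derive_eq. apply D_scal. apply D_mult. apply (top_dp H). apply (top_dq H).
eqR. cbv beta. rewrite S. ring.
Qed.

(** Jacobi's substitution: with [Z = Q'/Q], [u'^2 - K u^2 = (u' - Z u)^2 + (Z u^2)'].
    At the zeros of [Q] the quotient is regularized to [Q Q' / (Q^2 + e^2)]; the
    error is controlled by [u^2 <= m Q^2] and tends to 0 with [e]. *)
Lemma form_nonneg_of_dominated (u u' Q Q' Q'' K : R -> R) (m : R) :
  (forall y, is_derive u y (u' y)) -> (forall y, continuous u' y) -> u 1 = u 0 ->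
  (forall y, is_derive Q y (Q' y)) -> (forall y, is_derive Q' y (Q'' y)) ->
  (forall y, continuous Q'' y) -> (forall y, continuous K y) ->
  (forall y, Q'' y = - K y * Q y) -> Q 1 = Q 0 -> Q' 1 = Q' 0 ->
  0 <= m -> (forall y, 0 <= y <= 1 -> u y ^ 2 <= m * Q y ^ 2) ->
  0 <= RInt (fun y => u' y ^ 2 - K y * u y ^ 2) 0 1.
Proof.
intros Du Cu' Pu DQ DQ' CQ'' CK HQ PQ PQ' Hm Hdom.
assert (Cu : forall y, continuous u y) by (intro; eapply C_of_D; auto).
assert (CQ : forall y, continuous Q y) by (intro; eapply C_of_D; auto).
assert (CQ' : forall y, continuous Q' y) by (intro; eapply C_of_D; auto).
destruct (continuous_bounded K 0 1 (fun x _ => CK x)) as [Kb [HKb HKb']].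
destruct (continuous_bounded Q'' 0 1 (fun x _ => CQ'' x)) as [Qb [HQb HQb']].
set (F := RInt (fun y => u' y ^ 2 - K y * u y ^ 2) 0 1).
destruct (Rle_dec 0 F) as [|Hneg]; auto. exfalso.
set (C := m * Kb + 2 * m * Qb). assert (HC : 0 <= C) by (unfold C; assert (0 <= m * Kb) by nra; assert (0 <= m * Qb) by nra; lra).
assert (Main : forall e, 0 < e <= 1 -> - (e * C) <= F).
{ intros e He.
  assert (Hd : forall y, 0 < Q y ^ 2 + e ^ 2) by (intro; generalize (pow2_ge_0 (Q y)); nra).
  set (Z := fun y => Q y * Q' y / (Q y ^ 2 + e ^ 2)).
  set (Z' := fun y => (((Q' y * Q' y + Q y * Q'' y) * (Q y ^ 2 + e ^ 2)
     - Q y * Q' y * (2 * Q y * Q' y)) / (Q y ^ 2 + e ^ 2) ^ 2)).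
  assert (DZ : forall y, is_derive Z y (Z' y)).
  { intro y. unfold Z, Z'. eapply is_derive_eq. apply (D_div (fun y => Q y * Q' y) (fun y => Q y ^ 2 + e ^ 2)).
    apply D_mult; auto. apply D_plus. apply D_pow2; auto. apply D_const.
    specialize (Hd y); lra. eqR. cbv beta. f_equal. ring. }
  set (A := fun y => atan (Q y / e) * Q' y).
  assert (DA : forall y, is_derive A y (e * Q' y ^ 2 / (Q y ^ 2 + e ^ 2) + atan (Q y / e) * Q'' y)).
  { intro y. unfold A. eapply is_derive_eq. apply D_mult; auto.
    apply (D_comp atan (fun y => Q y / e)). apply is_derive_atan. 
    apply (is_derive_ext (fun y => / e * Q y)). intro; unfold Rdiv; eqR; ring. apply D_scal; auto.
    eqR. cbv beta. specialize (Hd y). generalize (pow2_ge_0 (Q y)); intro.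
    unfold Rsqr. set (at_ := atan _). field. split; [lra|]. nra. }
  assert (CA : forall y, continuous (fun y => atan (Q y / e)) y).
  { intro y. apply (continuous_comp (fun y => Q y / e) atan).
    apply C_mult; auto. apply C_const. eapply C_of_D, is_derive_atan. }
  assert (Cden : forall y, continuous (fun y => / (Q y ^ 2 + e ^ 2)) y).
  { intro y. eapply C_of_D. apply (D_inv (fun y => Q y ^ 2 + e ^ 2)). apply D_plus. apply D_pow2; auto. apply D_const.
    specialize (Hd y); lra. }
  (* [m * e * atan (Q / e) * Q'] absorbs the error of the regularization and is of order [e] *)
  set (g' := fun y => (Z' y * u y ^ 2 + Z y * (2 * u y * u' y))
     - m * e * (e * Q' y ^ 2 / (Q y ^ 2 + e ^ 2) + atan (Q y / e) * Q'' y)).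
  set (g := fun y => Z y * u y ^ 2 - m * e * A y).
  assert (Dg : forall y, is_derive g y (g' y)).
  { intro y. apply D_minus. apply D_mult; auto. apply D_pow2; auto. apply D_scal, DA. }
  assert (CZ : forall y, continuous Z y) by (intro; eapply C_of_D; auto).
  assert (CZ' : forall y, continuous Z' y).
  { intro y. unfold Z'. apply C_mult.
    contR.
    eapply C_of_D. apply (D_inv (fun y => (Q y ^ 2 + e ^ 2) ^ 2)). apply D_pow2. apply D_plus. apply D_pow2; auto. apply D_const.
    specialize (Hd y). apply pow_nonzero; lra. }
  assert (Cg' : forall y, continuous g' y).
  { intro y. apply C_minus. apply C_plus; apply C_mult; auto. apply C_pow2; auto.
    apply C_mult; auto. apply C_mult; auto. apply C_const.
    apply C_mult. apply C_const. apply C_plus; apply C_mult; auto. apply C_mult. apply C_const. apply C_pow2; auto. }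
  assert (EG : RInt g' 0 1 = 0).
  { rewrite (RInt_derivative g g' 0 1 Dg Cg'). unfold g, Z, A. rewrite Pu, PQ, PQ'. apply Rminus_diag. }
  assert (I0 : RInt (fun y => g' y - e * C) 0 1 <= F).
  { apply RInt_le; [lra| | |].
    - apply ex_RInt_C. intro. apply C_minus; auto. apply C_const.
    - apply ex_RInt_C. intro. apply C_minus. apply C_pow2; auto. apply C_mult; auto. apply C_pow2; auto.
    - intros y Hy. specialize (Hdom y ltac:(lra)). specialize (HKb' y ltac:(lra)). specialize (HQb' y ltac:(lra)).
      unfold g', Z', Z. specialize (HQ y). specialize (Hd y).
      assert (Hat : Rabs (atan (Q y / e) * Q'' y) <= 2 * Qb).
      { rewrite Rabs_mult. apply Rmult_le_compat; try apply Rabs_pos; auto.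
        generalize (atan_bound (Q y / e)) PI_4; intros. apply Rabs_le; lra. }
      set (at_ := atan (Q y / e) * Q'' y) in *.
      rewrite HQ. set (d := Q y ^ 2 + e ^ 2) in *.
      set (z := Q y * Q' y / d).
      assert (R1 : u' y ^ 2 >= 2 * z * (u y * u' y) - z ^ 2 * u y ^ 2).
      { generalize (pow2_ge_0 (u' y - z * u y)); intro; nra. }
      assert (EZ : ((Q' y * Q' y + Q y * (- K y * Q y)) * d - Q y * Q' y * (2 * Q y * Q' y)) / d ^ 2
        = - K y + K y * e ^ 2 / d + Q' y ^ 2 * e ^ 2 / d ^ 2 - z ^ 2).
      { unfold z. apply Rmult_eq_reg_r with (d ^ 2); [|apply pow_nonzero; lra].
        field_simplify; [|lra|lra]. unfold d. ring. }
      rewrite EZ. clear EZ.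
      assert (Hid : 0 < / d) by (apply Rinv_0_lt_compat; auto).
      assert (Hidd : d * / d = 1) by (field; lra).
      assert (HQd : Q y ^ 2 * / d <= 1).
      { apply Rmult_le_reg_r with d; auto. rewrite Rmult_assoc, Rinv_l by lra. unfold d. generalize (pow2_ge_0 e); lra. }
      assert (HQd0 : 0 <= Q y ^ 2 * / d) by (apply Rmult_le_pos; [apply pow2_ge_0|lra]).
      assert (Hud : 0 <= u y ^ 2 * / d <= m).
      { split. apply Rmult_le_pos; [apply pow2_ge_0|lra].
        apply Rle_trans with (m * Q y ^ 2 * / d). apply Rmult_le_compat_r; lra. nra. }
      apply Rabs_le_between in HKb'. apply Rabs_le_between in Hat.
      assert (B1 : K y * e ^ 2 / d * u y ^ 2 <= e * (m * Kb)).
      { replace (K y * e ^ 2 / d * u y ^ 2) with (e ^ 2 * (K y * (u y ^ 2 * / d))) by (field; lra).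
        assert (K y * (u y ^ 2 * / d) <= m * Kb) by nra.
        apply Rle_trans with (e ^ 2 * (m * Kb)). apply Rmult_le_compat_l; nra.
        apply Rmult_le_compat_r; nra. }
      assert (B2 : Q' y ^ 2 * e ^ 2 / d ^ 2 * u y ^ 2 <= m * e * (e * Q' y ^ 2 / d)).
      { replace (Q' y ^ 2 * e ^ 2 / d ^ 2 * u y ^ 2) with (e ^ 2 * Q' y ^ 2 * / d * (u y ^ 2 * / d)) by (field; lra).
        replace (m * e * (e * Q' y ^ 2 / d)) with (e ^ 2 * Q' y ^ 2 * / d * m) by (field; lra).
        apply Rmult_le_compat_l; [|lra]. apply Rmult_le_pos; [|lra]. apply Rmult_le_pos; apply pow2_ge_0. }
      assert (B3 : - (m * e * at_) <= e * (2 * m * Qb)).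
      { assert (0 <= m * e) by nra. nra. }
      unfold C. unfold Rdiv in *. nra. }
  rewrite RI_minus, RI_const in I0. 2: apply ex_RInt_C; auto. 2: apply ex_RInt_const.
  unfold rint in I0. rewrite EG in I0. lra. }
assert (HF : F < 0) by lra.
set (e := Rmin 1 (- F / (2 * (C + 1)))).
assert (H1 : 0 < - F / (2 * (C + 1))) by (apply Rdiv_lt_0_compat; lra).
assert (He : 0 < e <= 1) by (unfold e; split; [apply Rmin_pos; lra|apply Rmin_l]).
specialize (Main e He).
assert (e * C <= - F / (2 * (C + 1)) * C) by (apply Rmult_le_compat_r; auto; apply Rmin_r).
assert (- F / (2 * (C + 1)) * C <= - F / 2).
{ apply Rmult_le_reg_r with (2 * (C + 1)); [lra|].
  replace (- F / (2 * (C + 1)) * C * (2 * (C + 1))) with (- F * C) by (field; lra). nra. }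
lra.
Qed.

(** The spectral gap on the orthogonal complement of the two lowest eigenfunctions.  A
    combination [al P + be mu] added to [w] changes the form by a nonpositive
    amount, the mixed terms being zero by orthogonality; [al] and [be] are chosen so
    that the sum vanishes at the two zeros of [Q], where [form_nonneg_of_dominated]
    applies. *)
Lemma slice_form_nonneg A B P Q mu (w w' : R -> R) : libration A B P Q mu ->
  (forall y, is_derive w y (w' y)) -> (forall y, continuous w' y) -> w 1 = w 0 ->
  RInt (fun y => w y * P y) 0 1 = 0 -> RInt (fun y => w y * mu y) 0 1 = 0 ->
  0 <= RInt (fun y => w' y ^ 2 - (2 * mu y ^ 2 + A + B) * w y ^ 2) 0 1.
Proof.
intros Hl Dw Cw' Pw OP Om.
assert (HAB := lib_AB Hl). apply Rabs_def2 in HAB.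
assert (Ht := lib_top Hl).
destruct (libration_zeros Hl) as [y0 [Hy0 [Q0 [Q1 [mu0 Hz]]]]].
assert (DP := top_dp Ht). assert (DQ := top_dq Ht). assert (Dm := top_dk Ht).
assert (Cw : forall y, continuous w y) by (intro; eapply C_of_D; auto).
assert (CP : forall y, continuous P y) by (intro; apply (top_cont Ht)).
assert (CQ : forall y, continuous Q y) by (intro; apply (top_cont Ht)).
assert (Cm : forall y, continuous mu y) by (intro; apply (top_cont Ht)).
assert (P1 : P 1 = P 0 /\ Q 1 = Q 0 /\ mu 1 = mu 0).
{ replace 1 with (0 + 1) by ring. apply (lib_per Hl). }
destruct P1 as [P1 [Qp1 m1]].
destruct (lib_sym Hl y0) as [SP [SQ Sm]].
assert (HP := top_pos Ht y0).
set (al := - (w y0 + w (1 - y0)) / (2 * P y0)).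
set (be := - (w y0 - w (1 - y0)) / (2 * mu y0)).
set (P' := fun y => - (Q y * mu y)). set (m' := fun y => - (2 * B * P y * Q y)).
set (u := fun y => w y + (al * P y + be * mu y)).
set (u' := fun y => w' y + (al * P' y + be * m' y)).
assert (CP' : forall y, continuous P' y).
{ intro. eapply C_of_D. apply (top_p_eq Ht). }
assert (Cm' : forall y, continuous m' y).
{ intro. eapply C_of_D. apply (top_k_eq Ht). }
assert (Du : forall y, is_derive u y (u' y)).
{ intro y. apply D_plus; auto. apply D_plus; apply D_scal; auto. }
assert (Cu' : forall y, continuous u' y).
{ intro y. apply C_plus; auto. apply C_plus; apply C_mult; auto; apply C_const. }
assert (U0 : u y0 = 0) by (unfold u, al, be; field; split; lra).
assert (U1 : u (1 - y0) = 0) by (unfold u, al, be; rewrite SP, Sm; field; split; lra).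
assert (CK : forall y, continuous (fun y => 2 * mu y ^ 2 + A + B) y).
{ intro y. apply C_plus; [|apply C_const]. apply C_plus; [|apply C_const]. apply C_mult. apply C_const. apply C_pow2; auto. }
destruct (dominated_by_simple_zeros u u' Q y0 (1 - y0) (P y0 * mu y0) (P (1 - y0) * mu (1 - y0)))
  as [m [Hm Hdom]]; auto; try lra.
{ apply Rmult_integral_contrapositive_currified; lra. }
{ rewrite SP, Sm. apply Rmult_integral_contrapositive_currified; lra. }
assert (F0 : 0 <= RInt (fun y => u' y ^ 2 - (2 * mu y ^ 2 + A + B) * u y ^ 2) 0 1).
{ apply (form_nonneg_of_dominated u u' Q (fun y => P y * mu y) (fun y => - (2 * mu y ^ 2 - - A + B) * Q y)
    (fun y => 2 * mu y ^ 2 + A + B) m); auto.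
  - unfold u. rewrite Pw, P1, m1. reflexivity.
  - intro y. apply (top_q_eq Ht).
  - intro y. apply C_mult; auto. apply (continuous_ext (fun y => - (2 * mu y ^ 2 + A + B))).
    intro; eqR; ring. apply (continuous_opp (V := R_NormedModule)), CK.
  - intro y. ring.
  - rewrite P1, m1. reflexivity. }
(* the terms in [al] and [be] are the derivative of [h], up to products with [P] and [mu] that orthogonality controls *)
set (V := fun y => w' y * (al * P' y + be * m' y)).
set (h := fun y => (2 * w y * (al * P' y + be * m' y) + (al * P y + be * mu y) * (al * P' y + be * m' y))).
set (h' := fun y => 2 * (w' y * (al * P' y + be * m' y)
     + w y * (al * (- (2 * mu y ^ 2 - - A - B) * P y) + be * (- (2 * mu y ^ 2 - 2 * - A) * mu y)))
   + ((al * P' y + be * m' y) * (al * P' y + be * m' y)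
     + (al * P y + be * mu y) * (al * (- (2 * mu y ^ 2 - - A - B) * P y) + be * (- (2 * mu y ^ 2 - 2 * - A) * mu y)))).
assert (Dq2 : forall y, is_derive (fun y => al * P' y + be * m' y) y
   (al * (- (2 * mu y ^ 2 - - A - B) * P y) + be * (- (2 * mu y ^ 2 - 2 * - A) * mu y))).
{ intro y. apply D_plus; apply D_scal. apply (top_p_eq Ht). apply (top_k_eq Ht). }
assert (Dq1 : forall y, is_derive (fun y => al * P y + be * mu y) y (al * P' y + be * m' y)).
{ intro y. apply D_plus; apply D_scal; auto. }
assert (Dh : forall y, is_derive h y (h' y)).
{ intro y. unfold h, h'. apply D_plus.
  - eapply is_derive_eq. apply (D_mult (fun y => 2 * w y) (fun y => al * P' y + be * m' y)).
    apply D_scal; apply Dw. apply Dq2. rring.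
  - apply (D_mult (fun y => al * P y + be * mu y) (fun y => al * P' y + be * m' y)). apply Dq1. apply Dq2. }
assert (Ch' : forall y, continuous h' y).
{ intro y. unfold h'.
  contR. }
assert (Eh : RInt h' 0 1 = 0).
{ rewrite (RInt_derivative h h' 0 1 Dh Ch'). unfold h, P', m'. rewrite Pw, P1, Qp1, m1. apply Rminus_diag. }
set (G := fun y => w' y ^ 2 - (2 * mu y ^ 2 + A + B) * w y ^ 2).
assert (CG : forall y, continuous G y).
{ intro y. apply C_minus. apply C_pow2; auto. apply C_mult; auto. apply C_pow2; auto. }
set (N := fun y => 2 * B * al ^ 2 * P y ^ 2 + (B - A) * be ^ 2 * mu y ^ 2).
assert (CN : forall y, continuous N y).
{ intro y. apply C_plus; apply C_mult; try apply C_const; apply C_pow2; auto. }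
set (O := fun y => 4 * B * al * (w y * P y) + 2 * (B - A) * be * (w y * mu y)).
assert (CO1 : forall y, continuous (fun y => 4 * B * al * (w y * P y)) y)
  by (intro; contR).
assert (CO2 : forall y, continuous (fun y => 2 * (B - A) * be * (w y * mu y)) y)
  by (intro; contR).
assert (EO : RInt O 0 1 = 0).
{ unfold O. rewrite RI_plus by (apply ex_RInt_C; auto). unfold rint.
  rewrite RI_scal, RI_scal. unfold rint. rewrite OP, Om. rring.
  apply ex_RInt_C; intro; apply C_mult; auto. apply ex_RInt_C; intro; apply C_mult; auto. }
set (X := fun y => (3 * B - A) * al * be * (P y * mu y)).
assert (CX : forall y, continuous X y).
{ intro y. unfold X. apply C_mult. apply C_const. apply C_mult; auto. }
assert (EX : RInt X 0 1 = 0).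
{ unfold X. rewrite RI_scal. 2: apply ex_RInt_C; intro; apply C_mult; auto. unfold rint.
  rewrite (RInt_derivative Q (fun y => P y * mu y) 0 1); auto. rewrite Qp1, Rminus_diag. apply Rmult_0_r.
  intro; apply C_mult; auto. }
assert (ED : RInt (fun y => u' y ^ 2 - (2 * mu y ^ 2 + A + B) * u y ^ 2) 0 1
  = RInt (fun y => ((G y + h' y) - (O y + N y)) - X y) 0 1).
{ apply RInt_ext. intros y _. unfold G, h', O, N, X, u, u'. eqR. ring. }
rewrite ED in F0.
assert (CO : forall y, continuous O y) by (intro; apply C_plus; auto).
rewrite RI_minus in F0 by (apply ex_RInt_C; intro; contR).
unfold rint in F0. rewrite RI_minus in F0 by (apply ex_RInt_C; intro; contR).
unfold rint in F0. rewrite RI_plus, RI_plus in F0 by (apply ex_RInt_C; intro; contR).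
unfold rint in F0. rewrite Eh, EO, EX in F0.
assert (0 <= RInt N 0 1).
{ apply RInt_ge_0; [lra|apply ex_RInt_C; auto|]. intros y _. unfold N.
  generalize (pow2_ge_0 (P y)) (pow2_ge_0 (mu y)) (pow2_ge_0 al) (pow2_ge_0 be). intros.
  assert (0 <= al ^ 2 * P y ^ 2) by (apply Rmult_le_pos; auto).
  assert (0 <= be ^ 2 * mu y ^ 2) by (apply Rmult_le_pos; auto). nra. }
fold G. lra.
Qed.

(** * Bounded solutions of the separated equation *)

Lemma sin_shift_period (a T x : R) (n : nat) : a * T = 2 * PI -> sin (a * (x + INR n * T)) = sin (a * x).
Proof.
intro H. replace (a * (x + INR n * T)) with (a * x + 2 * INR n * PI).
apply sin_period. replace (a * (x + INR n * T)) with (a * x + INR n * (a * T)) by ring. rewrite H. ring.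
Qed.

(** Both fluxes of [v] against [f g] and [f2 g] are constant in [x]; as [f] and [f2]
    have constant Wronskian [Wr], these two linear equations determine the
    coefficient. *)
Lemma slice_coefficient a V Kb Bv v vx vy vxx vyy (f f' f'' f2 f2' f2'' g g' g'' : R -> R) (Wr : R) :
  weighted_solution a (fun _ => 1) (fun _ => 0) V 1 1 Kb Bv v vx vy vxx vyy ->
  (forall x, is_derive f x (f' x)) -> (forall x, is_derive f' x (f'' x)) ->
  (forall x, continuous f'' x) ->
  (forall x, is_derive f2 x (f2' x)) -> (forall x, is_derive f2' x (f2'' x)) ->
  (forall x, continuous f2'' x) ->
  (forall x, is_derive g x (g' x)) -> (forall x, is_derive g' x (g'' x)) ->
  (forall x, continuous g'' x) -> g 1 = g 0 -> g' 1 = g' 0 ->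
  (forall x y, f'' x * g y + f x * g'' y + V x y * (f x * g y) = 0) ->
  (forall x y, f2'' x * g y + f2 x * g'' y + V x y * (f2 x * g y) = 0) ->
  (forall x, f x * f2' x - f' x * f2 x = Wr) -> Wr <> 0 ->
  (exists x, sin (a * x) <> 0) ->
  exists C1 C2, forall x, sin (a * x) <> 0 ->
    RInt (fun y => v x y * g y) 0 1 = C1 * f2 x + C2 * f x.
Proof.
intros Hw Df Df' Cf'' Df2 Df2' Cf2'' Dg Dg' Cg'' Pg Pg' E1 E2 HW HW0 [x0 Hx0].
assert (Hr := ws_reg Hw).
assert (Cg : forall y, continuous g y) by (intro; eapply C_of_D; auto).
assert (Split : forall h h' x, sin (a * x) <> 0 ->
   RInt (fun y => vx x y * (h x * g y) - v x y * (h' x * g y)) 0 1 =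
   h x * rint (fun y => vx x y * g y) 0 1 - h' x * rint (fun y => v x y * g y) 0 1).
{ intros h h' x Hx.
  assert (Cv : forall y, continuous (fun y => v x y * g y) y).
  { intro y. apply C_mult; auto. apply (c2d_slice_y v), (reg_c Hr), ns_of_sin; auto. }
  assert (Cvx : forall y, continuous (fun y => vx x y * g y) y).
  { intro y. apply C_mult; auto. apply (c2d_slice_y vx), (reg_cx Hr), ns_of_sin; auto. }
  transitivity (RInt (fun y => h x * (vx x y * g y) - h' x * (v x y * g y)) 0 1).
  { apply RInt_ext. intros; simpl; eqR; ring. }
  rewrite RI_minus.
  unfold rint at 1 2. rewrite RI_scal, RI_scal; auto; apply ex_RInt_C; auto.
  apply ex_RInt_C; intro; apply C_mult; auto; apply C_const.
  apply ex_RInt_C; intro; apply C_mult; auto; apply C_const. }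
set (F1 := RInt (fun y => vx x0 y * (f x0 * g y) - v x0 y * (f' x0 * g y)) 0 1).
set (F2 := RInt (fun y => vx x0 y * (f2 x0 * g y) - v x0 y * (f2' x0 * g y)) 0 1).
exists (F1 / Wr), (- F2 / Wr). intros x Hx.
assert (G1 : F1 = f x * rint (fun y => vx x y * g y) 0 1 - f' x * rint (fun y => v x y * g y) 0 1).
{ rewrite <- Split; auto.
  apply (flux_const a V Kb Bv v vx vy vxx vyy f f' f'' g g' g''); auto. }
assert (G2 : F2 = f2 x * rint (fun y => vx x y * g y) 0 1 - f2' x * rint (fun y => v x y * g y) 0 1).
{ rewrite <- Split; auto.
  apply (flux_const a V Kb Bv v vx vy vxx vyy f2 f2' f2'' g g' g''); auto. }
rewrite G1, G2. specialize (HW x). fold (rint (fun y => v x y * g y) 0 1).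
set (u1 := rint _ 0 1). set (u2 := rint _ 0 1).
apply Rmult_eq_reg_r with Wr; auto. eqR. field_simplify; auto. rewrite <- HW. ring.
Qed.

Lemma slice_coefficient_bound a V Kb Bv v vx vy vxx vyy (g : R -> R) :
  weighted_solution a (fun _ => 1) (fun _ => 0) V 1 1 Kb Bv v vx vy vxx vyy ->
  (forall y, continuous g y) ->
  exists Bd, forall x, sin (a * x) <> 0 -> Rabs (RInt (fun y => v x y * g y) 0 1) <= Bd.
Proof.
intros Hw Cg. assert (Hr := ws_reg Hw).
destruct (continuous_bounded g 0 1 (fun x _ => Cg x)) as [G [HG HG']].
exists (Bv * G). intros x Hx.
assert (Cv : forall y, continuous (fun y => v x y * g y) y).
{ intro y. apply C_mult; auto. apply (c2d_slice_y v), (reg_c Hr), ns_of_sin; auto. }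
eapply Rle_trans. apply abs_RInt_le; [lra|apply ex_RInt_C; auto].
apply Rle_trans with (RInt (fun _ => Bv * G) 0 1). 2:{ rewrite RI_const. lra. }
apply RInt_le; [lra| |apply ex_RInt_const|].
- apply ex_RInt_C. intro y. apply (continuous_comp (fun y => v x y * g y) Rabs); auto. apply continuous_Rabs.
- intros y Hy. rewrite Rabs_mult. apply Rmult_le_compat; try apply Rabs_pos.
  apply (ws_q Hw), ns_of_sin; auto. apply HG'; lra.
Qed.

Lemma cont_eq_of_dense (f g : R -> R) (y : R) : continuous f y -> continuous g y ->
  (forall d, 0 < d -> exists t, Rabs (t - y) < d /\ f t = g t) -> f y = g y.
Proof.
intros Cf Cg H. destruct (Req_dec (f y) (g y)) as [|Hn]; auto. exfalso.
assert (Hp : 0 < Rabs (f y - g y) / 2) by (assert (0 < Rabs (f y - g y)) by (apply Rabs_pos_lt; lra); lra).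
destruct (proj1 (continuous_R f y) Cf _ Hp) as [d1 [Hd1 H1]].
destruct (proj1 (continuous_R g y) Cg _ Hp) as [d2 [Hd2 H2]].
destruct (H (Rmin d1 d2) ltac:(apply Rmin_pos; auto)) as [t [Ht E]].
specialize (H1 t ltac:(eapply Rlt_le_trans; [apply Ht|apply Rmin_l])).
specialize (H2 t ltac:(eapply Rlt_le_trans; [apply Ht|apply Rmin_r])).
rewrite E in H1.
assert (Rabs (f y - g y) <= Rabs (g t - f y) + Rabs (g t - g y)).
{ rewrite (Rabs_minus_sym (g t) (f y)). replace (f y - g y) with ((f y - g t) + (g t - g y)) by ring. apply Rabs_triang. }
lra.
Qed.

Lemma sin_nonzero_dense (b y d : R) : 0 < b -> 0 < d -> exists t, Rabs (t - y) < d /\ sin (b * t) <> 0.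
Proof.
intros Hb Hd. destruct (Req_dec (sin (b * y)) 0) as [H|H].
2:{ exists y. rewrite Rminus_diag, Rabs_R0. auto. }
set (e := Rmin (d / 2) (1 / b)).
assert (He : 0 < e) by (apply Rmin_pos; [lra|apply Rdiv_lt_0_compat; lra]).
exists (y + e). split.
- replace (y + e - y) with e by ring. rewrite Rabs_pos_eq by lra.
  apply Rle_lt_trans with (d / 2); [apply Rmin_l|lra].
- rewrite Rmult_plus_distr_l, sin_plus, H, Rmult_0_l, Rplus_0_l.
  apply Rmult_integral_contrapositive_currified.
  + intro E. generalize (sin2_cos2 (b * y)). rewrite H, E. unfold Rsqr. lra.
  + apply Rgt_not_eq, sin_gt_0. nra.
    apply Rle_lt_trans with 1. 2: generalize PI2_3_2; lra.
    replace 1 with (b * (1 / b)) by (field; lra). apply Rmult_le_compat_l; [lra|apply Rmin_r].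
Qed.

Lemma sin2PI_perZ (t : R) (n : Z) : sin (2 * PI * (t + IZR n)) = sin (2 * PI * t).
Proof.
assert (N : forall (k : nat) t, sin (2 * PI * (t + INR k)) = sin (2 * PI * t)).
{ intros k u. replace (2 * PI * (u + INR k)) with (2 * PI * u + 2 * INR k * PI) by ring. apply sin_period. }
destruct (Z_le_gt_dec 0 n) as [H|H].
- rewrite <- (Z2Nat.id n H), <- INR_IZR_INZ. apply N.
- rewrite <- (N (Z.to_nat (- n)) (t + IZR n)). f_equal. f_equal.
  rewrite INR_IZR_INZ, Z2Nat.id by lia. rewrite opp_IZR. ring.
Qed.

Lemma periodic_Z (f : R -> R) (P : R -> Prop) :
  (forall y, P y -> P (y + 1)) -> (forall y, P y -> P (y - 1)) ->
  (forall y, P y -> f (y + 1) = f y) ->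
  forall (n : Z) y, P y -> P (y + IZR n) /\ f (y + IZR n) = f y.
Proof.
intros H1 H2 Hf.
assert (N : forall (k : nat) y, P y -> (P (y + INR k) /\ f (y + INR k) = f y) /\ (P (y - INR k) /\ f (y - INR k) = f y)).
{ induction k as [|k IH]; intros y Hy.
  - simpl. rewrite Rplus_0_r, Rminus_0_r. auto.
  - destruct (IH y Hy) as [[A1 A2] [B1 B2]]. rewrite S_INR. split; split.
    + replace (y + (INR k + 1)) with (y + INR k + 1) by ring. auto.
    + replace (y + (INR k + 1)) with (y + INR k + 1) by ring. rewrite Hf; auto.
    + replace (y - (INR k + 1)) with (y - INR k - 1) by ring. auto.
    + replace (y - (INR k + 1)) with (y - INR k - 1) by ring.
      rewrite <- B2. rewrite <- (Hf (y - INR k - 1)); auto. f_equal; ring. }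
intros n y Hy. destruct (Z_le_gt_dec 0 n) as [H|H].
- rewrite <- (Z2Nat.id n H), <- INR_IZR_INZ. apply N; auto.
- replace (IZR n) with (- INR (Z.to_nat (- n))). apply (N (Z.to_nat (- n))); auto.
  rewrite INR_IZR_INZ, Z2Nat.id by lia. rewrite opp_IZR. ring.
Qed.

Lemma int_part_bounds (y : R) : exists n : Z, 0 <= y - IZR n < 1.
Proof. exists (Int_part y). generalize (base_Int_part y). lra. Qed.

Lemma reg2_ext_lin a q qx qy qxx qyy (f f' f'' g g' g'' : R -> R) (c : R) :
  reg2 a q qx qy qxx qyy ->
  (forall x, is_derive f x (f' x)) -> (forall x, is_derive f' x (f'' x)) -> (forall x, continuous f'' x) ->
  (forall x, is_derive g x (g' x)) -> (forall x, is_derive g' x (g'' x)) -> (forall x, continuous g'' x) ->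
  (forall y, g (y + 1) = g y) ->
  reg2 a (fun x y => q x y - c * (f x * g y)) (fun x y => qx x y - c * (f' x * g y))
    (fun x y => qy x y - c * (f x * g' y)) (fun x y => qxx x y - c * (f'' x * g y))
    (fun x y => qyy x y - c * (f x * g'' y)).
Proof.
intros Hq Df Df' Cf Dg Dg' Cg Pg.
assert (cf : forall x y, c2d (fun x _ => f x) x y) by (intros; apply c2d_x; eapply C_of_D; auto).
assert (cf' : forall x y, c2d (fun x _ => f' x) x y) by (intros; apply c2d_x; eapply C_of_D; auto).
assert (cf'' : forall x y, c2d (fun x _ => f'' x) x y) by (intros; apply c2d_x; auto).
assert (cg : forall x y, c2d (fun _ y => g y) x y) by (intros; apply c2d_y; eapply C_of_D; auto).
assert (cg' : forall x y, c2d (fun _ y => g' y) x y) by (intros; apply c2d_y; eapply C_of_D; auto).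
assert (cg'' : forall x y, c2d (fun _ y => g'' y) x y) by (intros; apply c2d_y; auto).
assert (DX : forall (h h' : R -> R) w x, is_derive h x (h' x) -> is_derive (fun x => c * (h x * w)) x (c * (h' x * w))).
{ intros h h' w x H. eapply is_derive_eq. apply D_scal. apply D_mult. apply H. apply D_const. rring. }
constructor; intros x y H.
- apply (D_minus (fun x => q x y)). apply (reg_dx Hq); auto. apply DX; auto.
- apply (D_minus (fun y => q x y)). apply (reg_dy Hq); auto. apply D_scal, D_scal; auto.
- apply (D_minus (fun x => qx x y)). apply (reg_dxx Hq); auto. apply DX; auto.
- apply (D_minus (fun y => qy x y)). apply (reg_dyy Hq); auto. apply D_scal, D_scal; auto.
- generalize (reg_c Hq x y H) (cf x y) (cg x y); intros; c2d_auto.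
- generalize (reg_cx Hq x y H) (cf' x y) (cg x y); intros; c2d_auto.
- generalize (reg_cy Hq x y H) (cf x y) (cg' x y); intros; c2d_auto.
- generalize (reg_cxx Hq x y H) (cf'' x y) (cg x y); intros; c2d_auto.
- generalize (reg_cyy Hq x y H) (cf x y) (cg'' x y); intros; c2d_auto.
- rewrite Pg, (reg_per Hq); auto.
Qed.

Lemma reg2_mult_x a q qx qy qxx qyy (f f' f'' : R -> R) :
  reg2 a q qx qy qxx qyy ->
  (forall x, is_derive f x (f' x)) -> (forall x, is_derive f' x (f'' x)) -> (forall x, continuous f'' x) ->
  reg2 a (fun x y => f x * q x y) (fun x y => f' x * q x y + f x * qx x y)
    (fun x y => f x * qy x y) 
    (fun x y => (f'' x * q x y + f' x * qx x y) + (f' x * qx x y + f x * qxx x y))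
    (fun x y => f x * qyy x y).
Proof.
intros Hq Df Df' Cf.
assert (cf : forall x y, c2d (fun x _ => f x) x y) by (intros; apply c2d_x; eapply C_of_D; auto).
assert (cf' : forall x y, c2d (fun x _ => f' x) x y) by (intros; apply c2d_x; eapply C_of_D; auto).
assert (cf'' : forall x y, c2d (fun x _ => f'' x) x y) by (intros; apply c2d_x; auto).
constructor; intros x y H;
 generalize (reg_c Hq x y H) (reg_cx Hq x y H) (reg_cy Hq x y H)
  (reg_cxx Hq x y H) (reg_cyy Hq x y H) (cf x y) (cf' x y) (cf'' x y); intros; try (c2d_auto; fail).
- apply (D_mult f (fun x => q x y)); auto. apply (reg_dx Hq); auto.
- apply D_scal. apply (reg_dy Hq); auto.
- apply D_plus. apply (D_mult f' (fun x => q x y)); auto. apply (reg_dx Hq); auto.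
  apply (D_mult f (fun x => qx x y)); auto. apply (reg_dxx Hq); auto.
- apply D_scal. apply (reg_dyy Hq); auto.
- rewrite (reg_per Hq); auto.
Qed.

(** The hypothesis concerns circles free of half-lattice points only; the others are
    crossed by continuity at regular points. *)
Lemma independent_of_x a u ux uy uxx uyy x0 : 0 < a -> reg2 a u ux uy uxx uyy ->
  (forall x y, sin (a * x) <> 0 -> 0 < y < 1 -> ux x y = 0) -> sin (a * x0) <> 0 ->
  forall x y, ns a x y -> u x y = u x0 y.
Proof.
intros Ha R3 Hux Hs0.
assert (Hns0 : forall y, ns a x0 y) by (intro; apply ns_of_sin; auto).
assert (Uy : forall t, sin (2 * PI * t) <> 0 -> forall x, u x t = u x0 t).
{ intros t0 Ht0 x.
  destruct (int_part_bounds t0) as [n Hn]. set (t := t0 - IZR n) in *.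
  assert (Et : t0 = t + IZR n) by (unfold t; ring).
  assert (Hst : sin (2 * PI * t) <> 0) by (rewrite Et, sin2PI_perZ in Ht0; auto).
  assert (Hnst : forall x, ns a x t).
  { intro z. unfold ns, rho. assert (0 < sin (2 * PI * t) ^ 2) by (apply pow2_gt_0; auto).
    generalize (pow2_ge_0 (sin (a * z))). lra. }
  assert (Ez : forall z, u z t0 = u z t).
  { intro z. rewrite Et. apply (periodic_Z (fun y => u z y) (fun y => ns a z y)); auto.
    - intros y Hy. unfold ns. rewrite rho_per; auto.
    - intros y Hy. unfold ns. rewrite <- rho_per. replace (y - 1 + 1) with y by ring. auto.
    - intros y Hy. apply (reg_per R3); auto. }
  rewrite !Ez.
  assert (Ht01 : 0 < t < 1).
  { split; [|lra]. destruct (Req_dec t 0) as [E|]; [|lra]. exfalso. apply Hst. rewrite E, Rmult_0_r. apply sin_0. }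
  apply (constant_of_derive_zero (fun x => u x t)). intro z.
  replace 0 with (ux z t). apply (reg_dx R3); auto.
  apply (cont_eq_of_dense (fun z => ux z t) (fun _ => 0)).
  - apply (c2d_slice_x ux), (reg_cx R3); auto.
  - apply C_const.
  - intros d Hd0. destruct (sin_nonzero_dense a z d Ha Hd0) as [z' [Hz' Hsz']]. exists z'. split; auto. }
intros x y H. apply (cont_eq_of_dense (fun y => u x y) (fun y => u x0 y)).
- apply (c2d_slice_y u), (reg_c R3); auto.
- apply (c2d_slice_y u), (reg_c R3); auto.
- intros d Hd0. destruct (sin_nonzero_dense (2 * PI) y d) as [t [Ht1 Ht2]]; auto.
  generalize PI_RGT_0; lra. exists t. split; auto.
Qed.

Lemma dx_zero_of_independent a u ux uy uxx uyy x0 : reg2 a u ux uy uxx uyy -> sin (a * x0) <> 0 ->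
  (forall x y, ns a x y -> u x y = u x0 y) -> forall y, ux x0 y = 0.
Proof.
intros R3 Hs0 Uy2 y. assert (Hns0 : ns a x0 y) by (apply ns_of_sin; auto).
rewrite <- (is_derive_unique _ _ _ (reg_dx R3 x0 y Hns0)).
transitivity (Derive (fun _ => u x0 y) x0); [|apply Derive_const]. apply Derive_ext_loc.
apply (filter_imp (fun t => ns a t y)). intros t Hnt; apply Uy2; auto.
apply locally_2d_slice_x. apply ns_locally. auto.
Qed.

(** Near 0, which is a simple zero of [k] and of the sine, and not a zero of [q]. *)
Lemma top_generic_point A B p q k (a : R) : Rabs A < B -> top A B p q k -> k 0 = 0 -> 0 < a ->
  exists x0, sin (a * x0) <> 0 /\ q x0 <> 0 /\ k x0 <> 0.
Proof.
intros HAB H k0 Ha. apply Rabs_def2 in HAB.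
assert (U := top_unit H 0). assert (S := top_sq H 0).
rewrite k0 in S. assert (Hp := top_pos H 0).
assert (Hq : q 0 <> 0).
{ intro E. rewrite E in U, S. assert (p 0 ^ 2 = 1) by lra. nra. }
destruct (simple_zero_lower k 0 (- (2 * B * p 0 * q 0)) (top_dk H 0)) as [d1 [Hd1 L1]]; auto.
{ apply Ropp_neq_0_compat. repeat apply Rmult_integral_contrapositive_currified; lra. }
assert (Hl : 0 < Rabs (- (2 * B * p 0 * q 0))).
{ apply Rabs_pos_lt. apply Ropp_neq_0_compat. repeat apply Rmult_integral_contrapositive_currified; lra. }
destruct (simple_zero_lower (fun x => sin (a * x)) 0 a) as [d2 [Hd2 L2]].
{ auto_derive; auto. rewrite Rmult_0_r, cos_0. ring. } { lra. } { rewrite Rmult_0_r, sin_0; auto. }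
destruct (proj1 (continuous_R q 0) (proj1 (proj2 (top_cont H 0))) (Rabs (q 0))
   (Rabs_pos_lt _ Hq)) as [d3 [Hd3 L3]].
set (x0 := Rmin (d1 / 2) (Rmin (d2 / 2) (d3 / 2))).
assert (Hx0 : 0 < x0 /\ x0 < d1 /\ x0 < d2 /\ x0 < d3).
{ unfold x0. split. repeat apply Rmin_pos; lra.
  generalize (Rmin_l (d1 / 2) (Rmin (d2 / 2) (d3 / 2))) (Rmin_r (d1 / 2) (Rmin (d2 / 2) (d3 / 2)))
   (Rmin_l (d2 / 2) (d3 / 2)) (Rmin_r (d2 / 2) (d3 / 2)). lra. }
assert (Ex : Rabs (x0 - 0) = x0) by (rewrite Rminus_0_r; apply Rabs_pos_eq; lra).
exists x0. repeat split; intro E.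
- specialize (L2 x0 ltac:(lra)). rewrite E, Rabs_R0, Ex, Rabs_pos_eq in L2 by lra. nra.
- specialize (L3 x0 ltac:(lra)). rewrite E in L3. rewrite Rminus_0_l, Rabs_Ropp in L3. lra.
- specialize (L1 x0 ltac:(lra)). rewrite E, Rabs_R0, Ex in L1. nra.
Qed.

Definition bounded_solution (a : R) (k mu : R -> R) (Kb Bv : R) (v vx vy vxx vyy : R -> R -> R) : Prop :=
  weighted_solution a (fun _ => 1) (fun _ => 0)
    (fun x y => 2 * (k x ^ 2 + mu y ^ 2)) 1 1 Kb Bv v vx vy vxx vyy.

(** The coefficients are combinations of a periodic and a linearly growing solution;
    they are bounded, being integrals of a bounded function. *)
Lemma lowest_coefficients a T A B p q k P Q mu Kb Bv v vx vy vxx vyy :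
  a * T = 2 * PI -> 0 < T -> Rabs A < B -> top A B p q k -> k 0 = 0 ->
  (forall x, p (x + T) = p x /\ q (x + T) = q x /\ k (x + T) = k x) ->
  libration A B P Q mu -> bounded_solution a k mu Kb Bv v vx vy vxx vyy ->
  exists c1 c2, forall x, sin (a * x) <> 0 ->
    RInt (fun y => v x y * P y) 0 1 = c1 * q x /\
    RInt (fun y => v x y * mu y) 0 1 = c2 * k x.
Proof.
intros HaT HT HAB Hx k0 Hper Hl Hw.
assert (Ha := ws_a Hw).
destruct (top_generic_point A B p q k a HAB Hx k0 Ha) as [x0 [Hs0 [Hq0 Hk0]]].
assert (HAB' := HAB). apply Rabs_def2 in HAB'.
assert (Ht := lib_top Hl).
assert (P1 : P 1 = P 0 /\ Q 1 = Q 0 /\ mu 1 = mu 0).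
{ replace 1 with (0 + 1) by ring. apply (lib_per Hl). }
destruct P1 as [P1 [Qp1 m1]].
assert (Cp : forall x, continuous p x) by (intro; apply (top_cont Hx)).
assert (Cq : forall x, continuous q x) by (intro; apply (top_cont Hx)).
assert (Ck : forall x, continuous k x) by (intro; apply (top_cont Hx)).
assert (CP : forall x, continuous P x) by (intro; apply (top_cont Ht)).
assert (CQ : forall x, continuous Q x) by (intro; apply (top_cont Ht)).
assert (Cm : forall x, continuous mu x) by (intro; apply (top_cont Ht)).
assert (Cqq2 : forall x, continuous (qq2 B p q k) x) by (intro x; exact (C_of_D _ _ _ (proj1 (D_qq2 Hx x)))).
assert (Ckk2 : forall x, continuous (kk2 B p q k) x) by (intro x; exact (C_of_D _ _ _ (proj1 (D_kk2 Hx x)))).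
assert (Hn : forall n : nat, sin (a * (x0 + INR n * T)) <> 0).
{ intro n. rewrite sin_shift_period; auto. }
destruct (slice_coefficient a _ Kb Bv v vx vy vxx vyy
   q (fun x => p x * k x) (fun x => - (2 * k x ^ 2 - A + B) * q x)
   (qq2 B p q k) (qq2' B p q k) (fun x => (A - B - 2 * k x ^ 2) * qq2 B p q k x)
   P (fun y => - (Q y * mu y)) (fun y => - (2 * mu y ^ 2 - - A - B) * P y) (A + B) Hw) as [C1 [C2 E1]].
{ apply (top_dq Hx). } { apply (top_q_eq Hx). } { intro; contR. }
{ intro x; apply (proj1 (D_qq2 Hx x)). } { intro x; apply (proj2 (D_qq2 Hx x)). } { intro; contR. }
{ apply (top_dp Ht). } { apply (top_p_eq Ht). } { intro; contR. }
{ auto. } { rewrite Qp1, m1; auto. }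
{ intros; ring. } { intros; ring. }
{ intro x. apply (wronskian_qq2 Hx). } { lra. } { exists x0; auto. }
destruct (slice_coefficient a _ Kb Bv v vx vy vxx vyy
   k (fun x => - (2 * B * p x * q x)) (fun x => - (2 * k x ^ 2 - 2 * A) * k x)
   (kk2 B p q k) (kk2' B p q k) (fun x => (2 * A - 2 * k x ^ 2) * kk2 B p q k x)
   mu (fun y => - (2 * B * P y * Q y)) (fun y => - (2 * mu y ^ 2 - 2 * - A) * mu y) (B ^ 2 - A ^ 2) Hw) as [D1 [D2 E2]].
{ apply (top_dk Hx). } { apply (top_k_eq Hx). } { intro; contR. }
{ intro x; apply (proj1 (D_kk2 Hx x)). } { intro x; apply (proj2 (D_kk2 Hx x)). } { intro; contR. }
{ apply (top_dk Ht). } { apply (top_k_eq Ht). } { intro; contR. }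
{ auto. } { rewrite P1, Qp1; auto. }
{ intros; ring. } { intros; ring. }
{ intro x. apply (wronskian_kk2 _ _ _ _ _ Hx). } { nra. } { exists x0; auto. }
destruct (slice_coefficient_bound a _ Kb Bv v vx vy vxx vyy P Hw CP) as [Bd1 HB1].
destruct (slice_coefficient_bound a _ Kb Bv v vx vy vxx vyy mu Hw Cm) as [Bd2 HB2].
assert (Z1 : C1 = 0).
{ apply (qq2_bounded A B p q k T C1 C2 Bd1 HAB Hx HT Hper x0 Hq0).
  intro n. rewrite <- E1; auto. }
assert (Z2 : D1 = 0).
{ apply (kk2_bounded A B p q k T D1 D2 Bd2 HAB Hx HT Hper x0 Hk0).
  intro n. rewrite <- E2; auto. }
exists C2, D2. intros x Hsx. rewrite (E1 x Hsx), (E2 x Hsx), Z1, Z2. split; rring.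
Qed.

(** The Wronskians with [Q] and with [qq2] are constant, so [r] is a combination of the
    two, and [qq2] grows. *)
Lemma periodic_solution_multiple A B P Q mu (r r' r'' : R -> R) :
  libration A B P Q mu ->
  (forall y, is_derive r y (r' y)) -> (forall y, is_derive r' y (r'' y)) ->
  (forall y, r'' y = - (2 * mu y ^ 2 + A + B) * r y) ->
  (forall y, r (y + 1) = r y) ->
  exists c, forall y, r y = c * Q y.
Proof.
intros Hl Dr Dr' Er Pr.
assert (Ht := lib_top Hl). assert (HAB := lib_AB Hl).
assert (HAB' : Rabs (- A) < B) by (rewrite Rabs_Ropp; auto).
assert (HAB2 := HAB). apply Rabs_def2 in HAB2.
assert (W1 : forall y, is_derive (fun y => r y * (P y * mu y) - r' y * Q y) y 0).
{ intro y. eapply is_derive_eq. apply D_minus.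
  apply (D_mult r (fun y => P y * mu y)). apply Dr. apply (top_q_eq Ht).
  apply (D_mult r' Q). apply Dr'. apply (top_dq Ht). rewrite Er. rring. }
assert (W2 : forall y, is_derive (fun y => r y * qq2' B P Q mu y - r' y * qq2 B P Q mu y) y 0).
{ intro y. eapply is_derive_eq. apply D_minus.
  apply D_mult. apply Dr. apply (proj2 (D_qq2 Ht y)).
  apply D_mult. apply Dr'. apply (proj1 (D_qq2 Ht y)). rewrite Er. rring. }
set (C1 := r 0 * (P 0 * mu 0) - r' 0 * Q 0).
set (C2 := r 0 * qq2' B P Q mu 0 - r' 0 * qq2 B P Q mu 0).
assert (E : forall y, r y * (- A + B) = C2 * Q y - C1 * qq2 B P Q mu y).
{ intro y. rewrite <- (wronskian_qq2 Ht y).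
  assert (F1 := constant_of_derive_zero _ W1 y 0). assert (F2 := constant_of_derive_zero _ W2 y 0).
  cbv beta in F1, F2. fold C1 in F1. fold C2 in F2. rewrite <- F1, <- F2. ring. }
assert (HQ : exists x0, Q x0 <> 0).
{ destruct (Req_dec (Q 0) 0) as [Q0|]; [|exists 0; auto].
  destruct (Req_dec (Q (/ 4)) 0) as [Q4|]; [|exists (/ 4); auto].
  exfalso. destruct (libration_zeros Hl) as [y0 [Hy0 [_ [_ [_ Hz]]]]].
  destruct (Hz 0 ltac:(lra) Q0); lra. }
destruct HQ as [x0 Hx0].
assert (Z : - C1 = 0).
{ apply (qq2_bounded (- A) B P Q mu 1 (- C1) C2 (Rabs (r x0 * (- A + B))) HAB' Ht Rlt_0_1
    (lib_per Hl) x0 Hx0).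
  intro n. right. f_equal. rewrite Rmult_1_r.
  replace (- C1 * qq2 B P Q mu (x0 + INR n) + C2 * Q (x0 + INR n)) with (r (x0 + INR n) * (- A + B))
    by (rewrite E; ring).
  f_equal. induction n as [|n IH]. simpl; f_equal; ring.
  rewrite S_INR. replace (x0 + (INR n + 1)) with (x0 + INR n + 1) by ring. rewrite Pr; auto. }
exists (C2 / (- A + B)). intro y. specialize (E y). replace C1 with 0 in E by lra.
apply Rmult_eq_reg_r with (- A + B); [|lra]. rewrite E. field. lra.
Qed.

(** The core of the proof.  [w] is [v] minus its components along [q P] and [k mu], and
    [u = w / p]. *)
Lemma bounded_solution_classification a T A B p q k P Q mu Kb Bv v vx vy vxx vyy :
  a * T = 2 * PI -> 0 < T -> Rabs A < B -> top A B p q k -> k 0 = 0 ->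
  (forall x, p (x + T) = p x /\ q (x + T) = q x /\ k (x + T) = k x) ->
  libration A B P Q mu -> bounded_solution a k mu Kb Bv v vx vy vxx vyy ->
  exists c1 c2 c3, forall x y, ns a x y ->
    v x y = c1 * (q x * P y) + c2 * (k x * mu y) + c3 * (p x * Q y).
Proof.
intros HaT HT HAB Hx k0 Hper Hl Hbs.
destruct (lowest_coefficients a T A B p q k P Q mu Kb Bv v vx vy vxx vyy HaT HT HAB Hx k0 Hper Hl Hbs)
  as [d1 [d2 Hd]].
rename Hbs into Hw.
assert (Ha := ws_a Hw).
assert (Hr := ws_reg Hw).
assert (HAB' := HAB). apply Rabs_def2 in HAB'.
assert (Ht := lib_top Hl).
assert (P1 : P 1 = P 0 /\ Q 1 = Q 0 /\ mu 1 = mu 0).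
{ replace 1 with (0 + 1) by ring. apply (lib_per Hl). }
destruct P1 as [P1 [Qp1 m1]].
assert (Cp : forall x, continuous p x) by (intro; apply (top_cont Hx)).
assert (Cq : forall x, continuous q x) by (intro; apply (top_cont Hx)).
assert (Ck : forall x, continuous k x) by (intro; apply (top_cont Hx)).
assert (CP : forall x, continuous P x) by (intro; apply (top_cont Ht)).
assert (CQ : forall x, continuous Q x) by (intro; apply (top_cont Ht)).
assert (Cm : forall x, continuous mu x) by (intro; apply (top_cont Ht)).
set (n1 := RInt (fun y => P y * P y) 0 1). set (n2 := RInt (fun y => mu y * mu y) 0 1).
assert (Hn1 : 0 < n1).
{ apply Rlt_le_trans with (RInt (fun _ => (B + A) / (2 * B)) 0 1).
  - rewrite RI_const. assert (0 < (B + A) / (2 * B)) by (apply Rdiv_lt_0_compat; lra). lra.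
  - apply RInt_le; [lra|apply ex_RInt_const|apply ex_RInt_C; intro; contR|].
    intros y _. assert (U := top_unit Ht y). assert (S := top_sq Ht y).
    replace (Q y ^ 2) with (1 - P y ^ 2) in S by lra.
    apply Rmult_le_reg_r with (2 * B); [lra|].
    replace ((B + A) / (2 * B) * (2 * B)) with (B + A) by (field; lra).
    generalize (pow2_ge_0 (mu y)). nra. }
assert (Hn2 : 0 < n2).
{ destruct (primitive_periodic (fun y => mu y * mu y) 1 (/ 4)) as [sg [Hsg E]]; try lra.
  - intro; contR.
  - intro y. destruct (lib_per Hl y) as [_ [_ ->]]. auto.
  - intro; nra.
  - assert (mu (/ 4) <> 0) by (apply (lib_nz Hl); lra).
    generalize (pow2_gt_0 _ H). simpl. lra.
  - specialize (E 1%nat). simpl in E. rewrite Rmult_1_l in E.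
    set (F := fun x => RInt (fun t => mu t * mu t) 0 x).
    assert (DF : forall x, is_derive F x (mu x * mu x)) by (intro; apply (D_RInt (fun t => mu t * mu t)); intro; contR).
    assert (K2 : F (/ 4 + 1) - F (/ 4) = F (0 + 1) - F 0).
    { apply (constant_of_derive_zero (fun x => F (x + 1) - F x)).
      intro x. eapply is_derive_eq. apply D_minus; [|apply DF].
      apply (D_comp F (fun x => x + 1)). apply DF. apply D_plus. apply D_id. apply D_const.
      destruct (lib_per Hl x) as [_ [_ ->]]. rring. }
    unfold F in K2. rewrite RInt_point in K2. change (@zero R_CompleteNormedModule) with 0 in K2.
    rewrite Rplus_0_l in K2. fold n2 in K2. rewrite E in K2. lra. }
assert (n12 : RInt (fun y => P y * mu y) 0 1 = 0).
{ rewrite (RInt_derivative Q (fun y => P y * mu y) 0 1). rewrite Qp1. apply Rminus_diag.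
  apply (top_dq Ht). intro; contR. }
set (c1 := d1 / n1). set (c2 := d2 / n2).
assert (Cdq : forall x, continuous (fun x => - (2 * k x ^ 2 - A + B) * q x) x) by (intro; contR).
assert (CdP : forall y, continuous (fun y => - (2 * mu y ^ 2 - - A - B) * P y) y) by (intro; contR).
assert (Cdk : forall x, continuous (fun x => - (2 * k x ^ 2 - 2 * A) * k x) x) by (intro; contR).
assert (Cdm : forall y, continuous (fun y => - (2 * mu y ^ 2 - 2 * - A) * mu y) y) by (intro; contR).
assert (R1 := reg2_ext_lin a v vx vy vxx vyy q (fun x => p x * k x) (fun x => - (2 * k x ^ 2 - A + B) * q x)
   P (fun y => - (Q y * mu y)) (fun y => - (2 * mu y ^ 2 - - A - B) * P y) c1 Hr
   (top_dq Hx) (top_q_eq Hx) Cdq (top_dp Ht) (top_p_eq Ht) CdP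
   (fun y => proj1 (lib_per Hl y))).
assert (R2 := reg2_ext_lin a _ _ _ _ _ k (fun x => - (2 * B * p x * q x)) (fun x => - (2 * k x ^ 2 - 2 * A) * k x)
   mu (fun y => - (2 * B * P y * Q y)) (fun y => - (2 * mu y ^ 2 - 2 * - A) * mu y) c2 R1
   (top_dk Hx) (top_k_eq Hx) Cdk (top_dk Ht) (top_k_eq Ht) Cdm
   (fun y => proj2 (proj2 (lib_per Hl y)))).
match type of R2 with reg2 a ?w0 ?wx0 ?wy0 ?wxx0 ?wyy0 =>
  set (w := w0) in *; set (wx := wx0) in *; set (wy := wy0) in *; set (wxx := wxx0) in *; set (wyy := wyy0) in * end.
clear R1.
assert (Hpp := top_pos Hx).
set (ip := fun x => / p x).
set (ip' := fun x => q x * k x * ip x ^ 2).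
set (ip'' := fun x => ((p x * k x * k x + q x * - (2 * B * p x * q x)) * ip x ^ 2
   + q x * k x * (2 * ip x * ip' x))).
assert (Dip : forall x, is_derive ip x (ip' x)).
{ intro x. unfold ip', ip. eapply is_derive_eq. apply D_inv. apply (top_dp Hx).
  specialize (Hpp x); lra. eqR. cbv beta. field. specialize (Hpp x); lra. }
assert (Dip' : forall x, is_derive ip' x (ip'' x)).
{ intro x. unfold ip', ip''. apply (D_mult (fun x => q x * k x) (fun x => ip x ^ 2)).
  apply D_mult. apply (top_dq Hx). apply (top_dk Hx).
  apply D_pow2, Dip. }
assert (Cip : forall x, continuous ip x) by (intro; eapply C_of_D; auto).
assert (Cip' : forall x, continuous ip' x) by (intro; eapply C_of_D; auto).
assert (Cip'' : forall x, continuous ip'' x) by (intro; unfold ip''; contR).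
assert (R3 := reg2_mult_x a w wx wy wxx wyy ip ip' ip'' R2 Dip Dip' Cip'').
match type of R3 with reg2 a ?w0 ?wx0 ?wy0 ?wxx0 ?wyy0 =>
  set (u := w0) in *; set (ux := wx0) in *; set (uy := wy0) in *; set (uxx := wxx0) in *; set (uyy := wyy0) in * end.
set (p0 := sqrt ((B - A) / (2 * B))).
assert (Hp0 : 0 < p0) by (apply sqrt_lt_R0, Rdiv_lt_0_compat; lra).
assert (Bx := top_bounds HAB Hx).
assert (HABo : Rabs (- A) < B) by (rewrite Rabs_Ropp; auto).
assert (By := top_bounds HABo Ht).
set (Bu := (Bv + Rabs c1 + Rabs c2 * (2 * B)) / p0).
assert (Hu : weighted_solution a p (fun x => - (q x * k x)) (fun _ y => 2 * mu y ^ 2 + A + B)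
   p0 1 (6 * B) Bu u ux uy uxx uyy).
{ constructor; auto.
  - apply (top_dp Hx).
  - intro; contR.
  - intro x. apply Bx.
  - intros x y. apply c2d_y. contR.
  - intros x y. destruct (By y) as [_ [_ Hm]]. lra.
  - lra.
  - intros x y H. unfold u, ip, w.
    assert (Hv := ws_q Hw x y H).
    destruct (Bx x) as [[X1 X2] [X3 X4]]. destruct (By y) as [[Y1 Y2] [Y3 Y4]].
    fold p0 in X1. rewrite Rabs_mult, (Rabs_pos_eq (/ p x)) by (apply Rlt_le, Rinv_0_lt_compat; lra).
    unfold Bu, Rdiv. rewrite (Rmult_comm _ (/ p0)).
    apply Rmult_le_compat. apply Rlt_le, Rinv_0_lt_compat; lra. apply Rabs_pos.
    apply Rinv_le_contravar; lra.
    assert (F1 : Rabs (c1 * (q x * P y)) <= Rabs c1).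
    { rewrite !Rabs_mult. rewrite (Rabs_pos_eq (P y)) by (generalize (sqrt_pos ((B - - A) / (2 * B))); lra).
      assert (HP0 : 0 <= P y <= 1) by (generalize (sqrt_pos ((B - - A) / (2 * B))); lra).
      generalize (Rabs_pos c1) (Rabs_pos (q x)). intros.
      assert (0 <= Rabs (q x) * P y <= 1) by nra. nra. }
    assert (F2 : Rabs (c2 * (k x * mu y)) <= Rabs c2 * (2 * B)).
    { rewrite Rabs_mult. apply Rmult_le_compat_l. apply Rabs_pos. apply Rabs_le.
      generalize (pow2_ge_0 (k x - mu y)) (pow2_ge_0 (k x + mu y)). intros. nra. }
    unfold Rminus. eapply Rle_trans. apply Rabs_triang. rewrite Rabs_Ropp.
    eapply Rle_trans. apply Rplus_le_compat_r. apply Rabs_triang. rewrite Rabs_Ropp. lra.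
  - intros x y H. assert (E := ws_eq Hw x y H). cbv beta in E.
    assert (Ev : vxx x y = - vyy x y - 2 * (k x ^ 2 + mu y ^ 2) * v x y) by lra.
    unfold u, ux, uxx, uyy, ip'', ip', ip.
    assert (Ew : wxx x y = - wyy x y - 2 * (k x ^ 2 + mu y ^ 2) * w x y).
    { unfold wxx, wyy, w. rewrite Ev. ring. }
    rewrite Ew. clear Ew Ev E.
    assert (U := top_unit Hx x). assert (S := top_sq Hx x).
    transitivity ((- k x ^ 2 + A + B - 2 * B * q x ^ 2) * w x y).
    { field. specialize (Hpp x); lra. }
    rewrite S. replace (p x ^ 2) with (1 - q x ^ 2) by lra. ring. }
assert (Hslice : forall x, sin (a * x) <> 0 ->
   0 <= RInt (fun y => uy x y ^ 2 - (2 * mu y ^ 2 + A + B) * u x y ^ 2) 0 1).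
{ intros x Hsx. assert (Hns : forall y, ns a x y) by (intro; apply ns_of_sin; auto).
  assert (Cv : forall y, continuous (fun y => v x y) y)
    by (intro; apply (c2d_slice_y v), (reg_c Hr); auto).
  apply (slice_form_nonneg A B P Q mu (fun y => u x y) (fun y => uy x y) Hl).
  - intro y. apply (reg_dy R3); auto.
  - intro y. apply (c2d_slice_y uy), (reg_cy R3); auto.
  - replace 1 with (0 + 1) by ring. apply (reg_per R3); auto.
  - transitivity (RInt (fun y => ip x * ((v x y * P y - c1 * q x * (P y * P y)) - c2 * k x * (P y * mu y))) 0 1).
    { apply RInt_ext. intros; unfold u, w. simpl; eqR; ring. }
    rewrite RI_scal by (apply ex_RInt_C; intro; contR).
    unfold rint. rewrite RI_minus by (apply ex_RInt_C; intro; contR).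
    unfold rint. rewrite RI_minus by (apply ex_RInt_C; intro; contR).
    unfold rint. rewrite RI_scal, RI_scal by (apply ex_RInt_C; intro; contR).
    unfold rint. rewrite n12. fold n1. destruct (Hd x Hsx) as [-> _]. unfold c1. eqR. field. lra.
  - transitivity (RInt (fun y => ip x * ((v x y * mu y - c1 * q x * (P y * mu y)) - c2 * k x * (mu y * mu y))) 0 1).
    { apply RInt_ext. intros; unfold u, w. simpl; eqR; ring. }
    rewrite RI_scal by (apply ex_RInt_C; intro; contR).
    unfold rint. rewrite RI_minus by (apply ex_RInt_C; intro; contR).
    unfold rint. rewrite RI_minus by (apply ex_RInt_C; intro; contR).
    unfold rint. rewrite RI_scal, RI_scal by (apply ex_RInt_C; intro; contR).
    unfold rint. rewrite n12. fold n2. destruct (Hd x Hsx) as [_ ->]. unfold c2. eqR. field. lra. }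
assert (Hux := energy_main a p _ _ p0 1 (6 * B) Bu u ux uy uxx uyy Hu Hslice).
destruct (top_generic_point A B p q k a HAB Hx k0 Ha) as [x0 [Hs0 _]].
assert (Hns0 : forall y, ns a x0 y) by (intro; apply ns_of_sin; auto).
assert (Uy2 := independent_of_x a u ux uy uxx uyy x0 Ha R3 Hux Hs0).
assert (Exx : forall y, uxx x0 y = 0).
{ intro y. assert (E : is_derive (fun x => ux x y) x0 (uxx x0 y)) by (apply (reg_dxx R3); auto).
  rewrite <- (is_derive_unique _ _ _ E). rewrite <- (Derive_const 0 x0). apply Derive_ext_loc.
  destruct (locally_R_inv _ _ (locally_2d_slice_x _ _ _ (ns_locally a x0 0 (Hns0 0)))) as [d0 [Hd0 Hd0']].
  assert (Cs : continuous (fun x => sin (a * x)) x0) by (eapply C_of_D; auto_derive; auto).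
  destruct (proj1 (continuous_R _ _) Cs (Rabs (sin (a * x0))) (Rabs_pos_lt _ Hs0)) as [d1' [Hd1' L1]].
  apply (locally_R _ x0 d1' Hd1'). intros z Hz.
  assert (Hsz : sin (a * z) <> 0).
  { intro E0. specialize (L1 z Hz). rewrite E0, Rminus_0_l, Rabs_Ropp in L1. lra. }
  rewrite <- (is_derive_unique _ _ _ (reg_dx R3 z y (ns_of_sin _ _ _ Hsz))).
  transitivity (Derive (fun _ => u x0 y) z); [|apply Derive_const]. apply Derive_ext_loc.
  apply (filter_imp (fun t => ns a t y)). intros t Hnt; apply Uy2; auto.
  apply locally_2d_slice_x. apply ns_locally. apply ns_of_sin; auto. }
assert (Ex0 := dx_zero_of_independent a u ux uy uxx uyy x0 R3 Hs0 Uy2).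
destruct (periodic_solution_multiple A B P Q mu (fun y => u x0 y) (fun y => uy x0 y) (fun y => uyy x0 y) Hl) as [c3 E3].
- intro y. apply (reg_dy R3); auto.
- intro y. apply (reg_dyy R3); auto.
- intro y. assert (E := ws_eq Hu x0 y (Hns0 y)). cbv beta in E.
  rewrite Exx, Ex0 in E. specialize (Hpp x0).
  apply Rmult_eq_reg_l with (p x0); [|lra]. lra.
- intro y. apply (reg_per R3); auto.
- exists c1, c2, c3. intros x y H. specialize (Uy2 x y H). rewrite E3 in Uy2.
  unfold u, w, ip in Uy2. specialize (Hpp x).
  assert (Eq : v x y - c1 * (q x * P y) - c2 * (k x * mu y) = c3 * Q y * p x).
  { rewrite <- Uy2. field. lra. }
  lra.
Qed.

(** * Limits of complex sequences *)

Lemma Cmod_minus_sym (a b : C) : Cmod (a - b)%C = Cmod (b - a)%C.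
Proof. rewrite <- Cmod_opp. f_equal. ring. Qed.
Lemma Cmod_triangle_minus (a b : C) : Cmod a - Cmod b <= Cmod (a - b)%C.
Proof.
assert (H := Cmod_triangle (a - b) b). replace (a - b + b)%C with a in H by ring. lra.
Qed.
Lemma Cmod_triangle_minus' (a b : C) : Cmod (a - b)%C <= Cmod a + Cmod b.
Proof. unfold Cminus. eapply Rle_trans. apply Cmod_triangle. rewrite Cmod_opp. lra. Qed.
Lemma Cmod_fst (z : C) : Rabs (fst z) <= Cmod z.
Proof. eapply Rle_trans. 2: apply Rmax_Cmod. apply Rmax_l. Qed.
Lemma Cmod_snd (z : C) : Rabs (snd z) <= Cmod z.
Proof. eapply Rle_trans. 2: apply Rmax_Cmod. apply Rmax_r. Qed.
Lemma Cmod_le_sum (z : C) : Cmod z <= Rabs (fst z) + Rabs (snd z).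
Proof.
destruct z as [x y]. replace (x, y) with (RtoC x + Ci * RtoC y)%C.
2:{ unfold RtoC, Ci, Cplus, Cmult; simpl. f_equal; ring. }
eapply Rle_trans. apply Cmod_triangle. rewrite Cmod_mult, !Cmod_R. simpl.
replace (Cmod Ci) with 1. 2:{ unfold Cmod, Ci; simpl. rewrite Rmult_0_l, !Rmult_1_r, Rplus_0_l, sqrt_1; auto. }
rewrite Rmult_1_l. right. f_equal; f_equal; unfold RtoC, Cplus, Cmult, Ci; simpl; ring.
Qed.
Lemma Cmod_neq0 (z : C) : 0 < Cmod z -> z <> (RtoC 0).
Proof. intro H. apply Cmod_gt_0; auto. Qed.

(** Epsilon form of convergence, in terms of which the sums over squares are estimated;
    [Clim_eq] connects it with [C_complete_lim]. *)
Definition Ccv (u : nat -> C) (l : C) : Prop :=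
  forall eps, 0 < eps -> exists N, forall k, (N <= k)%nat -> Cmod (u k - l)%C < eps.

Lemma Ccv_unique u l1 l2 : Ccv u l1 -> Ccv u l2 -> l1 = l2.
Proof.
intros H1 H2. destruct (Ceq_dec l1 l2) as [|Hn]; auto. exfalso.
assert (Hp : 0 < Cmod (l1 - l2)%C).
{ apply Cmod_gt_0. intro E. apply Hn. transitivity (l1 - l2 + l2)%C; [ring|rewrite E; ring]. }
destruct (H1 (Cmod (l1 - l2)%C / 2) ltac:(lra)) as [N1 A1].
destruct (H2 (Cmod (l1 - l2)%C / 2) ltac:(lra)) as [N2 A2].
specialize (A1 (N1 + N2)%nat ltac:(lia)). specialize (A2 (N1 + N2)%nat ltac:(lia)).
assert (Cmod (l1 - l2)%C <= Cmod (u (N1 + N2)%nat - l1)%C + Cmod (u (N1 + N2)%nat - l2)%C).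
{ replace (l1 - l2)%C with ((u (N1 + N2)%nat - l2) - (u (N1 + N2)%nat - l1))%C by ring.
  rewrite Rplus_comm. apply Cmod_triangle_minus'. }
lra.
Qed.

Lemma Ccv_const c : Ccv (fun _ => c) c.
Proof. intros e He. exists 0%nat. intros. replace (c - c)%C with (RtoC 0) by ring. rewrite Cmod_0. auto. Qed.
Lemma Ccv_plus u v l m : Ccv u l -> Ccv v m -> Ccv (fun k => u k + v k)%C (l + m)%C.
Proof.
intros H1 H2 e He. destruct (H1 (e / 2) ltac:(lra)) as [N1 A1]. destruct (H2 (e / 2) ltac:(lra)) as [N2 A2].
exists (N1 + N2)%nat. intros k Hk. specialize (A1 k ltac:(lia)). specialize (A2 k ltac:(lia)).
replace (u k + v k - (l + m))%C with ((u k - l) + (v k - m))%C by ring.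
eapply Rle_lt_trans. apply Cmod_triangle. lra.
Qed.
Lemma Ccv_scal c u l : Ccv u l -> Ccv (fun k => c * u k)%C (c * l)%C.
Proof.
intros H e He. assert (Hc := Cmod_ge_0 c).
destruct (H (e / (Cmod c + 1))) as [N A]. apply Rdiv_lt_0_compat; lra.
exists N. intros k Hk. specialize (A k Hk).
replace (c * u k - c * l)%C with (c * (u k - l))%C by ring. rewrite Cmod_mult.
assert (Hm := Cmod_ge_0 (u k - l)%C).
apply Rle_lt_trans with ((Cmod c + 1) * Cmod (u k - l)%C). nra.
apply Rlt_le_trans with ((Cmod c + 1) * (e / (Cmod c + 1))).
apply Rmult_lt_compat_l; lra. right. field. lra.
Qed.
Lemma Ccv_ext u v l : (forall k, u k = v k) -> Ccv u l -> Ccv v l.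
Proof. intros E H e He. destruct (H e He) as [N A]. exists N. intros k Hk. rewrite <- E. auto. Qed.
Lemma Ccv_conj u l : Ccv u l -> Ccv (fun k => Cconj (u k)) (Cconj l).
Proof.
intros H e He. destruct (H e He) as [N A]. exists N. intros k Hk.
rewrite <- Cminus_conj, Cmod_conj. auto.
Qed.
Lemma Ccv_bound u l M : Ccv u l -> (forall k, Cmod (u k) <= M) -> Cmod l <= M.
Proof.
intros H HM. destruct (Rle_dec (Cmod l) M) as [|Hn]; auto. exfalso.
destruct (H (Cmod l - M) ltac:(lra)) as [N A]. specialize (A N (le_n N)). specialize (HM N).
rewrite Cmod_minus_sym in A. generalize (Cmod_triangle_minus l (u N)). lra.
Qed.
Lemma Ccv_0_of_bound u (C0 : R) : 0 <= C0 -> (forall k, Cmod (u k) <= C0 / (INR k + 1)) -> Ccv u (RtoC 0).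
Proof.
intros HC H e He. destruct (INR_unbounded (C0 / e)) as [N HN].
exists N. intros k Hk. replace (u k - 0)%C with (u k) by ring.
eapply Rle_lt_trans. apply H. apply le_INR in Hk.
assert (0 <= INR N) by apply pos_INR.
apply Rmult_lt_reg_r with (INR k + 1); [lra|]. unfold Rdiv. rewrite Rmult_assoc, Rinv_l by lra.
apply Rmult_lt_compat_r with (r := e) in HN; auto. unfold Rdiv in HN. rewrite Rmult_assoc, Rinv_l in HN by lra.
assert (INR N * e <= INR k * e) by (apply Rmult_le_compat_r; lra). lra.
Qed.

Lemma Ccv_cauchy (u : nat -> C) :
  (forall eps, 0 < eps -> exists N, forall k l, (N <= k)%nat -> (k <= l)%nat -> Cmod (u l - u k)%C < eps) ->
  exists l, Ccv u l.
Proof.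
intro H.
assert (P : forall (pr : C -> R), (forall a b, Rabs (pr a - pr b) <= Cmod (a - b)%C) ->
   exists l, Un_cv (fun k => pr (u k)) l).
{ intros pr Hpr. destruct (Rcomplete.R_complete (fun k => pr (u k))) as [l Hl]; [|exists l; auto].
  intros e He. destruct (H e He) as [N A]. exists N. intros n m Hn Hm. unfold Rdist.
  eapply Rle_lt_trans. apply Hpr. destruct (Nat.le_gt_cases n m).
  - rewrite Cmod_minus_sym. apply A; lia.
  - apply A; lia. }
destruct (P fst) as [x Hx]. { intros a b. apply (Cmod_fst (a - b)%C). }
destruct (P snd) as [y Hy]. { intros a b. apply (Cmod_snd (a - b)%C). }
exists (x, y). intros e He.
destruct (Hx (e / 2) ltac:(lra)) as [N1 A1]. destruct (Hy (e / 2) ltac:(lra)) as [N2 A2].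
exists (N1 + N2)%nat. intros k Hk. specialize (A1 k ltac:(lia)). specialize (A2 k ltac:(lia)).
unfold Rdist in *. eapply Rle_lt_trans. apply Cmod_le_sum.
change (fst (u k - (x, y))%C) with (fst (u k) - x). change (snd (u k - (x, y))%C) with (snd (u k) - y). lra.
Qed.

Definition Clim (u : nat -> C) : C := C_complete_lim (filtermap u eventually).

Lemma Clim_eq u l : Ccv u l -> Clim u = l.
Proof.
intro H.
assert (PF : ProperFilter (filtermap u eventually)).
{ apply filtermap_proper_filter. apply eventually_filter. }
assert (B : forall eps : posreal, filtermap u eventually (ball (M := C_UniformSpace) l eps)).
{ intro eps. destruct (H (eps / 2)) as [N A]. { generalize (cond_pos eps); lra. }
  exists N. intros k Hk. specialize (A k Hk). assert (He := cond_pos eps).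
  split.
  - change (Rabs (fst (u k) - fst l) < eps). eapply Rle_lt_trans. apply (Cmod_fst (u k - l)%C). lra.
  - change (Rabs (snd (u k) - snd l) < eps). eapply Rle_lt_trans. apply (Cmod_snd (u k - l)%C). lra. }
assert (A := C_complete_ax1 (filtermap u eventually) PF (fun eps => ex_intro _ l (B eps))).
fold (Clim u) in A.
assert (E : forall eps : posreal, ball (M := C_UniformSpace) (Clim u) eps l).
{ intro eps. assert (He := cond_pos eps). set (e2 := mkposreal (eps / 2) ltac:(lra)).
  destruct (A e2) as [N1 A1]. destruct (B e2) as [N2 A2].
  specialize (A1 (N1 + N2)%nat ltac:(lia)). specialize (A2 (N1 + N2)%nat ltac:(lia)).
  apply ball_sym in A2.
  replace (pos eps) with (e2 + e2) by (simpl; lra).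
  apply (ball_triangle _ _ _ _ _ A1 A2). }
assert (Hz : forall a b : R, (forall eps : posreal, Rabs (a - b) < eps) -> a = b).
{ intros a b Hab. destruct (Req_dec a b) as [|Hn]; auto. exfalso.
  assert (Hp : 0 < Rabs (a - b)) by (apply Rabs_pos_lt; lra).
  specialize (Hab (mkposreal _ Hp)). simpl in Hab. lra. }
destruct (Clim u) as [a b]. destruct l as [c d]. f_equal; symmetry; apply Hz; intro eps; apply (E eps).
Qed.

(** * Sums over symmetric intervals and squares of integers *)

(** Sum over [|m| <= k], written as a recursion so that reflections and telescoping are
    immediate; [zsum_sum_n] gives the usual form. *)
Fixpoint zsum (f : Z -> C) (k : nat) : C :=
  match k with
  | O => f 0%Z
  | S k' => (zsum f k' + (f (Z.of_nat k) + f (- Z.of_nat k)%Z))%C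
  end.
Definition sq (t : Z -> Z -> C) (k : nat) : C := zsum (fun m => zsum (t m) k) k.

Lemma zsum_ext f g k : (forall m, f m = g m) -> zsum f k = zsum g k.
Proof. intro H. induction k; simpl. apply H. rewrite IHk, !H. reflexivity. Qed.
Lemma zsum_plus f g k : zsum (fun m => f m + g m)%C k = (zsum f k + zsum g k)%C.
Proof. induction k; cbn [zsum]. auto. rewrite IHk. ring. Qed.
Lemma zsum_scal c f k : zsum (fun m => c * f m)%C k = (c * zsum f k)%C.
Proof. induction k; cbn [zsum]. auto. rewrite IHk. ring. Qed.
Lemma zsum_opp f k : zsum (fun m => f (- m)%Z) k = zsum f k.
Proof.
induction k; cbn [zsum]. auto. rewrite IHk, Z.opp_involutive. ring.
Qed.
Lemma zsum_conj f k : zsum (fun m => Cconj (f m)) k = Cconj (zsum f k).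
Proof. induction k; cbn [zsum]. auto. rewrite IHk, !Cplus_conj. reflexivity. Qed.
Lemma zsum_telescope f k :
  zsum (fun m => f (m - 1)%Z - f m)%C k = (f (- Z.of_nat k - 1)%Z - f (Z.of_nat k))%C.
Proof.
induction k.
- reflexivity.
- cbn [zsum]. rewrite IHk.
  replace (Z.of_nat (S k) - 1)%Z with (Z.of_nat k) by lia.
  replace (- Z.of_nat (S k))%Z with (- Z.of_nat k - 1)%Z by lia. ring.
Qed.
Lemma zsum_bound f k B : (forall m, (Z.abs m <= Z.of_nat k)%Z -> Cmod (f m) <= B) ->
  Cmod (zsum f k) <= (2 * INR k + 1) * B.
Proof.
induction k; intro H.
- cbn [zsum]. change (INR 0) with 0. assert (E := H 0%Z ltac:(simpl; lia)). lra.
- cbn [zsum]. rewrite S_INR.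
  assert (E1 := H (Z.of_nat (S k)) ltac:(lia)). assert (E2 := H (- Z.of_nat (S k))%Z ltac:(lia)).
  assert (E3 := IHk ltac:(intros; apply H; lia)).
  eapply Rle_trans. apply Cmod_triangle.
  assert (Cmod (f (Z.of_nat (S k)) + f (- Z.of_nat (S k))%Z)%C <= B + B).
  { eapply Rle_trans. apply Cmod_triangle. lra. }
  lra.
Qed.

Lemma sum_n_shift (g : nat -> C) n :
  sum_n (G := C_AbelianMonoid) g (S n) = (g 0%nat + sum_n (G := C_AbelianMonoid) (fun i => g (S i)) n)%C.
Proof.
induction n.
- rewrite sum_Sn, !sum_O. reflexivity.
- rewrite sum_Sn, IHn, (sum_Sn (fun i => g (S i))). unfold plus; simpl. ring.
Qed.

Lemma zsum_sum_n (f : Z -> C) k :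
  sum_n (G := C_AbelianMonoid) (fun i => f (Z.of_nat i - Z.of_nat k)%Z) (2 * k) = zsum f k.
Proof.
induction k.
- simpl. rewrite sum_O. reflexivity.
- replace (2 * S k)%nat with (S (S (2 * k))) by lia.
  rewrite sum_Sn, sum_n_shift. cbn [zsum]. rewrite <- IHk.
  rewrite (sum_n_ext (fun i => f (Z.of_nat (S i) - Z.of_nat (S k))%Z) (fun i => f (Z.of_nat i - Z.of_nat k)%Z))
    by (intro; f_equal; lia).
  unfold plus; simpl (AbelianMonoid.plus _ _).
  replace (Z.of_nat 0 - Z.of_nat (S k))%Z with (- Z.of_nat (S k))%Z by lia.
  replace (Z.of_nat (S (S (2 * k))) - Z.of_nat (S k))%Z with (Z.of_nat (S k)) by lia.
  simpl. ring.
Qed.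

(** 1 plus the sup norm; there are [8 k] indices of norm [k + 1], whence sums of [nm^-3]
    over squares converge like [1 / k]. *)
Definition nm (m n : Z) : R := 1 + Rmax (Rabs (IZR m)) (Rabs (IZR n)).

Lemma nm_ge1 m n : 1 <= nm m n.
Proof. unfold nm. generalize (Rmax_l (Rabs (IZR m)) (Rabs (IZR n))) (Rabs_pos (IZR m)). lra. Qed.

Lemma nm_left (m n : Z) k : Z.abs m = Z.of_nat k -> INR k + 1 <= nm m n.
Proof.
intro H. unfold nm. rewrite INR_IZR_INZ, <- H, abs_IZR.
generalize (Rmax_l (Rabs (IZR m)) (Rabs (IZR n))). lra.
Qed.
Lemma nm_right (m n : Z) k : Z.abs n = Z.of_nat k -> INR k + 1 <= nm m n.
Proof.
intro H. unfold nm. rewrite INR_IZR_INZ, <- H, abs_IZR.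
generalize (Rmax_r (Rabs (IZR m)) (Rabs (IZR n))). lra.
Qed.

Lemma sq_step (t : Z -> Z -> C) k M :
  (forall m n, Cmod (t m n) <= M / nm m n ^ 3) -> 0 <= M ->
  Cmod (sq t (S k) - sq t k)%C <= 8 * M / (INR k + 1) - 8 * M / (INR k + 2).
Proof.
intros H HM. set (K := INR k). assert (HK : 0 <= K) by apply pos_INR.
assert (B : forall m n, K + 2 <= nm m n -> Cmod (t m n) <= M / (K + 2) ^ 3).
{ intros m n Hmn. eapply Rle_trans. apply H. unfold Rdiv. apply Rmult_le_compat_l; auto.
  apply Rinv_le_contravar. apply pow_lt; lra. apply pow_incr; lra. }
assert (ES : INR (S k) + 1 = K + 2) by (rewrite S_INR; unfold K; ring).
unfold sq. cbn [zsum].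
rewrite zsum_plus.
replace (zsum (fun m => zsum (t m) k) k +
   zsum (fun m => t m (Z.of_nat (S k)) + t m (- Z.of_nat (S k))%Z)%C k +
   (zsum (t (Z.of_nat (S k))) k + (t (Z.of_nat (S k)) (Z.of_nat (S k)) + t (Z.of_nat (S k)) (- Z.of_nat (S k))%Z) +
    (zsum (t (- Z.of_nat (S k))%Z) k + (t (- Z.of_nat (S k))%Z (Z.of_nat (S k)) + t (- Z.of_nat (S k))%Z (- Z.of_nat (S k))%Z))) -
   zsum (fun m => zsum (t m) k) k)%C
 with (zsum (fun m => t m (Z.of_nat (S k)) + t m (- Z.of_nat (S k))%Z)%C k +
   (zsum (t (Z.of_nat (S k))) (S k) + zsum (t (- Z.of_nat (S k))%Z) (S k)))%C by (cbn [zsum]; ring).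
eapply Rle_trans. apply Cmod_triangle.
eapply Rle_trans. apply Rplus_le_compat. 2: apply Cmod_triangle.
{ apply zsum_bound with (B := 2 * (M / (K + 2) ^ 3)). intros m Hm.
  eapply Rle_trans. apply Cmod_triangle.
  assert (E1 := B m (Z.of_nat (S k))). assert (E2 := B m (- Z.of_nat (S k))%Z).
  assert (F1 := nm_right m (Z.of_nat (S k)) (S k) ltac:(lia)).
  assert (F2 := nm_right m (- Z.of_nat (S k))%Z (S k) ltac:(lia)). rewrite ES in F1, F2.
  specialize (E1 F1). specialize (E2 F2). lra. }
apply Rle_trans with ((2 * INR k + 1) * (2 * (M / (K + 2) ^ 3)) + (2 * ((2 * INR (S k) + 1) * (M / (K + 2) ^ 3)))).
{ apply Rplus_le_compat_l. 
  assert (G : forall m, Z.abs m = Z.of_nat (S k) -> Cmod (zsum (t m) (S k)) <= (2 * INR (S k) + 1) * (M / (K + 2) ^ 3)).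
  { intros m Hm. apply zsum_bound. intros n _. apply B. rewrite <- ES. apply nm_left; auto. }
  generalize (G (Z.of_nat (S k)) ltac:(lia)) (G (- Z.of_nat (S k))%Z ltac:(lia)). lra. }
rewrite S_INR. fold K.
replace ((2 * K + 1) * (2 * (M / (K + 2) ^ 3)) + 2 * ((2 * (K + 1) + 1) * (M / (K + 2) ^ 3)))
  with (8 * M * ((K + 1) / (K + 2) ^ 3)) by (field; lra).
replace (8 * M / (K + 1) - 8 * M / (K + 2)) with (8 * M * (/ ((K + 1) * (K + 2)))) by (field; lra).
apply Rmult_le_compat_l; [lra|].
apply Rmult_le_reg_r with ((K + 1) * (K + 2) ^ 3). apply Rmult_lt_0_compat; [lra|apply pow_lt; lra].
replace ((K + 1) / (K + 2) ^ 3 * ((K + 1) * (K + 2) ^ 3)) with ((K + 1) ^ 2) by (field; lra).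
replace (/ ((K + 1) * (K + 2)) * ((K + 1) * (K + 2) ^ 3)) with ((K + 2) ^ 2) by (field; lra).
apply pow_incr; lra.
Qed.

Lemma sq_increments (t : Z -> Z -> C) M :
  (forall m n, Cmod (t m n) <= M / nm m n ^ 3) -> 0 <= M ->
  forall k l, (k <= l)%nat -> Cmod (sq t l - sq t k)%C <= 8 * M / (INR k + 1) - 8 * M / (INR l + 1).
Proof.
intros H HM k l Hkl. induction Hkl as [|l Hl IH].
- replace (sq t k - sq t k)%C with (RtoC 0) by ring. rewrite Cmod_0. lra.
- replace (sq t (S l) - sq t k)%C with ((sq t (S l) - sq t l) + (sq t l - sq t k))%C by ring.
  eapply Rle_trans. apply Cmod_triangle. assert (E := sq_step t l M H HM).
  rewrite S_INR. replace (INR l + 1 + 1) with (INR l + 2) by ring. lra.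
Qed.

Lemma sq_bound (t : Z -> Z -> C) M :
  (forall m n, Cmod (t m n) <= M / nm m n ^ 3) -> 0 <= M -> forall k, Cmod (sq t k) <= 9 * M.
Proof.
intros H HM k. replace (sq t k) with (sq t 0 + (sq t k - sq t 0))%C by ring.
eapply Rle_trans. apply Cmod_triangle.
assert (E := sq_increments t M H HM 0 k ltac:(lia)). simpl INR in E.
assert (F := H 0%Z 0%Z). unfold nm in F. rewrite Rabs_R0, Rmax_left in F by lra.
assert (0 <= 8 * M / (INR k + 1)) by (apply Rdiv_le_0_compat; [lra|generalize (pos_INR k); lra]).
change (sq t 0) with (t 0%Z 0%Z). change (sq t 0) with (t 0%Z 0%Z) in E.
replace (M / (1 + 0) ^ 3) with M in F by field.
replace (8 * M / (0 + 1)) with (8 * M) in E by field. lra.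
Qed.

Lemma sq_converges (t : Z -> Z -> C) M :
  (forall m n, Cmod (t m n) <= M / nm m n ^ 3) -> 0 <= M -> exists l, Ccv (sq t) l.
Proof.
intros H HM. apply Ccv_cauchy. intros e He.
destruct (INR_unbounded (8 * M / e)) as [N HN]. exists N. intros k l Hk Hl.
eapply Rle_lt_trans. apply (sq_increments t M H HM k l Hl).
assert (0 <= 8 * M / (INR l + 1)) by (apply Rdiv_le_0_compat; [lra|generalize (pos_INR l); lra]).
apply le_INR in Hk. assert (0 <= INR N) by apply pos_INR.
assert (8 * M / (INR k + 1) < e); [|lra].
apply Rmult_lt_reg_r with (INR k + 1); [lra|]. unfold Rdiv. rewrite Rmult_assoc, Rinv_l by lra.
apply Rmult_lt_compat_r with (r := e) in HN; auto. unfold Rdiv in HN. rewrite Rmult_assoc, Rinv_l in HN by lra.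
assert (INR N * e <= INR k * e) by (apply Rmult_le_compat_r; lra). lra.
Qed.

Lemma sq_plus t u k : sq (fun m n => t m n + u m n)%C k = (sq t k + sq u k)%C.
Proof. unfold sq. rewrite <- zsum_plus. apply zsum_ext. intro. apply zsum_plus. Qed.
Lemma sq_scal c t k : sq (fun m n => c * t m n)%C k = (c * sq t k)%C.
Proof. unfold sq. rewrite <- zsum_scal. apply zsum_ext. intro. apply zsum_scal. Qed.
Lemma sq_ext t u k : (forall m n, t m n = u m n) -> sq t k = sq u k.
Proof. intro H. unfold sq. apply zsum_ext. intro. apply zsum_ext. auto. Qed.
Lemma sq_opp t k : sq (fun m n => t (- m)%Z (- n)%Z) k = sq t k.
Proof.
unfold sq. rewrite <- (zsum_opp (fun m => zsum (t m) k)). apply zsum_ext. intro m.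
apply (zsum_opp (t (- m)%Z)).
Qed.

(** * Complex derivatives *)

(** Complex differentiability with an explicit remainder.  The next lemmas lead from it
    to the real partial derivatives. *)
Definition cder (f : C -> C) (z l : C) : Prop :=
  forall eps, 0 < eps -> exists d, 0 < d /\ forall h, Cmod h < d ->
    Cmod (f (z + h) - f z - l * h)%C <= eps * Cmod h.

Lemma cder_const c z : cder (fun _ => c) z (RtoC 0).
Proof.
intros e He. exists 1. split; [lra|]. intros h _. replace (c - c - 0 * h)%C with (RtoC 0) by ring.
rewrite Cmod_0. generalize (Cmod_ge_0 h). nra.
Qed.
Lemma cder_plus f g z a b : cder f z a -> cder g z b -> cder (fun w => f w + g w)%C z (a + b)%C.
Proof.
intros H1 H2 e He. destruct (H1 (e / 2) ltac:(lra)) as [d1 [Hd1 A1]].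
destruct (H2 (e / 2) ltac:(lra)) as [d2 [Hd2 A2]].
exists (Rmin d1 d2). split. apply Rmin_pos; auto. intros h Hh.
specialize (A1 h ltac:(eapply Rlt_le_trans; [apply Hh|apply Rmin_l])).
specialize (A2 h ltac:(eapply Rlt_le_trans; [apply Hh|apply Rmin_r])).
replace (f (z + h) + g (z + h) - (f z + g z) - (a + b) * h)%C
 with ((f (z + h) - f z - a * h) + (g (z + h) - g z - b * h))%C by ring.
eapply Rle_trans. apply Cmod_triangle. lra.
Qed.
Lemma cder_scal c f z a : cder f z a -> cder (fun w => c * f w)%C z (c * a)%C.
Proof.
intros H e He. assert (Hc := Cmod_ge_0 c).
destruct (H (e / (Cmod c + 1))) as [d [Hd A]]. apply Rdiv_lt_0_compat; lra.
exists d; split; auto. intros h Hh. specialize (A h Hh).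
replace (c * f (z + h) - c * f z - c * a * h)%C with (c * (f (z + h) - f z - a * h))%C by ring.
rewrite Cmod_mult.
apply Rle_trans with ((Cmod c + 1) * Cmod (f (z + h) - f z - a * h)%C).
{ apply Rmult_le_compat_r; [apply Cmod_ge_0|lra]. }
apply Rle_trans with ((Cmod c + 1) * (e / (Cmod c + 1) * Cmod h)).
{ apply Rmult_le_compat_l; lra. } right. field. lra.
Qed.
Lemma cder_cont f z a : cder f z a -> forall eps, 0 < eps -> exists d, 0 < d /\
  forall w, Cmod (w - z)%C < d -> Cmod (f w - f z)%C < eps.
Proof.
intros H e He. destruct (H 1 Rlt_0_1) as [d [Hd A]]. assert (Ha := Cmod_ge_0 a).
exists (Rmin d (e / (Cmod a + 2))). split. apply Rmin_pos; auto. apply Rdiv_lt_0_compat; lra.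
intros w Hw. specialize (A (w - z)%C ltac:(eapply Rlt_le_trans; [apply Hw|apply Rmin_l])).
assert (Hw2 : Cmod (w - z)%C < e / (Cmod a + 2)) by (eapply Rlt_le_trans; [apply Hw|apply Rmin_r]).
replace (z + (w - z))%C with w in A by ring.
replace (f w - f z)%C with ((f w - f z - a * (w - z)) + a * (w - z))%C by ring.
eapply Rle_lt_trans. apply Cmod_triangle. rewrite Cmod_mult.
assert (Hm := Cmod_ge_0 (w - z)%C).
apply Rle_lt_trans with ((Cmod a + 1) * Cmod (w - z)%C). lra.
apply Rle_lt_trans with ((Cmod a + 1) * (e / (Cmod a + 2))). apply Rmult_le_compat_l; lra.
apply Rmult_lt_reg_r with (Cmod a + 2); [lra|].
replace ((Cmod a + 1) * (e / (Cmod a + 2)) * (Cmod a + 2)) with ((Cmod a + 1) * e) by (field; lra). nra.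
Qed.
Lemma cder_mult f g z a b : cder f z a -> cder g z b ->
  cder (fun w => f w * g w)%C z (a * g z + f z * b)%C.
Proof.
intros H1 H2 e He.
set (M := Cmod (f z) + Cmod (g z) + Cmod b + 2).
assert (HM : 0 < M) by (unfold M; generalize (Cmod_ge_0 (f z)) (Cmod_ge_0 (g z)) (Cmod_ge_0 b); lra).
set (e' := Rmin 1 (e / (2 * M))).
assert (He' : 0 < e') by (apply Rmin_pos; [lra|apply Rdiv_lt_0_compat; lra]).
assert (He1 : e' <= 1) by apply Rmin_l.
assert (HeM : e' * (2 * M) <= e).
{ apply Rle_trans with (e / (2 * M) * (2 * M)). apply Rmult_le_compat_r; [lra|apply Rmin_r]. right; field; lra. }
destruct (H1 e' He') as [d1 [Hd1 A1]]. destruct (H2 e' He') as [d2 [Hd2 A2]].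
destruct (cder_cont f z a H1 e' He') as [d3 [Hd3 A3]].
exists (Rmin d1 (Rmin d2 d3)). split. repeat apply Rmin_pos; auto. intros h Hh.
assert (Hh1 : Cmod h < d1) by (eapply Rlt_le_trans; [apply Hh|apply Rmin_l]).
assert (Hh2 : Cmod h < d2) by (eapply Rlt_le_trans; [apply Hh|eapply Rle_trans; [apply Rmin_r|apply Rmin_l]]).
assert (Hh3 : Cmod h < d3) by (eapply Rlt_le_trans; [apply Hh|eapply Rle_trans; [apply Rmin_r|apply Rmin_r]]).
specialize (A1 h Hh1). specialize (A2 h Hh2).
specialize (A3 (z + h)%C ltac:(replace (z + h - z)%C with h by ring; auto)).
replace (f (z + h) * g (z + h) - f z * g z - (a * g z + f z * b) * h)%C with
 (f (z + h) * (g (z + h) - g z - b * h) + ((f (z + h) - f z - a * h) * g z + (f (z + h) - f z) * (b * h)))%C by ring.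
eapply Rle_trans. apply Cmod_triangle.
eapply Rle_trans. apply Rplus_le_compat_l, Cmod_triangle. rewrite !Cmod_mult.
assert (Hfz : Cmod (f (z + h)%C) <= Cmod (f z) + 1).
{ replace (f (z + h)%C) with (f z + (f (z + h) - f z))%C by ring. eapply Rle_trans. apply Cmod_triangle. lra. }
assert (N0 := Cmod_ge_0 h). assert (N1 := Cmod_ge_0 (g z)). assert (N2 := Cmod_ge_0 b).
assert (N3 := Cmod_ge_0 (f z)). assert (N4 := Cmod_ge_0 (f (z + h)%C)).
assert (T1 : Cmod (f (z + h)%C) * Cmod (g (z + h) - g z - b * h)%C <= (Cmod (f z) + 1) * (e' * Cmod h)).
{ apply Rmult_le_compat; auto. apply Cmod_ge_0. }
assert (T2 : Cmod (f (z + h) - f z - a * h)%C * Cmod (g z) <= e' * Cmod h * Cmod (g z)).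
{ apply Rmult_le_compat_r; auto. }
assert (T3 : Cmod (f (z + h) - f z)%C * (Cmod b * Cmod h) <= e' * (Cmod b * Cmod h)).
{ apply Rmult_le_compat_r; [nra|lra]. }
apply Rle_trans with (e' * (2 * M) * Cmod h).
2:{ apply Rmult_le_compat_r; auto. }
apply Rle_trans with (e' * M * Cmod h). unfold M; nra.
assert (0 <= e' * M * Cmod h) by (apply Rmult_le_pos; [apply Rmult_le_pos|]; lra). nra.
Qed.
Lemma cder_eq f z a b : cder f z a -> a = b -> cder f z b.
Proof. intros H <-; auto. Qed.
Lemma cder_inv f z a : cder f z a -> f z <> (RtoC 0) -> cder (fun w => / f w)%C z (- a / (f z * f z))%C.
Proof.
intros H Hz e He.
assert (Hp : 0 < Cmod (f z)) by (apply Cmod_gt_0; auto). set (m := Cmod (f z)) in *.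
assert (Ha := Cmod_ge_0 a).
set (e1 := e * m ^ 2 / 4). assert (He1 : 0 < e1) by (unfold e1; apply Rdiv_lt_0_compat; [apply Rmult_lt_0_compat; [lra|apply pow_lt; lra]|lra]).
set (e2 := Rmin (m / 2) (e * m ^ 3 / (4 * (Cmod a + 1)))).
assert (He2 : 0 < e2).
{ apply Rmin_pos; [lra|]. apply Rdiv_lt_0_compat; [|lra]. apply Rmult_lt_0_compat; [lra|apply pow_lt; lra]. }
destruct (H e1 He1) as [d1 [Hd1 A1]]. destruct (cder_cont f z a H e2 He2) as [d2 [Hd2 A2]].
exists (Rmin d1 d2). split. apply Rmin_pos; auto. intros h Hh.
specialize (A1 h ltac:(eapply Rlt_le_trans; [apply Hh|apply Rmin_l])).
specialize (A2 (z + h)%C ltac:(replace (z + h - z)%C with h by ring; eapply Rlt_le_trans; [apply Hh|apply Rmin_r])).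
assert (Hlow : m / 2 <= Cmod (f (z + h)%C)).
{ generalize (Cmod_triangle_minus (f z) (f z - f (z + h))%C).
  replace (f z - (f z - f (z + h)))%C with (f (z + h)%C) by ring.
  rewrite (Cmod_minus_sym (f z)). assert (e2 <= m / 2) by apply Rmin_l. fold m. lra. }
assert (Hzh : f (z + h)%C <> (RtoC 0)) by (apply Cmod_neq0; lra).
assert (He2' : e2 * (Cmod a + 1) <= e * m ^ 3 / 4).
{ apply Rle_trans with (e * m ^ 3 / (4 * (Cmod a + 1)) * (Cmod a + 1)).
  apply Rmult_le_compat_r; [lra|apply Rmin_r]. right; field; lra. }
replace (/ f (z + h) - / f z - - a / (f z * f z) * h)%C with
 ((- (f (z + h) - f z - a * h) * f z + a * h * (f (z + h) - f z)) / (f (z + h) * f z * f z))%C.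
2:{ field. split; auto. }
rewrite Cmod_div by (repeat apply Cmult_neq_0; auto).
rewrite !Cmod_mult. fold m.
assert (Hmm : m ^ 3 / 2 <= Cmod (f (z + h)%C) * m * m) by (simpl; nra).
assert (Hm3 : 0 < m ^ 3) by (apply pow_lt; lra).
apply Rmult_le_reg_r with (Cmod (f (z + h)%C) * m * m); [lra|].
unfold Rdiv. rewrite Rmult_assoc, Rinv_l by lra. rewrite Rmult_1_r.
eapply Rle_trans. apply Cmod_triangle. rewrite !Cmod_mult, Cmod_opp. fold m.
assert (N0 := Cmod_ge_0 h).
assert (T1 : Cmod (f (z + h) - f z - a * h)%C * m <= e * m ^ 3 / 4 * Cmod h).
{ replace (e * m ^ 3 / 4 * Cmod h) with (e1 * Cmod h * m) by (unfold e1; field). apply Rmult_le_compat_r; lra. }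
assert (T2 : Cmod a * Cmod h * Cmod (f (z + h) - f z)%C <= e * m ^ 3 / 4 * Cmod h).
{ apply Rle_trans with (Cmod a * Cmod h * e2). apply Rmult_le_compat_l; nra. nra. }
apply Rle_trans with (e * Cmod h * (m ^ 3 / 2)). lra. apply Rmult_le_compat_l; nra.
Qed.
Lemma cder_minus f g z a b : cder f z a -> cder g z b -> cder (fun w => f w - g w)%C z (a - b)%C.
Proof.
intros H1 H2. assert (H := cder_plus _ _ _ _ _ H1 (cder_scal (-1) _ _ _ H2)).
intros e He. destruct (H e He) as [d [Hd A]]. exists d; split; auto. intros h Hh.
specialize (A h Hh). eapply Rle_trans; [|apply A]. right. f_equal. ring.
Qed.
Lemma cder_shift f z c a : cder f (z + c)%C a -> cder (fun w => f (w + c)%C) z a.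
Proof.
intros H e He. destruct (H e He) as [d [Hd A]]. exists d; split; auto. intros h Hh.
replace (z + h + c)%C with (z + c + h)%C by ring. auto.
Qed.
Lemma cder_ext_loc f g z a : (exists d, 0 < d /\ forall w, Cmod (w - z)%C < d -> f w = g w) ->
  cder f z a -> cder g z a.
Proof.
intros [d0 [Hd0 E]] H e He. destruct (H e He) as [d [Hd A]].
exists (Rmin d0 d). split. apply Rmin_pos; auto. intros h Hh.
rewrite <- (E z), <- (E (z + h)%C).
- apply A. eapply Rlt_le_trans; [apply Hh|apply Rmin_r].
- replace (z + h - z)%C with h by ring. eapply Rlt_le_trans; [apply Hh|apply Rmin_l].
- replace (z - z)%C with (RtoC 0) by ring. rewrite Cmod_0. auto.
Qed.

Lemma Cmod_dx (t x : R) (y : R) : Cmod ((t, y) - (x, y))%C = Rabs (t - x).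
Proof.
replace ((t, y) - (x, y))%C with (RtoC (t - x)). apply Cmod_R.
unfold RtoC, Cminus, Cplus, Copp; simpl; f_equal; ring.
Qed.
Lemma Cmod_dy (t x : R) (y : R) : Cmod ((x, t) - (x, y))%C = Rabs (t - y).
Proof.
replace ((x, t) - (x, y))%C with (Ci * RtoC (t - y))%C.
rewrite Cmod_mult, Cmod_R. replace (Cmod Ci) with 1. ring.
unfold Cmod, Ci; simpl. rewrite Rmult_0_l, !Rmult_1_r, Rplus_0_l, sqrt_1; auto.
unfold RtoC, Ci, Cmult, Cminus, Cplus, Copp; simpl; f_equal; ring.
Qed.

Lemma cder_partials {f x y l} : cder f (x, y) l ->
  is_derive (fun t => fst (f (t, y))) x (fst l) /\ is_derive (fun t => snd (f (t, y))) x (snd l) /\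
  is_derive (fun t => fst (f (x, t))) y (- snd l) /\ is_derive (fun t => snd (f (x, t))) y (fst l).
Proof.
intro H.
assert (G : forall (pr : C -> R) (lp : R) (c : C), (forall a, Rabs (pr a) <= Cmod a) -> Cmod c = 1 ->
  (forall a b, pr (a - b)%C = pr a - pr b) -> (forall (h : R), pr (l * (RtoC h * c))%C = lp * h) ->
  forall (F : R -> R) x0, (forall h, F (x0 + h) = pr (f ((x, y) + RtoC h * c)%C)) -> is_derive F x0 lp).
{ intros pr lp c Hpr Hc Hsub Hl F x0 HF. apply is_derive_Reals. intros eps Heps.
  destruct (H (eps / 2) ltac:(lra)) as [d [Hd A]]. exists (mkposreal d Hd). intros h Hh Hhd. simpl in Hhd.
  assert (Hmod : Cmod (RtoC h * c)%C = Rabs h) by (rewrite Cmod_mult, Cmod_R, Hc; ring).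
  specialize (A (RtoC h * c)%C ltac:(lra)). rewrite Hmod in A.
  assert (F0 : F x0 = pr (f (x, y))).
  { rewrite <- (Rplus_0_r x0), HF. f_equal. f_equal. ring. }
  rewrite F0, HF.
  assert (B := Hpr (f ((x, y) + RtoC h * c) - f (x, y) - l * (RtoC h * c))%C).
  rewrite !Hsub, Hl in B.
  assert (Hh0 : 0 < Rabs h) by (apply Rabs_pos_lt; auto).
  replace ((pr (f ((x, y) + RtoC h * c)%C) - pr (f (x, y))) / h - lp)
   with ((pr (f ((x, y) + RtoC h * c)%C) - pr (f (x, y)) - lp * h) / h) by (field; auto).
  unfold Rdiv. rewrite Rabs_mult, Rabs_inv.
  apply Rle_lt_trans with (eps / 2 * Rabs h * / Rabs h).
  apply Rmult_le_compat_r. apply Rlt_le, Rinv_0_lt_compat; auto. lra.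
  rewrite Rmult_assoc, Rinv_r by lra. lra. }
assert (M1 : Cmod 1 = 1) by apply Cmod_1.
assert (Mi : Cmod Ci = 1).
{ unfold Cmod, Ci; simpl. rewrite Rmult_0_l, !Rmult_1_r, Rplus_0_l, sqrt_1; auto. }
split; [|split; [|split]].
- refine (G fst (fst l) (RtoC 1) _ _ _ _ (fun t => fst (f (t, y))) x _); auto. apply Cmod_fst. intros; unfold RtoC, Cmult; simpl; ring.
  intro h. f_equal. f_equal. unfold RtoC, Cmult, Cplus; simpl; f_equal; ring.
- refine (G snd (snd l) (RtoC 1) _ _ _ _ (fun t => snd (f (t, y))) x _); auto. apply Cmod_snd. intros; unfold RtoC, Cmult; simpl; ring.
  intro h. f_equal. f_equal. unfold RtoC, Cmult, Cplus; simpl; f_equal; ring.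
- refine (G fst (- snd l) Ci _ _ _ _ (fun t => fst (f (x, t))) y _); auto. apply Cmod_fst. intros; unfold RtoC, Cmult, Ci; simpl; ring.
  intro h. f_equal. f_equal. unfold RtoC, Cmult, Cplus, Ci; simpl; f_equal; ring.
- refine (G snd (fst l) Ci _ _ _ _ (fun t => snd (f (x, t))) y _); auto. apply Cmod_snd. intros; unfold RtoC, Cmult, Ci; simpl; ring.
  intro h. f_equal. f_equal. unfold RtoC, Cmult, Cplus, Ci; simpl; f_equal; ring.
Qed.

Lemma cder_c2d {f x y l} : cder f (x, y) l ->
  c2d (fun u v => fst (f (u, v))) x y /\ c2d (fun u v => snd (f (u, v))) x y.
Proof.
intro H.
assert (G : forall pr : C -> R, (forall a b, Rabs (pr a - pr b) <= Cmod (a - b)%C) ->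
  c2d (fun u v => pr (f (u, v))) x y).
{ intros pr Hpr eps. destruct (cder_cont f (x, y) l H eps (cond_pos eps)) as [d [Hd A]].
  exists (mkposreal (d / 2) ltac:(lra)). intros u v Hu Hv. simpl in Hu, Hv.
  eapply Rle_lt_trans. apply Hpr. apply A. eapply Rle_lt_trans. apply Cmod_le_sum. simpl. unfold Rminus in *. lra. }
split; apply G.
- intros a b. apply (Cmod_fst (a - b)%C).
- intros a b. apply (Cmod_snd (a - b)%C).
Qed.

(** * The Eisenstein series of the rectangular lattice *)

(** [z] keeps a distance to the lattice proportional to the size of the index, which
    bounds the terms of all the series at once. *)
Definition sep (s : R) (z : C) (c : R) : Prop :=
  0 < c /\ forall m n, c * nm m n <= Cmod (z - lattice_point s m n)%C.
Definition offlat (s : R) (z : C) : Prop := forall m n, z <> lattice_point s m n.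

(** The subtraction that makes the series of exponent 2 converge. *)
Definition corr (s : R) (j : nat) (m n : Z) : C :=
  if ((j =? 2)%nat && negb ((m =? 0)%Z && (n =? 0)%Z))%bool
  then (/ (lattice_point s m n * lattice_point s m n))%C else RtoC 0.
Definition trm (s : R) (j : nat) (z : C) (m n : Z) : C :=
  (/ (z - lattice_point s m n) ^ j - corr s j m n)%C.
(** [eis s j z] is the sum of [1 / (z - w)^j] over the lattice, with the Weierstrass
    correction if [j = 2].  For [j = 2] it is the Weierstrass function, and the
    others are its derivatives up to constants. *)
Definition eis (s : R) (j : nat) (z : C) : C := Clim (sq (trm s j z)).

Definition c0 (s : R) : R := Rmin s 1 / 4.
Lemma c0_pos s : 0 < s -> 0 < c0 s /\ c0 s <= s / 4 /\ c0 s <= 1 / 4.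
Proof.
intro H. unfold c0. generalize (Rmin_l s 1) (Rmin_r s 1) (Rmin_pos s 1 H Rlt_0_1). lra.
Qed.

Local Opaque c0.

Lemma Rabs_IZR_nonzero (m : Z) : m <> 0%Z -> 1 <= Rabs (IZR m).
Proof. intro H. rewrite <- abs_IZR. apply IZR_le. lia. Qed.

Lemma cell_lower_1 (s x : R) (m : Z) : 0 < s -> Rabs x <= s / 2 -> s / 2 * Rabs (IZR m) <= Rabs (x - s * IZR m).
Proof.
intros Hs Hx. destruct (Z.eq_dec m 0) as [->|Hm].
{ rewrite Rabs_R0, Rmult_0_r. apply Rabs_pos. }
assert (H1 := Rabs_IZR_nonzero m Hm).
assert (H := Rabs_triang_inv (s * IZR m) x). rewrite Rabs_minus_sym in H.
rewrite Rabs_mult, (Rabs_pos_eq s) in H by lra. nra.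
Qed.

Lemma cell_sep (s : R) (z : C) (m n : Z) : 0 < s -> Rabs (fst z) <= s / 2 -> Rabs (snd z) <= / 2 ->
  (m <> 0%Z \/ n <> 0%Z) -> c0 s * nm m n <= Cmod (z - lattice_point s m n)%C.
Proof.
intros Hs Hx Hy Hmn. destruct (c0_pos s Hs) as [H0 [H1 H2]].
assert (L1 := cell_lower_1 s (fst z) m Hs Hx).
assert (L2 := cell_lower_1 1 (snd z) n Rlt_0_1 ltac:(lra)). rewrite Rmult_1_l in L2.
assert (M1 := Cmod_fst (z - lattice_point s m n)%C). assert (M2 := Cmod_snd (z - lattice_point s m n)%C).
change (fst (z - lattice_point s m n)%C) with (fst z - s * IZR m) in M1.
change (snd (z - lattice_point s m n)%C) with (snd z - IZR n) in M2.
set (D := Cmod _) in *.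
assert (P1 := Rabs_pos (IZR m)). assert (P2 := Rabs_pos (IZR n)).
assert (E1 : 2 * c0 s * Rabs (IZR m) <= D) by nra.
assert (E2 : 2 * c0 s * Rabs (IZR n) <= D) by nra.
assert (E : 2 * c0 s * Rmax (Rabs (IZR m)) (Rabs (IZR n)) <= D).
{ unfold Rmax. destruct (Rle_dec (Rabs (IZR m)) (Rabs (IZR n))); auto. }
assert (F : 1 <= Rmax (Rabs (IZR m)) (Rabs (IZR n))).
{ destruct Hmn as [Hm|Hn].
  - eapply Rle_trans. apply (Rabs_IZR_nonzero m Hm). apply Rmax_l.
  - eapply Rle_trans. apply (Rabs_IZR_nonzero n Hn). apply Rmax_r. }
unfold nm. nra.
Qed.

Lemma nm_mult (m n a b : Z) : nm m n <= nm (m - a) (n - b) * nm a b.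
Proof.
unfold nm.
assert (H1 : Rabs (IZR m) <= Rabs (IZR (m - a)) + Rabs (IZR a)).
{ rewrite minus_IZR. replace (IZR m) with (IZR m - IZR a + IZR a) at 1 by ring. apply Rabs_triang. }
assert (H2 : Rabs (IZR n) <= Rabs (IZR (n - b)) + Rabs (IZR b)).
{ rewrite minus_IZR. replace (IZR n) with (IZR n - IZR b + IZR b) at 1 by ring. apply Rabs_triang. }
generalize (Rmax_l (Rabs (IZR (m - a))) (Rabs (IZR (n - b)))) (Rmax_r (Rabs (IZR (m - a))) (Rabs (IZR (n - b))))
  (Rmax_l (Rabs (IZR a)) (Rabs (IZR b))) (Rmax_r (Rabs (IZR a)) (Rabs (IZR b))).
generalize (Rabs_pos (IZR (m - a))) (Rabs_pos (IZR a)).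
set (u := Rmax (Rabs (IZR (m - a))) _). set (v := Rmax (Rabs (IZR a)) _). intros.
assert (Rmax (Rabs (IZR m)) (Rabs (IZR n)) <= u + v).
{ unfold Rmax. destruct (Rle_dec (Rabs (IZR m)) (Rabs (IZR n))); lra. }
nra.
Qed.

Lemma reduce_cell (s : R) (z : C) : 0 < s -> exists a b,
  Rabs (fst (z - lattice_point s a b)%C) <= s / 2 /\ Rabs (snd (z - lattice_point s a b)%C) <= / 2.
Proof.
intro Hs.
assert (G : forall t, exists n : Z, Rabs (t - IZR n) <= / 2).
{ intro t. exists (Int_part (t + / 2)). generalize (base_Int_part (t + / 2)). intro. apply Rabs_le. lra. }
destruct (G (fst z / s)) as [a Ha]. destruct (G (snd z)) as [b Hb]. exists a, b.
change (fst (z - lattice_point s a b)%C) with (fst z - s * IZR a).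
change (snd (z - lattice_point s a b)%C) with (snd z - IZR b). split; auto.
replace (fst z - s * IZR a) with (s * (fst z / s - IZR a)) by (field; lra).
rewrite Rabs_mult, (Rabs_pos_eq s) by lra. nra.
Qed.

Lemma lattice_point_add s m n a b :
  lattice_point s (m + a) (n + b) = (lattice_point s m n + lattice_point s a b)%C.
Proof. unfold lattice_point, Cplus; simpl. rewrite !plus_IZR. f_equal; ring. Qed.
Lemma lattice_point_sub s m n a b :
  lattice_point s (m - a) (n - b) = (lattice_point s m n - lattice_point s a b)%C.
Proof. unfold lattice_point, Cminus, Cplus, Copp; simpl. rewrite !minus_IZR. f_equal; ring. Qed.
Lemma lattice_point_opp s m n : lattice_point s (- m) (- n) = (- lattice_point s m n)%C.
Proof. unfold lattice_point, Copp; simpl. rewrite !opp_IZR. f_equal; ring. Qed.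

Lemma offlat_sep (s : R) (z : C) : 0 < s -> offlat s z -> exists c, sep s z c.
Proof.
intros Hs Hz. destruct (reduce_cell s z Hs) as [a [b [Ha Hb]]].
set (z0 := (z - lattice_point s a b)%C) in *.
assert (Hz0 : 0 < Cmod z0).
{ apply Cmod_gt_0. intro E. apply (Hz a b). unfold z0 in E.
  transitivity (z - lattice_point s a b + lattice_point s a b)%C; [ring|]. rewrite E. ring. }
destruct (c0_pos s Hs) as [H0 _]. assert (Hn := nm_ge1 a b).
exists (Rmin (c0 s) (Cmod z0) / nm a b). split.
- apply Rdiv_lt_0_compat. apply Rmin_pos; auto. lra.
- intros m n. replace (z - lattice_point s m n)%C with (z0 - lattice_point s (m - a) (n - b))%C
    by (rewrite lattice_point_sub; unfold z0; ring).
  apply Rle_trans with (Rmin (c0 s) (Cmod z0) * nm (m - a) (n - b)).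
  { replace (Rmin (c0 s) (Cmod z0) * nm (m - a) (n - b)) with
      (Rmin (c0 s) (Cmod z0) / nm a b * (nm (m - a) (n - b) * nm a b)) by (field; lra).
    apply Rmult_le_compat_l. apply Rlt_le, Rdiv_lt_0_compat; [apply Rmin_pos; auto|lra]. apply nm_mult. }
  assert (Hn2 := nm_ge1 (m - a) (n - b)).
  destruct (Z.eq_dec (m - a) 0) as [E1|E1]; [destruct (Z.eq_dec (n - b) 0) as [E2|E2]|].
  + rewrite E1, E2. unfold nm. rewrite Rabs_R0, Rmax_left, Rplus_0_r, Rmult_1_r by lra.
    replace (z0 - lattice_point s 0 0)%C with z0. apply Rmin_r.
    unfold lattice_point. destruct z0 as [u v]; unfold Cminus, Cplus, Copp; simpl; f_equal; ring.
  + eapply Rle_trans; [|apply cell_sep; auto]. apply Rmult_le_compat_r; [lra|apply Rmin_l].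
  + eapply Rle_trans; [|apply cell_sep; auto]. apply Rmult_le_compat_r; [lra|apply Rmin_l].
Qed.

Lemma sep_near s z c h : sep s z c -> Cmod h <= c / 2 -> sep s (z + h)%C (c / 2).
Proof.
intros [Hc H] Hh. split; [lra|]. intros m n. specialize (H m n).
generalize (nm_ge1 m n) (Cmod_triangle_minus (z - lattice_point s m n)%C (- h)%C).
rewrite Cmod_opp. replace (z - lattice_point s m n - - h)%C with (z + h - lattice_point s m n)%C by ring. nra.
Qed.

Lemma nm_pow_ge (j : nat) m n : (3 <= j)%nat -> nm m n ^ 3 <= nm m n ^ j.
Proof. intro H. apply Rle_pow; auto. apply nm_ge1. Qed.

Lemma inv_pow_bound s z c j m n : (0 < c) -> (3 <= j)%nat ->
  c * nm m n <= Cmod (z - lattice_point s m n)%C ->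
  Cmod (/ (z - lattice_point s m n) ^ j)%C <= (/ c) ^ j / nm m n ^ 3.
Proof.
intros Hc Hj H. assert (Hn := nm_ge1 m n).
assert (Hp : 0 < Cmod (z - lattice_point s m n)%C) by nra.
rewrite Cmod_inv by (apply Cpow_nz, Cmod_neq0; auto). rewrite Cmod_pow.
apply Rle_trans with (/ (c * nm m n) ^ j).
- apply Rinv_le_contravar. apply pow_lt; nra. apply pow_incr. nra.
- rewrite Rpow_mult_distr, Rinv_mult, pow_inv. unfold Rdiv.
  apply Rmult_le_compat_l. apply Rlt_le, Rinv_0_lt_compat, pow_lt; auto.
  apply Rinv_le_contravar. apply pow_lt; lra. apply nm_pow_ge; auto.
Qed.

Lemma lattice_lower s m n : 0 < s -> (m <> 0%Z \/ n <> 0%Z) -> c0 s * nm m n <= Cmod (lattice_point s m n).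
Proof.
intros Hs H. assert (E := cell_sep s (RtoC 0) m n Hs). simpl in E. rewrite Rabs_R0 in E.
specialize (E ltac:(lra) ltac:(lra) H). eapply Rle_trans; [apply E|].
right. rewrite <- Cmod_opp. f_equal. ring.
Qed.

Lemma trm2_bound s z c m n : 0 < s -> 0 < c -> (m <> 0%Z \/ n <> 0%Z) ->
  c * nm m n <= Cmod (z - lattice_point s m n)%C ->
  Cmod (/ ((z - lattice_point s m n) * (z - lattice_point s m n)) - / (lattice_point s m n * lattice_point s m n))%C
  <= (2 * Cmod z / (c * c * c0 s) + Cmod z ^ 2 / (c * c * c0 s * c0 s)) / nm m n ^ 3.
Proof.
intros Hs Hc Hmn H. assert (Hn := nm_ge1 m n). destruct (c0_pos s Hs) as [H0 _].
assert (Hw := lattice_lower s m n Hs Hmn).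
set (w := lattice_point s m n) in *.
assert (Hp : 0 < Cmod (z - w)%C) by nra. assert (Hpw : 0 < Cmod w) by nra.
assert (Nz : (z - w)%C <> 0) by (apply Cmod_neq0; auto). assert (Nw : w <> 0) by (apply Cmod_neq0; auto).
replace (/ ((z - w) * (z - w)) - / (w * w))%C with
  (z * (2 * / ((z - w) * (z - w) * w) + - z * / ((z - w) * (z - w) * w * w)))%C
  by (field; auto).
assert (Hz := Cmod_ge_0 z). set (N := nm m n) in *.
assert (I1 : Cmod (/ ((z - w) * (z - w) * w))%C <= / (c * c * c0 s) / N ^ 3).
{ rewrite Cmod_inv by (repeat apply Cmult_neq_0; auto). rewrite !Cmod_mult.
  replace (/ (c * c * c0 s) / N ^ 3) with (/ ((c * N) * (c * N) * (c0 s * N))) by (field; repeat split; lra).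
  apply Rinv_le_contravar. repeat apply Rmult_lt_0_compat; lra.
  apply Rmult_le_compat; try nra. apply Rmult_le_compat; nra. }
assert (I2 : Cmod (/ ((z - w) * (z - w) * w * w))%C <= / (c * c * c0 s * c0 s) / N ^ 3).
{ rewrite Cmod_inv by (repeat apply Cmult_neq_0; auto). rewrite !Cmod_mult.
  replace (/ (c * c * c0 s * c0 s) / N ^ 3) with (/ ((c * N) * (c * N) * (c0 s * N) * (c0 s * 1))) by (field; repeat split; lra).
  apply Rinv_le_contravar. repeat apply Rmult_lt_0_compat; lra.
  apply Rmult_le_compat; try nra. apply Rmult_le_pos; [|nra]. apply Rmult_le_pos; nra.
  apply Rmult_le_compat; try nra. apply Rmult_le_compat; nra. }
rewrite Cmod_mult.
apply Rle_trans with (Cmod z * (2 * (/ (c * c * c0 s) / N ^ 3) + Cmod z * (/ (c * c * c0 s * c0 s) / N ^ 3))).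
- apply Rmult_le_compat_l; auto. eapply Rle_trans. apply Cmod_triangle.
  rewrite !Cmod_mult, Cmod_opp, Cmod_R, (Rabs_pos_eq 2) by lra.
  apply Rplus_le_compat. lra. apply Rmult_le_compat_l; auto.
- right. field. repeat split; lra.
Qed.

Lemma corr_ge3 s j m n : (3 <= j)%nat -> corr s j m n = 0.
Proof. intro H. unfold corr. destruct (Nat.eqb_spec j 2); [lia|]. reflexivity. Qed.
Lemma corr_0 s j : corr s j 0 0 = 0.
Proof. unfold corr. simpl. rewrite Bool.andb_false_r. reflexivity. Qed.
Lemma corr_2 s m n : (m <> 0%Z \/ n <> 0%Z) -> corr s 2 m n = (/ (lattice_point s m n * lattice_point s m n))%C.
Proof.
intro H. unfold corr. simpl. destruct (Z.eqb_spec m 0), (Z.eqb_spec n 0); simpl; auto. lia.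
Qed.

Lemma trm_bound s z c j : 0 < s -> sep s z c -> (2 <= j)%nat ->
  exists M, 0 <= M /\ forall m n, Cmod (trm s j z m n) <= M / nm m n ^ 3.
Proof.
intros Hs [Hc H] Hj. destruct (c0_pos s Hs) as [H0 _].
destruct (Nat.eq_dec j 2) as [->|Hj2].
- set (M1 := 2 * Cmod z / (c * c * c0 s) + Cmod z ^ 2 / (c * c * c0 s * c0 s)).
  assert (HM1 : 0 <= M1).
  { unfold M1. assert (Hz := Cmod_ge_0 z).
    apply Rplus_le_le_0_compat; apply Rdiv_le_0_compat; try nra; repeat apply Rmult_lt_0_compat; lra. }
  exists (M1 + / (c * c)). assert (Hcc : 0 < / (c * c)) by (apply Rinv_0_lt_compat; nra).
  split; [lra|]. intros m n. assert (Hn := nm_ge1 m n).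
  assert (Hn3 : 0 < / nm m n ^ 3) by (apply Rinv_0_lt_compat, pow_lt; lra).
  destruct (Z.eq_dec m 0) as [Em|Em]; [destruct (Z.eq_dec n 0) as [En|En]|].
  + subst. unfold trm. rewrite corr_0. specialize (H 0%Z 0%Z).
    set (u := (z - lattice_point s 0 0)%C) in *.
    replace (/ u ^ 2 - 0)%C with (/ u ^ 2)%C by ring.
    unfold nm in *. rewrite Rabs_R0, Rmax_left in * by lra. rewrite Rplus_0_r, Rmult_1_r in H.
    rewrite Cmod_inv by (apply Cpow_nz, Cmod_neq0; lra). rewrite Cmod_pow.
    apply Rle_trans with (/ (c * c)). apply Rinv_le_contravar; nra.
    rewrite Rplus_0_r, pow1. lra.
  + unfold trm. rewrite corr_2 by auto. 
    replace ((z - lattice_point s m n) ^ 2)%C with ((z - lattice_point s m n) * (z - lattice_point s m n))%C by (simpl; ring).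
    eapply Rle_trans. apply (trm2_bound s z c m n); auto. fold M1. unfold Rdiv. nra.
  + unfold trm. rewrite corr_2 by auto. 
    replace ((z - lattice_point s m n) ^ 2)%C with ((z - lattice_point s m n) * (z - lattice_point s m n))%C by (simpl; ring).
    eapply Rle_trans. apply (trm2_bound s z c m n); auto. fold M1. unfold Rdiv. nra.
- exists ((/ c) ^ j). split. apply pow_le, Rlt_le, Rinv_0_lt_compat; auto.
  intros m n. unfold trm. rewrite corr_ge3 by lia.
  replace (/ (z - lattice_point s m n) ^ j - 0)%C with (/ (z - lattice_point s m n) ^ j)%C by ring.
  apply inv_pow_bound; auto. lia.
Qed.

Lemma eis_cv s z c j : 0 < s -> sep s z c -> (2 <= j)%nat -> Ccv (sq (trm s j z)) (eis s j z).
Proof.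
intros Hs Hz Hj. destruct (trm_bound s z c j Hs Hz Hj) as [M [HM H]].
destruct (sq_converges _ M H HM) as [l Hl]. unfold eis. rewrite (Clim_eq _ _ Hl). exact Hl.
Qed.

Lemma offlat_cv s z j : 0 < s -> offlat s z -> (2 <= j)%nat -> Ccv (sq (trm s j z)) (eis s j z).
Proof. intros Hs Hz Hj. destruct (offlat_sep s z Hs Hz) as [c Hc]. apply (eis_cv s z c); auto. Qed.

Lemma inv_pow_taylor (u h : C) (j : nat) : (1 <= j)%nat -> 0 < Cmod u -> Cmod h <= Cmod u / 2 ->
  Cmod (/ (u + h) ^ j - / u ^ j + RtoC (INR j) * h * / u ^ S j)%C <= INR j * (INR j + 1) * 2 ^ j * Cmod h ^ 2 * (/ Cmod u) ^ (S (S j)).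
Proof.
intros Hj Hu Hh.
assert (Nu : u <> 0) by (apply Cmod_neq0; auto).
assert (Huh : Cmod u / 2 <= Cmod (u + h)%C).
{ generalize (Cmod_triangle_minus u (- h)%C). rewrite Cmod_opp. replace (u - - h)%C with (u + h)%C by ring. lra. }
assert (Nuh : (u + h)%C <> 0) by (apply Cmod_neq0; lra).
assert (Ha : Cmod (/ (u + h))%C <= 2 * / Cmod u).
{ rewrite Cmod_inv by auto. replace (2 * / Cmod u) with (/ (Cmod u / 2)) by (field; lra).
  apply Rinv_le_contravar; lra. }
assert (Hb : Cmod (/ u)%C = / Cmod u) by (rewrite Cmod_inv; auto).
assert (Hi : 0 < / Cmod u) by (apply Rinv_0_lt_compat; auto).
assert (Hh0 := Cmod_ge_0 h). assert (Ha0 := Cmod_ge_0 (/ (u + h))%C).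
set (r := / Cmod u) in *.
induction j as [|j IH]; [lia|].
destruct (Nat.eq_dec j 0) as [->|Hj0].
- replace (/ (u + h) ^ 1 - / u ^ 1 + RtoC (INR 1) * h * / u ^ 2)%C with (h * h * (/ (u + h) * (/ u * / u)))%C.
  2:{ simpl. field. auto. }
  rewrite !Cmod_mult, Hb. simpl.
  assert (0 <= Cmod h * Cmod h) by nra. assert (0 <= r * r) by nra.
  apply Rle_trans with (Cmod h * Cmod h * (2 * r * (r * r))).
  apply Rmult_le_compat_l; auto. apply Rmult_le_compat_r; auto. 
  assert (0 <= Cmod h * Cmod h * (r * (r * r))) by (apply Rmult_le_pos; nra). nra.
- specialize (IH ltac:(lia)).
  replace (/ (u + h) ^ S j - / u ^ S j + RtoC (INR (S j)) * h * / u ^ S (S j))%C with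
   (/ (u + h) * (/ (u + h) ^ j - / u ^ j + RtoC (INR j) * h * / u ^ S j)
     + RtoC (INR (S j)) * (h * h * (/ (u + h) * (/ u) ^ (S (S j)))))%C.
  2:{ rewrite S_INR, RtoC_plus, Cpow_inv by auto. rewrite !Cpow_S. field. repeat split; auto; apply Cpow_nz; auto. }
  eapply Rle_trans. apply Cmod_triangle. rewrite !Cmod_mult, Cmod_R, Cmod_pow, Hb.
  rewrite (Rabs_pos_eq (INR (S j))) by apply pos_INR.
  assert (HJ : 0 <= INR j) by apply pos_INR. rewrite S_INR. set (J := INR j) in *.
  assert (Hr : 0 <= r ^ S (S j)) by (apply pow_le; lra).
  assert (H2j : 1 <= 2 ^ j) by (apply pow_R1_Rle; lra).
  set (X := Cmod h ^ 2 * r ^ S (S (S j))).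
  assert (HX : 0 <= X) by (apply Rmult_le_pos; [apply pow2_ge_0|apply pow_le; lra]).
  apply Rle_trans with (J * (J + 1) * 2 ^ j * 2 * X + (J + 1) * 2 * X).
  + apply Rplus_le_compat.
    * apply Rle_trans with (2 * r * (J * (J + 1) * 2 ^ j * Cmod h ^ 2 * r ^ S (S j))).
      apply Rmult_le_compat; auto. apply Cmod_ge_0.
      right. unfold X. simpl. ring.
    * replace ((J + 1) * 2 * X) with ((J + 1) * (Cmod h * Cmod h * (2 * r * r ^ S (S j)))) by (unfold X; simpl; ring).
      apply Rmult_le_compat_l; [lra|]. apply Rmult_le_compat_l; [nra|]. apply Rmult_le_compat_r; auto.
  + replace ((J + 1) * (J + 1 + 1) * 2 ^ S j * Cmod h ^ 2 * r ^ S (S (S j)))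
      with ((J + 1) * (J + 1 + 1) * (2 * 2 ^ j) * X) by (unfold X; simpl; ring).
    replace (J * (J + 1) * 2 ^ j * 2 * X + (J + 1) * 2 * X) with ((J + 1) * (J * (2 * 2 ^ j) + 2) * X) by ring.
    apply Rmult_le_compat_r; auto.
    replace ((J + 1) * (J + 1 + 1) * (2 * 2 ^ j)) with ((J + 1) * ((J + 2) * (2 * 2 ^ j))) by ring.
    apply Rmult_le_compat_l; nra.
Qed.

(** Summing second-order Taylor remainders of the terms: this replaces theorems on
    termwise differentiation. *)
Lemma eis_taylor s z c j : 0 < s -> sep s z c -> (2 <= j)%nat ->
  exists K, 0 <= K /\ forall h, Cmod h <= c / 2 ->
  Cmod (eis s j (z + h) - eis s j z + RtoC (INR j) * h * eis s (S j) z)%C <= K * Cmod h ^ 2.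
Proof.
intros Hs Hz Hj. assert (Hc := proj1 Hz).
set (K0 := INR j * (INR j + 1) * 2 ^ j * (/ c) ^ (S (S j))).
assert (HK0 : 0 <= K0).
{ unfold K0. assert (0 <= INR j) by apply pos_INR. assert (0 < / c) by (apply Rinv_0_lt_compat; auto).
  apply Rmult_le_pos; [apply Rmult_le_pos; [apply Rmult_le_pos|]|]; try lra; apply pow_le; lra. }
exists (9 * K0). split; [lra|]. intros h Hh.
assert (C1 := eis_cv s (z + h) (c / 2) j Hs (sep_near s z c h Hz Hh) Hj).
assert (C2 := eis_cv s z c j Hs Hz Hj). assert (C3 := eis_cv s z c (S j) Hs Hz ltac:(lia)).
assert (CC := Ccv_plus _ _ _ _ (Ccv_plus _ _ _ _ C1 (Ccv_scal (RtoC (-1)) _ _ C2)) (Ccv_scal (RtoC (INR j) * h) _ _ C3)).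
replace (eis s j (z + h) - eis s j z + RtoC (INR j) * h * eis s (S j) z)%C with
  (eis s j (z + h) + RtoC (-1) * eis s j z + RtoC (INR j) * h * eis s (S j) z)%C by ring.
apply (Ccv_bound _ _ _ CC). intro k.
rewrite <- !sq_scal, <- !sq_plus.
replace (9 * K0 * Cmod h ^ 2) with (9 * (K0 * Cmod h ^ 2)) by ring.
apply sq_bound. 2:{ apply Rmult_le_pos; auto. apply pow2_ge_0. }
intros m n. destruct Hz as [_ Hz]. specialize (Hz m n). assert (Hn := nm_ge1 m n).
unfold trm. rewrite (corr_ge3 s (S j)) by lia.
set (u := (z - lattice_point s m n)%C) in *.
replace (/ (z + h - lattice_point s m n) ^ j - corr s j m n + RtoC (-1) * (/ u ^ j - corr s j m n) +
  RtoC (INR j) * h * (/ u ^ S j - 0))%C with (/ (u + h) ^ j - / u ^ j + RtoC (INR j) * h * / u ^ S j)%C.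
2:{ replace (z + h - lattice_point s m n)%C with (u + h)%C by (unfold u; ring). ring. }
assert (Hu : 0 < Cmod u) by nra.
eapply Rle_trans. apply inv_pow_taylor; auto. lia. nra.
unfold K0.
replace (INR j * (INR j + 1) * 2 ^ j * (/ c) ^ S (S j) * Cmod h ^ 2 / nm m n ^ 3)
 with (INR j * (INR j + 1) * 2 ^ j * Cmod h ^ 2 * ((/ c) ^ S (S j) / nm m n ^ 3)) by (unfold Rdiv; ring).
apply Rmult_le_compat_l.
{ assert (0 <= INR j) by apply pos_INR.
  apply Rmult_le_pos; [apply Rmult_le_pos; [apply Rmult_le_pos|]|]; try lra; [apply pow_le; lra|apply pow2_ge_0]. }
apply Rle_trans with ((/ (c * nm m n)) ^ S (S j)).
- apply pow_incr. split. apply Rlt_le, Rinv_0_lt_compat; auto. apply Rinv_le_contravar; nra.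
- rewrite Rinv_mult, Rpow_mult_distr. unfold Rdiv. apply Rmult_le_compat_l.
  apply pow_le, Rlt_le, Rinv_0_lt_compat; auto.
  rewrite pow_inv. apply Rinv_le_contravar. apply pow_lt; lra. apply nm_pow_ge. lia.
Qed.

Lemma cder_eis s z j : 0 < s -> offlat s z -> (2 <= j)%nat ->
  cder (eis s j) z (- RtoC (INR j) * eis s (S j) z)%C.
Proof.
intros Hs Hz Hj. destruct (offlat_sep s z Hs Hz) as [c Hc].
destruct (eis_taylor s z c j Hs Hc Hj) as [K [HK H]]. assert (Hcp := proj1 Hc).
intros e He. exists (Rmin (c / 2) (e / (K + 1))). split.
{ apply Rmin_pos; [lra|]. apply Rdiv_lt_0_compat; lra. }
intros h Hh.
assert (H1 : Cmod h < c / 2) by (eapply Rlt_le_trans; [apply Hh|apply Rmin_l]).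
assert (H2 : Cmod h < e / (K + 1)) by (eapply Rlt_le_trans; [apply Hh|apply Rmin_r]).
replace (eis s j (z + h) - eis s j z - - RtoC (INR j) * eis s (S j) z * h)%C with
  (eis s j (z + h) - eis s j z + RtoC (INR j) * h * eis s (S j) z)%C by ring.
eapply Rle_trans. apply H; lra.
assert (Hh0 := Cmod_ge_0 h).
replace (K * Cmod h ^ 2) with (K * Cmod h * Cmod h) by ring. apply Rmult_le_compat_r; auto.
apply Rle_trans with ((K + 1) * Cmod h). nra.
apply Rle_trans with ((K + 1) * (e / (K + 1))). apply Rmult_le_compat_l; lra. right; field; lra.
Qed.

(** * Periods and symmetries of the Eisenstein series *)

Lemma offlat_shift s z a b : offlat s z -> offlat s (z + lattice_point s a b)%C.
Proof.
intros H m n E. apply (H (m - a)%Z (n - b)%Z). rewrite lattice_point_sub, <- E. ring.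
Qed.
Lemma offlat_opp s z : offlat s z -> offlat s (- z)%C.
Proof.
intros H m n E. apply (H (- m)%Z (- n)%Z). rewrite lattice_point_opp, <- E. ring.
Qed.
Lemma conj_lattice s m n : Cconj (lattice_point s m n) = lattice_point s m (- n).
Proof. unfold Cconj, lattice_point; simpl. rewrite opp_IZR. f_equal; ring. Qed.
Lemma offlat_conj s z : offlat s z -> offlat s (Cconj z).
Proof.
intros H m n E. apply (H m (- n)%Z). rewrite <- conj_lattice, <- E, Cconj_conj. reflexivity.
Qed.

Lemma Ccv_minus_eq u v l m : Ccv u l -> Ccv v m -> Ccv (fun k => u k - v k)%C (RtoC 0) -> l = m.
Proof.
intros H1 H2 H. assert (E : Ccv (fun k => u k - v k)%C (l + RtoC (-1) * m)%C).
{ eapply Ccv_ext. 2: apply (Ccv_plus _ _ _ _ H1 (Ccv_scal (RtoC (-1)) _ _ H2)). intro; simpl. ring. }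
assert (X := Ccv_unique _ _ _ E H). 
transitivity (l + RtoC (-1) * m + m)%C; [ring|]. rewrite X. ring.
Qed.

Lemma inv_pow_bound2 s z c j m n k : 0 < c -> (2 <= j)%nat ->
  c * nm m n <= Cmod (z - lattice_point s m n)%C -> INR k + 1 <= nm m n ->
  Cmod (/ (z - lattice_point s m n) ^ j)%C <= (/ c) ^ j / (INR k + 1) ^ 2.
Proof.
intros Hc Hj H Hk. assert (HK := pos_INR k).
assert (Hp : 0 < Cmod (z - lattice_point s m n)%C) by nra.
rewrite Cmod_inv by (apply Cpow_nz, Cmod_neq0; auto). rewrite Cmod_pow.
apply Rle_trans with (/ (c * (INR k + 1)) ^ j).
- apply Rinv_le_contravar. apply pow_lt; nra. apply pow_incr. nra.
- rewrite Rpow_mult_distr, Rinv_mult, pow_inv. unfold Rdiv.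
  apply Rmult_le_compat_l. apply Rlt_le, Rinv_0_lt_compat, pow_lt; auto.
  apply Rinv_le_contravar. apply pow_lt; lra. apply Rle_pow; auto. lra.
Qed.

Lemma shift_remainder (u : nat -> C) K : 0 <= K ->
  (forall k, Cmod (u k) <= (2 * INR k + 1) * (K / (INR k + 1) ^ 2)) -> Ccv u (RtoC 0).
Proof.
intros HK H. apply (Ccv_0_of_bound u (2 * K)). lra. intro k. eapply Rle_trans. apply H.
assert (Hk := pos_INR k). set (x := INR k) in *.
replace (2 * K / (x + 1)) with ((2 * x + 2) * (K / (x + 1) ^ 2)) by (field; lra).
apply Rmult_le_compat_r; [|lra]. apply Rdiv_le_0_compat; auto. apply pow_lt; lra.
Qed.

(** A shift of the index by one changes the sum over a square by two of its sides only,
    [2 k + 1] terms of order [k^-2] each. *)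
Lemma eis_period_1 s z j : 0 < s -> offlat s z -> (2 <= j)%nat ->
  eis s j (z + lattice_point s 1 0)%C = eis s j z.
Proof.
intros Hs Hz Hj. destruct (offlat_sep s z Hs Hz) as [c Hc].
apply (Ccv_minus_eq _ _ _ _ (offlat_cv s _ j Hs (offlat_shift s z 1 0 Hz) Hj) (offlat_cv s z j Hs Hz Hj)).
set (G := fun k m => zsum (fun n => / (z - lattice_point s m n) ^ j)%C k).
assert (E : forall k, (G k (- Z.of_nat k - 1)%Z - G k (Z.of_nat k))%C =
   (sq (trm s j (z + lattice_point s 1 0)%C) k - sq (trm s j z) k)%C).
{ intro k. rewrite <- (zsum_telescope (G k)).
  replace (sq (trm s j (z + lattice_point s 1 0)%C) k - sq (trm s j z) k)%C with
   (sq (trm s j (z + lattice_point s 1 0)%C) k + RtoC (-1) * sq (trm s j z) k)%C by ring.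
  rewrite <- sq_scal, <- sq_plus. unfold sq. apply zsum_ext. intro m.
  unfold G. replace (zsum (fun n => / (z - lattice_point s (m - 1) n) ^ j)%C k - zsum (fun n => / (z - lattice_point s m n) ^ j)%C k)%C
   with (zsum (fun n => / (z - lattice_point s (m - 1) n) ^ j)%C k + RtoC (-1) * zsum (fun n => / (z - lattice_point s m n) ^ j)%C k)%C by ring.
  rewrite <- zsum_scal, <- zsum_plus. apply zsum_ext. intro n. unfold trm.
  replace (z + lattice_point s 1 0 - lattice_point s m n)%C with (z - lattice_point s (m - 1) n)%C. ring.
  replace n with (n - 0)%Z at 1 by ring. rewrite lattice_point_sub. ring. }
eapply Ccv_ext. apply E. destruct Hc as [Hc H].
assert (Hic : 0 <= (/ c) ^ j) by (apply pow_le, Rlt_le, Rinv_0_lt_compat; auto).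
apply (shift_remainder _ (2 * (/ c) ^ j)). lra. intro k.
eapply Rle_trans. apply Cmod_triangle_minus'.
assert (B : forall m, (Z.abs m = Z.of_nat k \/ Z.abs m = Z.of_nat (S k)) ->
   Cmod (G k m) <= (2 * INR k + 1) * ((/ c) ^ j / (INR k + 1) ^ 2)).
{ intros m Hm. apply zsum_bound. intros n _. apply (inv_pow_bound2 s z c j m n k Hc Hj); auto.
  destruct Hm as [Hm|Hm]. apply nm_left; auto.
  generalize (nm_left m n (S k) Hm). rewrite S_INR. lra. }
assert (B1 := B (- Z.of_nat k - 1)%Z ltac:(lia)). assert (B2 := B (Z.of_nat k) ltac:(lia)).
unfold Rdiv in *. lra.
Qed.

Lemma eis_period_i s z j : 0 < s -> offlat s z -> (2 <= j)%nat ->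
  eis s j (z + lattice_point s 0 1)%C = eis s j z.
Proof.
intros Hs Hz Hj. destruct (offlat_sep s z Hs Hz) as [c Hc].
apply (Ccv_minus_eq _ _ _ _ (offlat_cv s _ j Hs (offlat_shift s z 0 1 Hz) Hj) (offlat_cv s z j Hs Hz Hj)).
set (f := fun m n => (/ (z - lattice_point s m n) ^ j)%C).
assert (E : forall k, zsum (fun m => f m (- Z.of_nat k - 1)%Z - f m (Z.of_nat k))%C k =
   (sq (trm s j (z + lattice_point s 0 1)%C) k - sq (trm s j z) k)%C).
{ intro k.
  replace (sq (trm s j (z + lattice_point s 0 1)%C) k - sq (trm s j z) k)%C with
   (sq (trm s j (z + lattice_point s 0 1)%C) k + RtoC (-1) * sq (trm s j z) k)%C by ring.
  rewrite <- sq_scal, <- sq_plus. unfold sq. apply zsum_ext. intro m.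
  rewrite <- (zsum_telescope (f m)). apply zsum_ext. intro n. unfold f, trm.
  replace (z + lattice_point s 0 1 - lattice_point s m n)%C with (z - lattice_point s m (n - 1))%C. ring.
  replace m with (m - 0)%Z at 1 by ring. rewrite lattice_point_sub. ring. }
eapply Ccv_ext. apply E. destruct Hc as [Hc H].
assert (Hic : 0 <= (/ c) ^ j) by (apply pow_le, Rlt_le, Rinv_0_lt_compat; auto).
apply (shift_remainder _ (2 * (/ c) ^ j)). lra. intro k.
apply zsum_bound. intros m _.
eapply Rle_trans. apply Cmod_triangle_minus'.
assert (B : forall n, (Z.abs n = Z.of_nat k \/ Z.abs n = Z.of_nat (S k)) ->
   Cmod (f m n) <= (/ c) ^ j / (INR k + 1) ^ 2).
{ intros n Hn. apply (inv_pow_bound2 s z c j m n k Hc Hj); auto.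
  destruct Hn as [Hn|Hn]. apply nm_right; auto.
  generalize (nm_right m n (S k) Hn). rewrite S_INR. lra. }
assert (B1 := B (- Z.of_nat k - 1)%Z ltac:(lia)). assert (B2 := B (Z.of_nat k) ltac:(lia)).
unfold Rdiv in *. lra.
Qed.

Lemma eis_period s z j a b : 0 < s -> offlat s z -> (2 <= j)%nat ->
  eis s j (z + lattice_point s a b)%C = eis s j z.
Proof.
intros Hs Hz Hj.
assert (N : forall (k : nat) (p q : Z) z, offlat s z ->
  (forall z, offlat s z -> eis s j (z + lattice_point s p q)%C = eis s j z) ->
  eis s j (z + lattice_point s (Z.of_nat k * p) (Z.of_nat k * q))%C = eis s j z).
{ induction k as [|k IH]; intros p q w Hw Hp.
  - f_equal. unfold lattice_point. destruct w; unfold Cplus; simpl. f_equal; ring.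
  - replace (Z.of_nat (S k) * p)%Z with (Z.of_nat k * p + p)%Z by lia.
    replace (Z.of_nat (S k) * q)%Z with (Z.of_nat k * q + q)%Z by lia.
    rewrite lattice_point_add, Cplus_assoc, Hp. apply IH; auto. apply offlat_shift; auto. }
assert (Inv : forall p q, (forall z, offlat s z -> eis s j (z + lattice_point s p q)%C = eis s j z) ->
  forall z, offlat s z -> eis s j (z + lattice_point s (- p) (- q))%C = eis s j z).
{ intros p q Hp w Hw. rewrite <- (Hp (w + lattice_point s (- p) (- q))%C) by (apply offlat_shift; auto).
  f_equal. rewrite lattice_point_opp. ring. }
assert (P1 := fun z Hz => eis_period_1 s z j Hs Hz Hj).
assert (Pi := fun z Hz => eis_period_i s z j Hs Hz Hj).
assert (A : forall (a : Z) z, offlat s z -> eis s j (z + lattice_point s a 0)%C = eis s j z).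
{ intros x w Hw. destruct (Z_le_gt_dec 0 x) as [Hx|Hx].
  - generalize (N (Z.to_nat x) 1%Z 0%Z w Hw P1). rewrite Z2Nat.id by lia.
    now rewrite Z.mul_1_r, Z.mul_0_r.
  - generalize (N (Z.to_nat (- x)) (-1)%Z 0%Z w Hw (Inv 1%Z 0%Z P1)). rewrite Z2Nat.id by lia.
    replace (- x * -1)%Z with x by ring. now rewrite Z.mul_0_r. }
assert (B : forall (a : Z) z, offlat s z -> eis s j (z + lattice_point s 0 a)%C = eis s j z).
{ intros x w Hw. destruct (Z_le_gt_dec 0 x) as [Hx|Hx].
  - generalize (N (Z.to_nat x) 0%Z 1%Z w Hw Pi). rewrite Z2Nat.id by lia.
    now rewrite Z.mul_1_r, Z.mul_0_r.
  - generalize (N (Z.to_nat (- x)) 0%Z (-1)%Z w Hw (Inv 0%Z 1%Z Pi)). rewrite Z2Nat.id by lia.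
    replace (- x * -1)%Z with x by ring. now rewrite Z.mul_0_r. }
replace (lattice_point s a b) with (lattice_point s a 0 + lattice_point s 0 b)%C.
2:{ rewrite <- lattice_point_add. f_equal; ring. }
rewrite Cplus_assoc, B, A; auto. apply offlat_shift; auto.
Qed.

Lemma corr_opp s j m n : corr s j (- m) (- n) = corr s j m n.
Proof.
unfold corr. replace (- m =? 0)%Z with (m =? 0)%Z by (destruct (Z.eqb_spec m 0), (Z.eqb_spec (- m) 0); auto; lia).
replace (- n =? 0)%Z with (n =? 0)%Z by (destruct (Z.eqb_spec n 0), (Z.eqb_spec (- n) 0); auto; lia).
destruct (_ && _)%bool; auto. rewrite lattice_point_opp. f_equal. ring.
Qed.
Lemma corr_conj s j m n : corr s j m (- n) = Cconj (corr s j m n).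
Proof.
assert (C0 : Cconj 0 = 0) by (unfold Cconj, RtoC; simpl; f_equal; ring).
unfold corr.
replace (- n =? 0)%Z with (n =? 0)%Z by (destruct (Z.eqb_spec n 0), (Z.eqb_spec (- n) 0); auto; lia).
destruct (_ && _)%bool; auto.
destruct (Ceq_dec (lattice_point s m n) 0) as [E|E].
- rewrite <- conj_lattice, E, C0. 
  assert (I0 : forall x : C, x = RtoC 0 -> Cconj (/ x)%C = (/ x)%C).
  { intros x ->. unfold Cinv, Cconj, RtoC; simpl. f_equal. unfold Rdiv. rewrite Ropp_0, !Rmult_0_l. ring. }
  symmetry. apply I0. ring.
- rewrite Cinv_conj by (apply Cmult_neq_0; auto). rewrite Cmult_conj, conj_lattice. reflexivity.
Qed.

Lemma eis2_even s z : 0 < s -> offlat s z -> eis s 2 (- z)%C = eis s 2 z.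
Proof.
intros Hs Hz. apply (Ccv_unique (sq (trm s 2 (- z)%C))).
apply offlat_cv; auto. apply offlat_opp; auto.
eapply Ccv_ext; [|apply (offlat_cv s z 2); auto]. intro k.
rewrite <- (sq_opp (trm s 2 z)). apply sq_ext. intros m n. unfold trm.
rewrite corr_opp, lattice_point_opp. f_equal. f_equal. simpl. ring.
Qed.
Lemma eis3_odd s z : 0 < s -> offlat s z -> eis s 3 (- z)%C = (- eis s 3 z)%C.
Proof.
intros Hs Hz. replace (- eis s 3 z)%C with (RtoC (-1) * eis s 3 z)%C by ring.
apply (Ccv_unique (sq (trm s 3 (- z)%C))).
apply offlat_cv; auto. apply offlat_opp; auto.
eapply Ccv_ext; [|apply Ccv_scal, (offlat_cv s z 3); auto]. intro k. cbv beta.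
rewrite <- (sq_opp (trm s 3 z)), <- sq_scal. apply sq_ext. intros m n. unfold trm.
rewrite !corr_ge3 by lia. rewrite lattice_point_opp.
assert (N : (- z - lattice_point s m n)%C <> 0).
{ intro E. apply (Hz (- m)%Z (- n)%Z). rewrite lattice_point_opp.
  transitivity (- (- z - lattice_point s m n) - lattice_point s m n)%C; [ring|]. rewrite E. ring. }
assert (N2 : (z - - lattice_point s m n)%C <> 0).
{ intro E. apply N. transitivity (- (z - - lattice_point s m n))%C; [ring|]. rewrite E. ring. }
replace (- z - lattice_point s m n)%C with (- (z - - lattice_point s m n))%C by ring.
field; auto.
Qed.
Lemma eis_conj s z j : 0 < s -> offlat s z -> (2 <= j)%nat -> eis s j (Cconj z) = Cconj (eis s j z).
Proof.
intros Hs Hz Hj. apply (Ccv_unique (sq (trm s j (Cconj z)))).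
apply offlat_cv; auto. apply offlat_conj; auto.
eapply Ccv_ext; [|apply Ccv_conj, (offlat_cv s z j); auto]. intro k. cbv beta.
unfold sq. rewrite <- zsum_conj. apply zsum_ext. intro m.
rewrite <- zsum_conj, <- (zsum_opp (trm s j (Cconj z) m)). apply zsum_ext. intro n. unfold trm.
rewrite corr_conj, <- conj_lattice, Cminus_conj, Cinv_conj, Cpow_conj, Cminus_conj. reflexivity.
apply Cpow_nz. intro E. apply (Hz m n).
transitivity (z - lattice_point s m n + lattice_point s m n)%C; [ring|]. rewrite E. ring.
Qed.

Lemma zsum_delta (a : C) k : zsum (fun m => if (m =? 0)%Z then a else RtoC 0) k = a.
Proof.
induction k; [reflexivity|]. cbn [zsum]. rewrite IHk.
destruct (Z.eqb_spec (Z.of_nat (S k)) 0); [lia|]. destruct (Z.eqb_spec (- Z.of_nat (S k)) 0); [lia|]. ring.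
Qed.
Lemma zsum_zero k : zsum (fun _ => RtoC 0) k = RtoC 0.
Proof. induction k; [reflexivity|]. cbn [zsum]. rewrite IHk. ring. Qed.
Lemma sq_delta (a : C) k : sq (fun m n => if ((m =? 0) && (n =? 0))%Z%bool then a else RtoC 0) k = a.
Proof.
unfold sq. transitivity (zsum (fun m => if (m =? 0)%Z then a else RtoC 0) k); [|apply zsum_delta].
apply zsum_ext. intro m. destruct (m =? 0)%Z; simpl. apply zsum_delta. apply zsum_zero.
Qed.

Lemma lattice_00 s : lattice_point s 0 0 = RtoC 0.
Proof. unfold lattice_point, RtoC. f_equal. ring. Qed.

(** The terms without the one of index [(0,0)], which is the pole in the centred cell. *)
Definition trm0 (s : R) (j : nat) (z : C) (m n : Z) : C :=
  if ((m =? 0) && (n =? 0))%Z%bool then RtoC 0 else trm s j z m n.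

Lemma trm_split s j z k : sq (trm s j z) k = (/ z ^ j + sq (trm0 s j z) k)%C.
Proof.
rewrite <- (sq_delta (/ z ^ j)%C k) at 1. rewrite <- sq_plus. apply sq_ext. intros m n. unfold trm0.
destruct (Z.eqb_spec m 0), (Z.eqb_spec n 0); simpl; try ring.
subst. unfold trm. rewrite corr_0, lattice_00. replace (z - 0)%C with z by ring. ring.
Qed.

(** The square sums defining [wp] are the same sums, except that the term [1 / z^2]
    stands outside. *)
Lemma wp_eis s z : 0 < s -> offlat s z -> wp s z = eis s 2 z.
Proof.
intros Hs Hz. unfold wp. fold (Clim (wp_partial_sum s z)).
assert (E : forall k, wp_partial_sum s z k = sq (trm0 s 2 z) k).
{ intro k. unfold wp_partial_sum.
  rewrite (zsum_sum_n (fun m => sum_n (G := C_AbelianMonoid) (fun j => wp_term s z m (Z.of_nat j - Z.of_nat k)) (2 * k)) k).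
  apply zsum_ext. intro m. rewrite (zsum_sum_n (wp_term s z m) k). apply zsum_ext. intro n.
  unfold wp_term, trm0. destruct (Z.eqb_spec m 0), (Z.eqb_spec n 0); simpl; auto;
   unfold trm; rewrite corr_2 by auto; f_equal; f_equal; simpl; ring. }
assert (C1 := offlat_cv s z 2 Hs Hz (le_n 2)).
assert (C2 : Ccv (wp_partial_sum s z) (eis s 2 z - / z ^ 2)%C).
{ eapply Ccv_ext. 2: apply (Ccv_plus _ _ _ _ C1 (Ccv_const (- / z ^ 2)%C)).
  intro k. rewrite E, trm_split. ring. }
rewrite (Clim_eq _ _ C2). replace (z ^ 2)%C with (z * z)%C by (simpl; ring). ring.
Qed.

(** * Behaviour at the pole, uniformly in the centred cell *)

Definition incell (s : R) (z : C) : Prop := Rabs (fst z) <= s / 2 /\ Rabs (snd z) <= / 2.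
Lemma incell_mod s z : incell s z -> Cmod z <= s / 2 + / 2.
Proof. intros [H1 H2]. eapply Rle_trans. apply Cmod_le_sum. lra. Qed.
Lemma incell_offlat s z : 0 < s -> incell s z -> z <> 0 -> offlat s z.
Proof.
intros Hs [H1 H2] Hz m n E.
destruct (Z.eq_dec m 0) as [Em|Em]; [destruct (Z.eq_dec n 0) as [En|En]|].
- subst m n. rewrite lattice_00 in E. auto.
- assert (L := cell_sep s z m n Hs H1 H2 (or_intror En)). rewrite E in L.
  replace (lattice_point s m n - lattice_point s m n)%C with (RtoC 0) in L by ring. rewrite Cmod_0 in L.
  destruct (c0_pos s Hs) as [H0 _]. generalize (nm_ge1 m n). nra.
- assert (L := cell_sep s z m n Hs H1 H2 (or_introl Em)). rewrite E in L.
  replace (lattice_point s m n - lattice_point s m n)%C with (RtoC 0) in L by ring. rewrite Cmod_0 in L.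
  destruct (c0_pos s Hs) as [H0 _]. generalize (nm_ge1 m n). nra.
Qed.

Lemma trm0_nz s j z m n : (m <> 0%Z \/ n <> 0%Z) -> trm0 s j z m n = trm s j z m n.
Proof. intro H. unfold trm0. destruct (Z.eqb_spec m 0), (Z.eqb_spec n 0); simpl; auto. lia. Qed.
Lemma trm0_00 s j z : trm0 s j z 0 0 = RtoC 0.
Proof. reflexivity. Qed.

Lemma eis_cell_cv s z j : 0 < s -> incell s z -> z <> 0 -> (2 <= j)%nat ->
  Ccv (sq (trm0 s j z)) (eis s j z - / z ^ j)%C.
Proof.
intros Hs Hc Hz Hj. assert (C1 := offlat_cv s z j Hs (incell_offlat s z Hs Hc Hz) Hj).
eapply Ccv_ext. 2: apply (Ccv_plus _ _ _ _ C1 (Ccv_const (- / z ^ j)%C)).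
intro k. cbv beta. rewrite trm_split. ring.
Qed.

Lemma eis_cell_bound s j : 0 < s -> (3 <= j)%nat -> exists M, 0 <= M /\
  forall z, incell s z -> z <> 0 -> Cmod (eis s j z - / z ^ j)%C <= M.
Proof.
intros Hs Hj. destruct (c0_pos s Hs) as [H0 _].
assert (Hi : 0 <= (/ c0 s) ^ j) by (apply pow_le, Rlt_le, Rinv_0_lt_compat; auto).
exists (9 * (/ c0 s) ^ j). split; [lra|]. intros z Hc Hz.
apply (Ccv_bound _ _ _ (eis_cell_cv s z j Hs Hc Hz ltac:(lia))). intro k. apply sq_bound; auto.
intros m n. assert (Hn := nm_ge1 m n).
assert (Hp : 0 <= (/ c0 s) ^ j / nm m n ^ 3) by (apply Rdiv_le_0_compat; [auto|apply pow_lt; lra]).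
assert (G : (m <> 0%Z \/ n <> 0%Z) -> Cmod (trm0 s j z m n) <= (/ c0 s) ^ j / nm m n ^ 3).
{ intro Hmn. rewrite trm0_nz by auto. unfold trm. rewrite corr_ge3 by auto.
  replace (/ (z - lattice_point s m n) ^ j - 0)%C with (/ (z - lattice_point s m n) ^ j)%C by ring.
  apply inv_pow_bound; auto. apply cell_sep; auto; apply Hc. }
destruct (Z.eq_dec m 0) as [Em|Em]; [destruct (Z.eq_dec n 0) as [En|En]|]; auto.
subst. rewrite trm0_00, Cmod_0. auto.
Qed.

(** The corrections make each remaining term of order [|z|], and the terms of index [w]
    and [-w] together of order [|z|^2]. *)
Lemma eis2_cell_bound s : 0 < s -> exists M, 0 <= M /\
  forall z, incell s z -> z <> 0 -> Cmod (eis s 2 z - / z ^ 2)%C <= M * Cmod z ^ 2.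
Proof.
intros Hs. destruct (c0_pos s Hs) as [H0 _]. set (r := s / 2 + / 2). assert (Hr : 0 < r) by (unfold r; lra).
set (M := 3 / c0 s ^ 4 + r ^ 2 / c0 s ^ 6).
assert (HM : 0 <= M).
{ unfold M. apply Rplus_le_le_0_compat; apply Rdiv_le_0_compat; try lra; try apply pow_lt; auto. apply pow2_ge_0. }
exists (9 * M). split; [lra|]. intros z Hc Hz.
assert (Hzr := incell_mod s z Hc). fold r in Hzr. assert (Hz0 := Cmod_ge_0 z).
assert (C1 := eis_cell_cv s z 2 Hs Hc Hz (le_n 2)).
assert (C2 : Ccv (sq (fun m n => / 2 * (trm0 s 2 z m n + trm0 s 2 z (- m) (- n)))%C) (eis s 2 z - / z ^ 2)%C).
{ eapply Ccv_ext; [|apply C1]. intro k. rewrite sq_scal, sq_plus.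
  rewrite (sq_opp (trm0 s 2 z)). field. }
apply (Ccv_bound _ _ _ C2). intro k.
replace (9 * M * Cmod z ^ 2) with (9 * (M * Cmod z ^ 2)) by ring.
assert (HMz : 0 <= M * Cmod z ^ 2) by (apply Rmult_le_pos; [auto|apply pow2_ge_0]).
apply sq_bound; auto. intros m n. assert (Hn := nm_ge1 m n).
assert (G : (m <> 0%Z \/ n <> 0%Z) ->
  Cmod (/ 2 * (trm0 s 2 z m n + trm0 s 2 z (- m) (- n)))%C <= M * Cmod z ^ 2 / nm m n ^ 3).
{ intro Hmn. assert (Hmn' : (- m <> 0)%Z \/ (- n <> 0)%Z) by lia. rewrite !trm0_nz by auto. unfold trm.
  rewrite corr_opp, corr_2 by auto.
  assert (L1 := cell_sep s z m n Hs (proj1 Hc) (proj2 Hc) Hmn).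
  assert (L2 := cell_sep s z (- m) (- n) Hs (proj1 Hc) (proj2 Hc) Hmn').
  assert (L3 := lattice_lower s m n Hs Hmn).
  replace (nm (- m) (- n)) with (nm m n) in L2 by (unfold nm; rewrite !opp_IZR, !Rabs_Ropp; auto).
  rewrite lattice_point_opp in *. set (w := lattice_point s m n) in *. set (N := nm m n) in *.
  replace (z - - w)%C with (z + w)%C in * by ring.
  set (c := c0 s) in *.
  assert (HcN : 0 < c * N) by (apply Rmult_lt_0_compat; lra).
  assert (N1 : (z - w)%C <> 0) by (apply Cmod_neq0; lra).
  assert (N2 : (z + w)%C <> 0) by (apply Cmod_neq0; lra).
  assert (N3 : w <> 0) by (apply Cmod_neq0; lra).
  
  replace (/ 2 * (/ (z - w) ^ 2 - / (w * w) + (/ (z + w) ^ 2 - / (w * w))))%C with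
   (z ^ 2 * (3 * / ((z - w) * (z - w) * ((z + w) * (z + w))) + - z ^ 2 * / ((z - w) * (z - w) * ((z + w) * (z + w)) * (w * w))))%C
   by (field; auto).
  assert (F : (c * N) * (c * N) * ((c * N) * (c * N)) <= Cmod ((z - w) * (z - w) * ((z + w) * (z + w)))%C).
  { rewrite !Cmod_mult. apply Rmult_le_compat; try nra; apply Rmult_le_compat; lra. }
  assert (Fw : (c * N) * (c * N) <= Cmod (w * w)%C) by (rewrite Cmod_mult; apply Rmult_le_compat; lra).
  assert (Hp2 : 0 < (c * N) * (c * N)) by (apply Rmult_lt_0_compat; auto).
  assert (Hp4 : 0 < (c * N) * (c * N) * ((c * N) * (c * N))) by (apply Rmult_lt_0_compat; auto).
  assert (Nz1 : ((z - w) * (z - w) * ((z + w) * (z + w)))%C <> 0) by (repeat apply Cmult_neq_0; auto).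
  assert (Nz2 : ((z - w) * (z - w) * ((z + w) * (z + w)) * (w * w))%C <> 0) by (repeat apply Cmult_neq_0; auto).
  assert (I1 : Cmod (/ ((z - w) * (z - w) * ((z + w) * (z + w))))%C <= / c ^ 4 * / N ^ 3).
  { rewrite Cmod_inv by auto. apply Rle_trans with (/ ((c * N) * (c * N) * ((c * N) * (c * N)))).
    apply Rinv_le_contravar; auto.
    replace (/ (c * N * (c * N) * (c * N * (c * N)))) with (/ c ^ 4 * (/ N ^ 3 * / N)) by (field; lra).
    apply Rmult_le_compat_l. apply Rlt_le, Rinv_0_lt_compat, pow_lt; auto.
    rewrite <- (Rmult_1_r (/ N ^ 3)) at 2. apply Rmult_le_compat_l.
    apply Rlt_le, Rinv_0_lt_compat, pow_lt; lra. rewrite <- Rinv_1. apply Rinv_le_contravar; lra. }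
  assert (I2 : Cmod (/ ((z - w) * (z - w) * ((z + w) * (z + w)) * (w * w)))%C <= / c ^ 6 * / N ^ 3).
  { rewrite Cmod_inv by auto. rewrite Cmod_mult.
    apply Rle_trans with (/ ((c * N) * (c * N) * ((c * N) * (c * N)) * ((c * N) * (c * N)))).
    apply Rinv_le_contravar. apply Rmult_lt_0_compat; auto. apply Rmult_le_compat; lra.
    replace (/ (c * N * (c * N) * (c * N * (c * N)) * (c * N * (c * N)))) with (/ c ^ 6 * (/ N ^ 3 * / N ^ 3)) by (field; lra).
    apply Rmult_le_compat_l. apply Rlt_le, Rinv_0_lt_compat, pow_lt; auto.
    rewrite <- (Rmult_1_r (/ N ^ 3)) at 3. apply Rmult_le_compat_l.
    apply Rlt_le, Rinv_0_lt_compat, pow_lt; lra. rewrite <- Rinv_1. apply Rinv_le_contravar. lra.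
    apply pow_R1_Rle; lra. }
  rewrite Cmod_mult, Cmod_pow.
  replace (M * Cmod z ^ 2 / N ^ 3) with (Cmod z ^ 2 * (3 * (/ c ^ 4 * / N ^ 3) + r ^ 2 * (/ c ^ 6 * / N ^ 3)))
    by (unfold M; field; split; lra).
  apply Rmult_le_compat_l. apply pow2_ge_0.
  eapply Rle_trans. apply Cmod_triangle. rewrite !Cmod_mult, Cmod_opp, Cmod_pow, Cmod_R, (Rabs_pos_eq 3) by lra.
  apply Rplus_le_compat. lra. apply Rmult_le_compat; auto. apply pow2_ge_0. apply Cmod_ge_0.
  apply pow_incr; lra. }
destruct (Z.eq_dec m 0) as [Em|Em]; [destruct (Z.eq_dec n 0) as [En|En]|]; auto.
subst. change (- 0)%Z with 0%Z. rewrite trm0_00. replace (/ 2 * (0 + 0))%C with (RtoC 0) by ring. rewrite Cmod_0.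
apply Rdiv_le_0_compat; auto. apply pow_lt; lra.
Qed.

(** * Liouville's theorem *)

(** Three derivatives, since the real and imaginary parts have to satisfy [reg2]. *)
Set Implicit Arguments.
Record holo (a : R) (f f1 f2 f3 : C -> C) : Prop := {
  holo_1 : forall x y, ns a x y -> cder f (x, y) (f1 (x, y));
  holo_2 : forall x y, ns a x y -> cder f1 (x, y) (f2 (x, y));
  holo_3 : forall x y, ns a x y -> cder f2 (x, y) (f3 (x, y));
  holo_per : forall x y, ns a x y -> f (x, y + 1) = f (x, y) }.
Unset Implicit Arguments.
Arguments holo_1 {a f f1 f2 f3} _.
Arguments holo_2 {a f f1 f2 f3} _.
Arguments holo_3 {a f f1 f2 f3} _.
Arguments holo_per {a f f1 f2 f3} _.

Lemma holo_reg2 a f f1 f2 f3 : holo a f f1 f2 f3 ->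
  reg2 a (fun x y => fst (f (x, y))) (fun x y => fst (f1 (x, y))) (fun x y => - snd (f1 (x, y)))
    (fun x y => fst (f2 (x, y))) (fun x y => - fst (f2 (x, y))) /\
  reg2 a (fun x y => snd (f (x, y))) (fun x y => snd (f1 (x, y))) (fun x y => fst (f1 (x, y)))
    (fun x y => snd (f2 (x, y))) (fun x y => - snd (f2 (x, y))).
Proof.
intro H. split; constructor; intros x y Hn;
 destruct (cder_partials (holo_1 H x y Hn)) as [A1 [A2 [A3 A4]]];
 destruct (cder_partials (holo_2 H x y Hn)) as [B1 [B2 [B3 B4]]];
 destruct (cder_c2d (holo_1 H x y Hn)) as [K1 K2];
 destruct (cder_c2d (holo_2 H x y Hn)) as [L1 L2];
 destruct (cder_c2d (holo_3 H x y Hn)) as [M1 M2];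
 try assumption; try (apply continuity_2d_pt_opp; assumption).
- apply (D_opp (fun t => snd (f1 (x, t)))). exact B4.
- rewrite (holo_per H); auto.
- rewrite (holo_per H); auto.
Qed.

Lemma weighted_of_harmonic a u ux uy uxx B : 0 < a ->
  reg2 a u ux uy uxx (fun x y => - uxx x y) -> (forall x y, ns a x y -> Rabs (u x y) <= B) ->
  weighted_solution a (fun _ => 1) (fun _ => 0) (fun _ _ => 0) 1 1 0 B u ux uy uxx (fun x y => - uxx x y).
Proof.
intros Ha Hr Hb. constructor; auto; try lra.
- intro. apply D_const.
- intro. apply C_const.
- intro; lra.
- intros. apply continuity_2d_pt_const.
- intros; lra.
- intros; ring.
Qed.

Lemma bounded_harmonic_dx a u ux uy uxx B : 0 < a ->
  reg2 a u ux uy uxx (fun x y => - uxx x y) -> (forall x y, ns a x y -> Rabs (u x y) <= B) ->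
  forall x y, sin (a * x) <> 0 -> 0 < y < 1 -> ux x y = 0.
Proof.
intros Ha Hr Hb.
apply (energy_main a _ _ _ 1 1 0 B u ux uy uxx _ (weighted_of_harmonic a u ux uy uxx B Ha Hr Hb)).
intros x Hx. apply RInt_ge_0; [lra| |].
- apply ex_RInt_C. intro y. apply C_minus.
  + apply C_pow2. apply (c2d_slice_y uy), (reg_cy Hr), ns_of_sin; auto.
  + apply (continuous_ext (fun _ => 0)). intro; eqR; ring. apply C_const.
- intros y _. generalize (pow2_ge_0 (uy x y)). lra.
Qed.

(** Real and imaginary parts do not depend on [x], and by Cauchy-Riemann not on [y]. *)
Lemma holo_constant a f f1 f2 f3 : 0 < a -> holo a f f1 f2 f3 ->
  (forall x y, sin (a * x) <> 0 -> 0 < y < 1 -> f1 (x, y) = RtoC 0) ->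
  exists k, forall x y, ns a x y -> f (x, y) = k.
Proof.
intros Ha H Hz. destruct (holo_reg2 a f f1 f2 f3 H) as [R1 R2].
destruct (sin_nonzero_dense a 0 1 Ha Rlt_0_1) as [x0 [_ Hs0]].
assert (Hns0 : forall y, ns a x0 y) by (intro; apply ns_of_sin; auto).
assert (Z1 : forall x y, sin (a * x) <> 0 -> 0 < y < 1 -> fst (f1 (x, y)) = 0) by (intros; rewrite Hz; auto).
assert (Z2 : forall x y, sin (a * x) <> 0 -> 0 < y < 1 -> snd (f1 (x, y)) = 0) by (intros; rewrite Hz; auto).
assert (I1 := independent_of_x a _ _ _ _ _ x0 Ha R1 Z1 Hs0).
assert (I2 := independent_of_x a _ _ _ _ _ x0 Ha R2 Z2 Hs0).
assert (E1 := dx_zero_of_independent a _ _ _ _ _ x0 R1 Hs0 I1).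
assert (E2 := dx_zero_of_independent a _ _ _ _ _ x0 R2 Hs0 I2).
cbv beta in *.
exists (f (x0, 0)). intros x y Hn.
assert (Y1 : fst (f (x0, y)) = fst (f (x0, 0))).
{ apply (constant_of_derive_zero (fun y => fst (f (x0, y)))). intro t.
  assert (D := reg_dy R1 x0 t (Hns0 t)). cbv beta in D. rewrite E2, Ropp_0 in D. exact D. }
assert (Y2 : snd (f (x0, y)) = snd (f (x0, 0))).
{ apply (constant_of_derive_zero (fun y => snd (f (x0, y)))). intro t.
  assert (D := reg_dy R2 x0 t (Hns0 t)). cbv beta in D. rewrite E1 in D. exact D. }
rewrite (surjective_pairing (f (x, y))), (I1 x y Hn), (I2 x y Hn), Y1, Y2.
symmetry; apply surjective_pairing.
Qed.

(** Real and imaginary parts are bounded harmonic functions, to which the energy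
    argument applies with weight 1 and potential 0.  A bounded function is thus
    constant whatever its singularities at the half-lattice. *)
Lemma liouville a f f1 f2 f3 B : 0 < a -> holo a f f1 f2 f3 ->
  (forall x y, ns a x y -> Cmod (f (x, y)) <= B) ->
  exists k, forall x y, ns a x y -> f (x, y) = k.
Proof.
intros Ha H Hb. destruct (holo_reg2 a f f1 f2 f3 H) as [R1 R2].
apply (holo_constant a f f1 f2 f3 Ha H). intros x y Hx Hy.
assert (b1 : forall x y, ns a x y -> Rabs (fst (f (x, y))) <= B).
{ intros u v Hn. eapply Rle_trans; [apply Cmod_fst|auto]. }
assert (b2 : forall x y, ns a x y -> Rabs (snd (f (x, y))) <= B).
{ intros u v Hn. eapply Rle_trans; [apply Cmod_snd|auto]. }
assert (Z1 := bounded_harmonic_dx a _ _ _ _ B Ha R1 b1 x y Hx Hy).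
assert (Z2 := bounded_harmonic_dx a _ _ _ _ B Ha R2 b2 x y Hx Hy).
cbv beta in *. rewrite (surjective_pairing (f1 (x, y))), Z1, Z2. reflexivity.
Qed.

(** The sum of squares of the data satisfies [|N'| <= C N], so [N exp (- C x)] and [N
    exp (C x)] are monotone. *)
Lemma ode_zero (U V U1 V1 U2 V2 : R -> R) (al be x0 A : R) :
  al <= x0 <= be ->
  (forall x, al <= x <= be -> is_derive U x (U1 x) /\ is_derive V x (V1 x) /\
     is_derive U1 x (U2 x) /\ is_derive V1 x (V2 x)) ->
  (forall x, al <= x <= be -> U2 x ^ 2 + V2 x ^ 2 <= A * (U x ^ 2 + V x ^ 2)) -> 0 <= A ->
  U x0 = 0 -> V x0 = 0 -> U1 x0 = 0 -> V1 x0 = 0 ->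
  forall x, al <= x <= be -> U x = 0 /\ V x = 0 /\ U1 x = 0 /\ V1 x = 0.
Proof.
intros Hx0 HD HA HA0 E1 E2 E3 E4.
set (N := fun x => (U x ^ 2 + V x ^ 2) + (U1 x ^ 2 + V1 x ^ 2)).
set (N' := fun x => (2 * U x * U1 x + 2 * V x * V1 x) + (2 * U1 x * U2 x + 2 * V1 x * V2 x)).
set (C := 2 + A).
assert (DN : forall x, al <= x <= be -> is_derive N x (N' x)).
{ intros x Hx. destruct (HD x Hx) as [D1 [D2 [D3 D4]]].
  apply D_plus; apply D_plus; apply D_pow2; auto. }
assert (BN : forall x, al <= x <= be -> Rabs (N' x) <= C * N x).
{ intros x Hx. specialize (HA x Hx). unfold N', N, C.
  set (u := U x) in *. set (v := V x) in *. set (u1 := U1 x). set (v1 := V1 x). set (u2 := U2 x) in *. set (v2 := V2 x) in *.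
  generalize (pow2_ge_0 (u - u1)) (pow2_ge_0 (u + u1)) (pow2_ge_0 (v - v1)) (pow2_ge_0 (v + v1))
   (pow2_ge_0 (u1 - u2)) (pow2_ge_0 (u1 + u2)) (pow2_ge_0 (v1 - v2)) (pow2_ge_0 (v1 + v2))
   (pow2_ge_0 u) (pow2_ge_0 v) (pow2_ge_0 u1) (pow2_ge_0 v1). intros.
  assert (0 <= A * (u1 ^ 2 + v1 ^ 2)) by (apply Rmult_le_pos; lra).
  apply Rabs_le. split; nra. }
assert (N0 : forall x, 0 <= N x).
{ intro x. unfold N. generalize (pow2_ge_0 (U x)) (pow2_ge_0 (V x)) (pow2_ge_0 (U1 x)) (pow2_ge_0 (V1 x)). lra. }
assert (Nx0 : N x0 = 0) by (unfold N; rewrite E1, E2, E3, E4; ring).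
assert (NZ : forall x, al <= x <= be -> N x = 0).
{ intros x Hx. destruct (Rle_dec x0 x) as [Hle|Hle].
  - assert (G := increment_ge (fun t => - (N t * exp (- C * t))) (fun t => - (N' t * exp (- C * t) + N t * (- C * exp (- C * t)))) 0 x0 x Hle).
    assert (0 * (x - x0) <= - (N x * exp (- C * x)) - - (N x0 * exp (- C * x0))).
    { apply G.
      - intros t Ht. apply D_opp. apply (D_mult N (fun t => exp (- C * t))). apply DN; lra. auto_derive; auto; ring.
      - intros t Ht. specialize (BN t ltac:(lra)). apply Rabs_le_between in BN. generalize (exp_pos (- C * t)). nra. }
    rewrite Nx0 in H. generalize (exp_pos (- C * x)) (N0 x). nra.
  - assert (G := increment_ge (fun t => N t * exp (C * t)) (fun t => N' t * exp (C * t) + N t * (C * exp (C * t))) 0 x x0 ltac:(lra)).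
    assert (0 * (x0 - x) <= N x0 * exp (C * x0) - N x * exp (C * x)).
    { apply G.
      - intros t Ht. apply (D_mult N (fun t => exp (C * t))). apply DN; lra. auto_derive; auto; ring.
      - intros t Ht. specialize (BN t ltac:(lra)). apply Rabs_le_between in BN. generalize (exp_pos (C * t)). nra. }
    rewrite Nx0 in H. generalize (exp_pos (C * x)) (N0 x). nra. }
intros x Hx. specialize (NZ x Hx). unfold N in NZ.
generalize (pow2_ge_0 (U x)) (pow2_ge_0 (V x)) (pow2_ge_0 (U1 x)) (pow2_ge_0 (V1 x)). intros.
assert (S : forall t, t ^ 2 = 0 -> t = 0) by (intros; nra).
repeat split; apply S; lra.
Qed.

(** * The differential equation of the Weierstrass function *)

Definition om (s : R) : C := (s / 2, 1 / 2).
(** The frequency for which [rho] vanishes on the half-lattice. *)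
Definition fr (s : R) : R := 2 * PI / s.
(** Neither a pole nor a zero of the Gauss map.  This domain is larger than the set of
    regular points [ns], which also omits the two other half periods. *)
Definition dm (s : R) (z : C) : Prop := offlat s z /\ offlat s (z + om s)%C.

Lemma fr_pos s : 0 < s -> 0 < fr s.
Proof. intro H. unfold fr. apply Rdiv_lt_0_compat; [generalize PI_RGT_0; lra|auto]. Qed.

Lemma sin_half_lattice (s : R) (m n : Z) (x y : R) : 0 < s ->
  (x = s * IZR m \/ x = s * IZR m - s / 2) -> (y = IZR n \/ y = IZR n - 1 / 2) ->
  rho (fr s) x y = 0.
Proof.
intros Hs Hx Hy.
assert (Hz0 : forall k : Z, sin (2 * PI * IZR k) = 0).
{ intro k. generalize (sin2PI_perZ 0 k). rewrite Rplus_0_l, Rmult_0_r, sin_0. auto. }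
assert (Hz2 : forall k : Z, sin (2 * PI * IZR k - PI) = 0).
{ intro k. rewrite sin_minus, Hz0, sin_PI. ring. }
unfold rho.
assert (E1 : sin (fr s * x) = 0).
{ destruct Hx as [-> | ->].
  - replace (fr s * (s * IZR m)) with (2 * PI * IZR m) by (unfold fr; field; lra). apply Hz0.
  - replace (fr s * (s * IZR m - s / 2)) with (2 * PI * IZR m - PI) by (unfold fr; field; lra). apply Hz2. }
assert (E2 : sin (2 * PI * y) = 0).
{ destruct Hy as [-> | ->].
  - apply Hz0.
  - replace (2 * PI * (IZR n - 1 / 2)) with (2 * PI * IZR n - PI) by field. apply Hz2. }
rewrite E1, E2. ring.
Qed.

Lemma ns_dm s x y : 0 < s -> ns (fr s) x y -> dm s (x, y).
Proof.
intros Hs H. split; intros m n E; unfold ns in H.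
- unfold lattice_point in E. injection E as Ex Ey. rewrite (sin_half_lattice s m n x y) in H; auto. lra.
- unfold lattice_point, om, Cplus in E; simpl in E. injection E as Ex Ey.
  rewrite (sin_half_lattice s m n x y) in H; auto. lra. right; lra. right; lra.
Qed.

Lemma dm_opp s z : dm s z -> dm s (- z)%C.
Proof.
intros [H1 H2]. split. apply offlat_opp; auto.
intros m n E. apply (H2 (1 - m)%Z (1 - n)%Z). 
replace (1 - m)%Z with (1 + - m)%Z by ring. replace (1 - n)%Z with (1 + - n)%Z by ring.
rewrite lattice_point_add, lattice_point_opp, <- E.
unfold lattice_point, om, Cplus, Copp; destruct z; simpl. f_equal; field.
Qed.
Lemma dm_shift s z a b : dm s z -> dm s (z + lattice_point s a b)%C.
Proof.
intros [H1 H2]. split. apply offlat_shift; auto.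
replace (z + lattice_point s a b + om s)%C with (z + om s + lattice_point s a b)%C by ring.
apply offlat_shift; auto.
Qed.
Lemma two_om s : (om s + om s)%C = lattice_point s 1 1.
Proof. unfold om, lattice_point, Cplus; simpl. f_equal; field. Qed.
Lemma dm_om s z : dm s z -> dm s (z + om s)%C.
Proof.
intros [H1 H2]. split; auto.
replace (z + om s + om s)%C with (z + lattice_point s 1 1)%C by (rewrite <- two_om; ring).
apply offlat_shift; auto.
Qed.

Lemma offlat_y s x y : (forall n : Z, y <> IZR n) -> offlat s (x, y).
Proof. intros H m n E. injection E as _ Ey. apply (H n Ey). Qed.
Lemma offlat_x s x y : (forall m : Z, x <> s * IZR m) -> offlat s (x, y).
Proof. intros H m n E. injection E as Ex _. apply (H m Ex). Qed.
Lemma not_int_between (t : R) : 0 < t < 1 -> forall n : Z, t <> IZR n.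
Proof.
intros Ht n E. subst. destruct Ht as [H1 H2].
apply lt_IZR in H1. apply lt_IZR in H2. lia.
Qed.

(** Identities proved at the regular points extend to the other half periods by
    continuity. *)
Lemma ext_ns (a : R) (F : C -> C) (k : C) (x y : R) : 0 < a -> (exists l, cder F (x, y) l) ->
  (forall u v, ns a u v -> F (u, v) = k) -> F (x, y) = k.
Proof.
intros Ha [l Hl] H. destruct (cder_c2d Hl) as [C1 C2].
assert (E1 : fst (F (x, y)) = fst k).
{ apply (cont_eq_of_dense (fun t => fst (F (t, y))) (fun _ => fst k)).
  apply (c2d_slice_x _ _ _ C1). apply C_const.
  intros d Hd. destruct (sin_nonzero_dense a x d Ha Hd) as [t [Ht Hs]]. exists t. split; auto.
  rewrite H; auto. apply ns_of_sin; auto. }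
assert (E2 : snd (F (x, y)) = snd k).
{ apply (cont_eq_of_dense (fun t => snd (F (t, y))) (fun _ => snd k)).
  apply (c2d_slice_x _ _ _ C2). apply C_const.
  intros d Hd. destruct (sin_nonzero_dense a x d Ha Hd) as [t [Ht Hs]]. exists t. split; auto.
  rewrite H; auto. apply ns_of_sin; auto. }
rewrite (surjective_pairing (F (x, y))), E1, E2. symmetry. apply surjective_pairing.
Qed.

Lemma step_i (x y : R) s : (x, y + 1) = ((x, y) + lattice_point s 0 1)%C.
Proof. unfold lattice_point, Cplus; simpl. f_equal; ring. Qed.

Lemma D_eis s j z : 0 < s -> offlat s z -> (2 <= j)%nat -> cder (eis s j) z (RtoC (- INR j) * eis s (S j) z)%C.
Proof.
intros Hs Hz Hj. eapply cder_eq. apply cder_eis; auto. rewrite RtoC_opp. reflexivity.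
Qed.

Lemma om_offlat s : 0 < s -> offlat s (om s).
Proof. intro Hs. apply offlat_y. apply not_int_between. lra. Qed.
Lemma eis_om_shift s z j : 0 < s -> offlat s z -> (2 <= j)%nat -> eis s j (z + om s + om s)%C = eis s j z.
Proof.
intros Hs Hz Hj. replace (z + om s + om s)%C with (z + lattice_point s 1 1)%C by (rewrite <- two_om; ring).
apply eis_period; auto.
Qed.

Lemma eis3_om s : 0 < s -> eis s 3 (om s) = RtoC 0.
Proof.
intro Hs. assert (H := eis3_odd s (om s) Hs (om_offlat s Hs)).
rewrite <- (eis_om_shift s (- om s)%C 3) in H; auto. 2: apply offlat_opp, om_offlat; auto.
replace (- om s + om s + om s)%C with (om s) in H by ring.
assert (E : (eis s 3 (om s) + eis s 3 (om s))%C = RtoC 0) by (rewrite H at 1; ring).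
transitivity ((eis s 3 (om s) + eis s 3 (om s)) / 2)%C; [field|]. rewrite E. field.
Qed.

(** The combination [wp'' - 6 wp^2] in terms of Eisenstein series. *)
Definition Phi (s : R) (z : C) : C := (6 * eis s 4 z - 6 * (eis s 2 z * eis s 2 z))%C.

(** The principal parts [6 / z^4] cancel, and the product of [1 / z^2] with the
    remainder of [eis s 2] is bounded by [eis2_cell_bound]. *)
Lemma Phi_bounded s : 0 < s -> exists B, forall z, offlat s z -> Cmod (Phi s z) <= B.
Proof.
intro Hs. destruct (eis2_cell_bound s Hs) as [M2 [HM2 H2]].
destruct (eis_cell_bound s 4 Hs ltac:(lia)) as [M4 [HM4 H4]].
set (r := s / 2 + / 2). assert (Hr : 0 < r) by (unfold r; lra).
exists (6 * M4 + 12 * M2 + 6 * (M2 * r ^ 2) ^ 2). intros z Hz.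
destruct (reduce_cell s z Hs) as [a [b Hab]]. fold (incell s (z - lattice_point s a b)%C) in Hab.
set (z0 := (z - lattice_point s a b)%C) in *.
assert (Ez : z = (z0 + lattice_point s a b)%C) by (unfold z0; ring).
assert (Hz0 : z0 <> 0).
{ intro E. apply (Hz a b). rewrite Ez, E. ring. }
assert (Ho := incell_offlat s z0 Hs Hab Hz0).
unfold Phi. rewrite Ez, !eis_period; auto.
specialize (H2 z0 Hab Hz0). specialize (H4 z0 Hab Hz0).
assert (Hzr := incell_mod s z0 Hab). fold r in Hzr. assert (Hzp : 0 < Cmod z0) by (apply Cmod_gt_0; auto).
set (R2 := (eis s 2 z0 - / z0 ^ 2)%C) in *. set (R4 := (eis s 4 z0 - / z0 ^ 4)%C) in *.
replace (6 * eis s 4 z0 - 6 * (eis s 2 z0 * eis s 2 z0))%C with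
  (6 * R4 - (12 * (R2 * / z0 ^ 2) + 6 * (R2 * R2)))%C.
2:{ unfold R2, R4. field. auto. }
eapply Rle_trans. apply Cmod_triangle_minus'.
eapply Rle_trans. apply Rplus_le_compat_l. apply Cmod_triangle.
rewrite !Cmod_mult, !Cmod_R, (Rabs_pos_eq 6), (Rabs_pos_eq 12) by lra.
rewrite Cmod_inv by (apply Cpow_nz; auto). rewrite Cmod_pow.
assert (T1 : Cmod R2 * / Cmod z0 ^ 2 <= M2).
{ apply Rmult_le_reg_r with (Cmod z0 ^ 2). apply pow_lt; auto. rewrite Rmult_assoc, Rinv_l by (apply pow_nonzero; lra). lra. }
assert (T2 : Cmod R2 <= M2 * r ^ 2).
{ eapply Rle_trans; [apply H2|]. apply Rmult_le_compat_l; auto. apply pow_incr; lra. }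
assert (T3 : Cmod R2 * Cmod R2 <= (M2 * r ^ 2) ^ 2).
{ replace ((M2 * r ^ 2) ^ 2) with ((M2 * r ^ 2) * (M2 * r ^ 2)) by ring.
  apply Rmult_le_compat; auto; apply Cmod_ge_0. }
lra.
Qed.

Lemma holo_Phi s : 0 < s -> holo (fr s) (Phi s)
  (fun z => - 24 * eis s 5 z + 24 * (eis s 2 z * eis s 3 z))%C
  (fun z => 120 * eis s 6 z - 48 * (eis s 3 z * eis s 3 z) - 72 * (eis s 2 z * eis s 4 z))%C
  (fun z => - 720 * eis s 7 z + 432 * (eis s 3 z * eis s 4 z) + 288 * (eis s 2 z * eis s 5 z))%C.
Proof.
intro Hs.
constructor; intros x y H; destruct (ns_dm s x y Hs H) as [Ho _];
 assert (D2 := D_eis s 2 _ Hs Ho ltac:(lia)); assert (D3 := D_eis s 3 _ Hs Ho ltac:(lia));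
 assert (D4 := D_eis s 4 _ Hs Ho ltac:(lia)); assert (D5 := D_eis s 5 _ Hs Ho ltac:(lia));
 assert (D6 := D_eis s 6 _ Hs Ho ltac:(lia)); simpl INR in *.
- unfold Phi. eapply cder_eq. apply cder_minus; apply cder_scal. apply D4. apply cder_mult; apply D2.
  rewrite !RtoC_opp, ?RtoC_plus. ring.
- eapply cder_eq. apply cder_plus; apply cder_scal. apply D5. apply cder_mult; [apply D2|apply D3].
  rewrite !RtoC_opp, ?RtoC_plus. ring.
- eapply cder_eq. apply cder_minus. apply cder_minus; apply cder_scal. apply D6. apply cder_mult; apply D3.
  apply cder_scal. apply cder_mult; [apply D2|apply D4].
  rewrite !RtoC_opp, ?RtoC_plus. ring.
- unfold Phi. rewrite (step_i x y s), !eis_period; auto.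
Qed.

Lemma weierstrass_second_order s : 0 < s -> exists d, forall z, offlat s z ->
  (6 * eis s 4 z)%C = (6 * (eis s 2 z * eis s 2 z) + d)%C.
Proof.
intro Hs. destruct (Phi_bounded s Hs) as [B HB].
destruct (liouville (fr s) (Phi s) _ _ _ B (fr_pos s Hs) (holo_Phi s Hs)) as [d Hd].
{ intros x y H. apply HB. apply (ns_dm s x y Hs H). }
exists d. intros [x y] Hz.
assert (E : Phi s (x, y) = d).
{ apply (ext_ns (fr s)); auto. apply fr_pos; auto.
  eexists. unfold Phi. apply cder_minus; apply cder_scal. apply D_eis; auto.
  apply cder_mult; apply D_eis; auto. }
rewrite <- E. unfold Phi. ring.
Qed.

Lemma cder_unique f z a b : cder f z a -> cder f z b -> a = b.
Proof.
destruct z as [x y]. intros H1 H2.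
destruct (cder_partials H1) as [A1 [A2 _]]. destruct (cder_partials H2) as [B1 [B2 _]].
apply is_derive_unique in A1, A2, B1, B2. rewrite (surjective_pairing a), (surjective_pairing b). congruence.
Qed.

Lemma locally_constant_derivative f z l d : 0 < d -> (forall w, Cmod (w - z)%C < d -> f w = f z) ->
  cder f z l -> l = RtoC 0.
Proof.
intros Hd H D. apply (cder_unique f z); auto. apply (cder_ext_loc (fun _ => f z)).
exists d; split; auto. intros; symmetry; auto. apply cder_const.
Qed.

Definition ee (s : R) : C := eis s 2 (om s).
Definition ff (s : R) (z : C) : C := (eis s 2 z - ee s)%C.

Lemma D_ff s z : 0 < s -> offlat s z -> cder (ff s) z (-2 * eis s 3 z)%C.
Proof.
intros Hs Hz. unfold ff. eapply cder_eq. apply cder_minus. apply D_eis; auto. apply cder_const.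
simpl INR. replace (1 + 1) with 2 by ring. rewrite ?RtoC_opp. ring.
Qed.
Lemma D_eis3 s z : 0 < s -> offlat s z -> cder (eis s 3) z (-3 * eis s 4 z)%C.
Proof.
intros Hs Hz. eapply cder_eq. apply D_eis; auto.
simpl INR. replace (1 + 1 + 1) with 3 by ring. rewrite ?RtoC_opp. ring.
Qed.
Lemma ff_shift s z a b : 0 < s -> offlat s z -> ff s (z + lattice_point s a b)%C = ff s z.
Proof. intros. unfold ff. rewrite eis_period; auto. Qed.
Lemma ff_om2 s z : 0 < s -> offlat s z -> ff s (z + om s + om s)%C = ff s z.
Proof. intros. unfold ff. rewrite eis_om_shift; auto. Qed.

(** The derivative of the difference is 0 by the second-order equation; the constant is
    evaluated at [omega], a zero of both sides. *)
Lemma first_integral s d : 0 < s -> (forall z, offlat s z ->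
    (6 * eis s 4 z)%C = (6 * (eis s 2 z * eis s 2 z) + d)%C) ->
  forall z, offlat s z -> (eis s 3 z * eis s 3 z)%C =
    (ff s z * (ff s z * ff s z + 3 * ee s * ff s z + (3 * ee s * ee s + d / 2)))%C.
Proof.
intros Hs H4.
set (e := ee s). set (kp := (3 * e * e + d / 2)%C).
set (F := fun z => (eis s 3 z * eis s 3 z - ff s z * (ff s z * ff s z + 3 * e * ff s z + kp))%C).
assert (D : forall z, offlat s z -> cder F z (RtoC 0)).
{ intros z Hz. eapply cder_eq. unfold F.
  assert (A := D_ff s z Hs Hz). assert (B := D_eis3 s z Hs Hz).
  apply cder_minus. apply cder_mult; exact B.
  apply cder_mult; [exact A|]. apply cder_plus; [apply cder_plus|].
  apply cder_mult; exact A. apply cder_scal; exact A. apply cder_const. cbv beta.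
  assert (E : eis s 2 z = (ff s z + e)%C) by (unfold ff, e; ring).
  assert (E4 : eis s 4 z = ((6 * ((ff s z + e) * (ff s z + e)) + d) / 6)%C).
  { rewrite <- E, <- H4 by auto. field. }
  rewrite E4. unfold kp. field. }
assert (Hh : holo (fr s) F (fun _ => RtoC 0) (fun _ => RtoC 0) (fun _ => RtoC 0)).
{ constructor; intros x y Hn; destruct (ns_dm s x y Hs Hn) as [Ho _].
  - apply D; auto. - apply cder_const. - apply cder_const.
  - unfold F, ff. rewrite (step_i x y s), !eis_period; auto. }
destruct (holo_constant (fr s) F _ _ _ (fr_pos s Hs) Hh) as [k Hk]. reflexivity.
assert (Ek : forall z, offlat s z -> F z = k).
{ intros [x y] Hz. apply (ext_ns (fr s)); auto. apply fr_pos; auto. exists (RtoC 0). apply D; auto. }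
assert (k0 : k = RtoC 0).
{ rewrite <- (Ek (om s)) by (apply om_offlat; auto). unfold F, ff. rewrite eis3_om by auto. fold (ee s). fold e. ring. }
intros z Hz. specialize (Ek z Hz). rewrite k0 in Ek. unfold F in Ek.
transitivity (eis s 3 z * eis s 3 z - ff s z * (ff s z * ff s z + 3 * e * ff s z + kp)
  + ff s z * (ff s z * ff s z + 3 * e * ff s z + kp))%C; [ring|]. rewrite Ek. ring.
Qed.

(** The pole of one factor is a double zero of the other, because [wp] is even about
    [omega]. *)
Lemma product_bounded s : 0 < s -> exists B, forall z, dm s z -> Cmod (ff s z * ff s (z + om s))%C <= B.
Proof.
intro Hs. destruct (eis2_cell_bound s Hs) as [M [HM H2]].
destruct (offlat_sep s (om s) Hs (om_offlat s Hs)) as [c Hc].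
destruct (eis_taylor s (om s) c 2 Hs Hc ltac:(lia)) as [K [HK HT]]. assert (Hcp := proj1 Hc).
set (r := s / 2 + / 2). assert (Hr : 0 < r) by (unfold r; lra).
set (Q := M * r ^ 2 + Cmod (ee s)).
assert (HQ : 0 <= Q).
{ unfold Q. generalize (Cmod_ge_0 (ee s)) (pow2_ge_0 r). nra. }
set (dl := c / 2).
assert (Hdl : 0 < dl) by (unfold dl; lra).
assert (Ff : forall z, incell s z -> z <> RtoC 0 -> Cmod (ff s z) <= / Cmod z ^ 2 + Q).
{ intros z Hz Hz0. unfold ff.
  replace (eis s 2 z - ee s)%C with (/ z ^ 2 + ((eis s 2 z - / z ^ 2) - ee s))%C by ring.
  eapply Rle_trans. apply Cmod_triangle. rewrite Cmod_inv by (apply Cpow_nz; auto). rewrite Cmod_pow.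
  apply Rplus_le_compat_l. eapply Rle_trans. apply Cmod_triangle_minus'. unfold Q. apply Rplus_le_compat_r.
  eapply Rle_trans. apply H2; auto. apply Rmult_le_compat_l; auto. apply pow_incr. split. apply Cmod_ge_0.
  apply incell_mod; auto. }
assert (Near : forall z, incell s z -> z <> RtoC 0 -> Cmod z <= dl -> Cmod (ff s z * ff s (z + om s))%C <= K * (1 + Q * r ^ 2)).
{ intros z Hz Hz0 Hd. rewrite Cmod_mult. assert (Hp : 0 < Cmod z) by (apply Cmod_gt_0; auto).
  assert (T := HT z Hd). rewrite eis3_om in T by auto.
  replace (eis s 2 (om s + z) - eis s 2 (om s) + INR 2 * z * 0)%C with (ff s (z + om s)) in T.
  2:{ unfold ff, ee. replace (z + om s)%C with (om s + z)%C by ring. ring. }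
  apply Rle_trans with ((/ Cmod z ^ 2 + Q) * (K * Cmod z ^ 2)).
  { apply Rmult_le_compat; auto; apply Cmod_ge_0. }
  assert (Cmod z <= r) by (apply incell_mod; auto).
  assert (Cmod z ^ 2 <= r ^ 2) by (apply pow_incr; lra).
  replace ((/ Cmod z ^ 2 + Q) * (K * Cmod z ^ 2)) with (K * (1 + Q * Cmod z ^ 2)) by (field; lra).
  apply Rmult_le_compat_l; auto. apply Rplus_le_compat_l. apply Rmult_le_compat_l; auto. }
assert (Red : forall z, offlat s z -> exists a b, incell s (z - lattice_point s a b)%C /\ (z - lattice_point s a b)%C <> RtoC 0).
{ intros z Hz. destruct (reduce_cell s z Hs) as [a [b Hab]]. exists a, b. split; [exact Hab|].
  intro E. apply (Hz a b). transitivity (z - lattice_point s a b + lattice_point s a b)%C; [ring|]. rewrite E. ring. }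
assert (Far : forall z, incell s z -> z <> RtoC 0 -> dl < Cmod z -> Cmod (ff s z) <= / dl ^ 2 + Q).
{ intros z Hz Hz0 Hd. eapply Rle_trans. apply Ff; auto. apply Rplus_le_compat_r.
  apply Rinv_le_contravar. apply pow_lt; auto. apply pow_incr. lra. }
assert (Sh : forall z a b, dm s z -> ff s (z - lattice_point s a b)%C = ff s z /\ ff s (z - lattice_point s a b + om s)%C = ff s (z + om s)%C).
{ intros z a b [Hz1 Hz2].
  assert (E1 : (z - lattice_point s a b)%C = (z + lattice_point s (- a) (- b))%C) by (rewrite lattice_point_opp; ring).
  split. rewrite E1, ff_shift; auto.
  replace (z - lattice_point s a b + om s)%C with (z + om s + lattice_point s (- a) (- b))%C by (rewrite lattice_point_opp; ring).
  rewrite ff_shift; auto. }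
exists (K * (1 + Q * r ^ 2) + (/ dl ^ 2 + Q) * (/ dl ^ 2 + Q)).
assert (P1 : 0 <= K * (1 + Q * r ^ 2)).
{ apply Rmult_le_pos; auto. generalize (pow2_ge_0 r). nra. }
assert (P2 : 0 <= / dl ^ 2 + Q).
{ generalize (Rinv_0_lt_compat _ (pow_lt dl 2 Hdl)). lra. }
intros z Hz. destruct (Red z (proj1 Hz)) as [a [b [I1 N1]]]. destruct (Sh z a b Hz) as [S1 S2].
destruct (Red (z + om s)%C (proj2 Hz)) as [a' [b' [I2 N2]]]. destruct (Sh (z + om s)%C a' b' (dm_om s z Hz)) as [S3 S4].
rewrite ff_om2 in S4 by (auto; apply Hz).
destruct (Rle_dec (Cmod (z - lattice_point s a b)%C) dl) as [L1|L1].
- specialize (Near _ I1 N1 L1). rewrite S1, S2 in Near. nra.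
- destruct (Rle_dec (Cmod (z + om s - lattice_point s a' b')%C) dl) as [L2|L2].
  + specialize (Near _ I2 N2 L2). rewrite S3, S4, Cmult_comm in Near. nra.
  + assert (F1 := Far _ I1 N1 ltac:(lra)). assert (F2 := Far _ I2 N2 ltac:(lra)). rewrite S1 in F1. rewrite S3 in F2.
    rewrite Cmod_mult.
    assert (Cmod (ff s z) * Cmod (ff s (z + om s)) <= (/ dl ^ 2 + Q) * (/ dl ^ 2 + Q)).
    { apply Rmult_le_compat; auto; apply Cmod_ge_0. }
    lra.
Qed.

Lemma D_om (F : C -> C) s z l : cder F (z + om s)%C l -> cder (fun w => F (w + om s)%C) z l.
Proof. apply cder_shift. Qed.

Lemma product_constant s : 0 < s -> exists kk, forall z, dm s z -> (ff s z * ff s (z + om s))%C = kk.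
Proof.
intro Hs. destruct (product_bounded s Hs) as [B HB].
assert (D : forall z, dm s z -> cder (fun z => ff s z * ff s (z + om s))%C z
  (-2 * (eis s 3 z * ff s (z + om s) + ff s z * eis s 3 (z + om s)))%C).
{ intros z [H1 H2]. eapply cder_eq. apply cder_mult. apply D_ff; auto. apply D_om. apply D_ff; auto. cbv beta. ring. }
assert (Hh : holo (fr s) (fun z => ff s z * ff s (z + om s))%C
  (fun z => -2 * (eis s 3 z * ff s (z + om s) + ff s z * eis s 3 (z + om s)))%C
  (fun z => 6 * (eis s 4 z * ff s (z + om s) + ff s z * eis s 4 (z + om s)) + 8 * (eis s 3 z * eis s 3 (z + om s)))%C
  (fun z => -24 * (eis s 5 z * ff s (z + om s) + ff s z * eis s 5 (z + om s))
     - 36 * (eis s 4 z * eis s 3 (z + om s) + eis s 3 z * eis s 4 (z + om s)))%C).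
{ constructor; intros x y Hn; assert (Hdm := ns_dm s x y Hs Hn); destruct Hdm as [H1 H2];
  assert (A := D_ff s _ Hs H1); assert (A3 := D_eis3 s _ Hs H1); assert (A4 := D_eis s 4 _ Hs H1 ltac:(lia));
  assert (A' := D_om _ s _ _ (D_ff s _ Hs H2)); assert (A3' := D_om _ s _ _ (D_eis3 s _ Hs H2));
  assert (A4' := D_om _ s _ _ (D_eis s 4 _ Hs H2 ltac:(lia)));
  simpl INR in *; replace (1 + 1 + 1 + 1) with 4 in * by ring.
  - apply D. split; auto.
  - eapply cder_eq. apply cder_scal, cder_plus; apply cder_mult; [exact A3|exact A'|exact A|exact A3']. cbv beta. ring.
  - eapply cder_eq. apply cder_plus; apply cder_scal; [apply cder_plus|]; apply cder_mult; [exact A4|exact A'|exact A|exact A4'|exact A3|exact A3']. cbv beta.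
    rewrite !RtoC_opp. ring.
  - rewrite (step_i x y s). replace ((x, y) + lattice_point s 0 1 + om s)%C with ((x, y) + om s + lattice_point s 0 1)%C by ring.
    rewrite !ff_shift; auto. }
destruct (liouville (fr s) _ _ _ _ B (fr_pos s Hs) Hh) as [kk Hk].
{ intros x y H. apply HB. apply (ns_dm s x y Hs H). }
exists kk. intros [x y] Hz. apply (ext_ns (fr s) (fun z => ff s z * ff s (z + om s))%C); auto. apply fr_pos; auto.
eexists. apply D; auto.
Qed.

(** * Values on the symmetry axes *)

Lemma ode_zero_real (U U1 G : R -> R) (al be x0 : R) : al <= x0 <= be ->
  (forall x, al <= x <= be -> is_derive U x (U1 x) /\ is_derive U1 x (G x * U x) /\ continuous G x) ->
  U x0 = 0 -> U1 x0 = 0 -> forall x, al <= x <= be -> U x = 0.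
Proof.
intros Hx0 H E0 E1 x Hx.
destruct (continuous_bounded G al be (fun x Hx => proj2 (proj2 (H x Hx)))) as [B [HB HG]].
apply (ode_zero U (fun _ => 0) U1 (fun _ => 0) (fun x => G x * U x) (fun _ => 0) al be x0 (B ^ 2)); auto.
- intros t Ht. destruct (H t Ht) as [H1 [H2 _]]. split; [|split; [|split]]; auto; apply D_const.
- intros t Ht. specialize (HG t Ht). assert (G t ^ 2 <= B ^ 2).
  { rewrite <- (pow2_abs (G t)). apply pow_incr. split; [apply Rabs_pos|auto]. }
  generalize (pow2_ge_0 (U t)). intro. replace ((G t * U t) ^ 2 + 0 ^ 2) with (G t ^ 2 * U t ^ 2) by ring. nra.
- apply pow2_ge_0.
Qed.

Lemma ff_large s N : 0 < s -> exists dl, 0 < dl <= c0 s /\ forall z, z <> RtoC 0 -> Cmod z < dl ->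
  offlat s z /\ N < Cmod (eis s 2 z).
Proof.
intro Hs. destruct (eis2_cell_bound s Hs) as [M [HM H2]]. destruct (c0_pos s Hs) as [H0 [Hc1 Hc2]].
set (Q := M + Rabs N + 1). assert (HQ : 1 <= Q) by (unfold Q; generalize (Rabs_pos N); lra).
exists (Rmin (c0 s) (/ Q)). split. { split; [apply Rmin_pos; auto; apply Rinv_0_lt_compat; lra|apply Rmin_l]. }
intros z Hz Hd. assert (Hp : 0 < Cmod z) by (apply Cmod_gt_0; auto).
assert (L1 : Cmod z < c0 s) by (eapply Rlt_le_trans; [apply Hd|apply Rmin_l]).
assert (L2 : Cmod z < / Q) by (eapply Rlt_le_trans; [apply Hd|apply Rmin_r]).
assert (Hin : incell s z).
{ split. eapply Rle_trans; [apply Cmod_fst|]; lra. eapply Rle_trans; [apply Cmod_snd|]; lra. }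
split. apply incell_offlat; auto. specialize (H2 z Hin Hz).
assert (T := Cmod_triangle_minus (/ z ^ 2)%C (/ z ^ 2 - eis s 2 z)%C).
rewrite (Cmod_minus_sym (/ z ^ 2)%C (eis s 2 z)) in T.
replace (/ z ^ 2 - (/ z ^ 2 - eis s 2 z))%C with (eis s 2 z) in T by ring.
rewrite Cmod_inv, Cmod_pow in T by (apply Cpow_nz; auto).
assert (Q <= / Cmod z).
{ rewrite <- (Rinv_inv Q). apply Rinv_le_contravar; lra. }
assert (/ Cmod z ^ 2 = / Cmod z * / Cmod z) by (field; lra).
assert (Cmod z ^ 2 <= 1). { assert (/ Q <= 1). rewrite <- Rinv_1. apply Rinv_le_contravar; lra. nra. }
generalize (Rle_abs N). unfold Q in *. nra.
Qed.

(** Conjugation acts on [z] like a symmetry of [wp]; this holds on the horizontal and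
    vertical lines through the half periods, where [wp] is therefore real. *)
Definition mirror (s : R) (z : C) : Prop := exists a b, Cconj z = (z + lattice_point s a b)%C \/ Cconj z = (- z + lattice_point s a b)%C.

Lemma eis2_real s z : 0 < s -> offlat s z -> mirror s z -> snd (eis s 2 z) = 0.
Proof.
intros Hs Hz [a [b H]].
assert (E : Cconj (eis s 2 z) = eis s 2 z).
{ rewrite <- eis_conj by auto. destruct H as [-> | ->]. apply eis_period; auto.
  rewrite eis_period; auto. apply eis2_even; auto. apply offlat_opp; auto. }
apply (f_equal snd) in E. destruct (eis s 2 z); unfold Cconj in E; simpl in *. lra.
Qed.
Lemma mirror_horizontal s x n : mirror s (x, IZR n / 2).
Proof. exists 0%Z, (- n)%Z. left. unfold Cconj, lattice_point, Cplus; simpl. rewrite opp_IZR. f_equal; field. Qed.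
Lemma mirror_vertical s y m : mirror s (s * IZR m / 2, y).
Proof. exists m, 0%Z. right. unfold Cconj, lattice_point, Copp, Cplus; simpl. f_equal; field. Qed.
Lemma mirror_om s : mirror s (om s).
Proof. unfold om. apply (mirror_horizontal s (s / 2) 1). Qed.

Definition er (s : R) : R := fst (ee s).
Lemma ee_real s : 0 < s -> ee s = RtoC (er s).
Proof.
intro Hs. unfold er. rewrite (surjective_pairing (ee s)) at 1. unfold ee at 2.
rewrite eis2_real; auto. apply om_offlat; auto. apply mirror_om.
Qed.
Lemma ff_real s z : 0 < s -> offlat s z -> mirror s z -> ff s z = RtoC (fst (ff s z)).
Proof.
intros Hs Hz Hm. unfold ff. rewrite ee_real by auto. assert (R := eis2_real s z Hs Hz Hm).
destruct (eis s 2 z) as [u v]. simpl in R. subst v. unfold RtoC, Cminus, Cplus, Copp; simpl. f_equal; ring.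
Qed.

Lemma off_vertical s x y : 0 < x < s -> offlat s (x, y).
Proof.
intros Hx m n E. injection E as Ex _. 
assert (0 < IZR m < 1) by (split; apply Rmult_lt_reg_l with s; lra).
apply (not_int_between (IZR m) H m). reflexivity.
Qed.
Lemma off_horizontal s x y : 0 < y < 1 -> offlat s (x, y).
Proof. intro. apply offlat_y, not_int_between; auto. Qed.
Lemma dm_imag_axis s y : 0 < s -> 0 < y < 1 -> dm s (0, y).
Proof.
intros Hs Hy. split. apply off_horizontal; auto.
unfold om, Cplus; simpl. apply off_vertical. lra.
Qed.
Lemma dm_real_axis s x : 0 < s -> 0 < x < s -> dm s (x, 0).
Proof.
intros Hs Hx. split. apply off_vertical; auto.
unfold om, Cplus; simpl. apply off_horizontal. lra.
Qed.

Lemma D_ff_x s x y : 0 < s -> offlat s (x, y) ->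
  is_derive (fun t => fst (ff s (t, y))) x (-2 * fst (eis s 3 (x, y))) /\
  is_derive (fun t => -2 * fst (eis s 3 (t, y))) x (6 * fst (eis s 4 (x, y))).
Proof.
intros Hs Hz. destruct (cder_partials (D_ff s _ Hs Hz)) as [A _].
destruct (cder_partials (D_eis3 s _ Hs Hz)) as [B _]. split.
- eapply is_derive_eq. apply A. simpl. ring.
- eapply is_derive_eq. apply D_scal, B. simpl. ring.
Qed.
Lemma D_ff_y s x y : 0 < s -> offlat s (x, y) ->
  is_derive (fun t => fst (ff s (x, t))) y (2 * snd (eis s 3 (x, y))) /\
  is_derive (fun t => 2 * snd (eis s 3 (x, t))) y (- 6 * fst (eis s 4 (x, y))).
Proof.
intros Hs Hz. destruct (cder_partials (D_ff s _ Hs Hz)) as [_ [_ [A _]]].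
destruct (cder_partials (D_eis3 s _ Hs Hz)) as [_ [_ [_ B]]]. split.
- eapply is_derive_eq. apply A. simpl. ring.
- eapply is_derive_eq. apply D_scal, B. simpl. ring.
Qed.

Definition wconst (s : R) (d : C) : Prop := forall z, offlat s z ->
    (6 * eis s 4 z)%C = (6 * (eis s 2 z * eis s 2 z) + d)%C.
(** The product constant, as it appears in the first integral. *)
Definition kp (s : R) (d : C) : C := (3 * ee s * ee s + d / 2)%C.

Lemma eis4_ff s d z : wconst s d -> offlat s z ->
  (6 * eis s 4 z)%C = (6 * (ff s z * ff s z) + 12 * ee s * ff s z + 2 * kp s d)%C.
Proof. intros H Hz. rewrite H by auto. unfold ff, kp. field. Qed.

Lemma eis3_half s z a b : 0 < s -> offlat s z -> (z + z)%C = lattice_point s a b -> eis s 3 z = RtoC 0.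
Proof.
intros Hs Hz E. assert (H := eis3_odd s z Hs Hz).
rewrite <- (eis_period s (- z)%C 3 a b), <- E in H; auto. 2: apply offlat_opp; auto.
replace (- z + (z + z))%C with z in H by ring.
assert (E2 : (eis s 3 z + eis s 3 z)%C = RtoC 0) by (rewrite H at 1; ring).
transitivity ((eis s 3 z + eis s 3 z) / 2)%C; [field|]. rewrite E2. field.
Qed.

(** If it were 0, then [ff] would solve a linear equation with zero data at [omega].
    Following the solution along a horizontal and then a vertical line gives a
    contradiction at the pole. *)
Lemma kp_nonzero s d : 0 < s -> wconst s d -> kp s d <> RtoC 0.
Proof.
intros Hs Hd E0.
assert (E4 : forall z, offlat s z -> mirror s z ->
  6 * fst (eis s 4 z) = (6 * fst (ff s z) + 12 * er s) * fst (ff s z)).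
{ intros z Hz Hm. assert (E := eis4_ff s d z Hd Hz). rewrite E0, ee_real, ff_real in E by auto.
  apply (f_equal fst) in E. generalize E. clear. generalize (eis s 4 z) (fst (ff s z)) (er s).
  intros [u v] f0 e0; simpl. lra. }
assert (Cx : forall x y, offlat s (x, y) -> continuous (fun t => 6 * fst (ff s (t, y)) + 12 * er s) x).
{ intros x y Hz. eapply C_of_D. apply D_plus. apply D_scal, (proj1 (D_ff_x s x y Hs Hz)). apply D_const. }
assert (Cy : forall x y, offlat s (x, y) -> continuous (fun t => - (6 * fst (ff s (x, t)) + 12 * er s)) y).
{ intros x y Hz. eapply C_of_D. apply D_opp, D_plus. apply D_scal, (proj1 (D_ff_y s x y Hs Hz)). apply D_const. }
assert (Hh : forall x, offlat s (x, 1 / 2)) by (intro; apply off_horizontal; lra).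
assert (Z1 : fst (ff s (0, 1 / 2)) = 0).
{ apply (ode_zero_real (fun t => fst (ff s (t, 1 / 2))) (fun t => -2 * fst (eis s 3 (t, 1 / 2)))
    (fun t => 6 * fst (ff s (t, 1 / 2)) + 12 * er s) 0 (s / 2) (s / 2)); try lra.
  - intros x _. destruct (D_ff_x s x (1 / 2) Hs (Hh x)) as [A B].
    rewrite E4 in B; auto. apply (mirror_horizontal s x 1).
  - fold (om s). unfold ff. fold (ee s). simpl. ring.
  - fold (om s). rewrite eis3_om by auto. simpl. ring. }
assert (Hv : forall y, 0 < y < 1 -> offlat s (0, y)) by (intros; apply off_horizontal; auto).
assert (Mv : forall y, mirror s (0, y)).
{ intro y. replace 0 with (s * IZR 0 / 2) by field. apply mirror_vertical. }
assert (Z2 : forall y, 0 < y <= 1 / 2 -> fst (ff s (0, y)) = 0).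
{ intros y Hy. apply (ode_zero_real (fun t => fst (ff s (0, t))) (fun t => 2 * snd (eis s 3 (0, t)))
    (fun t => - (6 * fst (ff s (0, t)) + 12 * er s)) y (1 / 2) (1 / 2)); try lra.
  - intros t Ht. assert (Hz : offlat s (0, t)) by (apply Hv; lra). destruct (D_ff_y s 0 t Hs Hz) as [A B].
    split; [|split]; auto. eapply is_derive_eq. apply B. cbv beta.
    replace (- 6 * fst (eis s 4 (0, t))) with (- (6 * fst (eis s 4 (0, t)))) by ring. rewrite E4; auto. ring.
  - rewrite (eis3_half s (0, 1 / 2) 0 1 Hs (Hv (1 / 2) ltac:(lra))). simpl; ring.
    unfold lattice_point, Cplus; simpl; f_equal; field. }
destruct (ff_large s (Cmod (ee s)) Hs) as [dl [Hdl Hl]].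
destruct (c0_pos s Hs) as [_ [_ Hc]].
assert (Ez : Cmod (0, dl / 2) = dl / 2).
{ generalize (Cmod_dy (dl / 2) 0 0). replace ((0, (dl / 2)%R) - (0, 0))%C with (0, dl / 2). rewrite Rminus_0_r, Rabs_pos_eq by lra. auto.
  unfold Cminus, Cplus, Copp; simpl; f_equal; ring. }
destruct (Hl (0, dl / 2)) as [Ho HN].
{ intro E. injection E. lra. }
{ rewrite Ez; lra. }
assert (Hz := Z2 (dl / 2) ltac:(lra)). assert (Er := ff_real s _ Hs Ho (Mv (dl / 2))). rewrite Hz in Er.
assert (Ee : eis s 2 (0, dl / 2) = ee s).
{ unfold ff in Er. transitivity (eis s 2 (0, (dl / 2)%R) - ee s + ee s)%C; [ring|]. rewrite Er. ring. }
rewrite Ee in HN. lra.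
Qed.

(** Squaring [(f f2)' = 0] and inserting the first integrals of [f] and [f2] gives [kk
    (kk - kp) (f - f2) = 0].  If [kk = 0], one factor vanishes near [omega], and so
    does its second derivative there, which is [2 kp]: the two constants agree in
    this case as well. *)
Lemma product_value s d kk : 0 < s -> wconst s d ->
  (forall z, dm s z -> (ff s z * ff s (z + om s))%C = kk) -> kk = kp s d.
Proof.
intros Hs Hd Hk. destruct (ff_large s (Cmod (ee s) + Cmod kk + 1) Hs) as [dl [Hdl Hl]].
destruct (c0_pos s Hs) as [H0 [Hc1 Hc2]].
assert (FL : forall z, z <> RtoC 0 -> Cmod z < dl -> offlat s z /\ Cmod kk + 1 < Cmod (ff s z)).
{ intros z Hz Hm. destruct (Hl z Hz Hm) as [Ho Hn]. split; auto. unfold ff.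
  generalize (Cmod_triangle_minus (eis s 2 z) (ee s)). lra. }
assert (Near : forall h, Cmod h < dl -> offlat s (om s + h)%C).
{ intros h Hh. unfold om. generalize (Cmod_fst h). intro F. rewrite (surjective_pairing h). unfold Cplus; simpl.
  apply off_vertical. generalize (Rabs_def2 (fst h) (c0 s) ltac:(lra)). lra. }
assert (ND : forall h, h <> RtoC 0 -> Cmod h < dl -> dm s h).
{ intros h Hh Hm. split. apply FL; auto. replace (h + om s)%C with (om s + h)%C by ring. auto. }
destruct (Ceq_dec kk (RtoC 0)) as [Ek|Ek].
- (* the zero set would contain a punctured disc around omega *)
  subst kk.
  assert (Z0 : forall h, h <> RtoC 0 -> Cmod h < dl -> ff s (om s + h)%C = RtoC 0).
  { intros h Hh Hm. assert (E := Hk h (ND h Hh Hm)). destruct (FL h Hh Hm) as [_ Hb]. rewrite Cmod_0 in Hb.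
    assert (N : ff s h <> RtoC 0) by (apply Cmod_neq0; lra).
    replace (om s + h)%C with (h + om s)%C by ring.
    destruct (Ceq_dec (ff s (h + om s)) (RtoC 0)) as [|E1]; auto. exfalso. revert E. apply Cmult_neq_0; auto. }
  assert (Z00 : forall h, Cmod h < dl -> ff s (om s + h)%C = RtoC 0).
  { intros h Hm. destruct (Ceq_dec h (RtoC 0)) as [-> |]; auto.
    replace (om s + 0)%C with (om s) by ring. unfold ff, ee. ring. }
  assert (D1 : forall h, Cmod h < dl -> eis s 3 (om s + h)%C = RtoC 0).
  { intros h Hm.
    assert (E : (-2 * eis s 3 (om s + h))%C = RtoC 0).
    { apply (locally_constant_derivative (ff s) (om s + h)%C _ (dl - Cmod h)); [lra| |apply D_ff; auto]. intros w Hw. rewrite (Z00 h Hm).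
      replace w with (om s + (w - om s))%C by ring. apply Z00.
      replace (w - om s)%C with ((w - (om s + h)) + h)%C by ring. eapply Rle_lt_trans. apply Cmod_triangle. lra. }
    transitivity (-2 * eis s 3 (om s + h) / -2)%C. field. rewrite E. field. }
  assert (D2 : eis s 4 (om s) = RtoC 0).
  { assert (E : (-3 * eis s 4 (om s))%C = RtoC 0).
    { apply (locally_constant_derivative (eis s 3) (om s) _ dl); [lra| |apply D_eis3; auto; apply om_offlat; auto]. intros w Hw. rewrite eis3_om by auto.
      replace w with (om s + (w - om s))%C by ring. apply D1; auto. }
    transitivity (-3 * eis s 4 (om s) / -3)%C. field. rewrite E. field. }
  assert (E := eis4_ff s d (om s) Hd (om_offlat s Hs)). rewrite D2 in E.
  replace (ff s (om s)) with (RtoC 0) in E by (unfold ff, ee; ring).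
  transitivity (2 * kp s d / 2)%C; [|field].
  replace (2 * kp s d)%C with (6 * 0)%C by (rewrite E; ring). field.
- (* compare the first integral at z and at z + omega *)
  set (h := RtoC (dl / 2)).
  assert (Hh : h <> RtoC 0) by (intro E; injection E; lra).
  assert (Hm : Cmod h < dl) by (unfold h; rewrite Cmod_R, Rabs_pos_eq; lra).
  assert (Hdm := ND h Hh Hm). destruct Hdm as [H1 H2]. assert (E := Hk h (conj H1 H2)).
  destruct (FL h Hh Hm) as [_ Hb].
  assert (I1 := first_integral s d Hs Hd h H1). assert (I2 := first_integral s d Hs Hd _ H2).
  fold (kp s d) in I1, I2.
  assert (DD : (eis s 3 h * ff s (h + om s) + ff s h * eis s 3 (h + om s))%C = RtoC 0).
  { assert (E' : (-2 * (eis s 3 h * ff s (h + om s) + ff s h * eis s 3 (h + om s)))%C = RtoC 0).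
    { apply (locally_constant_derivative (fun z => ff s z * ff s (z + om s))%C h _ (dl / 2)). lra.
      - intros w Hw. rewrite E. apply Hk. apply ND.
        + intro Ew. rewrite Ew, Cmod_minus_sym in Hw. replace (h - 0)%C with h in Hw by ring.
          unfold h in Hw. rewrite Cmod_R, Rabs_pos_eq in Hw; lra.
        + replace w with ((w - h) + h)%C by ring. eapply Rle_lt_trans. apply Cmod_triangle.
          unfold h at 2. rewrite Cmod_R, Rabs_pos_eq; lra.
      - eapply cder_eq. apply cder_mult. apply D_ff; auto. apply D_om. apply D_ff; auto. cbv beta. ring. }
    match type of E' with (_ * ?u)%C = _ => transitivity (-2 * u / -2)%C end. field. rewrite E'. field. }
  set (f := ff s h) in *. set (f2 := ff s (h + om s)) in *. set (p := eis s 3 h) in *. set (p2 := eis s 3 (h + om s)) in *.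
  set (e := ee s) in *. set (k := kp s d) in *.
  assert (Q : (kk * ((kk - k) * (f - f2)))%C = RtoC 0).
  { transitivity ((p * f2 + f * p2) * (p * f2 - f * p2)
       - (p * p - f * (f * f + 3 * e * f + k)) * f2 * f2 + (p2 * p2 - f2 * (f2 * f2 + 3 * e * f2 + k)) * f * f)%C.
    rewrite <- E. ring. rewrite DD, I1, I2. ring. }
  assert (Nf : (f - f2)%C <> RtoC 0).
  { intro E1. assert (f2 = f). { transitivity (f - (f - f2))%C; [ring|]. rewrite E1. ring. }
    rewrite H in E. assert (X := Cmod_mult f f). rewrite E in X. generalize (Cmod_ge_0 kk). nra. }
  destruct (Ceq_dec (kk - k)%C (RtoC 0)) as [E1|E1].
  + transitivity (kk - k + k)%C; [ring|]. rewrite E1. ring.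
  + exfalso. revert Q. apply Cmult_neq_0; auto. apply Cmult_neq_0; auto.
Qed.

Lemma same_sign_of_nonzero (f : R -> R) (u v : R) : u <= v ->
  (forall x, u <= x <= v -> continuous f x /\ f x <> 0) -> 0 < f u -> 0 < f v.
Proof.
intros Huv H Hu. destruct (Rlt_dec 0 (f v)) as [|Hn]; auto. exfalso.
assert (Hv : f v < 0). { destruct (H v ltac:(lra)) as [_ N]. lra. }
destruct (Rle_lt_or_eq_dec u v Huv) as [L|E].
- destruct (Ranalysis5.IVT_interv (fun x => - f x) u v) as [z [Hz E]]; try lra.
  + intros x Hx. apply continuity_pt_opp, continuity_pt_filterlim, (proj1 (H x Hx)).
  + apply (proj2 (H z Hz)). lra.
- subst. lra.
Qed.

Lemma eis2_axes s N : 0 < s -> exists dl, 0 < dl <= / 4 /\ dl <= s / 4 /\ forall t, 0 < t < dl ->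
  N < fst (eis s 2 (t, 0)) /\ fst (eis s 2 (0, t)) < - N.
Proof.
intro Hs. destruct (eis2_cell_bound s Hs) as [M [HM H2]]. destruct (c0_pos s Hs) as [H0 [Hc1 Hc2]].
set (Q := M + Rabs N + 1). assert (HQ : 1 <= Q) by (unfold Q; generalize (Rabs_pos N); lra).
exists (Rmin (c0 s) (/ Q)). assert (B1 := Rmin_l (c0 s) (/ Q)). assert (B2 := Rmin_r (c0 s) (/ Q)).
split; [split; [apply Rmin_pos; auto; apply Rinv_0_lt_compat; lra|lra]|]. split; [lra|].
intros t Ht. assert (HNabs := Rle_abs N).
assert (T1 : Q <= / t) by (rewrite <- (Rinv_inv Q); apply Rinv_le_contravar; lra).
assert (T3 : / Q <= 1) by (rewrite <- Rinv_1; apply Rinv_le_contravar; lra).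
assert (T2 : Q <= / t ^ 2).
{ replace (/ t ^ 2) with (/ t * / t) by (field; lra). nra. }
assert (T4 : t ^ 2 <= 1) by nra.
assert (T5 : M * t ^ 2 <= M) by nra.
assert (M1 : Cmod (t, 0) = t).
{ change (t, 0) with (RtoC t). rewrite Cmod_R, Rabs_pos_eq; lra. }
assert (M2 : Cmod (0, t) = t).
{ replace (0, t) with (RtoC t * Ci)%C by (unfold RtoC, Ci, Cmult; simpl; f_equal; ring).
  rewrite Cmod_mult, Cmod_R, Rabs_pos_eq by lra. replace (Cmod Ci) with 1. ring.
  unfold Cmod, Ci; simpl. rewrite Rmult_0_l, !Rmult_1_r, Rplus_0_l, sqrt_1; auto. }
split.
- assert (Nz : (t, 0) <> RtoC 0) by (intro E; injection E; lra).
  assert (B := H2 (t, 0)). rewrite M1 in B.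
  assert (B' := Rle_trans _ _ _ (Cmod_fst _) (B ltac:(split; simpl; rewrite ?Rabs_R0, ?(Rabs_pos_eq t); lra) Nz)).
  replace (/ (t, 0) ^ 2)%C with (RtoC (/ t ^ 2)) in B'.
  2:{ change (t, 0) with (RtoC t). rewrite <- RtoC_pow, RtoC_inv. auto. apply pow_nonzero; lra. }
  assert (B'' : Rabs (fst (eis s 2 (t, 0)) - / t ^ 2) <= M * t ^ 2) by exact B'.
  apply Rabs_le_between in B''. unfold Q in *. lra.
- assert (Nz : (0, t) <> RtoC 0) by (intro E; injection E; lra).
  assert (B := H2 (0, t)). rewrite M2 in B.
  assert (B' := Rle_trans _ _ _ (Cmod_fst _) (B ltac:(split; simpl; rewrite ?Rabs_R0, ?(Rabs_pos_eq t); lra) Nz)).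
  replace (/ (0, t) ^ 2)%C with (RtoC (- / t ^ 2)) in B'.
  2:{ replace ((0, t) ^ 2)%C with (RtoC (- t ^ 2)) by (apply injective_projections; simpl; ring).
      rewrite <- RtoC_inv. f_equal. field; lra. generalize (pow_lt t 2 ltac:(lra)); lra. }
  assert (B'' : Rabs (fst (eis s 2 (0, t)) - - / t ^ 2) <= M * t ^ 2) by exact B'.
  apply Rabs_le_between in B''. unfold Q in *. lra.
Qed.

(** The product in the definition of [a_]. *)
Definition kq (s : R) : R := fst (ff s (s / 2, 0)) * fst (ff s (0, 1 / 2)).

(** On the real axis [wp - e] is positive near the pole and has no zero up to [s/2]; on
    the imaginary axis it is negative near the pole.  So the product constant is
    negative, which makes [a_] real. *)
Lemma wp_data s : 0 < s -> exists d, wconst s d /\ kp s d = RtoC (kq s) /\ kq s < 0 /\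
  (forall z, dm s z -> (ff s z * ff s (z + om s))%C = RtoC (kq s)).
Proof.
intro Hs. destruct (weierstrass_second_order s Hs) as [d Hd]. fold (wconst s d) in Hd.
destruct (product_constant s Hs) as [kk Hk]. assert (Ek := product_value s d kk Hs Hd Hk).
assert (Kn := kp_nonzero s d Hs Hd). exists d. split; auto.
assert (Mv : forall y, mirror s (0, y)).
{ intro y. replace 0 with (s * IZR 0 / 2) by field. apply mirror_vertical. }
assert (Mh : forall x, mirror s (x, 0)).
{ intro x. replace 0 with (IZR 0 / 2) by field. apply mirror_horizontal. }
assert (E1 : kk = RtoC (kq s)).
{ rewrite <- (Hk (s / 2, 0)). 2: apply dm_real_axis; lra.
  replace ((s / 2, 0)%R + om s)%C with ((0, 1 / 2)%R + lattice_point s 1 0)%C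
    by (unfold om, lattice_point, Cplus; simpl; f_equal; field).
  assert (O1 : offlat s (s / 2, 0)) by (apply off_vertical; lra).
  assert (O2 : offlat s (0, 1 / 2)) by (apply off_horizontal; lra).
  rewrite ff_shift by auto.
  rewrite (ff_real s (s / 2, 0)), (ff_real s (0, 1 / 2)) by auto. unfold kq. rewrite <- RtoC_mult. reflexivity. }
assert (Fn : forall z, dm s z -> mirror s z -> fst (ff s z) <> 0).
{ intros z Hz Hm E. apply Kn. rewrite <- Ek, <- (Hk z Hz), ff_real, E; auto. ring. apply Hz. }
split; [congruence|]. split; [|intros; rewrite Hk; auto].
destruct (eis2_axes s (Rabs (er s)) Hs) as [dl [[Hdl Hd4] [Hds Hax]]].
destruct (Hax (dl / 2) ltac:(lra)) as [A1 A2].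
assert (Eee : fst (ee s) = er s) by reflexivity.
assert (P1 : 0 < fst (ff s (s / 2, 0))).
{ apply (same_sign_of_nonzero (fun x => fst (ff s (x, 0))) (dl / 2) (s / 2)); try lra.
  - intros x Hx. assert (O : dm s (x, 0)) by (apply dm_real_axis; lra). split. eapply C_of_D. apply (proj1 (D_ff_x s x 0 Hs (proj1 O))).
    apply Fn; auto.
  - change (0 < fst (eis s 2 ((dl / 2)%R, 0)) + - fst (ee s)). rewrite Eee. generalize (Rle_abs (er s)); lra. }
assert (P2 : 0 < - fst (ff s (0, 1 / 2))).
{ apply (same_sign_of_nonzero (fun y => - fst (ff s (0, y))) (dl / 2) (1 / 2)); try lra.
  - intros y Hy. assert (O : dm s (0, y)) by (apply dm_imag_axis; lra). split.
    eapply C_of_D. apply D_opp, (proj1 (D_ff_y s 0 y Hs (proj1 O))). generalize (Fn _ O (Mv y)). lra.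
  - change (0 < - (fst (eis s 2 (0, (dl / 2)%R)) + - fst (ee s))). rewrite Eee.
    generalize (Rle_abs (- er s)); rewrite Rabs_Ropp; lra. }
unfold kq. nra.
Qed.

Lemma e_ee s : 0 < s -> e_ s = ee s.
Proof. intro Hs. unfold e_, ee. rewrite wp_eis; auto. apply om_offlat; auto. Qed.

Lemma a_value s : 0 < s -> 0 < a_ s /\ a_ s * a_ s * kq s = -1.
Proof.
intro Hs. destruct (wp_data s Hs) as [d [_ [_ [Hk HH]]]].
assert (O1 : offlat s (s / 2, 0)) by (apply off_vertical; lra).
assert (O2 : offlat s (0, 1 / 2)) by (apply off_horizontal; lra).
assert (E : a_ s = / sqrt (- kq s)).
{ unfold a_. rewrite !wp_eis, e_ee by auto. f_equal. f_equal. f_equal.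
  fold (ff s (0, 1 / 2)). fold (ff s (s / 2, 0)).
  rewrite (ff_real s (0, 1 / 2)), (ff_real s (s / 2, 0)); auto.
  - rewrite <- RtoC_mult. unfold kq. rewrite Rmult_comm. reflexivity.
  - replace 0 with (IZR 0 / 2) by field. apply mirror_horizontal.
  - replace 0 with (s * IZR 0 / 2) by field. apply mirror_vertical. }
assert (Hq : 0 < sqrt (- kq s)) by (apply sqrt_lt_R0; lra).
assert (Q := sqrt_sqrt (- kq s) ltac:(lra)).
rewrite E. split. apply Rinv_0_lt_compat; auto.
replace (kq s) with (- (sqrt (- kq s) * sqrt (- kq s))) at 3 by lra. field. lra.
Qed.

(** * The Gauss map and its logarithmic derivative *)
Definition gg (s : R) (z : C) : C := (RtoC (a_ s) * ff s z)%C.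
Definition hh (s : R) (z : C) : C := (-2 * eis s 3 z / ff s z)%C.
(** The constants in [h^2 = c (g - 1/g) + 2 A]. *)
Definition cc (s : R) : R := 4 / a_ s.
Definition AA (s : R) : R := 6 * er s.

Lemma RtoC_neq0 (x : R) : x <> 0 -> RtoC x <> RtoC 0.
Proof. intros H E. apply H. injection E; auto. Qed.

Lemma ff_nz s z : 0 < s -> dm s z -> ff s z <> RtoC 0.
Proof.
intros Hs Hz E. destruct (wp_data s Hs) as [d [_ [_ [Hk HH]]]]. specialize (HH z Hz). rewrite E in HH.
assert (X : RtoC (kq s) = RtoC 0) by (rewrite <- HH; ring). injection X. lra.
Qed.
Lemma gg_nz s z : 0 < s -> dm s z -> gg s z <> RtoC 0.
Proof.
intros Hs Hz. apply Cmult_neq_0. apply RtoC_neq0. generalize (a_value s Hs); lra. apply ff_nz; auto.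
Qed.
Lemma cc_pos s : 0 < s -> 0 < cc s.
Proof. intro Hs. apply Rdiv_lt_0_compat. lra. apply (a_value s Hs). Qed.

Lemma D_gg s z : 0 < s -> dm s z -> cder (gg s) z (gg s z * hh s z)%C.
Proof.
intros Hs Hz. eapply cder_eq. apply cder_scal, D_ff; auto. apply Hz. unfold gg, hh. field. apply ff_nz; auto.
Qed.

(** The first integral of the Weierstrass function divided by [f^2]. *)
Lemma hh_sq s z : 0 < s -> dm s z -> (hh s z * hh s z)%C = (cc s * (gg s z - / gg s z) + 2 * AA s)%C.
Proof.
intros Hs Hz. destruct (wp_data s Hs) as [d [Hd [Hkp [Hk _]]]]. destruct (a_value s Hs) as [Ha Ha2].
assert (I := first_integral s d Hs Hd z (proj1 Hz)). fold (kp s d) in I. rewrite Hkp, ee_real in I by auto.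
assert (Hf := ff_nz s z Hs Hz). assert (Han : RtoC (a_ s) <> RtoC 0) by (apply RtoC_neq0; lra).
unfold hh, gg, cc, AA. rewrite RtoC_div, !RtoC_mult by lra.
assert (Ekq : RtoC (kq s) = (RtoC (-1) / (a_ s * a_ s))%C).
{ replace (kq s) with ((-1) / (a_ s * a_ s)).
  - rewrite RtoC_div, RtoC_mult. reflexivity. nra.
  - rewrite <- Ha2. field. lra. }
rewrite Ekq in I.
replace (-2 * eis s 3 z / ff s z * (-2 * eis s 3 z / ff s z))%C with (4 * (eis s 3 z * eis s 3 z) / (ff s z * ff s z))%C by (field; auto).
rewrite I. field. auto.
Qed.

Lemma D_hh s z : 0 < s -> dm s z -> cder (hh s) z (cc s / 2 * (gg s z + / gg s z))%C.
Proof.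
intros Hs Hz. destruct (wp_data s Hs) as [d [Hd [Hkp [Hk _]]]]. destruct (a_value s Hs) as [Ha Ha2].
assert (Hf := ff_nz s z Hs Hz). assert (Han : RtoC (a_ s) <> RtoC 0) by (apply RtoC_neq0; lra).
eapply cder_eq. unfold hh, Cdiv. apply cder_mult. apply cder_scal, D_eis3; auto; apply Hz.
apply cder_inv; auto. apply D_ff; auto; apply Hz.
assert (E4 := eis4_ff s d z Hd (proj1 Hz)).
assert (I := first_integral s d Hs Hd z (proj1 Hz)). fold (kp s d) in I. rewrite Hkp, ee_real in I, E4 by auto.
assert (Ekq : RtoC (kq s) = (RtoC (-1) / (a_ s * a_ s))%C).
{ replace (kq s) with ((-1) / (a_ s * a_ s)).
  - rewrite RtoC_div, RtoC_mult. reflexivity. nra.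
  - rewrite <- Ha2. field. lra. }
rewrite Ekq in I, E4.
transitivity (6 * eis s 4 z / ff s z - 4 * (eis s 3 z * eis s 3 z) / (ff s z * ff s z))%C. field; auto.
rewrite I, E4. unfold cc, gg. rewrite RtoC_div by lra. field. auto.
Qed.

Lemma gg_shift s z a b : 0 < s -> dm s z -> gg s (z + lattice_point s a b)%C = gg s z.
Proof. intros Hs Hz. unfold gg. rewrite ff_shift; auto. apply Hz. Qed.
Lemma hh_shift s z a b : 0 < s -> dm s z -> hh s (z + lattice_point s a b)%C = hh s z.
Proof. intros Hs Hz. unfold hh. rewrite ff_shift, eis_period; auto. apply Hz. apply Hz. Qed.
Lemma gg_opp s z : 0 < s -> dm s z -> gg s (- z)%C = gg s z.
Proof. intros Hs Hz. unfold gg, ff. rewrite eis2_even; auto. apply Hz. Qed.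
Lemma hh_opp s z : 0 < s -> dm s z -> hh s (- z)%C = (- hh s z)%C.
Proof.
intros Hs Hz. assert (Hf := ff_nz s z Hs Hz).
assert (E : ff s (- z)%C = ff s z) by (unfold ff; rewrite eis2_even; auto; apply Hz).
unfold hh. rewrite E, eis3_odd; auto. field; auto. apply Hz.
Qed.
Lemma Cconj_RtoC (r : R) : Cconj (RtoC r) = RtoC r.
Proof. unfold Cconj, RtoC; simpl. f_equal; ring. Qed.
Lemma ff_conj s z : 0 < s -> dm s z -> ff s (Cconj z) = Cconj (ff s z).
Proof.
intros Hs Hz. unfold ff. rewrite eis_conj, Cminus_conj, ee_real, Cconj_RtoC; auto. apply Hz.
Qed.
Lemma hh_conj s z : 0 < s -> dm s z -> hh s (Cconj z) = Cconj (hh s z).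
Proof.
intros Hs Hz. assert (Hf := ff_nz s z Hs Hz). unfold hh, Cdiv. rewrite ff_conj, eis_conj by (auto; apply Hz).
rewrite !Cmult_conj, Cinv_conj by auto. f_equal. f_equal. symmetry; apply Cconj_RtoC.
Qed.

(** Otherwise reflection of the imaginary axis in the branch point, a symmetry of the
    real second-order equation with these data, would carry the pole at 0 to a
    regular point. *)
Lemma hh_imag_nz s y : 0 < s -> 0 < y < 1 / 2 -> hh s (0, y) <> RtoC 0.
Proof.
intros Hs Hy E.
assert (Odm : forall t, 0 < t < 1 -> dm s (0, t)) by (intros; apply dm_imag_axis; auto).
assert (E3 : eis s 3 (0, y) = RtoC 0).
{ assert (Hf := ff_nz s (0, y) Hs (Odm y ltac:(lra))). unfold hh in E.
  transitivity (-2 * eis s 3 (0, y) / ff s (0, y) * (ff s (0, y) / -2))%C. field; auto. rewrite E. ring. }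
destruct (wp_data s Hs) as [d [Hd [Hkp _]]].
assert (Mv : forall y, mirror s (0, y)).
{ intro t. replace 0 with (s * IZR 0 / 2) by field. apply mirror_vertical. }
set (u := fun t => fst (ff s (0, t))). set (u1 := fun t => 2 * snd (eis s 3 (0, t))).
assert (Du : forall t, 0 < t < 1 -> is_derive u t (u1 t) /\ is_derive u1 t (- (6 * u t ^ 2 + 12 * er s * u t + 2 * kq s))).
{ intros t Ht. destruct (D_ff_y s 0 t Hs (proj1 (Odm t Ht))) as [A B]. split. exact A.
  eapply is_derive_eq. exact B. assert (E4 := eis4_ff s d _ Hd (proj1 (Odm t Ht))).
  rewrite Hkp, ee_real, ff_real in E4; auto. 2: apply (Odm t Ht).
  apply (f_equal fst) in E4. unfold u. generalize E4. clear. generalize (eis s 4 (0, t)) (fst (ff s (0, t))) (er s) (kq s).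
  intros [p q] f0 e0 k0; simpl. intro. lra. }
assert (Ew : forall t, y <= t < 2 * y -> u (2 * y - t) - u t = 0).
{ intros t Ht.
  apply (ode_zero_real (fun t => u (2 * y - t) - u t) (fun t => - u1 (2 * y - t) - u1 t)
    (fun t => - (6 * (u (2 * y - t) + u t) + 12 * er s)) y t y); try lra.
  - intros r Hr. destruct (Du r ltac:(lra)) as [A B]. destruct (Du (2 * y - r) ltac:(lra)) as [A' B'].
    assert (Dr : is_derive (fun t => 2 * y - t) r (-1)).
    { eapply is_derive_eq. apply D_minus. apply D_const. apply D_id. ring. }
    assert (DA := D_comp u (fun t => 2 * y - t) r _ _ A' Dr).
    split; [|split].
    + eapply is_derive_eq. apply D_minus; [exact DA|exact A]. eqR; ring.
    + eapply is_derive_eq. apply D_minus. apply D_opp. apply (D_comp u1 (fun t => 2 * y - t) r _ _ B' Dr). exact B. eqR; ring.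
    + eapply C_of_D. apply D_opp, D_plus; [apply D_scal, D_plus; [exact DA|exact A]|apply D_const].
  - replace (2 * y - y) with y by ring. ring.
  - replace (2 * y - y) with y by ring. unfold u1. rewrite E3. simpl. ring. }
assert (Cu : continuous u (2 * y)) by (exact (C_of_D _ _ _ (proj1 (Du (2 * y) ltac:(lra))))).
destruct (proj1 (continuous_R u (2 * y)) Cu 1 Rlt_0_1) as [e1 [He1 Hc]].
set (N := Rabs (u (2 * y)) + 1 + Rabs (er s)).
destruct (eis2_axes s N Hs) as [dl [[Hdl _] [_ Hax]]].
set (r := Rmin y (Rmin (e1 / 2) (dl / 2))).
assert (Hr : 0 < r) by (unfold r; repeat apply Rmin_pos; lra).
assert (R1 : r <= y) by apply Rmin_l.
assert (R2 : r <= e1 / 2) by (unfold r; eapply Rle_trans; [apply Rmin_r|apply Rmin_l]).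
assert (R3 : r <= dl / 2) by (unfold r; eapply Rle_trans; [apply Rmin_r|apply Rmin_r]).
specialize (Ew (2 * y - r) ltac:(lra)). replace (2 * y - (2 * y - r)) with r in Ew by ring.
specialize (Hc (2 * y - r)). replace (2 * y - r - 2 * y) with (- r) in Hc by ring.
rewrite Rabs_Ropp, Rabs_pos_eq in Hc by lra. specialize (Hc ltac:(lra)).
destruct (Hax r ltac:(lra)) as [_ Hb].
assert (Er : u r = fst (eis s 2 (0, r)) - er s) by reflexivity.
apply Rabs_lt_between in Hc. unfold N in Hb.
generalize (Rle_abs (- er s)) (Rle_abs (- u (2 * y))). rewrite !Rabs_Ropp. lra.
Qed.

(** * The domain, and polar coordinates of the Gauss map *)

Lemma g_gg s z : 0 < s -> offlat s z -> g_ s z = gg s z.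
Proof. intros Hs Hz. unfold g_, gg, ff. rewrite wp_eis, e_ee; auto. Qed.

Lemma dm_open s z : 0 < s -> dm s z -> exists d, 0 < d /\ forall w, Cmod (w - z)%C < d -> dm s w.
Proof.
intros Hs [H1 H2]. 
assert (N : forall z, offlat s z -> exists d, 0 < d /\ forall w, Cmod (w - z)%C < d -> offlat s w).
{ intros u Hu. destruct (offlat_sep s u Hs Hu) as [c Hc]. assert (Hcp := proj1 Hc). exists (c / 2). split; [lra|].
  intros w Hw m n E. destruct (sep_near s u c (w - u)%C Hc ltac:(lra)) as [_ S]. specialize (S m n).
  replace (u + (w - u))%C with w in S by ring. rewrite <- E in S. replace (w - w)%C with (RtoC 0) in S by ring.
  rewrite Cmod_0 in S. generalize (nm_ge1 m n). nra. }
destruct (N _ H1) as [d1 [P1 Q1]]. destruct (N _ H2) as [d2 [P2 Q2]].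
exists (Rmin d1 d2). split. apply Rmin_pos; auto. intros w Hw. split.
- apply Q1. eapply Rlt_le_trans; [apply Hw|apply Rmin_l].
- apply Q2. replace (w + om s - (z + om s))%C with (w - z)%C by ring. eapply Rlt_le_trans; [apply Hw|apply Rmin_r].
Qed.

(** [g] has poles exactly at the lattice and zeros exactly at its translate by [omega]. *)
Lemma dom_iff s z : 0 < s -> (~ E_ s z <-> dm s z).
Proof.
intro Hs. destruct (a_value s Hs) as [Ha _]. split.
- intro HE. split.
  + intros m n E. apply HE. right. intros P [M HP].
    destruct (ff_large s (Rabs M / a_ s + Cmod (ee s)) Hs) as [dl [[Hdl _] Hl]].
    exists (mkposreal (dl / 2) ltac:(lra)). intro w; change C in w; intros Hw Hwz. apply HP.
    assert (Hm : Cmod (w - z)%C < dl).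
    { destruct Hw as [B1 B2]. eapply Rle_lt_trans. apply Cmod_le_sum.
      change (Rabs (fst w - fst z) < dl / 2) in B1. change (Rabs (snd w - snd z) < dl / 2) in B2.
      change (Rabs (fst w - fst z) + Rabs (snd w - snd z) < dl). lra. }
    assert (Hn : (w - z)%C <> RtoC 0).
    { intro E0. apply Hwz. change (@eq C w z). transitivity (w - z + z)%C; [ring|]. rewrite E0. ring. }
    destruct (Hl _ Hn Hm) as [Ho HN].
    assert (Ew : @eq C w (w - z + lattice_point s m n)%C) by (rewrite <- E; ring).
    assert (Ho' : offlat s w) by (rewrite Ew; apply offlat_shift; auto).
    rewrite g_gg by auto. unfold gg. rewrite Ew, ff_shift, Cmod_mult, Cmod_R, Rabs_pos_eq by (auto; lra).
    unfold ff. assert (T := Cmod_triangle_minus (eis s 2 (w - z)%C) (ee s)).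
    apply Rle_lt_trans with (a_ s * (Rabs M / a_ s)).
    * replace (a_ s * (Rabs M / a_ s)) with (Rabs M) by (field; lra). apply Rle_abs.
    * apply Rmult_lt_compat_l; lra.
  + intros m n E. apply HE. left.
    assert (Ez : z = (om s + lattice_point s (m - 1) (n - 1))%C).
    { rewrite lattice_point_sub, <- E, <- two_om. ring. }
    assert (Ho : offlat s z) by (rewrite Ez; apply offlat_shift, om_offlat; auto).
    rewrite g_gg by auto. unfold gg. rewrite Ez, ff_shift; auto. 2: apply om_offlat; auto. unfold ff, ee. ring.
- intros Hz [E|P].
  + rewrite g_gg in E by (auto; apply Hz). apply (gg_nz s z Hs Hz E).
  + destruct (dm_open s z Hs Hz) as [d1 [Hd1 O1]].
    destruct (cder_cont _ _ _ (D_gg s z Hs Hz) 1 Rlt_0_1) as [d2 [Hd2 O2]].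
    destruct (P (fun x => Cmod (gg s z) + 1 < x) (ex_intro _ (Cmod (gg s z) + 1) (fun x H => H))) as [[d Hd] HP].
    simpl in HP. set (r := Rmin d (Rmin d1 d2) / 2).
    assert (R0 : 0 < Rmin d (Rmin d1 d2)) by (repeat apply Rmin_pos; auto).
    assert (R1 := Rmin_l d (Rmin d1 d2)). assert (R2 := Rmin_r d (Rmin d1 d2)).
    assert (R3 := Rmin_l d1 d2). assert (R4 := Rmin_r d1 d2).
    assert (Em : Cmod ((z + RtoC r) - z)%C = r).
    { replace ((z + RtoC r) - z)%C with (RtoC r) by ring. rewrite Cmod_R, Rabs_pos_eq; unfold r; lra. }
    assert (B : Cmod (gg s z) + 1 < Cmod (g_ s (z + RtoC r)%C)).
    { apply HP.
      - split; [change (Rabs (fst z + r - fst z) < d)|change (Rabs (snd z + 0 - snd z) < d)].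
        replace (fst z + r - fst z) with r by ring. rewrite Rabs_pos_eq; unfold r; lra.
        replace (snd z + 0 - snd z) with 0 by ring. rewrite Rabs_R0. auto.
      - intro E. rewrite E in Em. replace (z - z)%C with (RtoC 0) in Em by ring. rewrite Cmod_0 in Em. unfold r in Em. lra. }
    assert (Hw : dm s (z + RtoC r)%C) by (apply O1; unfold r in *; lra).
    rewrite g_gg in B by (auto; apply Hw). specialize (O2 (z + RtoC r)%C ltac:(unfold r in *; lra)).
    generalize (Cmod_triangle_minus (gg s (z + RtoC r)%C) (gg s z)). lra.
Qed.

(** The modulus and the argument have logarithmic derivative [a] and derivative [b]. *)
Lemma polar_derivatives (G1 G2 : R -> R) (t a b : R) :
  is_derive G1 t (G1 t * a - G2 t * b) -> is_derive G2 t (G1 t * b + G2 t * a) -> 0 < G1 t ^ 2 + G2 t ^ 2 ->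
  let r := fun t => sqrt (G1 t ^ 2 + G2 t ^ 2) in
  is_derive (fun t => G1 t / r t) t (- (G2 t / r t) * b) /\
  is_derive (fun t => G2 t / r t) t (G1 t / r t * b) /\
  is_derive (fun t => (r t + / r t) / 2) t ((r t - / r t) / 2 * a) /\
  is_derive (fun t => (r t - / r t) / 2) t ((r t + / r t) / 2 * a).
Proof.
intros D1 D2 Hp r.
assert (Hr : 0 < r t) by (apply sqrt_lt_R0; auto).
assert (Hsq : r t * r t = G1 t ^ 2 + G2 t ^ 2) by (apply sqrt_sqrt; lra).
assert (Dr : is_derive r t (r t * a)).
{ eapply is_derive_eq. unfold r.
  apply (is_derive_sqrt (fun t => G1 t ^ 2 + G2 t ^ 2)). apply D_plus; apply D_pow2; eassumption. auto.
  fold (r t). apply Rmult_eq_reg_r with (2 * r t); [|lra].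
  transitivity (2 * G1 t * (G1 t * a - G2 t * b) + 2 * G2 t * (G1 t * b + G2 t * a)). field; lra.
  replace (r t * a * (2 * r t)) with (2 * a * (r t * r t)) by ring. rewrite Hsq. ring. }
assert (Di : is_derive (fun t => / r t) t (- (/ r t * a))).
{ eapply is_derive_eq. apply D_inv; [exact Dr|lra]. field; lra. }
split; [|split; [|split]].
- eapply is_derive_eq. apply D_mult; [exact D1|exact Di]. eqR; cbv beta; field; lra.
- eapply is_derive_eq. apply D_mult; [exact D2|exact Di]. eqR; cbv beta; field; lra.
- eapply is_derive_eq. apply (D_mult (fun t => r t + / r t) (fun _ => / 2)); [apply D_plus; [exact Dr|exact Di]|apply D_const]. eqR; cbv beta; field; lra.
- eapply is_derive_eq. apply (D_mult (fun t => r t - / r t) (fun _ => / 2)); [apply D_minus; [exact Dr|exact Di]|apply D_const]. eqR; cbv beta; field; lra.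
Qed.

(** Polar coordinates of the Gauss map [g = r (ct + i st)], with [ch], [sh] the
    hyperbolic cosine and sine of [ln r], and [h1 + i h2] the logarithmic derivative
    [g'/g]. *)
Definition rr s x y := sqrt (fst (gg s (x, y)) ^ 2 + snd (gg s (x, y)) ^ 2).
Definition ct s x y := fst (gg s (x, y)) / rr s x y.
Definition st s x y := snd (gg s (x, y)) / rr s x y.
Definition ch s x y := (rr s x y + / rr s x y) / 2.
Definition sh s x y := (rr s x y - / rr s x y) / 2.
Definition h1 s x y := fst (hh s (x, y)).
Definition h2 s x y := snd (hh s (x, y)).

Lemma rr_sq s x y : 0 < s -> dm s (x, y) -> 0 < fst (gg s (x, y)) ^ 2 + snd (gg s (x, y)) ^ 2 /\ 0 < rr s x y /\
  rr s x y * rr s x y = fst (gg s (x, y)) ^ 2 + snd (gg s (x, y)) ^ 2.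
Proof.
intros Hs Hz. assert (H := gg_nz s _ Hs Hz).
assert (P : 0 < fst (gg s (x, y)) ^ 2 + snd (gg s (x, y)) ^ 2).
{ destruct (Rle_lt_dec (fst (gg s (x, y)) ^ 2 + snd (gg s (x, y)) ^ 2) 0) as [L|]; auto. exfalso. apply H.
  destruct (gg s (x, y)) as [u v]; simpl fst in *; simpl snd in *.
  assert (u = 0) by nra. assert (v = 0) by nra. subst; reflexivity. }
split; auto. split. apply sqrt_lt_R0; auto. apply sqrt_sqrt; lra.
Qed.

Lemma trig_unit s x y : 0 < s -> dm s (x, y) -> ct s x y ^ 2 + st s x y ^ 2 = 1.
Proof.
intros Hs Hz. destruct (rr_sq s x y Hs Hz) as [_ [H1 H2]]. unfold ct, st.
transitivity ((fst (gg s (x, y)) ^ 2 + snd (gg s (x, y)) ^ 2) / (rr s x y * rr s x y)). field; lra. rewrite <- H2. field; lra.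
Qed.
Lemma hyp_unit s x y : 0 < s -> dm s (x, y) -> ch s x y ^ 2 = 1 + sh s x y ^ 2 /\ 1 <= ch s x y.
Proof.
intros Hs Hz. destruct (rr_sq s x y Hs Hz) as [_ [H1 _]].
assert (E : ch s x y ^ 2 = 1 + sh s x y ^ 2) by (unfold ch, sh; field; lra). split; auto.
assert (0 < ch s x y). { unfold ch. generalize (Rinv_0_lt_compat _ H1). lra. } nra.
Qed.

Set Implicit Arguments.
Record polar_x s x y : Prop := {
  x_ct : is_derive (fun t => ct s t y) x (- st s x y * h2 s x y);
  x_st : is_derive (fun t => st s t y) x (ct s x y * h2 s x y);
  x_ch : is_derive (fun t => ch s t y) x (sh s x y * h1 s x y);
  x_sh : is_derive (fun t => sh s t y) x (ch s x y * h1 s x y);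
  x_h1 : is_derive (fun t => h1 s t y) x (cc s * (ch s x y * ct s x y));
  x_h2 : is_derive (fun t => h2 s t y) x (cc s * (sh s x y * st s x y)) }.
Unset Implicit Arguments.
Set Implicit Arguments.
Record polar_y s x y : Prop := {
  y_ct : is_derive (fun t => ct s x t) y (- st s x y * h1 s x y);
  y_st : is_derive (fun t => st s x t) y (ct s x y * h1 s x y);
  y_ch : is_derive (fun t => ch s x t) y (- (sh s x y * h2 s x y));
  y_sh : is_derive (fun t => sh s x t) y (- (ch s x y * h2 s x y));
  y_h1 : is_derive (fun t => h1 s x t) y (- (cc s * (sh s x y * st s x y)));
  y_h2 : is_derive (fun t => h2 s x t) y (cc s * (ch s x y * ct s x y)) }.
Unset Implicit Arguments.

Lemma Cinv_parts (z : C) : fst (/ z)%C = fst z / (fst z ^ 2 + snd z ^ 2) /\ snd (/ z)%C = - snd z / (fst z ^ 2 + snd z ^ 2).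
Proof. split; reflexivity. Qed.

Lemma D_hh_parts s x y : 0 < s -> dm s (x, y) ->
  fst (cc s / 2 * (gg s (x, y) + / gg s (x, y)))%C = cc s * (ch s x y * ct s x y) /\
  snd (cc s / 2 * (gg s (x, y) + / gg s (x, y)))%C = cc s * (sh s x y * st s x y).
Proof.
intros Hs Hz. destruct (rr_sq s x y Hs Hz) as [_ [H1 H2]].
rewrite <- RtoC_div by lra.
assert (E1 : fst (RtoC (cc s / 2) * (gg s (x, y) + / gg s (x, y)))%C = cc s / 2 * (fst (gg s (x, y)) + fst (/ gg s (x, y))%C)) by (simpl; ring).
assert (E2 : snd (RtoC (cc s / 2) * (gg s (x, y) + / gg s (x, y)))%C = cc s / 2 * (snd (gg s (x, y)) + snd (/ gg s (x, y))%C)) by (simpl; ring).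
rewrite E1, E2. destruct (Cinv_parts (gg s (x, y))) as [-> ->]. rewrite <- H2. unfold ch, sh, ct, st. split; field; lra.
Qed.

Lemma polar s x y : 0 < s -> dm s (x, y) -> polar_x s x y /\ polar_y s x y.
Proof.
intros Hs Hz. destruct (rr_sq s x y Hs Hz) as [H0 _].
destruct (cder_partials (D_gg s _ Hs Hz)) as [A1 [A2 [A3 A4]]].
destruct (cder_partials (D_hh s _ Hs Hz)) as [B1 [B2 [B3 B4]]].
destruct (D_hh_parts s x y Hs Hz) as [E1 E2]. rewrite E1 in B1, B4. rewrite E2 in B2, B3.
split.
- destruct (polar_derivatives (fun t => fst (gg s (t, y))) (fun t => snd (gg s (t, y))) x (h1 s x y) (h2 s x y)) as [P1 [P2 [P3 P4]]]; auto.
  constructor; auto.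
- destruct (polar_derivatives (fun t => fst (gg s (x, t))) (fun t => snd (gg s (x, t))) y (- h2 s x y) (h1 s x y)) as [P1 [P2 [P3 P4]]]; auto.
  + eapply is_derive_eq. apply A3. unfold h1, h2. simpl. ring.
  + eapply is_derive_eq. apply A4. unfold h1, h2. simpl. ring.
  + constructor; auto.
    eapply is_derive_eq. apply P3. unfold sh, rr. ring.
    eapply is_derive_eq. apply P4. unfold ch, rr. ring.
Qed.

(** Real and imaginary parts of [h^2 = c (g - 1/g) + 2 A]. *)
Lemma h_relations s x y : 0 < s -> dm s (x, y) ->
  h1 s x y ^ 2 - h2 s x y ^ 2 = 2 * cc s * (sh s x y * ct s x y) + 2 * AA s /\
  h1 s x y * h2 s x y = cc s * (ch s x y * st s x y).
Proof.
intros Hs Hz. destruct (rr_sq s x y Hs Hz) as [_ [H1 H2]]. assert (E := hh_sq s _ Hs Hz).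
assert (E1 : h1 s x y ^ 2 - h2 s x y ^ 2 = cc s * (fst (gg s (x, y)) - fst (/ gg s (x, y))%C) + 2 * AA s).
{ apply (f_equal fst) in E. unfold h1, h2. rewrite <- (Rplus_0_r (fst (hh s (x, y)) ^ 2 - _)).
  transitivity (fst (hh s (x, y) * hh s (x, y))%C). simpl; ring. rewrite E. simpl. ring. }
assert (E2 : 2 * (h1 s x y * h2 s x y) = cc s * (snd (gg s (x, y)) - snd (/ gg s (x, y))%C)).
{ apply (f_equal snd) in E. unfold h1, h2. 
  transitivity (snd (hh s (x, y) * hh s (x, y))%C). simpl; ring. rewrite E. simpl. ring. }
destruct (Cinv_parts (gg s (x, y))) as [I1 I2]. rewrite I1, <- H2 in E1. rewrite I2, <- H2 in E2. split.
- rewrite E1. unfold sh, ct. field; lra.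
- apply Rmult_eq_reg_l with 2; [|lra]. rewrite E2. unfold ch, st. field; lra.
Qed.

(** * Separation of the potential *)

Lemma dm_quarter_y s x : 0 < s -> dm s (x, 1 / 4).
Proof.
intro Hs. split. apply off_horizontal; lra. unfold om, Cplus; simpl. apply off_horizontal; lra.
Qed.
Lemma dm_quarter_x s y : 0 < s -> dm s (s / 4, y).
Proof.
intro Hs. split. apply off_vertical; lra. unfold om, Cplus; simpl. apply off_vertical; lra.
Qed.
Lemma dm_of_sin_x s x y : 0 < s -> sin (fr s * x) <> 0 -> dm s (x, y).
Proof. intros Hs H. apply ns_dm; auto. apply ns_of_sin; auto. Qed.
Lemma dm_of_sin_y s x y : 0 < s -> sin (2 * PI * y) <> 0 -> dm s (x, y).
Proof.
intros Hs H. apply ns_dm; auto. unfold ns, rho. generalize (pow2_ge_0 (sin (fr s * x))).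
assert (0 < sin (2 * PI * y) ^ 2) by (apply pow2_gt_0; auto). lra.
Qed.

(** The choice of the lines [y = 1/4] and [x = s/4] is immaterial; both lie in the
    domain. *)
Definition kap (s x : R) : R := h1 s x (1 / 4) / ch s x (1 / 4).
Definition mu (s y : R) : R := - (h2 s (s / 4) y / ch s (s / 4) y).

(** The two vanishing derivatives are the separation: they reduce to the imaginary part
    of [h^2 = c (g - 1/g) + 2 A]. *)
Lemma ratio_derivatives s x y : 0 < s -> dm s (x, y) ->
  is_derive (fun t => h1 s t y / ch s t y) x (cc s * ct s x y - (h1 s x y / ch s x y) ^ 2 * sh s x y) /\
  is_derive (fun t => h1 s x t / ch s x t) y 0 /\
  is_derive (fun t => h2 s t y / ch s t y) x 0 /\
  is_derive (fun t => h2 s x t / ch s x t) y (cc s * ct s x y + (h2 s x y / ch s x y) ^ 2 * sh s x y).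
Proof.
intros Hs Hz. destruct (polar s x y Hs Hz) as [X Y]. destruct (hyp_unit s x y Hs Hz) as [_ Hc].
destruct (h_relations s x y Hs Hz) as [_ H2].
split; [|split; [|split]].
- eapply is_derive_eq. apply D_div; [apply (x_h1 X)|apply (x_ch X)|lra]. eqR; cbv beta; field; lra.
- eapply is_derive_eq. apply D_div; [apply (y_h1 Y)|apply (y_ch Y)|lra]. eqR; cbv beta.
  replace (- (cc s * (sh s x y * st s x y)) * ch s x y - h1 s x y * - (sh s x y * h2 s x y))
    with (sh s x y * (h1 s x y * h2 s x y - cc s * (ch s x y * st s x y))) by ring. rewrite H2. field; lra.
- eapply is_derive_eq. apply D_div; [apply (x_h2 X)|apply (x_ch X)|lra]. eqR; cbv beta.
  replace (cc s * (sh s x y * st s x y) * ch s x y - h2 s x y * (sh s x y * h1 s x y))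
    with (sh s x y * (cc s * (ch s x y * st s x y) - h1 s x y * h2 s x y)) by ring. rewrite H2. field; lra.
- eapply is_derive_eq. apply D_div; [apply (y_h2 Y)|apply (y_ch Y)|lra]. eqR; cbv beta; field; lra.
Qed.

(** The line [x = t] lies in the domain for almost all [t]; the others follow by
    continuity. *)
Lemma kap_spec s x y : 0 < s -> dm s (x, y) -> h1 s x y / ch s x y = kap s x.
Proof.
intros Hs Hz.
assert (G : forall t, sin (fr s * t) <> 0 -> h1 s t y / ch s t y = kap s t).
{ intros t Ht. apply (constant_of_derive_zero (fun u => h1 s t u / ch s t u)). intro u.
  apply (proj1 (proj2 (ratio_derivatives s t u Hs (dm_of_sin_x s t u Hs Ht)))). }
apply (cont_eq_of_dense (fun t => h1 s t y / ch s t y) (kap s)).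
- eapply C_of_D. apply (proj1 (ratio_derivatives s x y Hs Hz)).
- eapply C_of_D. apply (proj1 (ratio_derivatives s x (1 / 4) Hs (dm_quarter_y s x Hs))).
- intros d Hd. destruct (sin_nonzero_dense (fr s) x d (fr_pos s Hs) Hd) as [t [Ht Hs2]]. exists t. auto.
Qed.
Lemma mu_spec s x y : 0 < s -> dm s (x, y) -> h2 s x y / ch s x y = - mu s y.
Proof.
intros Hs Hz.
assert (G : forall t, sin (2 * PI * t) <> 0 -> h2 s x t / ch s x t = h2 s (s / 4) t / ch s (s / 4) t).
{ intros t Ht. apply (constant_of_derive_zero (fun u => h2 s u t / ch s u t)). intro u.
  apply (proj1 (proj2 (proj2 (ratio_derivatives s u t Hs (dm_of_sin_y s u t Hs Ht))))). }
unfold mu. rewrite Ropp_involutive.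
assert (P2 : 0 < 2 * PI) by (generalize PI_RGT_0; lra).
apply (cont_eq_of_dense (fun t => h2 s x t / ch s x t) (fun t => h2 s (s / 4) t / ch s (s / 4) t)).
- eapply C_of_D. apply (proj2 (proj2 (proj2 (ratio_derivatives s x y Hs Hz)))).
- eapply C_of_D. apply (proj2 (proj2 (proj2 (ratio_derivatives s (s / 4) y Hs (dm_quarter_x s y Hs))))).
- intros d Hd. destruct (sin_nonzero_dense (2 * PI) y d P2 Hd) as [t [Ht Hs2]]. exists t. auto.
Qed.

Lemma h_of_curvatures s x y : 0 < s -> dm s (x, y) -> h1 s x y = kap s x * ch s x y /\ h2 s x y = - mu s y * ch s x y.
Proof.
intros Hs Hz. destruct (hyp_unit s x y Hs Hz) as [_ Hc].
rewrite <- (kap_spec s x y), <- (mu_spec s x y) by auto. split; field; lra.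
Qed.

Lemma D_kap s x y : 0 < s -> dm s (x, y) -> is_derive (kap s) x (cc s * ct s x y - kap s x ^ 2 * sh s x y).
Proof.
intros Hs Hz. rewrite <- (kap_spec s x y) by auto.
destruct (dm_open s (x, y) Hs Hz) as [d [Hd O]].
apply (is_derive_ext_loc (fun t => h1 s t y / ch s t y)).
- apply (locally_R _ x d Hd). intros t Ht. apply kap_spec; auto. apply O. rewrite Cmod_dx. auto.
- apply (proj1 (ratio_derivatives s x y Hs Hz)).
Qed.
Lemma D_mu s x y : 0 < s -> dm s (x, y) -> is_derive (mu s) y (- cc s * ct s x y - mu s y ^ 2 * sh s x y).
Proof.
intros Hs Hz. 
destruct (dm_open s (x, y) Hs Hz) as [d [Hd O]].
apply (is_derive_ext_loc (fun t => - (h2 s x t / ch s x t))).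
- apply (locally_R _ y d Hd). intros t Ht. rewrite mu_spec; auto. apply Ropp_involutive. apply O. rewrite Cmod_dy. auto.
- eapply is_derive_eq. apply D_opp. apply (proj2 (proj2 (proj2 (ratio_derivatives s x y Hs Hz)))). rewrite mu_spec by auto. eqR; ring.
Qed.

Lemma curvature_relations s x y : 0 < s -> dm s (x, y) ->
  (kap s x ^ 2 - mu s y ^ 2) * ch s x y ^ 2 = 2 * cc s * (sh s x y * ct s x y) + 2 * AA s /\
  kap s x * mu s y * ch s x y = - (cc s * st s x y).
Proof.
intros Hs Hz. destruct (h_relations s x y Hs Hz) as [E1 E2]. destruct (h_of_curvatures s x y Hs Hz) as [E3 E4].
destruct (hyp_unit s x y Hs Hz) as [_ Hc]. rewrite E3, E4 in E1, E2. split.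
- rewrite <- E1. ring.
- apply Rmult_eq_reg_l with (ch s x y); lra.
Qed.

Definition BB (s : R) : R := sqrt (cc s ^ 2 + AA s ^ 2).
Lemma BB_sq s : 0 < s -> BB s ^ 2 = cc s ^ 2 + AA s ^ 2 /\ Rabs (AA s) < BB s.
Proof.
intro Hs. assert (Hc := cc_pos s Hs). assert (H := pow2_ge_0 (AA s)).
assert (E : BB s ^ 2 = cc s ^ 2 + AA s ^ 2) by (unfold BB; apply pow2_sqrt; nra).
split; auto. assert (0 < BB s) by (apply sqrt_lt_R0; nra).
apply Rsqr_incrst_0; try lra. rewrite <- Rsqr_abs. unfold Rsqr. nra. apply Rabs_pos.
Qed.

Definition kap' (s x : R) : R := cc s * ct s x (1 / 4) - kap s x ^ 2 * sh s x (1 / 4).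
Definition mu' (s y : R) : R := - cc s * ct s (s / 4) y - mu s y ^ 2 * sh s (s / 4) y.

(** The equations are algebraic consequences of the derivatives of [ct], [sh] and of
    [curvature_relations], in which all dependence on [y] cancels. *)
Lemma kap_ode s x : 0 < s -> is_derive (kap s) x (kap' s x) /\
  is_derive (kap' s) x (- 2 * kap s x ^ 3 + 2 * AA s * kap s x) /\
  kap' s x ^ 2 = BB s ^ 2 - (kap s x ^ 2 - AA s) ^ 2.
Proof.
intro Hs. assert (Hz := dm_quarter_y s x Hs). set (y := 1 / 4) in *.
assert (Dk : is_derive (kap s) x (kap' s x)) by (apply (D_kap s x y Hs Hz)).
destruct (polar s x y Hs Hz) as [X Y]. destruct (curvature_relations s x y Hs Hz) as [R1 R2].
destruct (h_of_curvatures s x y Hs Hz) as [E1 E2]. destruct (hyp_unit s x y Hs Hz) as [U1 U2].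
assert (T := trig_unit s x y Hs Hz). destruct (BB_sq s Hs) as [HB _].
split; auto. split.
- eapply is_derive_eq. apply D_minus. apply D_scal, (x_ct X). apply D_mult. apply D_pow2, Dk. apply (x_sh X).
  eqR. fold y. unfold kap'. fold y. rewrite E1, E2. 
  set (k := kap s x) in *. set (m := mu s y) in *. set (c := cc s) in *. set (S := sh s x y) in *. set (H := ch s x y) in *.
  set (a := ct s x y) in *. set (b := st s x y) in *. set (A := AA s) in *.
  replace (c * (- b * (- m * H)) - (2 * k * (c * a - k ^ 2 * S) * S + k ^ 2 * (H * (k * H))))
    with (m * H * (c * b) - 2 * k * (c * a - k ^ 2 * S) * S - k ^ 3 * H ^ 2) by ring.
  replace (c * b) with (- (k * m * H)) by lra.
  replace (m * H * - (k * m * H)) with (k * ((k ^ 2 - m ^ 2) * H ^ 2) - k ^ 3 * H ^ 2) by ring. rewrite R1, U1. ring.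
- unfold kap'. fold y. rewrite HB.
  set (k := kap s x) in *. set (m := mu s y) in *. set (c := cc s) in *. set (S := sh s x y) in *. set (H := ch s x y) in *.
  set (a := ct s x y) in *. set (b := st s x y) in *. set (A := AA s) in *.
  assert (Q : (k * m * H) ^ 2 = c ^ 2 * b ^ 2) by (rewrite R2; ring).
  assert (E : k ^ 4 * H ^ 2 - k ^ 2 * ((k ^ 2 - m ^ 2) * H ^ 2) - c ^ 2 * b ^ 2 = 0).
  { rewrite <- Q. ring. }
  rewrite R1 in E. rewrite U1 in E. replace (b ^ 2) with (1 - a ^ 2) in E by lra. lra.
Qed.

Lemma mu_ode s y : 0 < s -> is_derive (mu s) y (mu' s y) /\
  is_derive (mu' s) y (- 2 * mu s y ^ 3 - 2 * AA s * mu s y) /\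
  mu' s y ^ 2 = BB s ^ 2 - (mu s y ^ 2 + AA s) ^ 2.
Proof.
intro Hs. assert (Hz := dm_quarter_x s y Hs). set (x := s / 4) in *.
assert (Dk : is_derive (mu s) y (mu' s y)) by (apply (D_mu s x y Hs Hz)).
destruct (polar s x y Hs Hz) as [X Y]. destruct (curvature_relations s x y Hs Hz) as [R1 R2].
destruct (h_of_curvatures s x y Hs Hz) as [E1 E2]. destruct (hyp_unit s x y Hs Hz) as [U1 U2].
assert (T := trig_unit s x y Hs Hz). destruct (BB_sq s Hs) as [HB _].
split; auto. split.
- eapply is_derive_eq. apply D_minus. apply D_scal, (y_ct Y). apply D_mult. apply D_pow2, Dk. apply (y_sh Y).
  eqR. fold x. unfold mu'. fold x. rewrite E1, E2. 
  set (k := kap s x) in *. set (m := mu s y) in *. set (c := cc s) in *. set (S := sh s x y) in *. set (H := ch s x y) in *.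
  set (a := ct s x y) in *. set (b := st s x y) in *. set (A := AA s) in *.
  replace (- c * (- b * (k * H)) - (2 * m * (- c * a - m ^ 2 * S) * S + m ^ 2 * - (H * (- m * H))))
    with (k * H * (c * b) - 2 * m * (- c * a - m ^ 2 * S) * S - m ^ 3 * H ^ 2) by ring.
  replace (c * b) with (- (k * m * H)) by lra.
  replace (k * H * - (k * m * H)) with (- m * ((k ^ 2 - m ^ 2) * H ^ 2) - m ^ 3 * H ^ 2) by ring. rewrite R1, U1. ring.
- unfold mu'. fold x. rewrite HB.
  set (k := kap s x) in *. set (m := mu s y) in *. set (c := cc s) in *. set (S := sh s x y) in *. set (H := ch s x y) in *.
  set (a := ct s x y) in *. set (b := st s x y) in *. set (A := AA s) in *.
  assert (Q : (k * m * H) ^ 2 = c ^ 2 * b ^ 2) by (rewrite R2; ring).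
  assert (E : m ^ 4 * H ^ 2 + m ^ 2 * ((k ^ 2 - m ^ 2) * H ^ 2) - c ^ 2 * b ^ 2 = 0).
  { rewrite <- Q. ring. }
  rewrite R1 in E. rewrite U1 in E. replace (b ^ 2) with (1 - a ^ 2) in E by lra. lra.
Qed.

(** [top_sq] and [top_unit] determine [p^2]; it is positive because [|A| < B]. *)
Definition top_p (A B : R) (k : R -> R) (x : R) : R := sqrt ((k x ^ 2 + B - A) / (2 * B)).
Definition top_q (A B : R) (k k' : R -> R) (x : R) : R := - k' x / (2 * B * top_p A B k x).

Lemma top_of_elliptic (A B : R) (k k' : R -> R) : Rabs A < B ->
  (forall x, is_derive k x (k' x)) -> (forall x, is_derive k' x (- 2 * k x ^ 3 + 2 * A * k x)) ->
  (forall x, k' x ^ 2 = B ^ 2 - (k x ^ 2 - A) ^ 2) -> top A B (top_p A B k) (top_q A B k k') k.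
Proof.
intros HAB D1 D2 E. apply Rabs_def2 in HAB. assert (HB : 0 < B) by lra.
set (p := top_p A B k). set (q := top_q A B k k').
assert (Pp : forall x, 0 < (k x ^ 2 + B - A) / (2 * B)).
{ intro x. apply Rdiv_lt_0_compat; generalize (pow2_ge_0 (k x)); lra. }
assert (p0 : forall x, 0 < p x) by (intro x; apply sqrt_lt_R0; auto).
assert (psq : forall x, 2 * B * (p x * p x) = k x ^ 2 + B - A).
{ intro x. unfold p, top_p. rewrite sqrt_sqrt by (generalize (Pp x); lra). field; lra. }
assert (Ek : forall x, k' x = - (2 * B * p x * q x)).
{ intro x. unfold q, top_q. fold p. field. generalize (p0 x). split; lra. }
assert (U : forall x, p x ^ 2 + q x ^ 2 = 1).
{ intro x. specialize (E x). rewrite (Ek x) in E. assert (Ep := psq x). specialize (p0 x).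
  assert (X : 2 * B * (p x * p x) * (2 * B * (q x ^ 2)) = 2 * B * (p x * p x) * (2 * B * (1 - p x * p x))).
  { transitivity ((- (2 * B * p x * q x)) ^ 2). ring. rewrite E.
    replace (k x ^ 2) with (2 * B * (p x * p x) - B + A) by lra. ring. }
  apply Rmult_eq_reg_l in X; [|nra]. apply Rmult_eq_reg_l in X; lra. }
assert (Dp : forall x, is_derive p x (- (q x * k x))).
{ intro x. specialize (p0 x). eapply is_derive_eq.
  apply (is_derive_sqrt (fun x => (k x ^ 2 + B - A) / (2 * B))).
  - apply (D_mult (fun x => k x ^ 2 + B - A) (fun _ => / (2 * B))). apply D_minus. apply D_plus. apply D_pow2, D1. apply D_const. apply D_const. apply D_const.
  - auto.
  - fold (top_p A B k x). fold p. rewrite (Ek x). eqR; field. lra. }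
constructor; auto.
- intro x. assert (Px := p0 x). eapply is_derive_eq. apply (D_div (fun x => - k' x) (fun x => 2 * B * p x)).
  apply D_opp, D2. apply D_scal, Dp. nra. rewrite (Ek x). 
  assert (K : k x * k x ^ 2 = k x * (2 * B * (p x * p x) - B + A)) by (f_equal; generalize (psq x); lra).
  apply Rmult_eq_reg_r with ((2 * B * p x) ^ 2); [|apply pow_nonzero; nra].
  unfold Rdiv. rewrite Rmult_assoc, Rinv_l by (apply pow_nonzero; nra).
  replace (- (- 2 * k x ^ 3 + 2 * A * k x)) with (2 * (k x * k x ^ 2) - 2 * A * k x) by ring. rewrite K.
  replace (q x) with (q x) by auto. assert (U1 := U x). 
  transitivity (4 * B ^ 2 * p x * k x * (2 * (p x * p x) - 1 + q x ^ 2)). ring.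
  replace (q x ^ 2) with (1 - p x ^ 2) by lra. ring.
- intro x. rewrite <- Ek. auto.
- intro x. assert (U1 := U x). assert (P1 := psq x). replace (q x ^ 2) with (1 - p x ^ 2) by lra. lra.
Qed.

Definition px s := top_p (AA s) (BB s) (kap s).
Definition qx s := top_q (AA s) (BB s) (kap s) (kap' s).
Definition py s := top_p (- AA s) (BB s) (mu s).
Definition qy s := top_q (- AA s) (BB s) (mu s) (mu' s).

Lemma top_x s : 0 < s -> top (AA s) (BB s) (px s) (qx s) (kap s).
Proof.
intro Hs. apply top_of_elliptic. apply BB_sq; auto.
intro x; apply (proj1 (kap_ode s x Hs)). intro x; apply (proj1 (proj2 (kap_ode s x Hs))). intro x; apply (proj2 (proj2 (kap_ode s x Hs))).
Qed.
Lemma top_y s : 0 < s -> top (- AA s) (BB s) (py s) (qy s) (mu s).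
Proof.
intro Hs. apply top_of_elliptic. rewrite Rabs_Ropp. apply BB_sq; auto.
intro y; apply (proj1 (mu_ode s y Hs)).
intro y; eapply is_derive_eq; [apply (proj1 (proj2 (mu_ode s y Hs)))|]. ring.
intro y. destruct (mu_ode s y Hs) as [_ [_ ->]]. ring.
Qed.

Lemma polar_shift s x y m n : 0 < s -> dm s (x, y) ->
  ct s (x + s * IZR m) (y + IZR n) = ct s x y /\ st s (x + s * IZR m) (y + IZR n) = st s x y /\
  ch s (x + s * IZR m) (y + IZR n) = ch s x y /\ sh s (x + s * IZR m) (y + IZR n) = sh s x y /\
  h1 s (x + s * IZR m) (y + IZR n) = h1 s x y /\ h2 s (x + s * IZR m) (y + IZR n) = h2 s x y.
Proof.
intros Hs Hz.
assert (E : (x + s * IZR m, y + IZR n) = ((x, y) + lattice_point s m n)%C) by reflexivity.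
unfold ct, st, ch, sh, h1, h2, rr. rewrite E, gg_shift, hh_shift by auto. repeat split.
Qed.

Lemma kap_period s x : 0 < s -> kap s (x + s) = kap s x /\ kap' s (x + s) = kap' s x.
Proof.
intro Hs. destruct (polar_shift s x (1 / 4) 1 0 Hs (dm_quarter_y s x Hs)) as [E1 [_ [E3 [E4 [E5 _]]]]].
rewrite Rmult_1_r, Rplus_0_r in *.
assert (E : kap s (x + s) = kap s x) by (unfold kap; congruence).
split; auto. unfold kap'. congruence.
Qed.
Lemma mu_period s y : 0 < s -> mu s (y + 1) = mu s y /\ mu' s (y + 1) = mu' s y.
Proof.
intro Hs. destruct (polar_shift s (s / 4) y 0 1 Hs (dm_quarter_x s y Hs)) as [E1 [_ [E3 [E4 [_ E5]]]]].
rewrite Rmult_0_r, Rplus_0_r in *.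
assert (E : mu s (y + 1) = mu s y) by (unfold mu; congruence).
split; auto. unfold mu'. congruence.
Qed.

(** The Gauss map is real on the imaginary axis and even, so [h] is imaginary there. *)
Lemma kap_0 s : 0 < s -> kap s 0 = 0.
Proof.
intro Hs. assert (Hz := dm_imag_axis s (1 / 4) Hs ltac:(lra)).
assert (E1 := hh_opp s _ Hs Hz). assert (E2 := hh_conj s _ Hs Hz).
replace (- (0, (1 / 4)%R))%C with (Cconj (0, 1 / 4)) in E1 by (unfold Cconj, Copp; simpl; f_equal; ring).
rewrite E2 in E1. unfold kap, h1. destruct (hh s (0, 1 / 4)) as [u v]. apply (f_equal fst) in E1. simpl in E1.
replace u with 0 by lra. simpl. unfold Rdiv; ring.
Qed.

(** [h] is odd and of period [i], and [mu] does not depend on the line on which it is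
    computed. *)
Lemma mu_reflect s y : 0 < s -> mu s (1 - y) = - mu s y /\ mu' s (1 - y) = mu' s y.
Proof.
intro Hs.
assert (G : forall y, mu s (1 - y) = - mu s y).
{ clear y. intro y. assert (Hz := dm_quarter_x s y Hs). assert (Hz' := dm_opp s _ Hz).
  assert (Eo : Copp (s / 4, y) = (- (s / 4), - y)) by reflexivity. rewrite Eo in Hz'.
  replace (1 - y) with (- y + 1) by ring. rewrite (proj1 (mu_period s (- y) Hs)).
  assert (M := mu_spec s _ _ Hs Hz'). replace (mu s (- y)) with (- (h2 s (- (s / 4)) (- y) / ch s (- (s / 4)) (- y))) by lra.
  assert (C1 : ch s (- (s / 4)) (- y) = ch s (s / 4) y) by (unfold ch, rr; rewrite <- Eo, gg_opp by auto; reflexivity).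
  assert (C2 : h2 s (- (s / 4)) (- y) = - h2 s (s / 4) y) by (unfold h2; rewrite <- Eo, hh_opp by auto; reflexivity).
  rewrite C1, C2. unfold mu. field. generalize (proj2 (hyp_unit s _ _ Hs Hz)). lra. }
split; auto.
assert (D1 : is_derive (fun y => mu s (1 - y)) y (- mu' s (1 - y))).
{ eapply is_derive_eq. apply (D_comp (mu s) (fun y => 1 - y) y). apply (proj1 (mu_ode s (1 - y) Hs)).
  apply D_minus. apply D_const. apply D_id. eqR; ring. }
assert (D2 : is_derive (fun y => mu s (1 - y)) y (- mu' s y)).
{ apply (is_derive_ext (fun y => - mu s y)). intro; symmetry; auto. apply D_opp, (proj1 (mu_ode s y Hs)). }
apply is_derive_unique in D1, D2. lra.
Qed.

Lemma libration_mu s : 0 < s -> libration (AA s) (BB s) (py s) (qy s) (mu s).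
Proof.
intro Hs. constructor.
- apply top_y; auto.
- apply BB_sq; auto.
- intro y. destruct (mu_period s y Hs) as [E1 E2]. unfold py, qy, top_q, top_p. rewrite E1, E2. auto.
- intro y. destruct (mu_reflect s y Hs) as [E1 E2]. unfold py, qy, top_q, top_p. rewrite E1, E2.
  replace ((- mu s y) ^ 2) with (mu s y ^ 2) by ring. auto.
- intros y Hy E. assert (Hz := dm_imag_axis s y Hs ltac:(lra)).
  destruct (h_of_curvatures s 0 y Hs Hz) as [E1 E2]. rewrite kap_0 in E1 by auto. rewrite E in E2.
  apply (hh_imag_nz s y Hs ltac:(lra)). unfold h1, h2 in *. rewrite (surjective_pairing (hh s (0, y))), E1, E2.
  unfold RtoC; f_equal; ring.
Qed.
Lemma top_x_period s x : 0 < s -> px s (x + s) = px s x /\ qx s (x + s) = qx s x /\ kap s (x + s) = kap s x.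
Proof.
intro Hs. destruct (kap_period s x Hs) as [E1 E2]. unfold px, qx, top_q, top_p. rewrite E1, E2. auto.
Qed.

(** * The Gauss map in terms of separated solutions *)

Lemma top_factors {A B : R} {p q k : R -> R} x : top A B p q k ->
  2 * B * p x ^ 2 = k x ^ 2 + B - A /\ 0 < p x.
Proof.
intro H. split; [|apply (top_pos H)].
generalize (top_sq H x) (top_unit H x). intros E U. rewrite E.
replace (q x ^ 2) with (1 - p x ^ 2) by lra. ring.
Qed.

(** The products [q P] and [p Q] have the common denominator [2 B p P], which is the
    rational expression [W] below; the rest is algebra with [curvature_relations]. *)
Lemma gauss_components s x y : 0 < s -> dm s (x, y) ->
  sh s x y / ch s x y = qx s x * py s y + px s x * qy s y /\
  cc s * (ct s x y / ch s x y) = AA s * (qx s x * py s y + px s x * qy s y) + BB s * (px s x * qy s y - qx s x * py s y) /\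
  - cc s * (st s x y / ch s x y) = kap s x * mu s y.
Proof.
intros Hs Hz. assert (T := trig_unit s x y Hs Hz). destruct (hyp_unit s x y Hs Hz) as [U Hc1].
destruct (curvature_relations s x y Hs Hz) as [R1 R2]. destruct (BB_sq s Hs) as [HB HAB].
assert (Hcc := cc_pos s Hs). apply Rabs_def2 in HAB.
destruct (top_factors x (top_x s Hs)) as [F1 p0]. destruct (top_factors y (top_y s Hs)) as [F2 P0].
assert (D1 : - (2 * BB s * px s x * qx s x) = cc s * ct s x y - kap s x ^ 2 * sh s x y).
{ generalize (is_derive_unique _ _ _ (top_dk (top_x s Hs) x)) (is_derive_unique _ _ _ (D_kap s x y Hs Hz)). congruence. }
assert (D2 : - (2 * BB s * py s y * qy s y) = - cc s * ct s x y - mu s y ^ 2 * sh s x y).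
{ generalize (is_derive_unique _ _ _ (top_dk (top_y s Hs) y)) (is_derive_unique _ _ _ (D_mu s x y Hs Hz)). congruence. }
set (k := kap s x) in *. set (m := mu s y) in *. set (c := cc s) in *. set (S := sh s x y) in *. set (H := ch s x y) in *.
set (a := ct s x y) in *. set (b := st s x y) in *. set (A := AA s) in *. set (B := BB s) in *.
set (p := px s x) in *. set (q := qx s x) in *. set (P := py s y) in *. set (Q := qy s y) in *.
assert (HH : 0 < H) by lra. assert (HB0 : 0 < B) by lra.
set (X := k ^ 2) in *. set (Y := m ^ 2) in *.
assert (HX : 0 <= X) by apply pow2_ge_0. assert (HY : 0 <= Y) by apply pow2_ge_0.
assert (Eb : X * Y * H ^ 2 = c ^ 2 * b ^ 2).
{ transitivity ((k * m * H) ^ 2). unfold X, Y; ring. rewrite R2. ring. }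
(* the product 2 B p P is rational in the data because its square is a perfect square *)
assert (W : 2 * B * (p * P) * H = (X + Y) * H ^ 2 / 2 + B).
{ assert (0 < p * P) by (apply Rmult_lt_0_compat; auto). apply Rsqr_inj.
  { apply Rlt_le, Rmult_lt_0_compat; [apply Rmult_lt_0_compat|]; lra. }
  { generalize (Rmult_le_pos (X + Y) (H ^ 2) ltac:(lra) (pow2_ge_0 H)). lra. }
  unfold Rsqr.
  replace (2 * B * (p * P) * H * (2 * B * (p * P) * H)) with ((2 * B * p ^ 2) * (2 * B * P ^ 2) * H ^ 2) by ring.
  rewrite F1, F2.
  transitivity (X * Y * H ^ 2 + B * (X + Y) * H ^ 2 + A * ((X - Y) * H ^ 2) + (B ^ 2 - A ^ 2) * H ^ 2). ring.
  replace (((X + Y) * H ^ 2 / 2 + B) * ((X + Y) * H ^ 2 / 2 + B))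
    with (((X - Y) * H ^ 2) ^ 2 / 4 + (X * Y * H ^ 2) * H ^ 2 + B * (X + Y) * H ^ 2 + B ^ 2) by field.
  rewrite R1, Eb, HB. 
  replace (b ^ 2) with (1 - a ^ 2) by lra.
  replace ((2 * c * (S * a) + 2 * A) ^ 2) with (4 * c ^ 2 * S ^ 2 * a ^ 2 + 8 * A * c * (S * a) + 4 * A ^ 2) by ring.
  replace (S ^ 2) with (H ^ 2 - 1) by lra. field. }
assert (Nq : 2 * B * (2 * B * (p * P)) * (q * P) = - (c * a - X * S) * (Y + B + A)).
{ rewrite <- D1. replace (Y + B + A) with (2 * B * P ^ 2) by lra. ring. }
assert (NQ : 2 * B * (2 * B * (p * P)) * (p * Q) = - (- c * a - Y * S) * (X + B - A)).
{ rewrite <- D2. rewrite <- F1. ring. }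
set (w := 2 * B * (p * P)) in *. assert (Hw : 0 < w) by (unfold w; apply Rmult_lt_0_compat; [lra|apply Rmult_lt_0_compat; auto]).
assert (N3 : S / H = q * P + p * Q).
{ apply Rmult_eq_reg_l with (2 * B * w * H ^ 2); [|apply Rgt_not_eq; apply Rmult_lt_0_compat; [apply Rmult_lt_0_compat; lra|apply pow_lt; auto]].
  transitivity (2 * B * S * (w * H)). field; lra. rewrite W.
  replace (2 * B * w * H ^ 2 * (q * P + p * Q)) with ((2 * B * w * (q * P) + 2 * B * w * (p * Q)) * H ^ 2) by ring.
  rewrite Nq, NQ.
  transitivity (- (c * a * (2 * A * H ^ 2 - (X - Y) * H ^ 2)) + S * (2 * (X * Y * H ^ 2) + B * (X + Y) * H ^ 2 + A * ((X - Y) * H ^ 2))); [|ring].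
  rewrite R1, Eb. replace (b ^ 2) with (1 - a ^ 2) by lra.
  replace (2 * B * S * ((X + Y) * H ^ 2 / 2 + B)) with (S * (B * (X + Y) * H ^ 2) + 2 * S * B ^ 2) by field. rewrite HB, U. ring. }
split; auto. split.
- rewrite <- N3.
  assert (G : B * (p * Q - q * P) = c * (a / H) - A * (S / H)).
  { apply Rmult_eq_reg_l with (2 * w * H ^ 2); [|apply Rgt_not_eq; apply Rmult_lt_0_compat; [apply Rmult_lt_0_compat; lra|apply pow_lt; auto]].
    transitivity ((2 * B * w * (p * Q) - 2 * B * w * (q * P)) * H ^ 2). ring.
    rewrite Nq, NQ. transitivity (2 * (w * H) * (c * a - A * S)). 2: field; lra. rewrite W.
    transitivity (c * a * ((X + Y) * H ^ 2 + 2 * B * H ^ 2) - S * B * ((X - Y) * H ^ 2) - S * A * (X + Y) * H ^ 2). ring.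
    rewrite R1, U. replace (a * (S * a)) with (S * a ^ 2) by ring. field. }
  lra.
- apply Rmult_eq_reg_r with H; [|lra]. rewrite R2. field. lra.
Qed.

(** The linear relations of [gauss_components], inverted; [B] is not 0. *)
Lemma separated_solutions_linear s : 0 < s -> forall u1 u2 u3, exists a1 a2 a3, forall x y, dm s (x, y) ->
  u1 * (qx s x * py s y) + u2 * (kap s x * mu s y) + u3 * (px s x * qy s y) =
  (ct s x y / ch s x y) * a1 + (st s x y / ch s x y) * a2 + (sh s x y / ch s x y) * a3.
Proof.
intros Hs u1 u2 u3. assert (Hc := cc_pos s Hs). destruct (BB_sq s Hs) as [_ HAB]. apply Rabs_def2 in HAB.
set (c := cc s) in *. set (A := AA s) in *. set (B := BB s) in *.
exists (c * (u3 - u1) / (2 * B)), (- c * u2), ((u1 + u3) / 2 - (u3 - u1) * A / (2 * B)).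
intros x y Hz. destruct (gauss_components s x y Hs Hz) as [E1 [E2 E3]]. fold c in E2, E3. fold A in E2. fold B in E2.
set (n1 := ct s x y / ch s x y) in *. set (n2 := st s x y / ch s x y) in *. set (n3 := sh s x y / ch s x y) in *.
set (d := px s x * qy s y) in *. set (g := qx s x * py s y) in *.
rewrite <- E3. 
replace (n1 * (c * (u3 - u1) / (2 * B))) with ((c * n1) * (u3 - u1) / (2 * B)) by (field; lra).
rewrite E2, E1. field. lra.
Qed.

(** * The immersion *)

Lemma dm_locally s x y : 0 < s -> dm s (x, y) -> exists d, 0 < d /\
  forall u v, Rabs (u - x) < d -> Rabs (v - y) < d -> dm s (u, v).
Proof.
intros Hs Hz. destruct (dm_open s (x, y) Hs Hz) as [d [Hd O]]. exists (d / 2). split; [lra|].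
intros u v Hu Hv. apply O. eapply Rle_lt_trans. apply Cmod_le_sum. simpl. unfold Rminus in *. lra.
Qed.

Lemma polar_c2d s x y : 0 < s -> dm s (x, y) ->
  (c2d (ct s) x y /\ c2d (st s) x y /\ c2d (ch s) x y /\ c2d (sh s) x y) /\ (c2d (h1 s) x y /\ c2d (h2 s) x y).
Proof.
intros Hs Hz. destruct (cder_c2d (D_gg s _ Hs Hz)) as [G1 G2]. destruct (cder_c2d (D_hh s _ Hs Hz)) as [K1 K2].
destruct (rr_sq s x y Hs Hz) as [P [Pr _]].
assert (Cr : c2d (rr s) x y).
{ unfold rr. apply (c2d_comp sqrt (fun u v => fst (gg s (u, v)) ^ 2 + snd (gg s (u, v)) ^ 2)).
  apply (ex_derive_continuous (V := R_NormedModule)). exists (/ (2 * sqrt (fst (gg s (x, y)) ^ 2 + snd (gg s (x, y)) ^ 2))).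
  apply is_derive_Reals, derivable_pt_lim_sqrt; auto.
  apply continuity_2d_pt_plus; apply c2d_pow2; auto. }
assert (Ci : c2d (fun u v => / rr s u v) x y) by (apply continuity_2d_pt_inv; auto; lra).
split; [split; [|split; [|split]]|split]; auto; unfold ct, st, ch, sh, Rdiv; apply continuity_2d_pt_mult;
  auto using continuity_2d_pt_const, continuity_2d_pt_plus, continuity_2d_pt_minus.
Qed.

(** A primitive of the Weierstrass forms, found from [k' = c ct - k^2 sh] and [mu' = - c
    ct - mu^2 sh]: the derivatives of [k sh] and [mu ch] are the wanted integrands
    up to a function of [x]. *)
Definition prim1 s x y := (RInt (fun t => kap s t ^ 2) 0 x - kap s x * sh s x y) / cc s.
Definition prim2 s x y := mu s y * ch s x y / cc s.
Definition prim3 (x y : R) := x.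

Lemma prim_partials s x y : 0 < s -> dm s (x, y) ->
  (is_derive (fun t => prim1 s t y) x (- (sh s x y * ct s x y)) /\
   is_derive (fun t => prim1 s x t) y (ch s x y * st s x y)) /\
  (is_derive (fun t => prim2 s t y) x (- (sh s x y * st s x y)) /\
   is_derive (fun t => prim2 s x t) y (- (ch s x y * ct s x y))).
Proof.
intros Hs Hz. destruct (polar s x y Hs Hz) as [X Y]. destruct (hyp_unit s x y Hs Hz) as [U _].
destruct (curvature_relations s x y Hs Hz) as [_ R]. destruct (h_of_curvatures s x y Hs Hz) as [E1 E2].
assert (Hc := cc_pos s Hs). assert (Dk := D_kap s x y Hs Hz). assert (Dm := D_mu s x y Hs Hz).
assert (DI : is_derive (fun t => RInt (fun t => kap s t ^ 2) 0 t) x (kap s x ^ 2)).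
{ apply (D_RInt (fun t => kap s t ^ 2)). intro t. apply C_pow2. eapply C_of_D. apply (proj1 (kap_ode s t Hs)). }
split; split.
- eapply is_derive_eq. unfold prim1. apply (D_mult (fun t => _ - _) (fun _ => / cc s)).
  apply D_minus. exact DI. apply D_mult. exact Dk. apply (x_sh X). apply D_const. eqR. cbv beta. rewrite E1.
  replace (ch s x y * (kap s x * ch s x y)) with (kap s x * ch s x y ^ 2) by ring. rewrite U. field. lra.
- eapply is_derive_eq. unfold prim1. apply (D_mult (fun t => _ - _) (fun _ => / cc s)).
  apply D_minus. apply D_const. apply D_scal, (y_sh Y). apply D_const. eqR. cbv beta. rewrite E2.
  replace (st s x y) with (- (kap s x * mu s y * ch s x y) / cc s) by (rewrite R; field; lra). field. lra.
- eapply is_derive_eq. unfold prim2. apply (D_mult (fun t => _ * _) (fun _ => / cc s)).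
  apply D_scal, (x_ch X). apply D_const. eqR. cbv beta. rewrite E1.
  replace (st s x y) with (- (kap s x * mu s y * ch s x y) / cc s) by (rewrite R; field; lra). field. lra.
- eapply is_derive_eq. unfold prim2. apply (D_mult (fun t => _ * _) (fun _ => / cc s)).
  apply D_mult. exact Dm. apply (y_ch Y). apply D_const. eqR. cbv beta. rewrite E2. field. lra.
Qed.

Lemma phi_parts s x y : 0 < s -> dm s (x, y) ->
  phi1 s (x, y) = (- (sh s x y * ct s x y), - (ch s x y * st s x y)) /\
  phi2 s (x, y) = (- (sh s x y * st s x y), ch s x y * ct s x y).
Proof.
intros Hs Hz. destruct (rr_sq s x y Hs Hz) as [_ [H1 H2]].
destruct (Cinv_parts (gg s (x, y))) as [I1 I2]. rewrite <- H2 in I1, I2.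
unfold phi1, phi2. rewrite g_gg by (auto; apply Hz).
assert (Eg : gg s (x, y) = (rr s x y * ct s x y, rr s x y * st s x y)).
{ rewrite (surjective_pairing (gg s (x, y))) at 1. unfold ct, st. f_equal; field; lra. }
assert (Ei : (/ gg s (x, y))%C = (/ rr s x y * ct s x y, - (/ rr s x y * st s x y))).
{ rewrite (surjective_pairing (/ gg s (x, y))%C), I1, I2. unfold ct, st. f_equal; field; lra. }
replace (Ci / 2)%C with ((0, / 2) : C).
2:{ unfold Cdiv. rewrite <- RtoC_inv by lra. unfold Ci, RtoC, Cmult; simpl. f_equal; ring. }
rewrite Ei, Eg. unfold ch, sh, RtoC, Cmult, Cminus, Cplus, Copp; simpl. split; f_equal; field; lra.
Qed.

Lemma path_components (gamma gamma' : R -> C) t : is_derive (V := C_R_NormedModule) gamma t (gamma' t) ->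
  is_derive (fun t => fst (gamma t)) t (fst (gamma' t)) /\ is_derive (fun t => snd (gamma t)) t (snd (gamma' t)).
Proof.
intro H. split.
- apply (filterdiff_comp' (V := prod_NormedModule _ R_NormedModule R_NormedModule) gamma fst t _ fst H).
  apply filterdiff_linear, is_linear_fst.
- apply (filterdiff_comp' (V := prod_NormedModule _ R_NormedModule R_NormedModule) gamma snd t _ snd H).
  apply filterdiff_linear, is_linear_snd.
Qed.

Lemma chain_rule (F Fx : R -> R -> R) (u v : R -> R) (t Fy u' v' d : R) : 0 < d ->
  (forall a b, Rabs (a - u t) < d -> Rabs (b - v t) < d -> is_derive (fun r => F r b) a (Fx a b)) ->
  is_derive (fun r => F (u t) r) (v t) Fy -> c2d Fx (u t) (v t) ->
  is_derive u t u' -> is_derive v t v' -> is_derive (fun r => F (u r) (v r)) t (Fx (u t) (v t) * u' + Fy * v').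
Proof.
intros Hd H1 H2 H3 Du Dv. apply is_derive_Reals. apply derivable_pt_lim_comp_2d; try (apply is_derive_Reals; auto).
apply filterdiff_differentiable_pt_lim. apply is_derive_filterdiff; auto.
- exists (mkposreal d Hd). intros [a b] [Ha Hb]. apply H1; [apply Ha|apply Hb].
- apply continuity_2d_pt_filterlim, H3.
Qed.

Lemma c2d_along (F : R -> R -> R) (u v : R -> R) t : c2d F (u t) (v t) -> continuous u t -> continuous v t ->
  continuous (fun r => F (u r) (v r)) t.
Proof.
intros H Hu Hv. apply (continuous_comp_2 u v F t Hu Hv). apply continuity_2d_pt_filterlim in H. exact H.
Qed.

(** The real part of the form [f dz] is the differential of [Y].  The imaginary part
    only has to be integrable, because the complex integral is defined as a whole. *)
Lemma path_integral_primitive s (f : C -> C) (U V Y : R -> R -> R) (gamma gamma' : R -> C) : 0 < s ->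
  (forall x y, dm s (x, y) -> f (x, y) = (U x y, V x y) /\ c2d U x y /\ c2d V x y /\
    is_derive (fun t => Y t y) x (U x y) /\ is_derive (fun t => Y x t) y (- V x y)) ->
  (forall t, is_derive (V := C_R_NormedModule) gamma t (gamma' t)) ->
  (forall t, continuous (U := C_UniformSpace) gamma' t) ->
  (forall t, 0 <= t <= 1 -> dm s (gamma t)) ->
  Re (path_integral f gamma gamma') = Y (fst (gamma 1)) (snd (gamma 1)) - Y (fst (gamma 0)) (snd (gamma 0)).
Proof.
intros Hs HF Hg Hg' Hd.
set (a := fun t => fst (gamma t)). set (b := fun t => snd (gamma t)).
set (a' := fun t => fst (gamma' t)). set (b' := fun t => snd (gamma' t)).
assert (Da : forall t, is_derive a t (a' t)) by (intro t; apply (path_components gamma gamma' t (Hg t))).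
assert (Db : forall t, is_derive b t (b' t)) by (intro t; apply (path_components gamma gamma' t (Hg t))).
assert (Ca : forall t, continuous a' t).
{ intro t. apply (continuous_comp (V := C_UniformSpace) gamma' fst t (Hg' t)). apply continuous_fst. }
assert (Cb : forall t, continuous b' t).
{ intro t. apply (continuous_comp (V := C_UniformSpace) gamma' snd t (Hg' t)). apply continuous_snd. }
assert (Hab : forall t, 0 <= t <= 1 -> dm s (a t, b t)).
{ intros t Ht. unfold a, b. rewrite <- surjective_pairing. auto. }
assert (I1 : is_RInt (fun t => U (a t) (b t) * a' t + - V (a t) (b t) * b' t) 0 1 (Y (a 1) (b 1) - Y (a 0) (b 0))).
{ apply (is_RInt_derive (V := R_CompleteNormedModule) (fun t => Y (a t) (b t))).
  - intros t Ht. rewrite Rmin_left, Rmax_right in Ht by lra. specialize (Hab t Ht).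
    destruct (HF _ _ Hab) as [_ [CU [_ [_ Dy]]]]. destruct (dm_locally s _ _ Hs Hab) as [d [Hd0 O]].
    apply (chain_rule Y U a b t _ _ _ d); auto. intros p q Hp Hq. apply (HF p q (O p q Hp Hq)).
  - intros t Ht. rewrite Rmin_left, Rmax_right in Ht by lra. destruct (HF _ _ (Hab t Ht)) as [_ [CU [CV _]]].
    assert (Ka : continuous a t) by (eapply C_of_D; apply Da). assert (Kb : continuous b t) by (eapply C_of_D; apply Db).
    apply C_plus; apply C_mult; auto. apply c2d_along; auto.
    apply (c2d_along (fun x y => - V x y)); auto. apply continuity_2d_pt_opp; auto. }
assert (I2 : ex_RInt (fun t => U (a t) (b t) * b' t + V (a t) (b t) * a' t) 0 1).
{ apply ex_RInt_C'. lra. intros t Ht. destruct (HF _ _ (Hab t Ht)) as [_ [CU [CV _]]].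
  assert (Ka : continuous a t) by (eapply C_of_D; apply Da). assert (Kb : continuous b t) by (eapply C_of_D; apply Db).
  apply C_plus; apply C_mult; auto; apply c2d_along; auto. }
destruct I2 as [w I2].
assert (E : forall t, 0 < t < 1 -> (f (gamma t) * gamma' t)%C =
  (U (a t) (b t) * a' t + - V (a t) (b t) * b' t, U (a t) (b t) * b' t + V (a t) (b t) * a' t)).
{ intros t Ht. rewrite (surjective_pairing (gamma t)). destruct (HF _ _ (Hab t ltac:(lra))) as [Ef _].
  fold (a t). fold (b t). rewrite Ef. unfold Cmult; simpl. fold (a' t). fold (b' t). f_equal. ring. }
unfold path_integral. rewrite (is_RInt_unique (V := C_R_CompleteNormedModule) _ 0 1 (Y (a 1) (b 1) - Y (a 0) (b 0), w)). reflexivity.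
apply (is_RInt_fct_extend_pair (U := R_NormedModule) (V := R_NormedModule) (fun t => (f (gamma t) * gamma' t)%C)).
- eapply is_RInt_ext; [|exact I1]. intros t Ht. rewrite Rmin_left, Rmax_right in Ht by lra. cbv beta. rewrite E by auto. reflexivity.
- eapply is_RInt_ext; [|exact I2]. intros t Ht. rewrite Rmin_left, Rmax_right in Ht by lra. cbv beta. rewrite E by auto. reflexivity.
Qed.

Lemma is_derive_pair (a b : R -> R) t a' b' : is_derive a t a' -> is_derive b t b' ->
  is_derive (V := C_R_NormedModule) (fun t => (a t, b t) : C) t ((a', b') : C).
Proof.
intros Ha Hb.
apply (filterdiff_comp'_2 (U := R_NormedModule) (V := R_NormedModule) (W := prod_NormedModule _ R_NormedModule R_NormedModule)
  a b (fun u v => (u, v)) t _ _ (fun u v => (u, v)) Ha Hb).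
apply (filterdiff_ext_lin _ (fun t => t)).
- apply (filterdiff_ext (fun t => t)). intros [u v]; reflexivity. apply filterdiff_id.
- intros [u v]; reflexivity.
Qed.
Lemma continuous_Cpair (a b : R -> R) t : continuous a t -> continuous b t ->
  continuous (U := C_UniformSpace) (fun t => (a t, b t) : C) t.
Proof.
intros Ha Hb. apply (continuous_comp_2 (V := R_UniformSpace) (W := R_UniformSpace) (X := C_UniformSpace) a b (fun u v => (u, v)) t Ha Hb).
apply (continuous_ext (fun t => t)). intros [u v]; reflexivity. apply continuous_id.
Qed.

Lemma not_half_integer (m n : Z) : IZR m <> IZR n + 1 / 2.
Proof.
intro E. assert (E2 : IZR (2 * m) = IZR (2 * n + 1)) by (rewrite plus_IZR, !mult_IZR; lra).
apply eq_IZR in E2. lia.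
Qed.

(** On the lines [x = m s] the segment must avoid the integers, and on the lines [x = m
    s - s/2] the integers plus 1/2; a suitable representative modulo the period
    does, and 1/4 lies in both kinds of gaps. *)
Lemma vertical_segment s x y : 0 < s -> dm s (x, y) ->
  exists n : Z, forall r, 0 <= r <= 1 -> dm s (x, 1 / 4 + (y + IZR n - 1 / 4) * r).
Proof.
intros Hs Hz. 
assert (Om : forall t, ((x, t) + om s)%C = (x + s / 2, t + 1 / 2)) by reflexivity.
assert (Conv : forall lo r t, 0 <= r <= 1 -> lo < 1 / 4 < lo + 1 -> lo < t < lo + 1 -> lo < 1 / 4 + (t - 1 / 4) * r < lo + 1).
{ intros lo r t Hr H1 H2. destruct (Rle_dec (1 / 4) t).
  - assert (0 <= (t - 1 / 4) * r <= t - 1 / 4) by (split; nra). lra.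
  - assert (t - 1 / 4 <= (t - 1 / 4) * r <= 0) by (split; nra). lra. }
destruct (excluded_middle_informative (exists m : Z, x = s * IZR m)) as [[m Em]|N1].
- assert (X2 : forall t, offlat s (x + s / 2, t)).
  { intro t. apply offlat_x. intros m' E. apply (not_half_integer m' m).
    apply Rmult_eq_reg_l with s; [|lra]. rewrite <- E, Em. field. }
  exists (- Int_part y)%Z. intros r Hr. split; [|rewrite Om; auto].
  apply off_horizontal. destruct (base_Int_part y) as [B1 B2]. rewrite opp_IZR.
  assert (y <> IZR (Int_part y)).
  { intro E. apply (proj1 Hz m (Int_part y)). unfold lattice_point. f_equal; auto. }
  generalize (Conv 0 r (y + - IZR (Int_part y)) Hr ltac:(lra) ltac:(lra)). lra.
- destruct (excluded_middle_informative (exists m : Z, x + s / 2 = s * IZR m)) as [[m Em]|N2].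
  + set (k := Int_part (y + 1 / 2)).
    exists (- k)%Z. intros r Hr. split.
    * apply offlat_x. intros m' E. apply N1. exists m'; auto.
    * rewrite Om. apply off_horizontal. destruct (base_Int_part (y + 1 / 2)) as [B1 B2]. fold k in B1, B2. rewrite opp_IZR.
      assert (y + 1 / 2 <> IZR k).
      { intro E. apply (proj2 Hz m k). rewrite Om. unfold lattice_point. f_equal; auto. }
      generalize (Conv (- (1 / 2)) r (y + - IZR k) Hr ltac:(lra) ltac:(lra)). lra.
  + exists 0%Z. intros r Hr. split; [|rewrite Om]; apply offlat_x; intros m' E.
    * apply N1; exists m'; auto.
    * apply N2; exists m'; auto.
Qed.

(** From [(0, 1/2)] down to height 1/4, along this height, which is free of poles and
    zeros, then vertically to [z].  The three stages are joined with [step], whose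
    derivative vanishes at the ends. *)
Lemma path_exists s x y : 0 < s -> dm s (x, y) -> exists gamma gamma', path_to s (0, 1 / 2) (x, y) gamma gamma'.
Proof.
intros Hs Hz. destruct (vertical_segment s x y Hs Hz) as [n Hn].
set (S := fun i t => step (3 * t - i)). set (S' := fun i t => 3 * step' (3 * t - i)).
assert (DS : forall i t, is_derive (S i) t (S' i t)).
{ intros i t. eapply is_derive_eq. apply (D_comp step (fun t => 3 * t - i) t). apply is_derive_step.
  apply D_minus. apply D_scal, D_id. apply D_const. unfold S'. eqR; ring. }
assert (CS : forall i t, continuous (S' i) t).
{ intros i t. unfold S'. apply C_mult. apply C_const. apply (continuous_comp (fun t => 3 * t - i) step').
  apply C_minus. apply C_mult. apply C_const. apply C_id. apply C_const. apply continuous_step'. }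
exists (fun t => (x * S 1 t, 1 / 2 + - (1 / 4) * S 0 t + (y + IZR n - 1 / 4) * S 2 t)),
  (fun t => (x * S' 1 t, 0 + - (1 / 4) * S' 0 t + (y + IZR n - 1 / 4) * S' 2 t)).
split; [|split; [|split; [|split]]].
- intro t. apply is_derive_pair. apply D_scal, DS. apply D_plus. apply D_plus. apply D_const. apply D_scal, DS. apply D_scal, DS.
- intro t. apply continuous_Cpair. apply C_mult. apply C_const. apply CS.
  apply C_plus. apply C_plus. apply C_const. apply C_mult. apply C_const. apply CS. apply C_mult. apply C_const. apply CS.
- intros t Ht. apply dom_iff; auto.
  assert (B0 := step_bounds (3 * t - 0)). assert (B1 := step_bounds (3 * t - 1)). assert (B2 := step_bounds (3 * t - 2)).
  fold (S 0 t) in B0. fold (S 1 t) in B1. fold (S 2 t) in B2.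
  destruct (Rle_dec t (1 / 3)) as [L1|L1]; [|destruct (Rle_dec t (2 / 3)) as [L2|L2]].
  + assert (E1 : S 1 t = 0) by (apply step_neg; lra). assert (E2 : S 2 t = 0) by (apply step_neg; lra).
    rewrite E1, E2, !Rmult_0_r, Rplus_0_r. apply dm_imag_axis; auto. lra.
  + assert (E0 : S 0 t = 1) by (apply step_ge1; lra). assert (E2 : S 2 t = 0) by (apply step_neg; lra).
    rewrite E0, E2. replace (1 / 2 + - (1 / 4) * 1 + (y + IZR n - 1 / 4) * 0) with (1 / 4) by field.
    apply dm_quarter_y; auto.
  + assert (E0 : S 0 t = 1) by (apply step_ge1; lra). assert (E1 : S 1 t = 1) by (apply step_ge1; lra).
    rewrite E0, E1, Rmult_1_r. replace (1 / 2 + - (1 / 4) * 1) with (1 / 4) by field. apply Hn. lra.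
- assert (E : forall i, 0 <= i -> S i 0 = 0) by (intros i Hi; apply step_neg; lra).
  rewrite !E by lra. f_equal; ring.
- exists n. assert (E : forall i, i <= 2 -> S i 1 = 1) by (intros i Hi; apply step_ge1; lra).
  rewrite !E by lra. unfold RtoC, Ci, Cplus, Cmult; simpl. f_equal; field.
Qed.

Definition prim (s : R) (z : C) : vec3 :=
  (prim1 s (fst z) (snd z), prim2 s (fst z) (snd z), prim3 (fst z) (snd z)).

Lemma prim_shift s z n : 0 < s -> dm s z -> prim s (z + RtoC (IZR n) * Ci)%C = prim s z.
Proof.
destruct z as [x y]. intros Hs Hz.
replace ((x, y) + RtoC (IZR n) * Ci)%C with (x, y + IZR n).
2:{ unfold RtoC, Ci, Cplus, Cmult; simpl. f_equal; ring. }
destruct (polar_shift s x y 0 n Hs Hz) as [_ [_ [E3 [E4 [_ E6]]]]]. rewrite Rmult_0_r, Rplus_0_r in *.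
assert (Hz' : dm s (x, y + IZR n)).
{ replace (x, y + IZR n) with ((x, y) + lattice_point s 0 n)%C. apply dm_shift; auto.
  unfold lattice_point, Cplus; simpl. f_equal; ring. }
assert (Em : mu s (y + IZR n) = mu s y).
{ generalize (mu_spec s _ _ Hs Hz) (mu_spec s _ _ Hs Hz'). rewrite E3, E6. lra. }
unfold prim, prim1, prim2, prim3; simpl fst; simpl snd. rewrite E3, E4, Em. reflexivity.
Qed.

(** All paths give the same value, so the one picked by the definition does. *)
Lemma X_value s z : 0 < s -> dm s z -> X_ s z = sub3 (prim s z) (prim s (0, 1 / 2)).
Proof.
intros Hs Hz.
assert (V : forall gamma gamma', path_to s (0, 1 / 2) z gamma gamma' ->
  re_integral s gamma gamma' = sub3 (prim s z) (prim s (0, 1 / 2))).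
{ intros g g' [P1 [P2 [P3 [P4 [n Pn]]]]].
  assert (Pd : forall t, 0 <= t <= 1 -> dm s (g t)) by (intros t Ht; apply dom_iff; auto).
  assert (E : prim s (g 1) = prim s z) by (rewrite Pn; apply prim_shift; auto).
  rewrite <- E, <- P4. unfold re_integral, sub3, prim, c1, c2, c3; simpl fst; simpl snd.
  f_equal; [f_equal|].
  - apply (path_integral_primitive s _ (fun x y => - (sh s x y * ct s x y)) (fun x y => - (ch s x y * st s x y)) (prim1 s)); auto.
    intros x y H. destruct (polar_c2d s x y Hs H) as [[C1 [C2 [C3 C4]]] _]. destruct (prim_partials s x y Hs H) as [[D1 D2] _].
    split; [apply (phi_parts s x y Hs H)|]. split; [apply continuity_2d_pt_opp, continuity_2d_pt_mult; auto|].
    split; [apply continuity_2d_pt_opp, continuity_2d_pt_mult; auto|]. split; auto. rewrite Ropp_involutive. auto.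
  - apply (path_integral_primitive s _ (fun x y => - (sh s x y * st s x y)) (fun x y => ch s x y * ct s x y) (prim2 s)); auto.
    intros x y H. destruct (polar_c2d s x y Hs H) as [[C1 [C2 [C3 C4]]] _]. destruct (prim_partials s x y Hs H) as [_ [D1 D2]].
    split; [apply (phi_parts s x y Hs H)|]. split; [apply continuity_2d_pt_opp, continuity_2d_pt_mult; auto|].
    split; [apply continuity_2d_pt_mult; auto|]. split; auto.
  - apply (path_integral_primitive s _ (fun x y => 1) (fun x y => 0) prim3); auto.
    intros x y H. split; [reflexivity|]. split; [apply continuity_2d_pt_const|]. split; [apply continuity_2d_pt_const|].
    split. apply D_id. rewrite Ropp_0. apply (D_const x). }
unfold X_.
assert (S := epsilon_spec (inhabits ((0, 0, 0) : vec3)) (fun p : vec3 =>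
    exists gamma gamma' : R -> C, path_to s (0, 1 / 2) z gamma gamma' /\ p = re_integral s gamma gamma')).
destruct S as [g [g' [P ->]]].
{ destruct z as [x y]. destruct (path_exists s x y Hs Hz) as [g [g' P]]. exists (re_integral s g g'), g, g'. auto. }
apply V; auto.
Qed.

(** * Rigid motions *)

Definition add3 (p q : vec3) : vec3 := (c1 p + c1 q, c2 p + c2 q, c3 p + c3 q).
Definition app (o1 o2 o3 v : vec3) : vec3 := add3 (scale (c1 v) o1) (add3 (scale (c2 v) o2) (scale (c3 v) o3)).
Set Implicit Arguments.
Record orthonormal (o1 o2 o3 : vec3) : Prop := {
  on_11 : dot o1 o1 = 1; on_22 : dot o2 o2 = 1; on_33 : dot o3 o3 = 1;
  on_12 : dot o1 o2 = 0; on_13 : dot o1 o3 = 0; on_23 : dot o2 o3 = 0 }.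
Unset Implicit Arguments.
Definition det3 (o1 o2 o3 : vec3) : R := dot (cross o1 o2) o3.

Ltac vec_ring := repeat match goal with v : vec3 |- _ => destruct v as [[? ?] ?] end;
  unfold app, det3, cross, dot, scale, add3, sub3, c1, c2, c3; simpl; ring.

Lemma dot_app o1 o2 o3 u v : orthonormal o1 o2 o3 -> dot (app o1 o2 o3 u) (app o1 o2 o3 v) = dot u v.
Proof.
intros [H11 H22 H33 H12 H13 H23].
transitivity (c1 u * c1 v * dot o1 o1 + c2 u * c2 v * dot o2 o2 + c3 u * c3 v * dot o3 o3 +
  (c1 u * c2 v + c2 u * c1 v) * dot o1 o2 + (c1 u * c3 v + c3 u * c1 v) * dot o1 o3 + (c2 u * c3 v + c3 u * c2 v) * dot o2 o3).
vec_ring. rewrite H11, H22, H33, H12, H13, H23. unfold dot. ring.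
Qed.
(** Multiplicativity of the determinant, in the form in which it gives the action of an
    orthogonal map on normals and second fundamental forms. *)
Lemma det_app o1 o2 o3 u v w :
  dot (cross (app o1 o2 o3 u) (app o1 o2 o3 v)) (app o1 o2 o3 w) = det3 o1 o2 o3 * dot (cross u v) w.
Proof. vec_ring. Qed.
Lemma lagrange_identity u v : dot (cross u v) (cross u v) = dot u u * dot v v - dot u v * dot u v.
Proof. vec_ring. Qed.
(** Gram's determinant. *)
Lemma det_sq o1 o2 o3 : orthonormal o1 o2 o3 -> det3 o1 o2 o3 * det3 o1 o2 o3 = 1.
Proof.
intros [H11 H22 H33 H12 H13 H23].
transitivity (dot o1 o1 * (dot o2 o2 * dot o3 o3 - dot o2 o3 * dot o2 o3) - dot o1 o2 * (dot o1 o2 * dot o3 o3 - dot o2 o3 * dot o1 o3)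
  + dot o1 o3 * (dot o1 o2 * dot o2 o3 - dot o2 o2 * dot o1 o3)).
vec_ring. rewrite H11, H22, H33, H12, H13, H23. ring.
Qed.

Lemma dot_self_zero u : dot u u = 0 -> u = (0, 0, 0).
Proof.
destruct u as [[a b] c]. unfold dot, c1, c2, c3; simpl. intro H.
assert (a = 0) by nra. assert (b = 0) by nra. assert (c = 0) by nra. subst; reflexivity.
Qed.

(** A map preserving distances, translated to fix 0, preserves scalar products; hence [T
    p] minus the combination of the images of the basis vectors with the coordinates
    of [p] has norm 0. *)
Lemma rigid_motion_affine Phi : rigid_motion Phi -> exists o1 o2 o3 b, orthonormal o1 o2 o3 /\
  forall p, Phi p = add3 b (app o1 o2 o3 p).
Proof.
intro H. set (T := fun p => sub3 (Phi p) (Phi (0, 0, 0))).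
assert (Hd : forall p q, dot (sub3 (T p) (T q)) (sub3 (T p) (T q)) = dot (sub3 p q) (sub3 p q)).
{ intros p q. assert (E := H p q). unfold norm3 in E. apply sqrt_inj in E.
  - rewrite <- E. unfold T. generalize (Phi p) (Phi q) (Phi (0, 0, 0)). clear. intros u v w. vec_ring.
  - unfold dot. generalize (c1 (sub3 (Phi p) (Phi q))) (c2 (sub3 (Phi p) (Phi q))) (c3 (sub3 (Phi p) (Phi q))). intros; nra.
  - unfold dot. generalize (c1 (sub3 p q)) (c2 (sub3 p q)) (c3 (sub3 p q)). intros; nra. }
assert (T0 : T (0, 0, 0) = (0, 0, 0)).
{ unfold T, sub3. f_equal; [f_equal|]; ring. }
assert (Hn : forall p, dot (T p) (T p) = dot p p).
{ intro p. assert (E := Hd p (0, 0, 0)). rewrite T0 in E. revert E. generalize (T p). clear. intros u E.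
  transitivity (dot (sub3 u (0, 0, 0)) (sub3 u (0, 0, 0))). vec_ring. rewrite E. vec_ring. }
assert (Hp : forall p q, dot (T p) (T q) = dot p q).
{ intros p q. assert (E := Hd p q). assert (E1 := Hn p). assert (E2 := Hn q).
  assert (X : forall u v, dot (sub3 u v) (sub3 u v) = dot u u + dot v v - 2 * dot u v) by (intros u v; vec_ring).
  rewrite !X in E. lra. }
set (o1 := T (1, 0, 0)). set (o2 := T (0, 1, 0)). set (o3 := T (0, 0, 1)).
assert (O : orthonormal o1 o2 o3).
{ constructor; unfold o1, o2, o3; rewrite Hp; unfold dot, c1, c2, c3; simpl; ring. }
exists o1, o2, o3, (Phi (0, 0, 0)). split; auto. intro p.
assert (E : sub3 (T p) (app o1 o2 o3 p) = (0, 0, 0)).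
{ apply dot_self_zero.
  assert (X : forall u v, dot (sub3 u v) (sub3 u v) = dot u u + dot v v - 2 * dot u v) by (intros u v; vec_ring).
  rewrite X, dot_app, Hn by auto.
  replace (dot (T p) (app o1 o2 o3 p)) with (c1 p * dot (T p) o1 + c2 p * dot (T p) o2 + c3 p * dot (T p) o3).
  - unfold o1, o2, o3. rewrite !Hp. vec_ring.
  - clear. generalize (T p) o1 o2 o3. intros t a b c. vec_ring. }
transitivity (add3 (Phi (0, 0, 0)) (T p)).
{ unfold T. generalize (Phi p) (Phi (0, 0, 0)). intros [[a b] c] [[a' b'] c'].
  unfold add3, sub3, c1, c2, c3; simpl. f_equal; [f_equal|]; ring. }
f_equal. revert E. generalize (T p) (app o1 o2 o3 p). intros [[a b] c] [[a' b'] c'].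
unfold sub3, c1, c2, c3; simpl. intro E. injection E. intros. f_equal; [f_equal|]; lra.
Qed.

(** * Fundamental forms *)

Lemma Derive_near (F G : R -> R) x l d : 0 < d -> (forall t, Rabs (t - x) < d -> F t = G t) ->
  is_derive G x l -> Derive F x = l.
Proof.
intros Hd E D. apply is_derive_unique, (is_derive_ext_loc G); auto.
apply (locally_R _ x d Hd). intros t Ht. symmetry; auto.
Qed.

Lemma partials_affine s (F : C -> vec3) (f1 f2 f3 : R -> R -> R) o1 o2 o3 b x y : 0 < s ->
  (forall u v, dm s (u, v) -> F (u, v) = add3 b (app o1 o2 o3 (f1 u v, f2 u v, f3 u v))) -> dm s (x, y) ->
  (forall l1 l2 l3, is_derive (fun t => f1 t y) x l1 -> is_derive (fun t => f2 t y) x l2 -> is_derive (fun t => f3 t y) x l3 ->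
    dx3 F (x, y) = app o1 o2 o3 (l1, l2, l3)) /\
  (forall l1 l2 l3, is_derive (fun t => f1 x t) y l1 -> is_derive (fun t => f2 x t) y l2 -> is_derive (fun t => f3 x t) y l3 ->
    dy3 F (x, y) = app o1 o2 o3 (l1, l2, l3)).
Proof.
intros Hs HF Hz. destruct (dm_locally s x y Hs Hz) as [d [Hd O]].
assert (R0 : forall t, Rabs (t - t) < d) by (intro t; rewrite Rminus_diag, Rabs_R0; auto).
assert (G : forall (g1 g2 g3 : R -> R) t l1 l2 l3 r a1 a2 a3, is_derive g1 t l1 -> is_derive g2 t l2 -> is_derive g3 t l3 ->
  is_derive (fun t => r + (g1 t * a1 + (g2 t * a2 + g3 t * a3))) t (l1 * a1 + (l2 * a2 + l3 * a3))).
{ intros g1 g2 g3 t l1 l2 l3 r a1 a2 a3 D1 D2 D3.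
  assert (S : forall g l a, is_derive g t l -> is_derive (fun t => g t * a) t (l * a)).
  { intros g l a D. eapply is_derive_eq. apply (D_mult g (fun _ => a)); [exact D|apply D_const]. eqR; cbv beta; ring. }
  eapply is_derive_eq. apply D_plus. apply D_const. apply D_plus. apply S; eassumption. apply D_plus; apply S; eassumption. eqR; cbv beta; ring. }
split; intros l1 l2 l3 D1 D2 D3.
- unfold dx3, dx. simpl fst; simpl snd.
  assert (E : forall t, Rabs (t - x) < d -> F (t, y) = add3 b (app o1 o2 o3 (f1 t y, f2 t y, f3 t y))) by auto.
  unfold app at 1. unfold add3 at 1. f_equal; [f_equal|].
  + apply (Derive_near _ (fun t => c1 (add3 b (app o1 o2 o3 (f1 t y, f2 t y, f3 t y)))) x _ d Hd); [intros t Ht; rewrite E by auto; reflexivity | apply G; auto].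
  + apply (Derive_near _ (fun t => c2 (add3 b (app o1 o2 o3 (f1 t y, f2 t y, f3 t y)))) x _ d Hd); [intros t Ht; rewrite E by auto; reflexivity | apply G; auto].
  + apply (Derive_near _ (fun t => c3 (add3 b (app o1 o2 o3 (f1 t y, f2 t y, f3 t y)))) x _ d Hd); [intros t Ht; rewrite E by auto; reflexivity | apply G; auto].
- unfold dy3, dy. simpl fst; simpl snd.
  assert (E : forall t, Rabs (t - y) < d -> F (x, t) = add3 b (app o1 o2 o3 (f1 x t, f2 x t, f3 x t))) by auto.
  unfold app at 1. unfold add3 at 1. f_equal; [f_equal|].
  + apply (Derive_near _ (fun t => c1 (add3 b (app o1 o2 o3 (f1 x t, f2 x t, f3 x t)))) y _ d Hd); [intros t Ht; rewrite E by auto; reflexivity | apply G; auto].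
  + apply (Derive_near _ (fun t => c2 (add3 b (app o1 o2 o3 (f1 x t, f2 x t, f3 x t)))) y _ d Hd); [intros t Ht; rewrite E by auto; reflexivity | apply G; auto].
  + apply (Derive_near _ (fun t => c3 (add3 b (app o1 o2 o3 (f1 x t, f2 x t, f3 x t)))) y _ d Hd); [intros t Ht; rewrite E by auto; reflexivity | apply G; auto].
Qed.

(** The image of the parametrized example under a rigid motion, on the domain of [X_ s]. *)
Set Implicit Arguments.
Record placed (s : R) (Y : C -> vec3) (o1 o2 o3 b : vec3) : Prop := {
  pl_on : orthonormal o1 o2 o3;
  pl_val : forall x y, dm s (x, y) -> Y (x, y) = add3 b (app o1 o2 o3
    (prim1 s x y - prim1 s 0 (1 / 2), prim2 s x y - prim2 s 0 (1 / 2), x)) }.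
Unset Implicit Arguments.
Arguments pl_val {s Y o1 o2 o3 b} _.

Lemma moved_placed s Phi : 0 < s -> rigid_motion Phi -> exists o1 o2 o3 b,
  placed s (fun z => Phi (X_ s z)) o1 o2 o3 b.
Proof.
intros Hs HP. destruct (rigid_motion_affine Phi HP) as [o1 [o2 [o3 [b [O E]]]]]. exists o1, o2, o3, b.
constructor; auto. intros x y Hz. rewrite E, X_value by auto. f_equal. f_equal.
unfold prim, prim3, sub3, c1, c2, c3; simpl. f_equal. ring.
Qed.

Lemma placed_dx s Y o1 o2 o3 b x y : 0 < s -> placed s Y o1 o2 o3 b -> dm s (x, y) ->
  dx3 Y (x, y) = app o1 o2 o3 (- (sh s x y * ct s x y), - (sh s x y * st s x y), 1) /\
  dy3 Y (x, y) = app o1 o2 o3 (ch s x y * st s x y, - (ch s x y * ct s x y), 0).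
Proof.
intros Hs [_ HY] Hz.
destruct (partials_affine s Y (fun x y => prim1 s x y - prim1 s 0 (1 / 2)) (fun x y => prim2 s x y - prim2 s 0 (1 / 2)) (fun x y => x)
  o1 o2 o3 b x y Hs HY Hz) as [Px Py].
destruct (prim_partials s x y Hs Hz) as [[A1 A2] [A3 A4]].
split; [apply Px|apply Py]; try apply D_id; try apply (D_const x);
  (eapply is_derive_eq; [apply D_minus; [eassumption|apply D_const]|eqR; ring]).
Qed.

Lemma placed_second s Y o1 o2 o3 b x y : 0 < s -> placed s Y o1 o2 o3 b -> dm s (x, y) ->
  dx3 (dx3 Y) (x, y) = app o1 o2 o3
    (- (ch s x y * h1 s x y * ct s x y - sh s x y * st s x y * h2 s x y),
     - (ch s x y * h1 s x y * st s x y + sh s x y * ct s x y * h2 s x y), 0) /\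
  dy3 (dx3 Y) (x, y) = app o1 o2 o3
    (ch s x y * h2 s x y * ct s x y + sh s x y * st s x y * h1 s x y,
     ch s x y * h2 s x y * st s x y - sh s x y * ct s x y * h1 s x y, 0) /\
  dy3 (dy3 Y) (x, y) = app o1 o2 o3
    (- (sh s x y * h2 s x y * st s x y) + ch s x y * ct s x y * h1 s x y,
     sh s x y * h2 s x y * ct s x y + ch s x y * st s x y * h1 s x y, 0).
Proof.
intros Hs HY Hz. destruct (polar s x y Hs Hz) as [X Z].
assert (Z0 : forall v, v = add3 (0, 0, 0) v).
{ intros [[u v] w]. unfold add3, c1, c2, c3; simpl. f_equal; [f_equal|]; ring. }
destruct (partials_affine s (dx3 Y) (fun x y => - (sh s x y * ct s x y)) (fun x y => - (sh s x y * st s x y)) (fun x y => 1)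
  o1 o2 o3 (0, 0, 0) x y Hs) as [Px Py]; auto.
{ intros u v Huv. rewrite <- Z0. apply (placed_dx s Y o1 o2 o3 b u v Hs HY Huv). }
destruct (partials_affine s (dy3 Y) (fun x y => ch s x y * st s x y) (fun x y => - (ch s x y * ct s x y)) (fun x y => 0)
  o1 o2 o3 (0, 0, 0) x y Hs) as [_ Qy]; auto.
{ intros u v Huv. rewrite <- Z0. apply (placed_dx s Y o1 o2 o3 b u v Hs HY Huv). }
split; [apply Px|split; [apply Py|apply Qy]]; try apply (D_const 0); try apply (D_const 1).
- eapply is_derive_eq. apply D_opp, D_mult; [apply (x_sh X)|apply (x_ct X)]. eqR; cbv beta; ring.
- eapply is_derive_eq. apply D_opp, D_mult; [apply (x_sh X)|apply (x_st X)]. eqR; cbv beta; ring.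
- eapply is_derive_eq. apply D_opp, D_mult; [apply (y_sh Z)|apply (y_ct Z)]. eqR; cbv beta; ring.
- eapply is_derive_eq. apply D_opp, D_mult; [apply (y_sh Z)|apply (y_st Z)]. eqR; cbv beta; ring.
- eapply is_derive_eq. apply D_mult; [apply (y_ch Z)|apply (y_st Z)]. eqR; cbv beta; ring.
- eapply is_derive_eq. apply D_opp, D_mult; [apply (y_ch Z)|apply (y_ct Z)]. eqR; cbv beta; ring.
Qed.

Lemma placed_forms s Y o1 o2 o3 b x y : 0 < s -> placed s Y o1 o2 o3 b -> dm s (x, y) ->
  formE Y (x, y) = ch s x y ^ 2 /\ formF Y (x, y) = 0 /\ formG Y (x, y) = ch s x y ^ 2.
Proof.
intros Hs HY Hz. destruct (placed_dx s Y o1 o2 o3 b x y Hs HY Hz) as [E1 E2].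
assert (O := pl_on HY). assert (T := trig_unit s x y Hs Hz). destruct (hyp_unit s x y Hs Hz) as [U _].
unfold formE, formF, formG. rewrite E1, E2, !dot_app by auto. unfold dot, c1, c2, c3; simpl fst; simpl snd.
set (S := sh s x y) in *. set (H := ch s x y) in *. set (a := ct s x y) in *. set (e := st s x y) in *.
split; [|split].
- transitivity (S ^ 2 * (a ^ 2 + e ^ 2) + 1). ring. rewrite T, U. ring.
- ring.
- transitivity (H ^ 2 * (a ^ 2 + e ^ 2)). ring. rewrite T. ring.
Qed.

(** The formula determines the Gauss map, as the vectors [app o1 o2 o3 w] are all
    vectors; [det3] is a sign. *)
Lemma placed_gauss s Y o1 o2 o3 b x y w : 0 < s -> placed s Y o1 o2 o3 b -> dm s (x, y) ->
  dot (gauss_map Y (x, y)) (app o1 o2 o3 w) = det3 o1 o2 o3 *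
    dot (ct s x y / ch s x y, st s x y / ch s x y, sh s x y / ch s x y) w.
Proof.
intros Hs HY Hz. destruct (placed_dx s Y o1 o2 o3 b x y Hs HY Hz) as [E1 E2].
destruct (placed_forms s Y o1 o2 o3 b x y Hs HY Hz) as [F1 [F2 F3]].
assert (T := trig_unit s x y Hs Hz). destruct (hyp_unit s x y Hs Hz) as [U Hc].
unfold gauss_map. set (n := cross (dx3 Y (x, y)) (dy3 Y (x, y))).
assert (Nn : norm3 n = ch s x y ^ 2).
{ unfold norm3, n. rewrite lagrange_identity.
  fold (formE Y (x, y)). fold (formF Y (x, y)). fold (formG Y (x, y)). rewrite F1, F2, F3.
  replace (ch s x y ^ 2 * ch s x y ^ 2 - 0 * 0) with (Rsqr (ch s x y ^ 2)) by (unfold Rsqr; ring).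
  apply sqrt_Rsqr, pow2_ge_0. }
cbv zeta. fold n. rewrite Nn.
transitivity (/ ch s x y ^ 2 * dot n (app o1 o2 o3 w)).
{ unfold dot, scale, c1, c2, c3; simpl. ring. }
unfold n. rewrite E1, E2, det_app. destruct w as [[w1 w2] w3]. unfold dot, cross, c1, c2, c3; simpl fst; simpl snd.
set (S := sh s x y) in *. set (H := ch s x y) in *. set (a := ct s x y) in *. set (e := st s x y) in *.
transitivity (det3 o1 o2 o3 * / H ^ 2 * (H * a * w1 + H * e * w2 + S * H * (a ^ 2 + e ^ 2) * w3)). ring.
rewrite T. field. lra.
Qed.

Lemma placed_curvature s Y o1 o2 o3 b x y : 0 < s -> placed s Y o1 o2 o3 b -> dm s (x, y) ->
  gauss_curvature Y (x, y) = - (h1 s x y ^ 2 + h2 s x y ^ 2) / ch s x y ^ 4.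
Proof.
intros Hs HY Hz. destruct (placed_second s Y o1 o2 o3 b x y Hs HY Hz) as [E1 [E2 E3]].
destruct (placed_forms s Y o1 o2 o3 b x y Hs HY Hz) as [F1 [F2 F3]].
assert (T := trig_unit s x y Hs Hz). destruct (hyp_unit s x y Hs Hz) as [U Hc].
assert (D := det_sq o1 o2 o3 (pl_on HY)).
assert (Com : forall u v, dot u v = dot v u) by (intros; unfold dot; ring).
unfold gauss_curvature, form_l, form_m, form_n, det1. rewrite E1, E2, E3, F1, F2, F3.
rewrite !(Com (app _ _ _ _)), !(placed_gauss s Y o1 o2 o3 b) by auto.
unfold dot, c1, c2, c3; simpl fst; simpl snd.
set (S := sh s x y) in *. set (H := ch s x y) in *. set (a := ct s x y) in *. set (e := st s x y) in *.
set (p := h1 s x y). set (q := h2 s x y). set (dt := det3 o1 o2 o3) in *.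
replace (a / H * - (H * p * a - S * e * q) + e / H * - (H * p * e + S * a * q) + S / H * 0) with (- p * (a ^ 2 + e ^ 2)) by (field; lra).
replace (a / H * (- (S * q * e) + H * a * p) + e / H * (S * q * a + H * e * p) + S / H * 0) with (p * (a ^ 2 + e ^ 2)) by (field; lra).
replace (a / H * (H * q * a + S * e * p) + e / H * (H * q * e - S * a * p) + S / H * 0) with (q * (a ^ 2 + e ^ 2)) by (field; lra).
rewrite T. transitivity ((dt * dt) * (- (p ^ 2 + q ^ 2)) / H ^ 4). field; lra. rewrite D. field. lra.
Qed.

Lemma placed_laplacian s Y o1 o2 o3 b v x y : 0 < s -> placed s Y o1 o2 o3 b -> dm s (x, y) ->
  laplacian Y v (x, y) = (dx (dx v) (x, y) + dy (dy v) (x, y)) / ch s x y ^ 2.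
Proof.
intros Hs HY Hz. destruct (dm_locally s x y Hs Hz) as [d [Hd O]].
assert (R0 : forall t, Rabs (t - t) < d) by (intro t; rewrite Rminus_diag, Rabs_R0; auto).
assert (Q : forall u w, dm s (u, w) -> sqrt (det1 Y (u, w)) = ch s u w ^ 2 /\
  (formG Y (u, w) * dx v (u, w) - formF Y (u, w) * dy v (u, w)) / sqrt (det1 Y (u, w)) = dx v (u, w) /\
  (formE Y (u, w) * dy v (u, w) - formF Y (u, w) * dx v (u, w)) / sqrt (det1 Y (u, w)) = dy v (u, w)).
{ intros u w Hu. destruct (placed_forms s Y o1 o2 o3 b u w Hs HY Hu) as [F1 [F2 F3]].
  destruct (hyp_unit s u w Hs Hu) as [_ Hc].
  assert (E : sqrt (det1 Y (u, w)) = ch s u w ^ 2).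
  { unfold det1. rewrite F1, F2, F3. replace (ch s u w ^ 2 * ch s u w ^ 2 - 0 * 0) with (Rsqr (ch s u w ^ 2)) by (unfold Rsqr; ring).
    apply sqrt_Rsqr, pow2_ge_0. }
  rewrite E, F1, F2, F3. split; auto. split; field; lra. }
assert (Ex : dx (fun w => (formG Y w * dx v w - formF Y w * dy v w) / sqrt (det1 Y w)) (x, y) = dx (dx v) (x, y)).
{ apply (Derive_ext_loc (fun t => (formG Y (t, y) * dx v (t, y) - formF Y (t, y) * dy v (t, y)) / sqrt (det1 Y (t, y))) (fun t => dx v (t, y))).
  apply (locally_R _ x d Hd). intros t Ht. apply (Q t y); auto. }
assert (Ey : dy (fun w => (formE Y w * dy v w - formF Y w * dx v w) / sqrt (det1 Y w)) (x, y) = dy (dy v) (x, y)).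
{ apply (Derive_ext_loc (fun t => (formE Y (x, t) * dy v (x, t) - formF Y (x, t) * dx v (x, t)) / sqrt (det1 Y (x, t))) (fun t => dy v (x, t))).
  apply (locally_R _ y d Hd). intros t Ht. apply (Q x t); auto. }
unfold laplacian. rewrite (proj1 (Q x y Hz)), Ex, Ey. reflexivity.
Qed.

(** * Bounded Jacobi functions *)

Lemma c2d_of_continuous (u : C -> R) x y : continuous u (x, y) -> c2d (fun a b => u (a, b)) x y.
Proof.
intro H. apply continuity_2d_pt_filterlim. intros P HP. destruct (H P HP) as [e He].
exists e. intros [a b] Hab. exact (He (a, b) Hab).
Qed.

(** One partial derivative continuous and the other existing suffice for
    differentiability. *)
Lemma c2d_of_partials (F Fx : R -> R -> R) x y Fy d : 0 < d ->
  (forall a b, Rabs (a - x) < d -> Rabs (b - y) < d -> is_derive (fun t => F t b) a (Fx a b)) ->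
  is_derive (fun t => F x t) y Fy -> c2d Fx x y -> c2d F x y.
Proof.
intros Hd H1 H2 H3. apply continuity_2d_pt_filterlim.
apply (filterdiff_continuous (U := prod_NormedModule _ R_NormedModule R_NormedModule) (V := R_NormedModule) (fun u => F (fst u) (snd u)) (x, y)).
eexists. apply (is_derive_filterdiff F x y Fx Fy); auto.
- exists (mkposreal d Hd). intros [a b] [Ha Hb]. apply H1; [apply Ha|apply Hb].
- apply continuity_2d_pt_filterlim, H3.
Qed.

(** The class C^2 is given by second derivatives only; continuity of the function and of
    its first derivatives follows. *)
Lemma C2_regularity s v x y : 0 < s -> C2_on (dm s) v -> dm s (x, y) ->
  (is_derive (fun t => v (t, y)) x (dx v (x, y)) /\ is_derive (fun t => v (x, t)) y (dy v (x, y)) /\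
   is_derive (fun t => dx v (t, y)) x (dx (dx v) (x, y)) /\ is_derive (fun t => dy v (x, t)) y (dy (dy v) (x, y))) /\
  c2d (fun a b => v (a, b)) x y /\ c2d (fun a b => dx v (a, b)) x y /\ c2d (fun a b => dy v (a, b)) x y /\
  c2d (fun a b => dx (dx v) (a, b)) x y /\ c2d (fun a b => dy (dy v) (a, b)) x y.
Proof.
intros Hs HC Hz. destruct (dm_locally s x y Hs Hz) as [d [Hd O]].
assert (D : forall a b, dm s (a, b) ->
  (is_derive (fun t => v (t, b)) a (dx v (a, b)) /\ is_derive (fun t => v (a, t)) b (dy v (a, b))) /\
  (is_derive (fun t => dx v (t, b)) a (dx (dx v) (a, b)) /\ is_derive (fun t => dx v (a, t)) b (dy (dx v) (a, b)) /\
   is_derive (fun t => dy v (t, b)) a (dx (dy v) (a, b)) /\ is_derive (fun t => dy v (a, t)) b (dy (dy v) (a, b)))).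
{ intros a b Hab. destruct (HC _ Hab) as [[E1 E2] [[E3 [E4 [E5 E6]]] _]].
  split; [split|split; [|split; [|split]]]; apply Derive_correct; assumption. }
destruct (HC _ Hz) as [_ [_ [K1 [K2 [K3 K4]]]]].
destruct (D x y Hz) as [[A1 A2] [A3 [A4 [A5 A6]]]].
assert (Cx : c2d (fun a b => dx v (a, b)) x y).
{ apply (c2d_of_partials (fun a b => dx v (a, b)) (fun a b => dx (dx v) (a, b)) x y (dy (dx v) (x, y)) d Hd); [|exact A4|apply c2d_of_continuous; auto].
  intros a b Ha Hb. apply (D a b (O a b Ha Hb)). }
assert (Cy : c2d (fun a b => dy v (a, b)) x y).
{ apply (c2d_of_partials (fun a b => dy v (a, b)) (fun a b => dx (dy v) (a, b)) x y (dy (dy v) (x, y)) d Hd); [|exact A6|apply c2d_of_continuous; auto].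
  intros a b Ha Hb. apply (D a b (O a b Ha Hb)). }
assert (Cv : c2d (fun a b => v (a, b)) x y).
{ apply (c2d_of_partials (fun a b => v (a, b)) (fun a b => dx v (a, b)) x y (dy v (x, y)) d Hd); [|exact A2|exact Cx].
  intros a b Ha Hb. apply (D a b (O a b Ha Hb)). }
repeat (split; auto using c2d_of_continuous).
Qed.

Lemma C2_on_dom s v : 0 < s -> C2_on (fun z => ~ E_ s z) v -> C2_on (dm s) v.
Proof. intros Hs H z Hz. apply H, dom_iff; auto. Qed.

Lemma curvature_bounds s x y : 0 < s -> 2 * (kap s x ^ 2 + mu s y ^ 2) <= 4 * BB s.
Proof.
intro Hs. destruct (top_factors x (top_x s Hs)) as [F1 _]. destruct (top_factors y (top_y s Hs)) as [F2 _].
assert (U1 := top_unit (top_x s Hs) x). assert (U2 := top_unit (top_y s Hs) y).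
destruct (BB_sq s Hs) as [_ HB]. apply Rabs_def2 in HB.
generalize (pow2_ge_0 (qx s x)) (pow2_ge_0 (qy s y)). intros. nra.
Qed.

Lemma jacobi_equation s Y o1 o2 o3 b v x y : 0 < s -> placed s Y o1 o2 o3 b -> dm s (x, y) ->
  laplacian Y v (x, y) - 2 * gauss_curvature Y (x, y) * v (x, y) = 0 ->
  dx (dx v) (x, y) + dy (dy v) (x, y) + 2 * (kap s x ^ 2 + mu s y ^ 2) * v (x, y) = 0.
Proof.
intros Hs HY Hz H. rewrite (placed_laplacian s Y o1 o2 o3 b), (placed_curvature s Y o1 o2 o3 b) in H by auto.
destruct (h_of_curvatures s x y Hs Hz) as [E1 E2]. destruct (hyp_unit s x y Hs Hz) as [_ Hc].
rewrite E1, E2 in H. apply (f_equal (fun r => r * ch s x y ^ 2)) in H. rewrite Rmult_0_l in H. rewrite <- H. field. lra.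
Qed.

Lemma bounded_jacobi_solution s Y o1 o2 o3 b v Bv : 0 < s -> placed s Y o1 o2 o3 b ->
  C2_on (dm s) v -> (forall x y, dm s (x, y) -> v (x, y + 1) = v (x, y)) ->
  (forall z, dm s z -> laplacian Y v z - 2 * gauss_curvature Y z * v z = 0) ->
  (forall z, dm s z -> Rabs (v z) <= Bv) ->
  bounded_solution (fr s) (kap s) (mu s) (4 * BB s) Bv (fun x y => v (x, y))
    (fun x y => dx v (x, y)) (fun x y => dy v (x, y)) (fun x y => dx (dx v) (x, y)) (fun x y => dy (dy v) (x, y)).
Proof.
intros Hs HY HC Hper HJ HB. constructor.
- apply fr_pos; auto.
- intro x. apply (D_const 1 x).
- intro x. apply C_const.
- lra.
- intros; lra.
- intros x y. apply continuity_2d_pt_mult. apply continuity_2d_pt_const.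
  apply continuity_2d_pt_plus; apply c2d_pow2.
  + apply c2d_x. eapply C_of_D. apply (proj1 (kap_ode s x Hs)).
  + apply c2d_y. eapply C_of_D. apply (proj1 (mu_ode s y Hs)).
- intros x y. apply curvature_bounds; auto.
- destruct (BB_sq s Hs) as [_ H]. generalize (Rabs_pos (AA s)). lra.
- constructor; intros x y Hn; assert (Hz := ns_dm s x y Hs Hn);
    destruct (C2_regularity s v x y Hs HC Hz) as [[A1 [A2 [A3 A4]]] [B1 [B2 [B3 [B4 B5]]]]]; auto.
- intros x y Hn. apply HB, ns_dm; auto.
- intros x y Hn. assert (Hz := ns_dm s x y Hs Hn).
  refine (eq_trans _ (jacobi_equation s Y o1 o2 o3 b v x y Hs HY Hz (HJ _ Hz))). ring.
Qed.

Theorem theorem7p1 :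
  forall M : surface, riemann_minimal_example M ->
  forall v : C -> R, jacobi_function M v -> bounded_on M v -> linear_function M v.
Proof.
intros M [s [Phi [Hs [HP ->]]]] v [Hf [HC HJ]] [Bv HB].
simpl in *. unfold function_on in Hf. simpl in Hf.
destruct (moved_placed s Phi Hs HP) as [o1 [o2 [o3 [b HY]]]]. set (Y := fun z => Phi (X_ s z)) in *.
assert (HC' := C2_on_dom s v Hs HC).
assert (Hd : forall z, dm s z -> ~ E_ s z) by (intros z Hz; apply dom_iff; auto).
assert (Hper : forall x y, dm s (x, y) -> v (x, y + 1) = v (x, y)).
{ intros x y Hz. symmetry. apply Hf. apply Hd; auto. apply Hd.
  rewrite (step_i x y s). apply dm_shift; auto. exists 1%Z. unfold RtoC, Ci, Cplus, Cmult; simpl. f_equal; ring. }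
assert (Sol := bounded_jacobi_solution s Y o1 o2 o3 b v Bv Hs HY HC' Hper (fun z Hz => HJ z (Hd z Hz)) (fun z Hz => HB z (Hd z Hz))).
destruct (bounded_solution_classification (fr s) s (AA s) (BB s) (px s) (qx s) (kap s) (py s) (qy s) (mu s) (4 * BB s) Bv
  _ _ _ _ _ ltac:(unfold fr; field; lra) Hs (proj2 (BB_sq s Hs)) (top_x s Hs) (kap_0 s Hs) (fun x => top_x_period s x Hs)
  (libration_mu s Hs) Sol) as [u1 [u2 [u3 Hv]]].
destruct (separated_solutions_linear s Hs u1 u2 u3) as [a1 [a2 [a3 Ha]]].
assert (Lin : forall x y, dm s (x, y) ->
  v (x, y) = ct s x y / ch s x y * a1 + st s x y / ch s x y * a2 + sh s x y / ch s x y * a3).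
{ intros x y Hz.
  destruct (C2_regularity s v x y Hs HC' Hz) as [_ [Cv _]]. destruct (polar s x y Hs Hz) as [X _].
  destruct (hyp_unit s x y Hs Hz) as [_ Hc].
  apply (cont_eq_of_dense (fun t => v (t, y)) (fun t => ct s t y / ch s t y * a1 + st s t y / ch s t y * a2 + sh s t y / ch s t y * a3)).
  - apply (c2d_slice_x (fun a b => v (a, b)) x y Cv).
  - assert (N : ch s x y <> 0) by lra.
    assert (Q : forall f l, is_derive (fun t => f s t y) x l -> continuous (fun t => f s t y / ch s t y) x)
      by (intros f l D; exact (C_of_D _ _ _ (D_div (fun t => f s t y) (fun t => ch s t y) x _ _ D (x_ch X) N))).
    apply C_plus; [apply C_plus|]; (apply C_mult; [|apply C_const]).
    + exact (Q ct _ (x_ct X)).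
    + exact (Q st _ (x_st X)).
    + exact (Q sh _ (x_sh X)).
  - intros d Hd0. destruct (sin_nonzero_dense (fr s) x d (fr_pos s Hs) Hd0) as [t [Ht Hsin]]. exists t. split; auto.
    rewrite (Hv t y), Ha. reflexivity. apply dm_of_sin_x; auto. apply ns_of_sin; auto. }
exists (scale (det3 o1 o2 o3) (app o1 o2 o3 (a1, a2, a3))). simpl. intros [x y] Hz.
assert (Hz' : dm s (x, y)) by (apply dom_iff; auto).
transitivity (det3 o1 o2 o3 * dot (gauss_map Y (x, y)) (app o1 o2 o3 (a1, a2, a3))).
- rewrite (placed_gauss s Y o1 o2 o3 b), Lin by auto. rewrite <- Rmult_assoc, (det_sq _ _ _ (pl_on HY)).
  unfold dot, c1, c2, c3; simpl. ring.
- fold Y. generalize (gauss_map Y (x, y)) (app o1 o2 o3 (a1, a2, a3)) (det3 o1 o2 o3). intros [[n1 n2] n3] [[w1 w2] w3] dt.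
  unfold dot, scale, c1, c2, c3; simpl. ring.
Qed.
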